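(* Let $n\ge 3$ and let $M^n$ be a connected smooth $n$-manifold. Suppose that $\phi: M^n\to\mathbb{H}^{n+1}$ is an immersed, complete, horospherically convex hypersurface with principal curvatures $\kappa_1,\dots,\kappa_n$, and suppose that at every point $$\sum_{i=1}^n\frac{2}{1-\kappa_i}\le n .$$ Then the Gauss map $G:M^n\to\mathbb{S}^n$ of $\phi$ is injective.
   Context: $\mathbb{R}^{1,n+1}$ is $\mathbb{R}^{n+2}$ with $\langle\bar x,\bar x\rangle=-x_0^2+\sum_{i=1}^{n+1}x_i^2$, and $\mathbb{H}^{n+1}=\{\bar x:\langle\bar x,\bar x\rangle=-1,\ x_0>0\}$. The ideal boundary of $\mathbb{H}^{n+1}$ is the unit sphere $\mathbb{S}^n$, where $x\in\mathbb{S}^n$ corresponds to the null ray through $(1,x)$. An immersed hypersurface $\phi:M^n\to\mathbb{H}^{n+1}$ is oriented by a unit normal field $\eta$, viewed as a map into $\{\bar x:\langle\bar x,\bar x\rangle=1\}$; its principal curvatures $\kappa_i$ are defined by $d\eta(e_i)=-\kappa_i\,d\phi(e_i)$ in an orthonormal basis of principal directions (so a geodesic sphere with outward normal has principal curvatures less than $-1$). ''Complete'' means that the induced metric on $M^n$ is complete. $\phi$ is horospherically convex if at each $p$ the hypersurface lies locally on one side of the horosphere $\mathcal{H}_p$ tangent to it at $\phi(p)$ with inward normal $\eta(p)$, touches it (near $p$) only at $p$, and the distance to $\mathcal{H}_p$ does not vanish to second order in any direction; equivalently, at each point all $\kappa_i<1$ or all $\kappa_i>1$. By convention the orientation is chosen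 so that all $\kappa_i<1$ everywhere. The Gauss map $G:M^n\to\mathbb{S}^n$ sends $p$ to the point at infinity of $\mathcal{H}_p$; equivalently $\phi+\eta=e^{\tilde\rho}(1,G)$ for a function $\tilde\rho$ on $M^n$ (the horospherical support function). *)

(* Defs.v *)
From HB Require Import structures.
From mathcomp Require Import all_boot all_order all_algebra.
From mathcomp Require Import all_classical all_reals all_analysis.
Import Order.TTheory GRing.Theory Num.Theory.
Import numFieldNormedType.Exports.

Set Implicit Arguments.
Unset Strict Implicit.
Unset Printing Implicit Defensive.

Local Open Scope classical_set_scope.
Local Open Scope ring_scope.

(* C^k on an open set U, through iterated directional derivatives: on a finite
   dimensional domain this is the usual C^k (all partial derivatives up to
   order k exist and are continuous). Only meaningful for open U. *)
Fixpoint Ck_on {R : realType} {V W : normedModType R} (k : nat) (U : set V)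
    (f : V -> W) : Prop :=
  (forall x, U x -> {for x, continuous f}) /\
  match k with
  | 0%N => True
  | j.+1 => forall v : V,
      (forall x, U x -> derivable f x v) /\ Ck_on j U ('D_v f)
  end.

Definition smooth_on {R : realType} {V W : normedModType R} (U : set V)
  (f : V -> W) : Prop := forall k, Ck_on k U f.

(* C^oo atlas modelled on R^n: charts are homeomorphisms
   coords c : dom c -> coords c @` dom c between open sets, with inverse param c;
   the values of coords c and param c elsewhere are irrelevant. *)
Record smooth_atlas (R : realType) (n : nat) (M : topologicalType) := {
  chart : Type;
  dom : chart -> set M;
  coords : chart -> M -> 'rV[R]_n;
  param : chart -> 'rV[R]_n -> M;
  dom_open : forall c, open (dom c);
  dom_cover : forall p, exists c, dom c p;
  image_open : forall c, open (coords c @` dom c);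
  coordsK : forall c p, dom c p -> param c (coords c p) = p;
  coords_continuous : forall c p, dom c p -> {for p, continuous (coords c)};
  param_continuous : forall c x, (coords c @` dom c) x ->
    {for x, continuous (param c)};
  transition_smooth : forall c d,
    smooth_on (coords c @` (dom c `&` dom d)) (coords d \o param c)
}.

Section Manifold.
Context {R : realType} {n : nat} {M : topologicalType}.
Variable A : smooth_atlas R n M.

Definition smooth_map {W : normedModType R} (f : M -> W) : Prop :=
  forall c : chart A, smooth_on (coords c @` dom c) (f \o param c).

(* df_p(v), where v is the coordinate vector of a tangent vector at p in the
   chart c *)
Definition tdiff {W : normedModType R} (f : M -> W) (c : chart A) (p : M)
  (v : 'rV[R]_n) : W := 'D_v (f \o param c) (coords c p).

Definition immersion {W : normedModType R} (f : M -> W) : Prop :=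
  smooth_map f /\
  forall c p, dom c p -> forall v, tdiff f c p v = 0 -> v = 0.

Definition smooth_curve (gamma : R -> M) : Prop :=
  continuous gamma /\
  forall c : chart A, smooth_on (gamma @^-1` dom c) (coords c \o gamma).

End Manifold.

Section Minkowski.
Context {R : realType} {m : nat}.
Implicit Types x y N : 'rV[R]_m.+1.

Definition lorentz x y : R :=
  - (x 0 ord0 * y 0 ord0) +
  \sum_(i < m) x 0 (lift ord0 i) * y 0 (lift ord0 i).

Definition hyperbolic_space : set 'rV[R]_m.+1 :=
  [set x | lorentz x x = -1 /\ 0 < x 0 ord0].

Definition unit_sphere : set 'rV[R]_m :=
  [set x | \sum_(i < m) x 0 i ^+ 2 = 1].

(* (1, x); this spans the null ray corresponding to x in the ideal boundary *)
Definition null_vector (x : 'rV[R]_m) : 'rV[R]_m.+1 :=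
  row_mx (const_mx 1 : 'rV[R]_1) x.

(* d = arcosh (- <x, y>), with arcosh c = ln (c + sqrt (c^2 - 1)) *)
Definition hdist x y : R :=
  let c := - lorentz x y in ln (c + Num.sqrt (c ^+ 2 - 1)).

Definition hdist_to (S : set 'rV[R]_m.+1) x : R :=
  inf [set hdist x y | y in S].

(* Horospheres are the sections of H by the affine hyperplanes <x, N> = -1,
   with N null and future directed. The unit normal of this horosphere at x is
   N - x, and it points into the horoball <x, N> > -1; hence the horosphere
   tangent at x to a hypersurface, with inward unit normal e, is the one
   given by N = x + e. *)
Definition horosphere N : set 'rV[R]_m.+1 :=
  [set x | hyperbolic_space x /\ lorentz x N = -1].

End Minkowski.

Section Hypersurface.
Context {R : realType} {n : nat} {M : topologicalType}.
Variable A : smooth_atlas R n M.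
Variables phi eta : M -> 'rV[R]_n.+2.

Definition immersed_hypersurface : Prop :=
  immersion A phi /\ forall p, hyperbolic_space (phi p).

Definition unit_normal : Prop :=
  [/\ smooth_map A eta,
      forall p, lorentz (eta p) (eta p) = 1,
      forall p, lorentz (phi p) (eta p) = 0 &
      forall (c : chart A) p v, dom c p ->
        lorentz (tdiff phi c p v) (eta p) = 0].

Definition curve_length (gamma : R -> M) : \bar R :=
  (\int[lebesgue_measure]_(t in `[0%R, 1%R])
     (let v : 'rV[R]_n.+2 := derive1 (phi \o gamma) t in
      Num.sqrt (lorentz v v))%:E)%E.

(* Riemannian distance of the metric induced by phi *)
Definition induced_dist (p q : M) : \bar R :=
  ereal_inf [set curve_length gamma | gamma in
    [set gamma | [/\ smooth_curve A gamma, gamma 0 = p & gamma 1 = q]]].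

Definition complete_hypersurface : Prop :=
  forall u : nat -> M,
    (forall e : R, 0 < e -> exists N, forall i j, (N <= i)%N -> (N <= j)%N ->
       (induced_dist (u i) (u j) < e%:E)%E) ->
    exists l, forall e : R, 0 < e -> exists N, forall i, (N <= i)%N ->
       (induced_dist (u i) l < e%:E)%E.

(* k lists the principal curvatures at p: e is an orthonormal basis of
   principal directions, written in the coordinates of some chart at p *)
Definition principal_curvatures (p : M) (k : 'I_n -> R) : Prop :=
  exists (c : chart A) (e : 'I_n -> 'rV[R]_n),
    [/\ dom c p,
        forall i j,
          lorentz (tdiff phi c p (e i)) (tdiff phi c p (e j)) = (i == j)%:R &
        forall i, tdiff eta c p (e i) = - k i *: tdiff phi c p (e i)].

Definition tangent_horosphere (p : M) : set 'rV[R]_n.+2 :=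
  horosphere (phi p + eta p).

(* The first clause says that near p, and except at p, the hypersurface lies
   strictly outside, or strictly inside, the open horoball
   <x, phi p + eta p> > -1 bounded by the tangent horosphere. *)
Definition horospherically_convex : Prop :=
  forall p,
    ((\forall q \near p, q != p -> lorentz (phi q) (phi p + eta p) < -1) \/
     (\forall q \near p, q != p -> -1 < lorentz (phi q) (phi p + eta p))) /\
    forall (c : chart A) (v : 'rV[R]_n), dom c p -> v != 0 ->
      ~ (hdist_to (tangent_horosphere p)
           (phi (param c (coords c p + t *: v))) / t ^+ 2 @[t --> 0^'] --> 0).

Definition gauss_map (G : M -> 'rV[R]_n.+1) : Prop :=
  (forall p, unit_sphere (G p)) /\
  exists rho : M -> R,
    forall p, phi p + eta p = expR (rho p) *: null_vector (G p).

End Hypersurface.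

(* Main.v *)
(** The map N = phi + eta = e^rho (1, G) takes values in the light cone.  Suppose
    G p = G q = y with p <> q.  On M0 = {G <> y}, stereographic projection from y
    gives a local diffeomorphism X : M0 -> R^n, and <dN, dN> = F^2 |dX|^2 with
    F = - <N, (1, y)>; this metric dominates a multiple of the induced one.  In the
    coordinates X the curvature bound says that u = sqrt F satisfies
    u Lap u <= (3 - n) |du|^2.  Hence v = u + 2 - 1 / (1 + u) satisfies
    v Lap v <= - (n - 3 + k) |dv|^2 with k > 0, and v >= max (1, u), so that the
    length element v^2 |dX| is complete on M0.  Near p and near q one has
    |X| -> oo and v -> 1, so M0 has two Euclidean ends.  Take a nearly minimizing
    path between far points of the two ends, and vary it in n directions which are
    parallel for v^2 |dX| and scaled by psi / v.  The variations of its length sum to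
    the integral of - 2 k psi^2 (v' / v)^2 + (2 n - 4) psi'^2, which must be almost
    nonnegative.  With psi a tent function the second term tends to 0 as the path
    gets longer, while v' must integrate to a fixed positive amount where the path
    leaves an end, a contradiction.  Paths are chains of straight segments
    in the coordinates X, so that no geodesics are needed. *)
Require Import Defs.
From HB Require Import structures.
From mathcomp Require Import all_boot all_order all_algebra.
From mathcomp Require Import all_classical all_reals all_analysis.
From mathcomp Require Import measurable_realfun ring lra.
Import Order.TTheory GRing.Theory Num.Theory.
Import numFieldNormedType.Exports.

Local Open Scope classical_set_scope.
Local Open Scope ring_scope.

Set Implicit Arguments.
Unset Strict Implicit.
Unset Printing Implicit Defensive.

(** * Calculus of C^k maps between normed spaces *)

(** The curvature bound says that <dN, dN> = u^4 |dX|^2 has nonnegative scalar curvature, that is,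
    that u^(n-2) is superharmonic in the coordinates X. Two obstacles shape the proof. The factor u
    vanishes at the removed fibre, so for u^2 |dX| the ends of M0 lie at finite distance; v tends to
    1 there, which moves them to infinity while the inequality persists, and the concavity of v as a
    function of u supplies the gain k. Moreover, scalar curvature alone does not control the Ricci
    term in the second variation of length. Here the coordinates are flat, and in the sum over a
    whole frame, tangential direction included, the Hessian of v enters only through its Laplacian,
    which is what the inequality bounds; the scaling 1 / v takes care of the first order terms.
    Since X tends to infinity and v to 1 at both ends, displacement in X alone forces a path joining
    far points to spend nearly all of its length in its two outer stretches, so that the stretch on
    which v has to rise is comparatively short. *)

Lemma Ck_cont {R : realType} {V W : normedModType R} k (U : set V) (f : V -> W) :
  Ck_on k U f -> forall x, U x -> {for x, continuous f}.
Proof. by case: k => [|k] []. Qed.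

Lemma CkS {R : realType} {V W : normedModType R} k (U : set V) (f : V -> W) :
  Ck_on k.+1 U f -> Ck_on k U f.
Proof.
elim: k f => [|k IH] f; first by move=> [c _].
move=> [c H]; split => // v; have [d h] := H v; split => //.
exact: IH.
Qed.

Lemma Ck_derivable {R : realType} {V W : normedModType R} k (U : set V) (f : V -> W) :
  Ck_on k.+1 U f -> forall v x, U x -> derivable f x v.
Proof. by move=> [_ H] v x Ux; have [d _] := H v; exact: d. Qed.

Lemma Ck_deriv {R : realType} {V W : normedModType R} k (U : set V) (f : V -> W) v :
  Ck_on k.+1 U f -> Ck_on k U ('D_v f).
Proof. by move=> [_ H]; have [] := H v. Qed.

Lemma Ck_sub {R : realType} {V W : normedModType R} k (U U' : set V) (f : V -> W) :
  U' `<=` U -> Ck_on k U f -> Ck_on k U' f.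
Proof.
move=> s; elim: k f => [|k IH] f [c H]; split => //; try by move=> x /s; apply: c.
move=> v; have [d h] := H v; split; first by move=> x /s; apply: d.
exact: IH.
Qed.

Lemma Ck_local {R : realType} {V W : normedModType R} k (U : set V) (f : V -> W) :
  (forall x, U x -> exists2 B, B x & Ck_on k B f) -> Ck_on k U f.
Proof.
elim: k f => [|k IH] f H; split => //.
- by move=> x Ux; have [B Bx h] := H x Ux; exact: (Ck_cont h).
- by move=> x Ux; have [B Bx h] := H x Ux; exact: (Ck_cont h).
move=> v; split.
  by move=> x Ux; have [B Bx h] := H x Ux; exact: (Ck_derivable h).
apply: IH => x Ux; have [B Bx h] := H x Ux; exists B => //.
exact: Ck_deriv.
Qed.

Lemma Ck_eq {R : realType} {V W : normedModType R} k (U : set V) (f g : V -> W) :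
  open U -> (forall x, U x -> f x = g x) -> Ck_on k U f -> Ck_on k U g.
Proof.
move=> oU; have nfg f' g' x : (forall x, U x -> f' x = g' x) -> U x -> {near x, f' =1 g'}.
  by move=> fg Ux; apply: filterS (open_nbhs_nbhs (conj oU Ux)) => y /fg.
have ct f' g' x : (forall x, U x -> f' x = g' x) -> U x ->
    {for x, continuous f'} -> {for x, continuous g'}.
  move=> fg Ux c; rewrite /prop_for /continuous_at -(fg _ Ux).
  apply: cvg_trans c; apply: near_eq_cvg; exact: nfg.
elim: k f g => [|k IH] f g fg [c H].
  by split => // x Ux; apply: ct (fg) (Ux) (c x Ux).
split; first by move=> x Ux; apply: ct (fg) (Ux) (c x Ux).
move=> v; have [d h] := H v; split.
  by move=> x Ux; apply: near_eq_derivable (d _ Ux); exact: nfg.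
apply: IH h => x Ux; apply: near_eq_derive; exact: nfg.
Qed.

Lemma Ck_near {R : realType} {V W : normedModType R} k (U : set V) (f : V -> W) :
  (forall x, U x -> exists B g, [/\ open B, B x, forall y, B y -> g y = f y & Ck_on k B g]) ->
  Ck_on k U f.
Proof.
move=> H; apply: Ck_local => x Ux; have [B [g [oB Bx gf cg]]] := H x Ux.
exists B => //; exact: Ck_eq cg.
Qed.

Section CkAlg.
Context {R : realType} {V : normedModType R}.
Implicit Types (f g : V -> R) (U : set V).

Lemma Ck_cst (W : normedModType R) k U (a : W) : Ck_on k U (fun=> a).
Proof.
elim: k U a => [|k IH] U a; split => //; try by move=> x _; exact: cst_continuous.
move=> v; split; first by move=> x _; exact: derivable_cst.
rewrite (_ : 'D_v _ = fun=> 0) //; apply/funext => x; exact: derive_cst.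
Qed.

Lemma CkD (W : normedModType R) k U (f g : V -> W) : open U ->
  Ck_on k U f -> Ck_on k U g -> Ck_on k U (fun x => f x + g x).
Proof.
move=> oU; elim: k f g => [|k IH] f g hf hg; split => //.
- move=> x Ux; exact: (cvgD (Ck_cont hf Ux) (Ck_cont hg Ux)).
- move=> x Ux; exact: (cvgD (Ck_cont hf Ux) (Ck_cont hg Ux)).
move=> v; split.
  by move=> x Ux; apply: derivableD; [apply: (Ck_derivable hf) Ux|apply: (Ck_derivable hg) Ux].
apply: (@Ck_eq _ _ _ _ _ (fun x => 'D_v f x + 'D_v g x)) => //.
  move=> x Ux; rewrite deriveD //; [apply: (Ck_derivable hf) Ux|apply: (Ck_derivable hg) Ux].
by apply: IH; apply: Ck_deriv.
Qed.

Lemma CkM k U f g : open U ->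
  Ck_on k U f -> Ck_on k U g -> Ck_on k U (fun x => f x * g x).
Proof.
move=> oU; elim: k f g => [|k IH] f g hf hg; split => //.
- move=> x Ux; exact: (cvgM (Ck_cont hf Ux) (Ck_cont hg Ux)).
- move=> x Ux; exact: (cvgM (Ck_cont hf Ux) (Ck_cont hg Ux)).
move=> v; split.
  by move=> x Ux; apply: derivableM; [apply: (Ck_derivable hf) Ux|apply: (Ck_derivable hg) Ux].
apply: (@Ck_eq _ _ _ _ _ (fun x => f x * 'D_v g x + g x * 'D_v f x)) => //.
  move=> x Ux; rewrite (@deriveM _ _ f g) //; [apply: (Ck_derivable hf) Ux|apply: (Ck_derivable hg) Ux].
by apply: CkD => //; apply: IH; rewrite ?(CkS hf) ?(CkS hg)//; 
  try (by apply: CkS); apply: Ck_deriv.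
Qed.

Lemma CkN (W : normedModType R) k U (f : V -> W) : open U ->
  Ck_on k U f -> Ck_on k U (fun x => - f x).
Proof.
move=> oU; elim: k f => [|k IH] f hf; split => //.
- move=> x Ux; exact: (cvgN (Ck_cont hf Ux)).
- move=> x Ux; exact: (cvgN (Ck_cont hf Ux)).
move=> v; split.
  by move=> x Ux; apply: derivableN; apply: (Ck_derivable hf) Ux.
apply: (@Ck_eq _ _ _ _ _ (fun x => - 'D_v f x)) => //.
  move=> x Ux; rewrite deriveN //; apply: (Ck_derivable hf) Ux.
by apply: IH; apply: Ck_deriv.
Qed.

Lemma CkB (W : normedModType R) k U (f g : V -> W) : open U ->
  Ck_on k U f -> Ck_on k U g -> Ck_on k U (fun x => f x - g x).
Proof. by move=> oU hf hg; apply: CkD => //; apply: CkN. Qed.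

Lemma CkV k U f : open U -> (forall x, U x -> f x != 0) ->
  Ck_on k U f -> Ck_on k U (fun x => (f x)^-1).
Proof.
move=> oU f0; elim: k => [|k IH] hf; split => //.
- move=> x Ux; exact: (cvgV (f0 _ Ux) (Ck_cont hf Ux)).
- move=> x Ux; exact: (cvgV (f0 _ Ux) (Ck_cont hf Ux)).
move=> v; split.
  by move=> x Ux; apply: derivableV; [apply: f0|apply: (Ck_derivable hf) Ux].
apply: (@Ck_eq _ _ _ _ _ (fun x => - ((f x)^-1 * (f x)^-1 * 'D_v f x))) => //.
  move=> x Ux; rewrite deriveV; [|exact: f0|apply: (Ck_derivable hf) Ux].
  by rewrite scaleNr /GRing.scale /= -exprVn expr2.
apply: CkN => //; apply: CkM => //; last exact: Ck_deriv.
have := IH (CkS hf) => h; exact: CkM.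
Qed.

Lemma Ck_sum (W : normedModType R) (I : Type) (r : seq I) (P : pred I) (F : I -> V -> W) k U :
  open U -> (forall i, P i -> Ck_on k U (F i)) ->
  Ck_on k U (fun x => \sum_(i <- r | P i) F i x).
Proof.
move=> oU H; elim: r => [|a r IH].
  by under eq_fun do rewrite big_nil; exact: Ck_cst.
under eq_fun do rewrite big_cons; have [Pa|//] := boolP (P a).
by apply: CkD => //; exact: H.
Qed.

Lemma Ck_prod (I : Type) (r : seq I) (P : pred I) (F : I -> V -> R) k U :
  open U -> (forall i, P i -> Ck_on k U (F i)) ->
  Ck_on k U (fun x => \prod_(i <- r | P i) F i x).
Proof.
move=> oU H; elim: r => [|a r IH].
  by under eq_fun do rewrite big_nil; exact: Ck_cst.
under eq_fun do rewrite big_cons; have [Pa|//] := boolP (P a).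
by apply: CkM => //; exact: H.
Qed.

Lemma Ck_mx m n k U (f : V -> 'M[R]_(m, n)) : open U ->
  Ck_on k U f <-> forall i j, Ck_on k U (fun x => f x i j).
Proof.
move=> oU; split.
  elim: k f => [|k IH] f hf i j; split => //.
  - move=> x Ux; apply: (@continuous_comp _ _ _ f (fun A : 'M[R]_(m, n) => A i j)).
      exact: (Ck_cont hf) Ux.
    exact: coord_continuous.
  - move=> x Ux; apply: (@continuous_comp _ _ _ f (fun A : 'M[R]_(m, n) => A i j)).
      exact: (Ck_cont hf) Ux.
    exact: coord_continuous.
  move=> v; split.
    move=> x Ux; have /derivable_mxP d := Ck_derivable hf Ux (v := v); exact: d.
  apply: (@Ck_eq _ _ _ _ _ (fun x => 'D_v f x i j)) => //.
    move=> x Ux; rewrite derive_mx ?mxE //; apply: (Ck_derivable hf) Ux.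
  by apply: IH; apply: Ck_deriv.
have cont (g : V -> 'M[R]_(m, n)) x : (forall i j, {for x, continuous (fun x => g x i j)}) ->
    {for x, continuous g}.
  move=> H; apply/cvgrPdist_le => /= e e0; near=> t.
  rewrite /Num.Def.normr/= mx_normrE (bigmax_le _ (ltW e0))//= => i _.
  rewrite !mxE/=.
  move: i; near: t; apply: filter_forall => /= i.
  exact: ((cvgrPdist_le _ _).1 (H i.1 i.2)).
elim: k f => [|k IH] f hf; split => //.
- by move=> x Ux; apply: cont => i j; apply: (Ck_cont (hf i j)) Ux.
- by move=> x Ux; apply: cont => i j; apply: (Ck_cont (hf i j)) Ux.
move=> v; split.
  by move=> x Ux; apply/derivable_mxP => i j; apply: (Ck_derivable (hf i j)) Ux.
apply: (@Ck_eq _ _ _ _ _ (fun x => \matrix_(i, j) 'D_v (fun x => f x i j) x)) => //.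
  move=> x Ux; rewrite derive_mx //; apply/derivable_mxP => i j.
  exact: (Ck_derivable (hf i j)) Ux.
apply: IH => i j; under eq_fun do rewrite mxE; exact: Ck_deriv.
Unshelve. all: by end_near. Qed.

Lemma Ck_rV n k U (f : V -> 'rV[R]_n) : open U ->
  Ck_on k U f <-> forall j, Ck_on k U (fun x => f x 0 j).
Proof.
move=> oU; split => [/(Ck_mx _ _ oU) H j|H]; first exact: H.
by apply/Ck_mx => // i j; rewrite (ord1 i).
Qed.

Lemma Ck_det n k U (A : V -> 'M[R]_n) : open U -> Ck_on k U A ->
  Ck_on k U (fun x => \det (A x)).
Proof.
move=> oU /(Ck_mx _ _ oU) H.
rewrite /determinant; apply: Ck_sum => // s _; apply: CkM => //.
  exact: Ck_cst.
by apply: Ck_prod => // i _; exact: H.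
Qed.

(** Cramer's rule: the entries of the inverse are rational in those of [A]. *)
Lemma Ck_invmx n k U (A : V -> 'M[R]_n) : open U -> Ck_on k U A ->
  (forall x, U x -> A x \in unitmx) -> Ck_on k U (fun x => invmx (A x)).
Proof.
move=> oU CA uA; have /(Ck_mx _ _ oU) H := CA.
apply: (@Ck_eq _ _ _ _ _ (fun x => (\det (A x))^-1 *: \adj (A x))) => //.
  by move=> x Ux; rewrite /invmx uA.
apply/Ck_mx => // i j; under eq_fun do rewrite !mxE; apply: CkM => //.
  apply: CkV => //; last exact: Ck_det.
  by move=> x Ux; have := uA x Ux; rewrite unitmxE unitfE.
rewrite /cofactor; apply: CkM => //; first exact: Ck_cst.
apply: Ck_det => //; apply/Ck_mx => // a b.
by under eq_fun do rewrite !mxE; exact: H.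
Qed.

End CkAlg.

Section Lines.
Context {R : realType} {V : normedModType R}.

Lemma is_derive_line (W : normedModType R) (f : V -> W) (x v : V) (s : R) :
  derivable f (x + s *: v) v ->
  is_derive s (1 : R) (fun s : R => f (x + s *: v)) ('D_v f (x + s *: v)).
Proof.
have E : (fun h : R => h^-1 *: (f (h *: v + (x + s *: v)) - f (x + s *: v))) =
  (fun h : R => h^-1 *: (((fun s : R => f (x + s *: v)) \o shift s) (h *: 1) - f (x + s *: v))).
  apply/funext => h /=; congr (_ *: (f _ - _)).
  by rewrite scalerDl [h *: 1]mulr1 addrCA.
move=> H; apply: DeriveDef; first by move: H; rewrite /derivable /= E.
by rewrite /derive /= -E.
Qed.

Lemma line_MVT (f : V -> R) (x v : V) :
  (forall s : R, 0 <= s <= 1 -> derivable f (x + s *: v) v) ->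
  exists2 c : R, 0 <= c <= 1 & f (x + v) - f x = 'D_v f (x + c *: v).
Proof.
move=> df.
pose h (s : R) := f (x + s *: v).
have H (s : R) : s \in `[0, 1] -> is_derive s (1 : R) h ('D_v f (x + s *: v)).
  by move=> s01; apply: is_derive_line; apply: df; move: s01; rewrite in_itv.
have H1 (s : R) : s \in `]0, 1[ -> is_derive s (1 : R) h ('D_v f (x + s *: v)).
  by move=> s01; apply: H; apply: subset_itv_oo_cc.
have H2 : {within `[0, 1], continuous h}.
  by apply: derivable_within_continuous => s s01; exact: (@ex_derive _ _ _ _ _ _ _ (H s s01)).
have [c c01] := MVT_segment ler01 H1 H2; rewrite /h.
rewrite scale1r scale0r addr0 subr0 mulr1 => E; by exists c; first by move: c01; rewrite in_itv.
Qed.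

End Lines.

Lemma continuous_dist {R : realType} {V W : normedModType R} (f : V -> W) x :
  {for x, continuous f} ->
  forall e : R, 0 < e -> exists2 d : R, 0 < d & forall y, `|y - x| < d -> `|f y - f x| < e.
Proof.
move=> /cvgrPdist_lt H e e0; have := H e e0.
move=> /nbhs_ballP [d /= d0 B]; exists d => // y yx.
by rewrite distrC; apply: B; rewrite -ball_normE /= distrC.
Qed.

Lemma open_dist {R : realType} {V : normedModType R} (U : set V) x :
  open U -> U x -> exists2 d : R, 0 < d & forall y, `|y - x| < d -> U y.
Proof.
move=> oU Ux; have /nbhs_ballP [d /= d0 B] := open_nbhs_nbhs (conj oU Ux).
by exists d => // y yx; apply: B; rewrite -ball_normE /= distrC.
Qed.

Lemma dist_continuous {R : realType} {V W : normedModType R} (f : V -> W) x :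
  (forall e : R, 0 < e -> exists2 d : R, 0 < d & forall y, `|y - x| < d -> `|f y - f x| <= e) ->
  {for x, continuous f}.
Proof.
move=> H; apply/cvgrPdist_le => e e0; have [d d0 B] := H e e0.
apply/nbhs_ballP; exists d => // y; rewrite -ball_normE /= => xy.
by rewrite distrC; apply: B; rewrite distrC.
Qed.

Section C1.
Context {R : realType} {V : normedModType R}.
Implicit Types (f : V -> R) (U : set V).

Lemma is_deriveP (W : normedModType R) (f : V -> W) x v l :
  (forall e : R, 0 < e -> exists2 d : R, 0 < d & forall t : R, t != 0 -> `|t| < d ->
     `|t^-1 *: (f (x + t *: v) - f x) - l| <= e) ->
  is_derive x v f l.
Proof.
move=> H.
have C : (h^-1 *: ((f \o shift x) (h *: v) - f x) @[h --> (0:R)^']) --> l.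
  apply/cvgrPdist_le => e e0; have [d d0 B] := H e e0.
  near=> t; rewrite distrC /= [t *: v + x]addrC; apply: B.
    by near: t; exact: nbhs_dnbhs_neq.
  by near: t; exact: dnbhs0_lt.
apply: DeriveDef; first by apply/cvg_ex; exists l.
exact: (cvg_lim _ C).
Unshelve. all: by end_near. Qed.

Lemma deriveP_dist (W : normedModType R) (f : V -> W) x v :
  derivable f x v ->
  forall e : R, 0 < e -> exists2 d : R, 0 < d & forall t : R, t != 0 -> `|t| < d ->
     `|t^-1 *: (f (x + t *: v) - f x) - 'D_v f x| <= e.
Proof.
move=> df e e0.
have : (h^-1 *: ((f \o shift x) (h *: v) - f x) @[h --> (0:R)^']) --> 'D_v f x by exact: df.
move=> /cvgrPdist_le /(_ e e0) [d /= d0 B]; exists d => // t t0 td.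
by have := B t; rewrite /= sub0r normrN distrC [t *: v + x]addrC; apply.
Qed.

Lemma derivable_scale (W : normedModType R) (f : V -> W) x v (a : R) :
  derivable f x v -> is_derive x (a *: v) f (a *: 'D_v f x).
Proof.
move=> df; have [->|a0] := eqVneq a 0; first by rewrite !scale0r; exact: is_derive0.
have na0 : 0 < `|a| by rewrite normr_gt0.
apply: is_deriveP => e e0.
have [d d0 B] := deriveP_dist df (e := e / `|a|) (divr_gt0 e0 na0).
exists (d / `|a|); first by rewrite divr_gt0.
move=> t t0 td; have ta0 : t * a != 0 by rewrite mulf_neq0.
have := B (t * a) ta0; rewrite normrM -ltr_pdivlMr // => /(_ td).
rewrite -scalerA ler_pdivlMr // => H.
have E : a * (t * a)^-1 = t^-1 by field; rewrite t0 a0.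
have -> : t^-1 *: (f (x + t *: (a *: v)) - f x) - a *: 'D_v f x =
    a *: ((t * a)^-1 *: (f (x + t *: (a *: v)) - f x) - 'D_v f x).
  by rewrite [RHS]scalerBr [X in _ = X - _]scalerA E.
by rewrite normrZ mulrC.
Qed.

Lemma C1_line_MVT f U x v (d : R) : Ck_on 1 U f -> (forall y, `|y - x| < d -> U y) ->
  `|v| < d -> exists2 c : R, 0 <= c <= 1 & f (x + v) - f x = 'D_v f (x + c *: v).
Proof.
move=> hf dU vd; apply: line_MVT => s /andP[s0 s1].
apply: (Ck_derivable hf); apply: dU; rewrite [_ + _ *: _]addrC addrK normrZ ger0_norm //.
by apply: le_lt_trans vd; rewrite ler_piMl.
Qed.

(** Additivity is not built in, since [Ck_on] speaks of one direction at a time. The increment along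
    u + v is split into two legs; the mean value theorem on the leg along [v] gives 'D_v f at a
    nearby point, and continuity brings it back to [x]. *)
Lemma C1_deriveD f U x u v : open U -> Ck_on 1 U f -> U x ->
  'D_(u + v) f x = 'D_u f x + 'D_v f x.
Proof.
move=> oU hf Ux; apply: derive_val; apply: is_deriveP => e e0.
have e2 : 0 < e / 2 by rewrite divr_gt0.
have [d1 d10 B1] := deriveP_dist (Ck_derivable hf Ux (v := u)) e2.
have [d2 d20 B2] := continuous_dist (Ck_cont (Ck_deriv v hf) Ux) e2.
have [d3 d30 B3] := open_dist oU Ux.
pose d := Num.min d1 (Num.min d2 d3 / (1 + `|u| + `|v|)).
have D0 : 0 < 1 + `|u| + `|v| by rewrite -addrA ltr_pwDl // addr_ge0.
exists d; first by rewrite lt_min d10 divr_gt0 // lt_min d20.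
move=> t t0; rewrite lt_min ltr_pdivlMr // lt_min => /andP[td1 /andP[td2 td3]].
have td : `|t *: u| + `|t *: v| <= `|t| * (1 + `|u| + `|v|).
  by rewrite !normrZ -mulrDr ler_wpM2l // -addrA lerDr.
have near0 (c : R) : 0 <= c <= 1 -> `|x + t *: u + c *: (t *: v) - x| <= `|t| * (1 + `|u| + `|v|).
  move=> /andP[c0 c1]; rewrite -[x + _ + _]addrA [x + _]addrC addrK; apply: le_trans td.
  apply: le_trans (ler_normD _ _) _; rewrite lerD2l [leLHS]normrZ ger0_norm //.
  by rewrite ler_piMl.
have [c c01 E] : exists2 c : R, 0 <= c <= 1 & f (x + t *: u + t *: v) - f (x + t *: u)
    = 'D_(t *: v) f (x + t *: u + c *: (t *: v)).
  apply: line_MVT => s s01; have : U (x + t *: u + s *: (t *: v)).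
    by apply: B3; apply: le_lt_trans (near0 s s01) td3.
  exact: (Ck_derivable hf).
have Uc : U (x + t *: u + c *: (t *: v)) by apply: B3; apply: le_lt_trans (near0 c c01) td3.
have E2 : 'D_(t *: v) f (x + t *: u + c *: (t *: v)) = t *: 'D_v f (x + t *: u + c *: (t *: v)).
  exact: (@derive_val _ _ _ _ _ _ _ (derivable_scale t (Ck_derivable hf Uc (v := v)))).
have E3 : f (x + t *: (u + v)) - f x = t *: 'D_v f (x + t *: u + c *: (t *: v)) + (f (x + t *: u) - f x).
  by rewrite -E2 -E scalerDr [x + (_ + _)]addrA addrA subrK.
have -> : t^-1 *: (f (x + t *: (u + v)) - f x) - ('D_u f x + 'D_v f x) =
   (t^-1 *: (f (x + t *: u) - f x) - 'D_u f x) + ('D_v f (x + t *: u + c *: (t *: v)) - 'D_v f x).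
  by rewrite E3 /GRing.scale /=; move: ('D_v f _) (f (_ + _) - _) => a1 b1; field.
apply: le_trans (ler_normD _ _) _; rewrite [e]splitr; apply: lerD; first exact: B1.
by apply: ltW; apply: B2; apply: le_lt_trans (near0 c c01) td2.
Qed.

Lemma C1_deriveZ (W : normedModType R) (f : V -> W) U x (a : R) v : Ck_on 1 U f -> U x ->
  'D_(a *: v) f x = a *: 'D_v f x.
Proof.
move=> hf Ux.
exact: (@derive_val _ _ _ _ _ _ _ (derivable_scale a (Ck_derivable hf Ux (v := v)))).
Qed.
End C1.

Definition bas {R : nzRingType} {n : nat} (j : 'I_n) : 'rV[R]_n := delta_mx 0 j.

Section C1rV.
Context {R : realType} {n : nat}.
Local Notation V := 'rV[R]_n.

Lemma C1_derive_sum (f : V -> R) (U : set V) (x : V) (v : V) : open U -> Ck_on 1 U f -> U x ->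
  'D_v f x = \sum_j v 0 j * 'D_(bas j) f x.
Proof.
move=> oU hf Ux; rewrite {1}(row_sum_delta v).
elim/big_ind2: _ => [|u a w b <- <-|j _].
- exact: derive0.
- exact: (C1_deriveD _ _ oU hf Ux).
- exact: (C1_deriveZ _ _ hf Ux).
Qed.

Lemma rV_norm_le (v : V) (e : R) : 0 <= e -> (forall j, `|v 0 j| <= e) -> `|v| <= e.
Proof.
move=> e0 H; rewrite /Num.Def.normr/= mx_normrE (bigmax_le _ e0)//= => -[i j] _ /=.
by rewrite (ord1 i).
Qed.

Lemma rV_coord_le (v : V) j : `|v 0 j| <= `|v|.
Proof.
rewrite [leRHS]/Num.Def.normr/= mx_normrE.
exact: (le_bigmax _ (fun ij => `|v ij.1 ij.2|) (0, j)).
Qed.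

End C1rV.

Lemma cvg_sum {R : realType} {W : normedModType R} {T : Type} (F : set_system T)
    {FF : Filter F} (I : Type) (r : seq I) (f : I -> T -> W) (l : I -> W) :
  (forall i, f i x @[x --> F] --> l i) ->
  (\sum_(i <- r) f i x @[x --> F]) --> \sum_(i <- r) l i.
Proof.
move=> H; elim: r => [|a r IH].
  by under eq_fun do rewrite big_nil; rewrite big_nil; exact: cvg_cst.
under eq_fun do rewrite big_cons; rewrite big_cons; exact: cvgD.
Qed.

Section Chain.
Context {R : realType} {V : normedModType R} {n : nat}.

(** [g] is only derivable along [v]. The mean value theorem on the segment from g x to g (x + t v)
    expresses the increment of [f] exactly by its partial derivatives at a point [xi t], and xi t
    tends to g x. *)
Lemma chain_rule (f : 'rV[R]_n -> R) (U : set 'rV[R]_n) (g : V -> 'rV[R]_n) x v :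
  open U -> Ck_on 1 U f -> U (g x) -> derivable g x v ->
  is_derive x v (f \o g) (\sum_j 'D_v (fun y => g y 0 j) x * 'D_(bas j) f (g x)).
Proof.
move=> oU hf Ux dg.
have [r r0 rU] := open_dist oU Ux.
pose D (t : R) := g (x + t *: v) - g x.
have cD : (D t @[t --> (0:R)]) --> (0 : 'rV[R]_n).
  have dl : derivable g (x + (0:R) *: v) v by rewrite scale0r addr0.
  have := @ex_derive _ _ _ _ _ _ _ (is_derive_line dl).
  move=> /derivable1_diffP/differentiable_continuous C.
  have {}C : (g (x + t *: v) @[t --> (0:R)]) --> g (x + (0:R) *: v) by exact: C.
  rewrite -(subrr (g x)); apply: cvgB; last exact: cvg_cst.
  by move: C; rewrite scale0r addr0.
have [xi Hxi] : exists xi : R -> 'rV[R]_n, forall t, `|D t| < r ->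
    `|xi t - g x| <= `|D t| /\ f (g (x + t *: v)) - f (g x) = \sum_j D t 0 j * 'D_(bas j) f (xi t).
  suff : forall t, exists z, `|D t| < r ->
    `|z - g x| <= `|D t| /\ f (g (x + t *: v)) - f (g x) = \sum_j D t 0 j * 'D_(bas j) f z.
    by move=> /choice [xi H]; exists xi.
  move=> t; have [Dt|Dt] := ltP (`|D t|) r; last by exists 0.
  have [c c01 E] := C1_line_MVT hf rU Dt.
  have le : `|g x + c *: D t - g x| <= `|D t|.
    case/andP: c01 => c0 c1; rewrite [_ + _ *: _]addrC addrK normrZ ger0_norm //.
    by rewrite ler_piMl.
  exists (g x + c *: D t) => _; split => //.
  rewrite -(C1_derive_sum _ oU hf); last by apply: rU; apply: le_lt_trans le Dt.
  by rewrite -E /D (addrC (g x)) subrK.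
have nD : \forall t \near (0:R)^', `|D t| < r.
  have := cD; move=> /cvgrPdist_lt /(_ r r0) H.
  apply: cvg_within; apply: filterS H => t; by rewrite sub0r normrN.
have cxi : (xi t @[t --> (0:R)^']) --> g x.
  apply/cvgrPdist_le => e e0; near=> t; rewrite distrC.
  apply: (@le_trans _ _ `|D t|); first by apply: (Hxi _ _).1; near: t.
  near: t; apply: cvg_within.
  have := cD; move=> /cvgrPdist_le /(_ e e0); apply: filterS => t; by rewrite sub0r normrN.
have C : (\sum_j (t^-1 *: (g (x + t *: v) 0 j - g x 0 j)) * 'D_(bas j) f (xi t) @[t --> (0:R)^']) -->
   \sum_j 'D_v (fun y => g y 0 j) x * 'D_(bas j) f (g x).
  apply: cvg_sum => j; apply: cvgM.
    have := (derivable_mxP g x v).1 dg 0 j => dj.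
    have : (h^-1 *: (((fun y => g y 0 j) \o shift x) (h *: v) - g x 0 j) @[h --> (0:R)^']) --> 'D_v (fun y => g y 0 j) x by exact: dj.
    apply: cvg_trans; apply: near_eq_cvg; apply: nearW => t /=; by rewrite [t *: v + x]addrC.
  apply: (@cvg_comp _ _ _ xi ('D_(bas j) f) _ _ _ cxi); exact: (Ck_cont (Ck_deriv _ hf) Ux).
apply: is_deriveP => e e0.
have nE : \forall t \near (0:R)^', 
   `|t^-1 *: (f (g (x + t *: v)) - f (g x)) - \sum_j 'D_v (fun y => g y 0 j) x * 'D_(bas j) f (g x)| <= e.
  near=> t.
  rewrite (Hxi t _).2; last by near: t.
  rewrite scaler_sumr (eq_bigr (fun j => (t^-1 *: (g (x + t *: v) 0 j - g x 0 j)) * 'D_(bas j) f (xi t))); last first.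
    by move=> j _; rewrite /D !mxE /GRing.scale /= mulrA.
  rewrite distrC; near: t.
  by move/cvgrPdist_le : C => /(_ e e0).
case: nE => d /= d0 B; exists d => // t t0 td; apply: B => //=.
by rewrite sub0r normrN.
Unshelve. all: by end_near. Qed.

Lemma Ck_comp (k : nat) (f : 'rV[R]_n -> R) (U : set 'rV[R]_n) (g : V -> 'rV[R]_n) (B : set V) :
  open U -> open B -> (forall x, B x -> U (g x)) -> Ck_on k U f -> Ck_on k B g ->
  Ck_on k B (f \o g).
Proof.
move=> oU oB BU; elim: k f => [|k IH] f hf hg.
  split => // x Bx; apply: continuous_comp; first exact: (Ck_cont hg).
  by apply: (Ck_cont hf); exact: BU.
have hf1 : Ck_on 1 U f by elim: (k) hf => // j IHj /CkS.
split.
  move=> x Bx; apply: continuous_comp; first exact: (Ck_cont hg).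
  by apply: (Ck_cont hf); exact: BU.
move=> v; have ch x : B x -> is_derive x v (f \o g) (\sum_j 'D_v (fun y => g y 0 j) x * 'D_(bas j) f (g x)).
  by move=> Bx; apply: (chain_rule oU) => //; [exact: BU|exact: (Ck_derivable hg)].
split; first by move=> x Bx; have [] := ch x Bx.
apply: (@Ck_eq _ _ _ _ _ (fun x => \sum_j 'D_v (fun y => g y 0 j) x * 'D_(bas j) f (g x))) => //.
  by move=> x Bx; have := ch x Bx => /@derive_val ->.
apply: Ck_sum => // j _; apply: CkM => //.
  by apply: Ck_deriv; apply: ((Ck_rV k.+1 g oB).1 hg).
exact: (IH ('D_(bas j) f) (Ck_deriv _ hf) (CkS hg)).
Qed.

Lemma Ck_compV m (k : nat) (f : 'rV[R]_n -> 'rV[R]_m) (U : set 'rV[R]_n) (g : V -> 'rV[R]_n) (B : set V) :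
  open U -> open B -> (forall x, B x -> U (g x)) -> Ck_on k U f -> Ck_on k B g ->
  Ck_on k B (f \o g).
Proof.
move=> oU oB BU /(Ck_rV _ _ oU) hf hg; apply/Ck_rV => // j.
exact: (Ck_comp oU oB BU (hf j) hg).
Qed.

Lemma chain_rule1 (f : R -> R) (g : V -> R) x v :
  derivable f (g x) 1 -> derivable g x v ->
  is_derive x v (f \o g) ('D_1 f (g x) * 'D_v g x).
Proof.
move=> df dg.
have dl : derivable g (x + (0:R) *: v) v by rewrite scale0r addr0.
have [dh Eh] := is_derive_line dl; rewrite scale0r addr0 in Eh.
have df' : derivable f ((fun s : R => g (x + s *: v)) 0) 1 by rewrite scale0r addr0.
have E := derive1_comp dh df'; rewrite !derive1E scale0r addr0 Eh in E.
have D : derivable (f \o (fun s : R => g (x + s *: v))) 0 1.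
  apply/derivable1_diffP; apply: (@differentiable_comp _ _ _ _ _ f).
    by move/derivable1_diffP: dh.
  by move/derivable1_diffP: df'.
apply: is_deriveP => e e0; have [d d0 B] := deriveP_dist D e0.
exists d => // t t0 td; have := B t t0 td.
by rewrite /= E scale0r addr0 add0r [t *: 1]mulr1.
Qed.

Lemma Ck_comp1 (k : nat) (f : R -> R) (U : set R) (g : V -> R) (B : set V) :
  open B -> (forall x, B x -> U (g x)) -> Ck_on k U f -> Ck_on k B g ->
  Ck_on k B (f \o g).
Proof.
move=> oB BU; elim: k f => [|k IH] f hf hg.
  split => // x Bx; apply: continuous_comp; first exact: (Ck_cont hg).
  by apply: (Ck_cont hf); exact: BU.
split.
  move=> x Bx; apply: continuous_comp; first exact: (Ck_cont hg).
  by apply: (Ck_cont hf); exact: BU.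
move=> v; have ch x : B x -> is_derive x v (f \o g) ('D_1 f (g x) * 'D_v g x).
  by move=> Bx; apply: chain_rule1; [exact: (Ck_derivable hf (BU _ Bx))|exact: (Ck_derivable hg)].
split; first by move=> x Bx; have [] := ch x Bx.
apply: (@Ck_eq _ _ _ _ _ (fun x => 'D_1 f (g x) * 'D_v g x)) => //.
  by move=> x Bx; have := ch x Bx => /@derive_val ->.
apply: CkM => //; last exact: Ck_deriv.
exact: (IH ('D_1 f) (Ck_deriv _ hf) (CkS hg)).
Qed.

End Chain.

(** * The inverse function theorem *)

Section IsDerive.
Context {R : realType} {V : normedModType R}.

Lemma isdD (W : normedModType R) (f g : V -> W) x v a b :
  is_derive x v f a -> is_derive x v g b -> is_derive x v (fun y => f y + g y) (a + b).
Proof. exact: is_deriveD. Qed.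

Lemma isdN (W : normedModType R) (f : V -> W) x v a :
  is_derive x v f a -> is_derive x v (fun y => - f y) (- a).
Proof. exact: is_deriveN. Qed.

Lemma isdB (W : normedModType R) (f g : V -> W) x v a b :
  is_derive x v f a -> is_derive x v g b -> is_derive x v (fun y => f y - g y) (a - b).
Proof. exact: is_deriveB. Qed.

Lemma isdM (f g : V -> R) x v a b :
  is_derive x v f a -> is_derive x v g b ->
  is_derive x v (fun y => f y * g y) (f x * b + g x * a).
Proof. exact: is_deriveM. Qed.

Lemma isdC (W : normedModType R) (c : W) (x v : V) : is_derive x v (fun=> c) 0.
Proof. exact: is_derive_cst. Qed.

Lemma isdZ (f : V -> R) x v a (c : R) :
  is_derive x v f a -> is_derive x v (fun y => c * f y) (c * a).
Proof.
move=> h; have := isdM (isdC c x v) h; rewrite mulr0 addr0; exact.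
Qed.

Lemma isdV (f : V -> R) x v a : f x != 0 ->
  is_derive x v f a -> is_derive x v (fun y => (f y)^-1) (- a / f x ^+ 2).
Proof.
move=> f0 [df <-]; apply: DeriveDef; first exact: derivableV.
by rewrite deriveV // scaleNr /GRing.scale /= mulNr mulrC.
Qed.

Lemma isd_sum (W : normedModType R) (I : Type) (r : seq I) (f : I -> V -> W) (l : I -> W) x v :
  (forall i, is_derive x v (f i) (l i)) ->
  is_derive x v (fun y => \sum_(i <- r) f i y) (\sum_(i <- r) l i).
Proof.
move=> H; elim: r => [|a r IH].
  by rewrite big_nil; under eq_fun do rewrite big_nil; exact: isdC.
by rewrite big_cons; under eq_fun do rewrite big_cons; exact: isdD.
Qed.

Lemma isd_coord m n (f : V -> 'M[R]_(m, n)) i j x v :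
  derivable f x v -> is_derive x v (fun y => f y i j) ('D_v f x i j).
Proof.
move=> df; apply: DeriveDef; first exact: (derivable_mxP f x v).1.
by rewrite derive_mx // mxE.
Qed.

Lemma isd_mx m n (f : V -> 'M[R]_(m, n)) (l : 'M[R]_(m, n)) x v :
  (forall i j, is_derive x v (fun y => f y i j) (l i j)) -> is_derive x v f l.
Proof.
move=> H; have d : derivable f x v by apply/derivable_mxP => i j; have [] := H i j.
apply: DeriveDef => //; rewrite derive_mx //; apply/matrixP => i j.
by rewrite mxE; have /@derive_val := H i j.
Qed.

Lemma isd_eq (W : normedModType R) (f : V -> W) x v a b :
  is_derive x v f a -> a = b -> is_derive x v f b.
Proof. by move=> h <-. Qed.

End IsDerive.

(** Gives matrices the joint complete and normed structure that the Banach fixed point theorem asks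
    for. *)
HB.instance Definition _ (R : realType) (m n : nat) :=
  Complete.copy 'M[R]_(m, n) 'M[R]_(m, n).

Lemma isd_coord_id (R : realType) m n (x v : 'M[R]_(m, n)) i j :
  is_derive x v (fun y => y i j) (v i j).
Proof. by have := isd_coord i j (@derivable_id _ _ x v); rewrite derive_id. Qed.

Section IFT.
Context {R : realType} {n : nat}.
Local Notation V := 'rV[R]_n.
Implicit Types (f : V -> V) (U : set V).

Definition jacobian f (x : V) : 'M[R]_n := \matrix_(i, j) 'D_(bas i) (fun y => f y 0 j) x.

Lemma C1_jacobian f U x v : open U -> Ck_on 1 U f -> U x -> 'D_v f x = v *m jacobian f x.
Proof.
move=> oU hf Ux; have d := Ck_derivable hf Ux (v := v).
rewrite derive_mx //; apply/rowP => j; rewrite !mxE.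
rewrite (C1_derive_sum _ oU) ?(Ck_rV _ _ oU) //; last exact: ((Ck_rV _ _ oU).1 hf).
by apply: eq_bigr => i _; rewrite !mxE.
Qed.

Lemma mulmx_norm_le m p (v : 'rV[R]_m) (A : 'M[R]_(m, p)) :
  `|v *m A| <= m%:R * `|A| * `|v|.
Proof.
have A0 : 0 <= m%:R * `|A| * `|v| by rewrite !mulr_ge0.
apply: rV_norm_le => // j; rewrite mxE.
apply: le_trans (ler_norm_sum _ _ _) _.
apply: (@le_trans _ _ (\sum_(i < m) `|A| * `|v|)); last first.
  by rewrite sumr_const card_ord -[leLHS]mulr_natl mulrA.
apply: ler_sum => i _; rewrite normrM mulrC ler_pM //; last exact: rV_coord_le.
rewrite [leRHS]/Num.Def.normr/= mx_normrE.
exact: (le_bigmax _ (fun ij => `|A ij.1 ij.2|) (i, j)).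
Qed.

Lemma contraction_fix (x0 : V) (rho : R) (T : V -> V) : 0 <= rho ->
  (forall x, `|x - x0| <= rho -> `|T x - x0| <= rho) ->
  (forall x y, `|x - x0| <= rho -> `|y - x0| <= rho -> `|T x - T y| <= 2^-1 * `|x - y|) ->
  exists2 x, `|x - x0| <= rho & T x = x.
Proof.
move=> r0 TU TL; pose U : set V := [set x | `|x - x0| <= rho].
have TU' : forall x, U x -> U (T x) by move=> x; exact: TU.
pose TF := isFun.Build _ _ U U T TU'.
pose F : {fun U >-> U} := HB.pack T TF.
have q0 : (0 : R) <= 2^-1 by rewrite invr_ge0.
have cF : is_contraction F.
  exists (NngNum q0); split => /=; first by rewrite invf_lt1 // ltr1n.
  by move=> [x y] /= [Ux Uy]; exact: TL.
have cU : closed U.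
  apply: (closed_comp (f := fun x : V => `|x - x0|) (D := [set y | y <= rho])); last exact: closed_le.
  by move=> x _; apply: continuous_comp; [apply: continuousB; [exact: cvg_id|exact: cst_continuous]|exact: norm_continuous].
have U0 : U !=set0 by exists x0; rewrite /U /= subrr normr0.
have [p Up E] := @banach_fixed_point R 'rV[R]_n U F cF cU U0.
by exists p => //; rewrite {2}E.
Qed.

Lemma unitmx_inj (A : 'M[R]_n) : (forall v : V, v *m A = 0 -> v = 0) -> A \in unitmx.
Proof. by move=> H; rewrite -row_free_unit; apply: inj_row_free. Qed.

(** Newton iteration with the derivative frozen at [x0]: f x = y when x is fixed by x |-> x - (f x -
    y) A, with A the inverse Jacobian. The derivative [Phi] of this map vanishes at x0, so it
    contracts a small ball by 1/2. The same contraction gives the Lipschitz bound on [s] from which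
    [inverse_Ck] starts. *)
Lemma local_inverse f U (x0 : V) : open U -> Ck_on 1 U f -> U x0 ->
  (forall v, 'D_v f x0 = 0 -> v = 0) ->
  exists r : R, exists s : V -> V, exists B : set V, exists L : R,
  [/\ 0 < r, open B, B x0 & B `<=` U] /\
  [/\ forall x, B x -> `|f x - f x0| < r /\ s (f x) = x,
      forall y, `|y - f x0| < r -> B (s y) /\ f (s y) = y,
      forall y z, `|y - f x0| < r -> `|z - f x0| < r -> `|s y - s z| <= L * `|y - z| &
      forall x, B x -> jacobian f x \in unitmx].
Proof.
move=> oU hf Ux0 inj0.
have uJ : jacobian f x0 \in unitmx.
  by apply: unitmx_inj => v; rewrite -(C1_jacobian _ oU hf Ux0); exact: inj0.
pose A := invmx (jacobian f x0).
pose Phi x : 'M[R]_n := 1%:M - jacobian f x *m A.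
have hfj j : Ck_on 1 U (fun y => f y 0 j) by exact: ((Ck_rV _ _ oU).1 hf).
have cPhi : Ck_on 0 U Phi.
  apply/Ck_mx => // i j; under eq_fun do rewrite !mxE.
  apply: CkB => //; first exact: Ck_cst.
  apply: Ck_sum => // k _; apply: CkM => //; last exact: Ck_cst.
  under eq_fun do rewrite mxE; exact: Ck_deriv.
have Phi0 : Phi x0 = 0 by rewrite /Phi /A mulmxV // subrr.
(* [mulmx_norm_le] loses a factor n, so entries of [Phi] below this bound give a contraction by 1/2;
   the successor keeps the denominator nonzero. *)
have n1 : 0 < (2 * n.+1%:R)^-1 :> R by rewrite invr_gt0 mulr_gt0.
have [d1 d10 B1] := continuous_dist (Ck_cont cPhi Ux0) n1.
have [d2 d20 B2] := open_dist oU Ux0.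
pose rho := Num.min d1 d2; have rho0 : 0 < rho by rewrite lt_min d10.
have rU x : `|x - x0| < rho -> U x by rewrite lt_min => /andP[_ /B2].
have PhiL x (v : V) : `|x - x0| < rho -> `|v *m Phi x| <= 2^-1 * `|v|.
  move=> xr; apply: le_trans (mulmx_norm_le _ _) _; rewrite ler_wpM2r //.
  have : `|Phi x - Phi x0| < (2 * n.+1%:R)^-1.
    by apply: B1; move: xr; rewrite lt_min => /andP[].
  rewrite Phi0 subr0 => /ltW H; apply: (@le_trans _ _ (n%:R * (2 * n.+1%:R)^-1)).
    by rewrite ler_wpM2l.
  rewrite invfM mulrCA ger_pMr ?invr_gt0 // ler_pdivrMr // mul1r ler_nat.
  exact: leqnSn.
pose psi x : V := x - f x *m A.
have dpsi x v j : U x -> is_derive x v (fun y => psi y 0 j) ((v *m Phi x) 0 j).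
  move=> Ux.
  have -> : (fun y => psi y 0 j) = (fun y => y 0 j - \sum_k A k j * f y 0 k).
    by apply/funext => y; rewrite !mxE; congr (_ - _); apply: eq_bigr => k _; rewrite mulrC.
  apply: isd_eq.
    apply: isdB; first exact: isd_coord_id.
    apply: isd_sum => k; apply: isdZ; apply: (isd_coord 0 k); exact: (Ck_derivable hf Ux).
  rewrite /Phi mulmxBr mulmx1 mulmxA -(C1_jacobian _ oU hf Ux) !mxE.
  by congr (_ - _); apply: eq_bigr => k _; rewrite mulrC.
have ball_line (x y : V) (s : R) : 0 <= s <= 1 -> `|x - x0| < rho -> `|y - x0| < rho ->
    `|y + s *: (x - y) - x0| < rho.
  move=> /andP[s0 s1] xr yr.
  have -> : y + s *: (x - y) - x0 = (1 - s) *: (y - x0) + s *: (x - x0).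
    by apply/rowP => j; rewrite !mxE; ring.
  apply: le_lt_trans (ler_normD _ _) _; rewrite !normrZ ger0_norm ?subr_ge0 // ger0_norm //.
  have [->|sn] := eqVneq s 0; first by rewrite subr0 mul1r mul0r addr0.
  have sp : 0 < s by rewrite lt_neqAle eq_sym sn.
  apply: (@lt_le_trans _ _ ((1 - s) * rho + s * rho)); last by rewrite -mulrDl subrK mul1r.
  apply: ler_ltD; first by rewrite ler_wpM2l ?subr_ge0 // ltW.
  by rewrite ltr_pM2l.
have psiL x y : `|x - x0| < rho -> `|y - x0| < rho -> `|psi x - psi y| <= 2^-1 * `|x - y|.
  move=> xr yr; apply: rV_norm_le; first by rewrite mulr_ge0 // invr_ge0.
  move=> j; have [|c c01] := @line_MVT _ _ (fun y => psi y 0 j) y (x - y).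
    by move=> s s01; have [] := dpsi (y + s *: (x - y)) (x - y) j (rU _ (ball_line _ _ _ s01 xr yr)).
  have cr := ball_line _ _ _ c01 xr yr.
  rewrite (@derive_val _ _ _ _ _ _ _ (dpsi _ (x - y) j (rU _ cr))) [y + _]addrC subrK => E.
  rewrite !mxE in E *; rewrite E; apply: le_trans (PhiL _ (x - y) cr).
  have := rV_coord_le ((x - y) *m Phi (y + c *: (x - y))) j; by rewrite mxE.
pose a := n%:R * `|A| + 1; have a0 : 0 < a by rewrite ltr_wpDl // mulr_ge0.
have AL (v : V) : `|v *m A| <= a * `|v|.
  by apply: le_trans (mulmx_norm_le _ _) _; rewrite ler_wpM2r // lerDl.
(* The ball of radius rho / 4 is mapped into itself: the contraction accounts for rho / 8 and the
   shift (y - f x0) A for another rho / 8. *)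
pose r := rho / 8 / a; have r0 : 0 < r by rewrite !divr_gt0.
have rho2 : rho / 2 < rho by lra.
have fix_ex y : exists x, `|y - f x0| < r -> `|x - x0| < rho / 2 /\ f x = y.
  have [yr|_] := ltP `|y - f x0| r; last by exists 0.
  have base : `|(y - f x0) *m A| <= rho / 8.
    apply: le_trans (AL _) _; rewrite mulrC -ler_pdivlMr //; exact: ltW.
  have [||| x xr fx] := @contraction_fix x0 (rho / 4) (fun x => psi x + y *m A).
  - by rewrite divr_ge0 // ltW.
  - move=> x xr; have -> : psi x + y *m A - x0 = (psi x - psi x0) + (y - f x0) *m A.
      by rewrite /psi mulmxBl; apply/rowP => j; rewrite !mxE; ring.
    apply: le_trans (ler_normD _ _) _.
    have := psiL x x0; rewrite subrr normr0 => /(_ _ rho0) H.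
    have : `|psi x - psi x0| <= 2^-1 * `|x - x0| by apply: H; lra.
    by move: base xr; lra.
  - move=> x z xr zr; rewrite opprD addrACA subrr addr0; apply: psiL; lra.
  exists x => _; split; first by lra.
  have : (f x - y) *m A = 0.
    rewrite mulmxBl; apply/eqP; rewrite subr_eq0; apply/eqP.
    move: fx; rewrite /psi => fx; apply/rowP => j; move/rowP/(_ j): fx; rewrite !mxE; lra.
  move/(congr1 (fun v => v *m jacobian f x0)); rewrite -mulmxA mulVmx // mulmx1 mul0mx.
  by move/eqP; rewrite subr_eq0 => /eqP.
have /choice [s sP] := fix_ex.
have fL x y : `|x - x0| < rho -> `|y - x0| < rho -> `|x - y| <= 2 * a * `|f x - f y|.
  move=> xr yr; have H1 := psiL x y xr yr; have H2 := AL (f x - f y).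
  have : x - y = (psi x - psi y) + (f x - f y) *m A.
    by rewrite /psi mulmxBl; apply/rowP => j; rewrite !mxE; ring.
  move=> E; have : `|x - y| <= `|psi x - psi y| + `|(f x - f y) *m A| by rewrite {1}E ler_normD.
  lra.
have cf : {in U, continuous f} by move=> x; rewrite inE => Ux; exact: (Ck_cont hf).
exists r, s, [set x | `|x - x0| < rho / 2 /\ `|f x - f x0| < r], (2 * a); split; split => //.
- rewrite openE => x /= [xr fr]; have Ux : U x by apply: rU; lra.
  have [e e0 Be] := continuous_dist (cf x (mem_set Ux)) (e := r - `|f x - f x0|) (ltac:(by rewrite subr_gt0)).
  apply/nbhs_ballP; exists (Num.min e (rho / 2 - `|x - x0|)).
    by rewrite /= lt_min e0 subr_gt0.
  move=> z; rewrite -ball_normE /= lt_min distrC => /andP[z1 z2]; split.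
    have := ler_distD x z x0; lra.
  have := Be z z1; have := ler_distD (f x) (f z) (f x0); lra.
- by rewrite /= !subrr !normr0; split => //; lra.
- by move=> x [xr _]; apply: rU; lra.
- move=> x [xr fr]; split => //; have [sr sf] := sP _ fr.
  apply/eqP; rewrite -subr_eq0 -normr_le0.
  have := fL (s (f x)) x; rewrite sf subrr normr0 mulr0; apply; lra.
- by move=> y yr; have [sr sf] := sP _ yr; rewrite /= sf.
- move=> y z yr zr; have [sr sf] := sP _ yr; have [tr tf] := sP _ zr.
  by have := fL (s y) (s z); rewrite sf tf; apply; lra.
move=> x [xr _]; apply: unitmx_inj => v v0.
have := PhiL x v (ltac:(lra)); rewrite /Phi mulmxBr mulmx1 mulmxA v0 mul0mx subr0.
move=> H; apply/eqP; rewrite -normr_le0; have := normr_ge0 v; lra.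
Qed.

End IFT.

Section InverseSmooth.
Context {R : realType} {n : nat}.
Local Notation V := 'rV[R]_n.
Implicit Types (f : V -> V) (U : set V).

Lemma jacobian_Ck k f U : open U -> Ck_on k.+1 U f -> Ck_on k U (jacobian f).
Proof.
move=> oU hf; apply/Ck_mx => // i j; under eq_fun do rewrite mxE.
by apply: Ck_deriv; apply: ((Ck_rV _ _ oU).1 hf).
Qed.

(** Let [Del] be the increment of [s]. The mean value theorem, applied to each coordinate of [f],
    shows that Del times a nearby Jacobian is t v; the Lipschitz bound makes Del of order t, so
    replacing that Jacobian by the one at s y costs o(t). *)
Lemma inverse_derive f U (s : V -> V) (D : set V) (L : R) y v :
  open U -> Ck_on 1 U f -> open D -> D y ->
  (forall y, D y -> U (s y) /\ f (s y) = y) ->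
  (forall y z, D y -> D z -> `|s y - s z| <= L * `|y - z|) ->
  jacobian f (s y) \in unitmx ->
  is_derive y v s (v *m invmx (jacobian f (s y))).
Proof.
move=> oU hf oD Dy sD sL uJ.
have [Ux fx] := sD y Dy; set x := s y in Ux fx uJ *.
set A := invmx (jacobian f x).
pose C := n%:R * `|L| * `|v| * (n%:R * `|A|) + 1.
have C0 : 0 < C by rewrite ltr_wpDl // !mulr_ge0.
apply: is_deriveP => e e0.
have [d1 d10 B1] := continuous_dist (Ck_cont (jacobian_Ck oU hf) Ux) (divr_gt0 e0 C0).
have [d2 d20 B2] := open_dist oU Ux.
have [d3 d30 B3] := open_dist oD Dy.
pose K := (`|L| + 1) * (`|v| + 1).
have K0 : 0 < K by rewrite mulr_gt0 // ltr_wpDl.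
pose d := Num.min (d3 / K) (Num.min d1 d2 / K).
exists d; first by rewrite lt_min !divr_gt0 // lt_min d10.
move=> t t0; rewrite lt_min !ltr_pdivlMr // lt_min => /andP[td3 /andP[td1 td2]].
have vK : `|v| <= K.
  by have := normr_ge0 L; have := normr_ge0 v; rewrite /K; nra.
have LvK : `|L| * `|v| <= K.
  by have := normr_ge0 L; have := normr_ge0 v; rewrite /K; nra.
have tn0 := normr_ge0 t.
have Dt : D (y + t *: v).
  apply: B3; rewrite [y + _]addrC addrK normrZ; apply: le_lt_trans td3.
  by rewrite ler_wpM2l.
set Del := s (y + t *: v) - x.
have DelL : `|Del| <= `|t| * (`|L| * `|v|).
  have := sL _ _ Dt Dy; rewrite -/x -/Del [y + _]addrC addrK normrZ => H.
  apply: le_trans H _; rewrite mulrCA ler_wpM2l // ler_wpM2r //; exact: ler_norm.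
have DelK : `|Del| <= `|t| * K by apply: le_trans DelL _; rewrite ler_wpM2l.
have hfj j : Ck_on 1 U (fun y => f y 0 j) by exact: ((Ck_rV _ _ oU).1 hf).
have fE : f (x + Del) - f x = t *: v.
  by rewrite /Del [x + _]addrC subrK (sD _ Dt).2 fx [y + _]addrC addrK.
have bnd : `|t^-1 *: Del *m jacobian f x - v| <= n%:R * (e / C) * (`|L| * `|v|).
  apply: rV_norm_le; first by rewrite !mulr_ge0 // ltW // ?divr_gt0 // invr_gt0.
  move=> j.
  have [c /andP[c0 c1] E] := C1_line_MVT (hfj j) B2 (le_lt_trans DelK td2).
  have cr : `|x + c *: Del - x| <= `|Del|.
    by rewrite [x + _]addrC addrK normrZ ger0_norm // ler_piMl.
  have Uc : U (x + c *: Del) by apply: B2; apply: le_lt_trans cr (le_lt_trans DelK td2).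
  have Jc : `|jacobian f (x + c *: Del) - jacobian f x| < e / C.
    by apply: B1; apply: le_lt_trans cr (le_lt_trans DelK td1).
  have E' : t * v 0 j = (Del *m jacobian f (x + c *: Del)) 0 j.
    have := congr1 (fun w : V => w 0 j) fE; rewrite !mxE E => <-.
    rewrite (C1_derive_sum _ oU (hfj j) Uc); by apply: eq_bigr => i _; rewrite !mxE.
  have -> : (t^-1 *: Del *m jacobian f x - v) 0 j =
      - (t^-1 *: (Del *m (jacobian f (x + c *: Del) - jacobian f x))) 0 j.
    rewrite mulmxBr -scalemxAl; move: (Del *m _) (Del *m _) E' => m1 m2 E'; rewrite !mxE.
    rewrite -E'; field; exact: t0.
  rewrite normrN; apply: le_trans (rV_coord_le _ _) _.
  rewrite normrZ normfV mulrC ler_pdivrMr ?normr_gt0 //.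
  apply: le_trans (mulmx_norm_le _ _) _.
  apply: (@le_trans _ _ (n%:R * (e / C) * (`|t| * (`|L| * `|v|)))).
    by apply: ler_pM => //; rewrite ?mulr_ge0 // ler_wpM2l // ltW.
  by rewrite -[leRHS]mulrA [`|t| * _]mulrC.
have -> : t^-1 *: (s (y + t *: v) - s y) - v *m A = (t^-1 *: Del *m jacobian f x - v) *m A.
  by rewrite mulmxBl -mulmxA /A mulmxV // mulmx1.
apply: le_trans (mulmx_norm_le _ _) _.
apply: (@le_trans _ _ (n%:R * `|A| * (n%:R * (e / C) * (`|L| * `|v|)))).
  by rewrite ler_wpM2l // mulr_ge0.
have -> : n%:R * `|A| * (n%:R * (e / C) * (`|L| * `|v|)) = e * ((C - 1) / C).
  rewrite /C; ring.
by rewrite ger_pMr // ler_pdivrMr // mul1r gerBl.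
Qed.

(** Bootstrapping: the derivative of [s] is [v] times the inverse Jacobian along s, so s is always
    one class smoother than already known. *)
Lemma inverse_Ck f U (s : V -> V) (D : set V) (L : R) :
  open U -> (forall k, Ck_on k U f) -> open D ->
  (forall y, D y -> U (s y) /\ f (s y) = y) ->
  (forall y z, D y -> D z -> `|s y - s z| <= L * `|y - z|) ->
  (forall y, D y -> jacobian f (s y) \in unitmx) ->
  forall k, Ck_on k D s.
Proof.
move=> oU hf oD sD sL uJ.
have sd y v : D y -> is_derive y v s (v *m invmx (jacobian f (s y))).
  by move=> Dy; apply: (inverse_derive _ oU (hf 1%N) oD Dy sD sL); exact: uJ.
have cs : forall y, D y -> {for y, continuous s}.
  move=> y Dy; apply: dist_continuous => e e0.
  have [d d0 B] := open_dist oD Dy.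
  have L1 : 0 < `|L| + 1 by rewrite ltr_wpDl.
  exists (Num.min d (e / (`|L| + 1))); first by rewrite lt_min d0 divr_gt0.
  move=> z; rewrite lt_min ltr_pdivlMr // => /andP[zd ze].
  apply: le_trans (sL _ _ (B _ zd) Dy) _; apply: le_trans (ltW ze).
  by rewrite mulrC ler_wpM2l // (le_trans (ler_norm _)) // lerDl.
elim=> [|k IH]; first by split.
split => // v; split; first by move=> y Dy; have [] := sd y v Dy.
apply: (@Ck_eq _ _ _ _ _ (fun y => v *m invmx (jacobian f (s y)))) => //.
  by move=> y Dy; have /@derive_val -> := sd y v Dy.
have CJ : Ck_on k D (fun y => invmx (jacobian f (s y))).
  apply: Ck_invmx => //; apply/Ck_mx => // i j.
  apply: (@Ck_comp _ _ _ k (fun x => jacobian f x i j) U s D) => //.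
    by move=> y /sD [].
  exact: ((Ck_mx _ _ oU).1 (jacobian_Ck oU (hf k.+1))).
apply/Ck_rV => // j; under eq_fun do rewrite mxE.
apply: Ck_sum => // i _; apply: CkM => //; first exact: Ck_cst.
exact: ((Ck_mx _ _ oD).1 CJ).
Qed.

End InverseSmooth.

(** * Smooth cutoff functions *)

Section Bump.
Context {R : realType}.

(* The functions x^-m exp(-1/x), extended by 0, are closed under
   differentiation up to linear combinations, which gives their smoothness. *)
Definition expinv (m : nat) (x : R) : R := if 0 < x then x^-1 ^+ m * expR (- x^-1) else 0.

(** One term of the exponential series at 1/x beats the power of 1/x. Quadratic decay is what makes
    the derivative at 0 exist and vanish. *)
Lemma expinv_le m : exists2 C : R, 0 < C & forall x, `|expinv m x| <= C * x ^+ 2.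
Proof.
exists ((m.+2)`!%:R); first by rewrite ltr0n fact_gt0.
move=> x; rewrite /expinv; case: (ltP 0 x) => x0; last first.
  by rewrite normr0 mulr_ge0 // sqr_ge0.
rewrite ger0_norm; last by rewrite mulr_ge0 ?expR_ge0 // exprn_ge0 // invr_ge0 ltW.
have y0 : 0 < x^-1 by rewrite invr_gt0.
have H := expR_ge1Dxn m.+1 (ltW y0).
rewrite expRN ler_pdivrMr ?expR_gt0 //.
have f0 : 0 < (m.+2)`!%:R :> R by rewrite ltr0n fact_gt0.
apply: (@le_trans _ _ ((m.+2)`!%:R * x ^+ 2 * (x^-1 ^+ m.+2 / (m.+2)`!%:R))); last first.
  rewrite ler_wpM2l ?mulr_ge0 ?sqr_ge0 //; lra.
rewrite le_eqVlt; apply/orP; left; apply/eqP; rewrite !exprS expr0.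
move: (x^-1 ^+ m) ((m.+2)`!%:R : R) f0 => z N N0; field.
by rewrite !gt_eqF.
Qed.

Lemma expinv_derive m (x : R) : is_derive x (1 : R) (expinv m) (- m%:R * expinv m.+1 x + expinv m.+2 x).
Proof.
have [x0|x0|->] := ltgtP x 0.
- have E : {near x, (fun=> 0) =1 expinv m}.
    near=> y; rewrite /expinv ifN // -leNgt ltW //.
    by near: y; exact: lt_nbhsl.
  apply: near_eq_is_derive E _; rewrite /expinv !ifN ?mulr0 ?addr0; last 2 first.
    by rewrite -leNgt ltW.
    by rewrite -leNgt ltW.
  exact: isdC.
- have E : {near x, (fun y => y^-1 ^+ m * expR (- y^-1)) =1 expinv m}.
    near=> y; rewrite /expinv ifT //.
    by near: y; exact: lt_nbhsr.
  apply: near_eq_is_derive E _; rewrite /expinv !ifT //.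
  have dV : is_derive x (1:R) (fun y : R => y^-1) (- x^-1 ^+ 2).
    have h : is_derive x (1 : R) (fun y : R => y) 1 by exact: is_derive_id.
    have xn0 : (fun y : R => y) x != 0 by rewrite gt_eqF.
    by apply: isd_eq (isdV xn0 h) _; rewrite exprVn mulN1r.
  have dP : is_derive x (1:R) (fun y : R => y^-1 ^+ m) (- m%:R * x^-1 ^+ m.+1).
    have -> : (fun y : R => y^-1 ^+ m) = (fun y : R => y^-1) ^+ m by rewrite exprfctE.
    apply: isd_eq (is_deriveX m dV) _.
    case: (m) => [|k]; first by rewrite mul0r scale0r oppr0 mul0r.
    rewrite /GRing.scale /= !exprS; ring.
  have dE : is_derive x (1:R) (fun y : R => expR (- y^-1)) (expR (- x^-1) * x^-1 ^+ 2).
    have dN : is_derive x (1 : R) (fun y : R => - y^-1) (x^-1 ^+ 2).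
      by apply: isd_eq (isdN dV) _; rewrite opprK.
    have := @chain_rule1 R _ expR (fun y : R => - y^-1) x 1 (@derivable_expR _ _) (@ex_derive _ _ _ _ _ _ _ dN).
    have E y : 'D_1 (@expR R) y = expR y by exact: (congr1 (fun f => f y) (@derive_expR R)).
    by rewrite E (@derive_val _ _ _ _ _ _ _ dN).
  apply: isd_eq (isdM dP dE) _.
  rewrite !exprS; move: (x^-1 ^+ m) (expR _) => p q; ring.
rewrite {2 3}/expinv ltxx mulr0 addr0; apply: is_deriveP => e e0.
have [C C0 H] := expinv_le m.
exists (e / C); first by rewrite divr_gt0.
move=> t t0; rewrite ltr_pdivlMr // => te.
have f0 : expinv m 0 = 0 by rewrite /expinv ltxx.
rewrite f0 !subr0 add0r [t *: 1]mulr1 normrZ normfV mulrC ler_pdivrMr ?normr_gt0 //.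
apply: le_trans (H t) _; have := normr_gt0 t; rewrite t0 => tp.
rewrite -(real_normK (num_real t)); have := ltW te; nra.
Unshelve. all: by end_near. Qed.

Lemma expinv_Ck k m : Ck_on k [set: R] (expinv m).
Proof.
have ct m' x : {for x, continuous (expinv m')}.
  by apply/differentiable_continuous/derivable1_diffP; have [] := expinv_derive m' x.
elim: k m => [|k IH] m; first by split.
split => // v.
have dv x : is_derive x v (expinv m) (v * (- m%:R * expinv m.+1 x + expinv m.+2 x)).
  have [d <-] := expinv_derive m x; have := derivable_scale v d.
  by rewrite [v *: 1]mulr1.
split; first by move=> x _; have [] := dv x.
rewrite (_ : 'D_v _ = fun x => v * (- m%:R * expinv m.+1 x + expinv m.+2 x)).
  by repeat (first [exact: openT|exact: IH|exact: Ck_cst|apply: CkM|apply: CkD]).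
by apply/funext => x; have /@derive_val := dv x.
Qed.

Lemma expinv_ge0 m x : 0 <= expinv m x.
Proof.
rewrite /expinv; case: ltP => // x0.
by rewrite mulr_ge0 ?expR_ge0 // exprn_ge0 // invr_ge0 ltW.
Qed.

Lemma expinv_gt0 m x : 0 < x -> 0 < expinv m x.
Proof. by move=> x0; rewrite /expinv x0 mulr_gt0 ?expR_gt0 // exprn_gt0 // invr_gt0. Qed.

Lemma smooth_step : exists chi : R -> R, exists C : R,
  [/\ smooth_on [set: R] chi, forall t, 0 <= chi t <= 1,
      forall t, t <= 4^-1 -> chi t = 0, forall t, 3 / 4 <= t -> chi t = 1 &
      0 < C /\ forall t, `|'D_1 chi t| <= C].
Proof.
pose a t := expinv 0 (t - 4^-1); pose b t := expinv 0 (3 / 4 - t).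
have ab t : 0 < a t + b t.
  have [t1|t1] := ltP 4^-1 t.
    by rewrite ltr_pwDl ?expinv_ge0 // expinv_gt0 // subr_gt0.
  rewrite ltr_wpDl ?expinv_ge0 // expinv_gt0 // subr_gt0; lra.
pose chi t := a t / (a t + b t).
have idC k : Ck_on k [set: R] (fun t : R => t).
  case: k => [|k]; first by split=> // x _; exact: cvg_id.
  split; first by move=> x _; exact: cvg_id.
  move=> v; split; first by move=> x _; exact: derivable_id.
  rewrite (_ : 'D_v _ = fun=> v); first exact: Ck_cst.
  by apply/funext => x; exact: derive_id.
have aC k : Ck_on k [set: R] a.
  rewrite (_ : a = expinv 0 \o (fun t => t - 4^-1)) //.
  apply: (Ck_comp1 (U := [set: R])) => //.
  - exact: openT.
  - exact: expinv_Ck.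
  - by apply: CkB => //; [exact: openT|exact: Ck_cst].
have bC k : Ck_on k [set: R] b.
  rewrite (_ : b = expinv 0 \o (fun t => 3 / 4 - t)) //.
  apply: (Ck_comp1 (U := [set: R])) => //.
  - exact: openT.
  - exact: expinv_Ck.
  - by apply: CkB => //; [exact: openT|exact: Ck_cst].
have chiC : smooth_on [set: R] chi.
  move=> k; apply: CkM => //; first exact: openT.
  apply: CkV; first exact: openT.
    by move=> x _; rewrite gt_eqF.
  by apply: CkD => //; exact: openT.
have chi0 t : t <= 4^-1 -> chi t = 0.
  by move=> t1; rewrite /chi /a /expinv ifN ?mul0r // -leNgt subr_le0.
have chi1 t : 3 / 4 <= t -> chi t = 1.
  move=> t1; rewrite /chi; have -> : b t = 0.
    by rewrite /b /expinv ifN // -leNgt subr_le0.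
  by rewrite addr0 divff // gt_eqF //; have := ab t; rewrite /b /expinv ifN ?addr0 // -leNgt subr_le0.
have D0 t : t \notin `[0, 1] -> 'D_1 chi t = 0.
  rewrite in_itv /= negb_and -!ltNge => /orP[t0|t1].
    rewrite (@near_eq_derive R R R _ (fun=> 0)) ?derive_cst //.
    near=> y; apply: chi0; apply: (@le_trans _ _ 0) => //.
    by near: y; exact: lt_le_nbhsl.
  rewrite (@near_eq_derive R R R _ (fun=> 1)) ?derive_cst //.
  near=> y; apply: chi1; apply: (@le_trans _ _ 1); first by lra.
  by near: y; exact: lt_le_nbhsr.
have cD : {within `[0, 1], continuous (fun t => `|'D_1 chi t|)}.
  apply: continuous_subspaceT => t.
  have c := Ck_cont (Ck_deriv (1 : R) (chiC 1%N)) (I : [set: R] t).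
  exact: cvg_norm c.
have [c _ cM] := EVT_max ler01 cD.
exists chi, (`|'D_1 chi c| + 1); split => //.
- move=> t; rewrite /chi; apply/andP; split.
    by apply: divr_ge0; [exact: expinv_ge0|exact: ltW].
  by rewrite ler_pdivrMr // mul1r lerDl expinv_ge0.
- split; first by rewrite ltr_wpDl.
  move=> t; have [t01|t01] := boolP (t \in `[0, 1]).
    by apply: le_trans (cM t t01) _; rewrite lerDl.
  by rewrite D0 // normr0 addr_ge0.
Unshelve. all: by end_near. Qed.

End Bump.

(** * Euclidean rotations *)

Section Dot.
Context {R : realType} {n : nat}.
Local Notation V := 'rV[R]_n.
Implicit Types u v w T e d : V.

(** The norm carried by row vectors is the sup norm, so the Euclidean product and norm are
    introduced separately. *)
Definition dot u v : R := \sum_j u 0 j * v 0 j.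
Definition enorm u : R := Num.sqrt (dot u u).

Lemma dotC u v : dot u v = dot v u.
Proof. by apply: eq_bigr => j _; rewrite mulrC. Qed.
Lemma dotDl u v w : dot (u + v) w = dot u w + dot v w.
Proof. by rewrite -big_split; apply: eq_bigr => j _; rewrite mxE mulrDl. Qed.
Lemma dotDr u v w : dot w (u + v) = dot w u + dot w v.
Proof. by rewrite dotC dotDl !(dotC w). Qed.
Lemma dotZl (a : R) u v : dot (a *: u) v = a * dot u v.
Proof. by rewrite mulr_sumr; apply: eq_bigr => j _; rewrite mxE mulrA. Qed.
Lemma dotZr (a : R) u v : dot u (a *: v) = a * dot u v.
Proof. by rewrite dotC dotZl dotC. Qed.
Lemma dotNl u v : dot (- u) v = - dot u v.
Proof. by rewrite -scaleN1r dotZl mulN1r. Qed.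
Lemma dotNr u v : dot u (- v) = - dot u v.
Proof. by rewrite dotC dotNl dotC. Qed.
Definition dotE := (dotDl, dotDr, dotNl, dotNr, dotZl, dotZr).

Lemma dot_ge0 u : 0 <= dot u u.
Proof. by apply: sumr_ge0 => j _; rewrite -expr2 sqr_ge0. Qed.

Lemma dot_CS u v : dot u v ^+ 2 <= dot u u * dot v v.
Proof.
have H (a b : R) : 0 <= a ^+ 2 * dot u u + 2 * a * b * dot u v + b ^+ 2 * dot v v.
  have := dot_ge0 (a *: u + b *: v); rewrite !dotE (dotC v u); lra.
have u0 := dot_ge0 u; have v0 := dot_ge0 v.
have [E|E] := eqVneq (dot u u) 0.
  have [->|x0] := eqVneq (dot u v) 0; first by rewrite E mul0r expr0n.
  have := H (- (dot v v + 1) / dot u v) 1; rewrite E !mulr0 add0r expr1n.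
  have -> : 2 * (- (dot v v + 1) / dot u v) * 1 * dot u v = - 2 * (dot v v + 1).
    by field; rewrite x0.
  lra.
have up : 0 < dot u u by rewrite lt_neqAle eq_sym E.
have := H (- dot u v / dot u u) 1.
have -> : (- dot u v / dot u u) ^+ 2 * dot u u + 2 * (- dot u v / dot u u) * 1 * dot u v + 1 ^+ 2 * dot v v
   = (dot u u * dot v v - dot u v ^+ 2) / dot u u by field; rewrite gt_eqF.
by rewrite pmulr_lge0 ?invr_gt0 // subr_ge0.
Qed.

Lemma enorm_ge0 u : 0 <= enorm u. Proof. exact: sqrtr_ge0. Qed.
Lemma enorm_sq u : enorm u ^+ 2 = dot u u. Proof. by rewrite sqr_sqrtr // dot_ge0. Qed.

Lemma enorm_le u (a : R) : 0 <= a -> dot u u <= a ^+ 2 -> enorm u <= a.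
Proof. by move=> a0 H; rewrite -(ger0_norm a0) -sqrtr_sqr ler_wsqrtr. Qed.

Lemma dot_le u v : `|dot u v| <= enorm u * enorm v.
Proof.
rewrite -[leLHS]sqrtr_sqr /enorm -sqrtrM ?dot_ge0 // ler_wsqrtr //; exact: dot_CS.
Qed.

Lemma enormD u v : enorm (u + v) <= enorm u + enorm v.
Proof.
apply: enorm_le; first by rewrite addr_ge0 ?enorm_ge0.
rewrite !dotE (dotC v u) sqrrD !enorm_sq.
have := le_trans (ler_norm _) (dot_le u v); lra.
Qed.

Lemma enormZ (a : R) u : enorm (a *: u) = `|a| * enorm u.
Proof. by rewrite /enorm !dotE mulrA -expr2 sqrtrM ?sqr_ge0 // sqrtr_sqr. Qed.

Lemma enormN u : enorm (- u) = enorm u.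
Proof. by rewrite /enorm !dotE opprK. Qed.

Lemma enorm_coord u j : `|u 0 j| <= enorm u.
Proof.
rewrite -sqrtr_sqr /enorm ler_wsqrtr // /dot (bigD1 j) //= -expr2 lerDl.
by apply: sumr_ge0 => i _; rewrite -expr2 sqr_ge0.
Qed.

Lemma norm_enorm u : `|u| <= enorm u.
Proof. by apply: rV_norm_le; [exact: enorm_ge0|exact: enorm_coord]. Qed.

Lemma enorm_norm u : enorm u <= n%:R * `|u|.
Proof.
apply: enorm_le; first by rewrite mulr_ge0.
apply: (@le_trans _ _ (\sum_(j < n) `|u| ^+ 2)).
  apply: ler_sum => j _; rewrite -expr2 -real_normK ?num_real //.
  by rewrite lerXn2r ?nnegrE //; exact: rV_coord_le.
rewrite sumr_const card_ord exprMn -[leLHS]mulr_natl ler_wpM2r ?sqr_ge0 //.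
rewrite -natrX ler_nat; case: (n) => // k.
by rewrite -{1}[k.+1]expn1 leq_pexp2l.
Qed.

Lemma enorm_gt0 u : u != 0 -> 0 < enorm u.
Proof. by move=> u0; apply: lt_le_trans (norm_enorm u); rewrite normr_gt0. Qed.

Lemma dot_mul u v : u *m v^T = (dot u v)%:M.
Proof.
apply/matrixP => i j; rewrite (ord1 i) (ord1 j) !mxE /= mulr1n.
by apply: eq_bigr => k _; rewrite mxE.
Qed.

Lemma dot_row (A : 'M[R]_n) k v : dot (row k A) v = (v *m A^T) 0 k.
Proof. by rewrite mxE; apply: eq_bigr => j _; rewrite !mxE mulrC. Qed.

Lemma dot_mulmx u v (A : 'M[R]_n) : dot (u *m A) v = dot u (v *m A^T).
Proof.
have : (u *m A) *m v^T = u *m (v *m A^T)^T by rewrite trmx_mul trmxK mulmxA.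
by rewrite !dot_mul => /matrixP/(_ 0 0); rewrite !mxE /= !mulr1n.
Qed.

Section Orth.
Variable Q : 'M[R]_n.
Hypothesis QQ : Q^T *m Q = 1%:M.
Let e k := row k Q.

Lemma orth_sum u v : \sum_k dot (e k) u * dot (e k) v = dot u v.
Proof.
have -> : dot u v = dot (u *m Q^T) (v *m Q^T).
  by rewrite dot_mulmx trmxK -mulmxA QQ mulmx1.
by apply: eq_bigr => k _; rewrite !dot_row.
Qed.

Lemma orth_unit k : dot (e k) (e k) = 1.
Proof.
have QQ' : Q *m Q^T = 1%:M by apply: mulmx1C.
by rewrite dot_row /e -row_mul QQ' !mxE eqxx.
Qed.

Lemma orth_trace (H : 'M[R]_n) : \sum_k dot (e k *m H) (e k) = \tr H.
Proof.
rewrite -[in RHS](mulmx1 H) -QQ mulmxA mxtrace_mulC mulmxA /mxtrace.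
by apply: eq_bigr => k _; rewrite dotC dot_row /e -!row_mul mxE.
Qed.
End Orth.

End Dot.

Section Rotation.
Context {R : realType} {n : nat}.
Local Notation V := 'rV[R]_n.
Implicit Types u v w T e d : V.

Definition reflect w : 'M[R]_n := 1%:M - 2 *: (w^T *m w).

Lemma reflectE w e : e *m reflect w = e - 2 * dot e w *: w.
Proof.
rewrite mulmxBr mulmx1 -scalemxAr mulmxA dot_mul mul_scalar_mx scalerA.
by [].
Qed.

Lemma reflect_tr w : (reflect w)^T = reflect w.
Proof. by rewrite /reflect !linearB /= linearZ /= trmx_mul trmxK trmx1. Qed.

Lemma reflect_orth w : dot w w = 1 -> reflect w *m reflect w = 1%:M.
Proof.
move=> w1.
have PP : (w^T *m w) *m (w^T *m w) = w^T *m w.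
  by rewrite mulmxA -(mulmxA w^T w) dot_mul w1 mulmx1.
rewrite /reflect mulmxBl !mulmxBr !mul1mx mulmx1 -!scalemxAl -!scalemxAr PP scalerA.
by apply/matrixP => i j; rewrite !mxE; ring.
Qed.

(* The rational parametrization u of the unit sphere near T makes the product
   of the reflections in T and u an exact rotation, which agrees with the
   infinitesimal rotation e |-> e + 2 (T.e) z - 2 (z.e) T to second order. *)
Lemma rotation T z : dot T T = 1 -> dot z T = 0 -> dot z z <= 1 ->
  exists2 S : 'M[R]_n, S *m S^T = 1%:M &
    forall e, enorm (e *m S - e - (2 * dot T e *: z - 2 * dot z e *: T)) <= 30 * dot z z * enorm e.
Proof.
move=> T1 zT z1; pose q := dot z z / 4; have z0 := dot_ge0 z.
have q0 : 0 <= q by rewrite divr_ge0.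
have q1 : 0 < 1 + q by lra.
pose u := (1 + q)^-1 *: ((1 - q) *: T + z).
have u1 : dot u u = 1.
  rewrite !dotE (dotC T z) zT T1 /q; field; have : 0 < 4 + dot z z by lra.
  by move=> h; rewrite gt_eqF.
exists (reflect T *m reflect u).
  rewrite trmx_mul !reflect_tr mulmxA -(mulmxA (reflect T)) reflect_orth // mulmx1.
  exact: reflect_orth.
move=> e; rewrite mulmxA !reflectE.
set E := enorm e; have E0 : 0 <= E by exact: enorm_ge0.
have eT1 : enorm T = 1 by rewrite /enorm T1 sqrtr1.
have eu1 : enorm u = 1 by rewrite /enorm u1 sqrtr1.
have Te : `|dot T e| <= E by have := dot_le T e; rewrite eT1 mul1r.
pose s := enorm z; have s0 : 0 <= s by exact: enorm_ge0.
have ss : s ^+ 2 = dot z z by exact: enorm_sq.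
have s1 : s <= 1 by rewrite -(@ler_pXn2r _ 2) ?nnegrE // ss expr1n.
have ze : `|dot z e| <= s * E by exact: dot_le.
pose k := (1 + q)^-1; have k0 : 0 < k by rewrite invr_gt0.
have k1 : k <= 1 by rewrite invf_le1 // lerDl.
have kq : (1 + q) * k = 1 by rewrite /k divff // gt_eqF.
(* u - T = z + r with |r| = O(|z|^2) *)
pose r := (- q * k) *: z + (- 2 * q * k) *: T.
have uE : u = T + z + r.
  rewrite /u -/k /r; apply/rowP => j; rewrite !mxE.
  have F : (k - 1 + q * k) * (T 0 j + z 0 j) = 0.
    have -> : k - 1 + q * k = 0 by lra.
    by rewrite mul0r.
  move: (T 0 j) (z 0 j) F => a b F; lra.
have qs : q = s ^+ 2 / 4 by rewrite ss.
have rL : enorm r <= s ^+ 2.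
  apply: le_trans (enormD _ _) _; rewrite !enormZ eT1 -/s.
  have qk0 : 0 <= q * k by rewrite mulr_ge0 // ltW.
  have -> : - q * k = - (q * k) by ring.
  have -> : - 2 * q * k = - (2 * (q * k)) by ring.
  rewrite !normrN (ger0_norm qk0) (ger0_norm (mulr_ge0 (ler0n _ 2) qk0)) qs.
  have : s ^+ 2 / 4 * k <= s ^+ 2 / 4 by rewrite ler_piMr // divr_ge0 // sqr_ge0.
  have w0 : 0 <= s ^+ 2 / 4 * k by rewrite mulr_ge0 ?divr_ge0 ?sqr_ge0 // ltW.
  have ws : s ^+ 2 / 4 * k * s <= s ^+ 2 / 4 * k by rewrite ler_piMr.
  have := sqr_ge0 s; lra.
clearbody r u.
have [de deE] : exists de, de = z + r by exists (z + r).
have deL : enorm de <= 2 * s.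
  rewrite deE; apply: le_trans (enormD _ _) _; have : s ^+ 2 <= s by rewrite expr2 ler_piMr.
  by move: rL; rewrite -/s; lra.
have uE' : u = T + de by rewrite deE addrA -uE.
have uT : dot T u = 1 - dot de de / 2.
  have := u1; rewrite uE' !dotE T1 (dotC de T); lra.
have -> : e - 2 * dot e T *: T - 2 * dot (e - 2 * dot e T *: T) u *: u - e - (2 * dot T e *: z - 2 * dot z e *: T) =
   2 * dot T e *: r - 2 * dot r e *: T - 2 * dot de e *: de - 2 * dot de de * dot T e *: u.
  have uTe : dot (e - 2 * dot e T *: T) u = dot de e + dot T e * (dot de de - 1).
    rewrite !dotE (dotC e u) uT uE' dotDl (dotC e T); lra.
  rewrite uTe uE' deE (dotC e T) !dotDl.
  apply/rowP => j; rewrite !mxE.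
  ring.
have re : `|dot r e| <= s ^+ 2 * E.
  by apply: le_trans (dot_le _ _) _; rewrite ler_wpM2r.
have dee : `|dot de e| <= 2 * s * E.
  by apply: le_trans (dot_le _ _) _; rewrite ler_wpM2r.
have dd : `|dot de de| <= (2 * s) ^+ 2.
  rewrite ger0_norm ?dot_ge0 // -enorm_sq lerXn2r ?nnegrE ?enorm_ge0 //; lra.
apply: le_trans (enormD _ _) _; rewrite enormN.
apply: le_trans (lerD (enormD _ _) (lexx _)) _; rewrite enormN.
apply: le_trans (lerD (lerD (enormD _ _) (lexx _)) (lexx _)) _; rewrite enormN.
rewrite !enormZ eT1 eu1 !normrM !normr_nat -ss.
have h1 : `|dot T e| * enorm r <= E * s ^+ 2 by rewrite ler_pM // enorm_ge0.
have h2 : `|dot de e| * enorm de <= (2 * s * E) * (2 * s) by rewrite ler_pM // enorm_ge0.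
have h3 : `|dot de de| * `|dot T e| <= (2 * s) ^+ 2 * E by rewrite ler_pM.
have h4 : 0 <= s ^+ 2 * E by rewrite mulr_ge0 // sqr_ge0.
move: h1 h2 h3 h4 re; move: (`|dot T e|) (`|dot de e|) (`|dot de de|) (`|dot r e|) (enorm r) (enorm de) => b1 b2 b3 b4 b5 b6.
nra.
Qed.
End Rotation.

(** * Second variation of f^2 |dX| at a single step *)

Section StepVariation.
Context {R : realType} {n : nat}.
Local Notation V := 'rV[R]_n.
Implicit Types (T d e Y z : V) (f K t : R).

(** With m = 1 + t <T, Y> the norm is sqrt (m^2 + t^2 B) <= m + t^2 B / (2 m). Replacing 1 / (2 m)
    by 1 / 2 costs the cubic term, as 2 t K <= 1 keeps m above 1/2. *)
Lemma enorm_unitD T Y t K : dot T T = 1 -> `|dot T Y| <= K -> dot Y Y <= K ^+ 2 -> 1 <= K ->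
  0 < t -> 2 * t * K <= 1 ->
  enorm (T + t *: Y) <= 1 + t * dot T Y + t ^+ 2 * (dot Y Y - dot T Y ^+ 2) / 2 + t ^+ 3 * K ^+ 3.
Proof.
move=> T1 gK YK K1 t0 tK; set g := dot T Y in gK *.
set B := dot Y Y - g ^+ 2.
have B0 : 0 <= B by have := dot_CS T Y; rewrite T1 mul1r subr_ge0.
have BK : B <= K ^+ 2 by rewrite /B; have := sqr_ge0 g; lra.
have tg : `|t * g| <= t * K by rewrite normrM gtr0_norm // ler_wpM2l // ltW.
have m0 : 2^-1 <= 1 + t * g by move: tg; rewrite ler_norml => /andP[]; lra.
have mp : 0 < 1 + t * g by lra.
apply: (@le_trans _ _ (1 + t * g + t ^+ 2 * B / (2 * (1 + t * g)))).
  have c0 : 0 <= t ^+ 2 * B / (2 * (1 + t * g)).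
    by apply: divr_ge0; [rewrite mulr_ge0 // sqr_ge0|lra].
  apply: enorm_le; first by lra.
  have -> : dot (T + t *: Y) (T + t *: Y) = (1 + t * g) ^+ 2 + t ^+ 2 * B.
    rewrite !dotE T1 (dotC Y T) -/g /B; ring.
  have mc : 2 * ((1 + t * g) * (t ^+ 2 * B / (2 * (1 + t * g)))) = t ^+ 2 * B.
    by field; rewrite gt_eqF.
  move: c0 mc; set c := t ^+ 2 * B / _; set m := 1 + t * g => c0 mc.
  have -> : (m + c) ^+ 2 = m ^+ 2 + 2 * (m * c) + c ^+ 2 by ring.
  by rewrite mc lerDl sqr_ge0.
rewrite -[leRHS]addrA lerD2l.
have -> : t ^+ 2 * B / (2 * (1 + t * g)) = t ^+ 2 * B / 2 + t ^+ 2 * B * (- (t * g) / (2 * (1 + t * g))).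
  by field; rewrite gt_eqF.
rewrite lerD2l; apply: (@le_trans _ _ (t ^+ 2 * K ^+ 2 * (t * K))); last by rewrite le_eqVlt; apply/orP; left; apply/eqP; ring.
apply: (@le_trans _ _ (t ^+ 2 * B * (t * K))).
  apply: ler_wpM2l; first by rewrite mulr_ge0 // sqr_ge0.
  rewrite ler_pdivrMr; last by lra.
  have h : - (t * g) <= t * K by move: tg; rewrite ler_norml => /andP[]; lra.
  have h2 : 0 <= t * K by apply: le_trans tg.
  nra.
by apply: ler_wpM2r; [apply: le_trans tg|rewrite ler_wpM2l // sqr_ge0].
Qed.

(** Two opposite displacements of one step: [P], [P'] stand for the values of the conformal factor
    and [N], [N'] for the stretching of the step. The terms of first order in [t] cancel in the sum,
    which is why displacements are always used in pairs. *)
Lemma pair_bound (f al be g B t K P N P' N' : R) :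
  1 <= K -> 1 <= f <= K -> `|al| <= K -> `|be| <= K -> `|g| <= K -> 0 <= B <= K ^+ 2 ->
  0 < t <= 1 ->
  0 <= P <= f + t * al + t ^+ 2 * be -> 0 <= P' <= f - t * al + t ^+ 2 * be ->
  0 <= N <= 1 + t * g + t ^+ 2 * B / 2 + t ^+ 3 * K ^+ 3 ->
  0 <= N' <= 1 - t * g + t ^+ 2 * B / 2 + t ^+ 3 * K ^+ 3 ->
  P ^+ 2 * N + P' ^+ 2 * N' <= 2 * f ^+ 2 +
    t ^+ 2 * (2 * al ^+ 2 + 4 * f * be + 4 * f * al * g + f ^+ 2 * B) + 60 * K ^+ 5 * t ^+ 3.
Proof.
move=> K1 /andP[f1 fK] aK bK gK /andP[B0 BK] /andP[t0 t1] /andP[P0 PL] /andP[P0' PL'] /andP[N0 NL] /andP[N0' NL'].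
pose p := al ^+ 2 + 2 * f * be.
have K0 : 0 <= K by lra.
have abs2 x : `|x| <= K -> x ^+ 2 <= K ^+ 2.
  by move=> xK; rewrite -real_normK ?num_real // lerXn2r ?nnegrE.
have a2 := abs2 _ aK; have b2 := abs2 _ bK.
have KK : K <= K ^+ 2 by rewrite expr2 ler_peMl.
have ab : `|al * be| <= K ^+ 2 by rewrite normrM expr2 ler_pM.
have fb : `|f * be| <= K ^+ 2 by rewrite normrM expr2 ler_pM // ger0_norm //; lra.
have pK : p <= 3 * K ^+ 2.
  by move: fb; rewrite /p ler_norml => /andP[_]; lra.
have t2 : t ^+ 2 <= t by rewrite expr2 ler_piMl // ltW.
have t2p : 0 < t ^+ 2 by rewrite exprn_gt0.
have t3p : 0 < t ^+ 3 by rewrite exprn_gt0.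
have t43 : t ^+ 4 <= t ^+ 3 by rewrite exprS ler_piMl // ltW.
have sq (s x : R) : `|s| <= K -> 0 <= x <= f + t * s + t ^+ 2 * be -> `|s * be| <= K ^+ 2 ->
   x ^+ 2 <= f ^+ 2 + 2 * t * f * s + t ^+ 2 * (s ^+ 2 + 2 * f * be) + 3 * K ^+ 2 * t ^+ 3.
  move=> sK /andP[x0 xL] sb; apply: (@le_trans _ _ ((f + t * s + t ^+ 2 * be) ^+ 2)).
    by rewrite lerXn2r ?nnegrE //; apply: le_trans xL.
  have -> : (f + t * s + t ^+ 2 * be) ^+ 2 = f ^+ 2 + 2 * t * f * s + t ^+ 2 * (s ^+ 2 + 2 * f * be)
     + (2 * t ^+ 3 * (s * be) + t ^+ 4 * be ^+ 2) by ring.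
  rewrite lerD2l.
  have h1 : t ^+ 3 * (s * be) <= t ^+ 3 * K ^+ 2.
    by rewrite ler_wpM2l ?(ltW t3p) //; apply: le_trans sb; exact: ler_norm.
  have h2 : t ^+ 4 * be ^+ 2 <= t ^+ 3 * K ^+ 2.
    by apply: ler_pM => //; rewrite ?sqr_ge0 // exprn_ge0 // ltW.
  lra.
have S1 := sq al P aK (introT andP (conj P0 PL)) ab.
have S2 : P' ^+ 2 <= f ^+ 2 - 2 * t * f * al + t ^+ 2 * p + 3 * K ^+ 2 * t ^+ 3.
  have := sq (- al) P'; rewrite normrN mulNr normrN sqrrN !mulrN => /(_ aK) H.
  by apply: H => //; rewrite P0'.
have K2 : 1 <= K ^+ 2 by rewrite expr_ge1.
have K3 : K ^+ 2 <= K ^+ 3 by rewrite [K ^+ 3]exprS ler_peMl // sqr_ge0.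
have K35 : K ^+ 3 <= K ^+ 5 by rewrite -[5%N]/(2 + 3)%N exprD ler_peMl // exprn_ge0.
(* [M] and [L] are even in t; the odd parts 2 t f al and t g survive only through their product. *)
pose M := f ^+ 2 + t ^+ 2 * p + 3 * K ^+ 2 * t ^+ 3.
pose L := 1 + t ^+ 2 * B / 2 + t ^+ 3 * K ^+ 3.
apply: (@le_trans _ _ ((M + 2 * t * f * al) * (L + t * g) + (M - 2 * t * f * al) * (L - t * g))).
  by apply: lerD; apply: ler_pM => //; rewrite ?sqr_ge0 // /M /L; move: S1 S2 NL NL'; rewrite -/p; lra.
have -> : (M + 2 * t * f * al) * (L + t * g) + (M - 2 * t * f * al) * (L - t * g)
  = 2 * (M * L) + 4 * t ^+ 2 * f * al * g by ring.
have -> : M * L = f ^+ 2 + t ^+ 2 * p + f ^+ 2 * t ^+ 2 * B / 2 + 3 * K ^+ 2 * t ^+ 3 + f ^+ 2 * (t ^+ 3 * K ^+ 3)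
   + (t ^+ 2 * p + 3 * K ^+ 2 * t ^+ 3) * (t ^+ 2 * B / 2 + t ^+ 3 * K ^+ 3) by rewrite /M /L; ring.
have f2 : f ^+ 2 <= K ^+ 2 by rewrite lerXn2r ?nnegrE //; lra.
have H1 : f ^+ 2 * (t ^+ 3 * K ^+ 3) <= K ^+ 5 * t ^+ 3.
  have -> : K ^+ 5 * t ^+ 3 = K ^+ 2 * (t ^+ 3 * K ^+ 3) by ring.
  by rewrite ler_wpM2r // mulr_ge0 ?exprn_ge0 // ltW.
have A1 : t ^+ 2 * p + 3 * K ^+ 2 * t ^+ 3 <= t ^+ 2 * (6 * K ^+ 2).
  have : t ^+ 3 <= t ^+ 2 by rewrite exprS ler_piMl // ltW.
  have : t ^+ 2 * p <= t ^+ 2 * (3 * K ^+ 2) by rewrite ler_wpM2l // ltW.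
  move=> h1 h2; have : K ^+ 2 * t ^+ 3 <= K ^+ 2 * t ^+ 2 by rewrite ler_wpM2l // sqr_ge0.
  lra.
have A2 : t ^+ 2 * B / 2 + t ^+ 3 * K ^+ 3 <= t * (2 * K ^+ 3).
  have h1 : t ^+ 2 * B <= t * K ^+ 3 by apply: ler_pM => //; [exact: ltW|apply: le_trans BK _].
  have h2 : t ^+ 3 * K ^+ 3 <= t * K ^+ 3.
    rewrite ler_wpM2r ?exprn_ge0 //; apply: le_trans t2; rewrite exprS ler_piMl // ltW //.
  have h3 : 0 <= t * K ^+ 3 by rewrite mulr_ge0 ?exprn_ge0 // ltW.
  lra.
have A20 : 0 <= t ^+ 2 * B / 2 + t ^+ 3 * K ^+ 3.
  by rewrite addr_ge0 // ?divr_ge0 // mulr_ge0 ?exprn_ge0 // ltW.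
have H2 : (t ^+ 2 * p + 3 * K ^+ 2 * t ^+ 3) * (t ^+ 2 * B / 2 + t ^+ 3 * K ^+ 3) <= 12 * K ^+ 5 * t ^+ 3.
  have -> : 12 * K ^+ 5 * t ^+ 3 = (t ^+ 2 * (6 * K ^+ 2)) * (t * (2 * K ^+ 3)) by ring.
  apply: le_trans (ler_wpM2r A20 A1) _; apply: ler_wpM2l => //.
  by apply: mulr_ge0; [exact: ltW|apply: mulr_ge0; [exact: ler0n|exact: sqr_ge0]].
have H3 : K ^+ 2 * t ^+ 3 <= K ^+ 5 * t ^+ 3 by rewrite ler_wpM2r ?(ltW t3p) // (le_trans K3).
have H4 : 0 <= K ^+ 5 * t ^+ 3 by rewrite mulr_ge0 ?exprn_ge0 // ltW.
move: H2; rewrite /p; lra.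
Qed.

(* Rotating e by omega keeps it parallel, up to a scaling, for the metric f^4 |dX|^2. *)
Definition omega f d T e : V := (2 / f) *: (dot T e *: d - dot d e *: T).
Definition vfield f d T (phi a : R) e : V := a *: e + phi *: omega f d T e.

(** Apart from constants, the summands are quadratic forms in the frame vector, and the product of
    two squares is avoided because the vector has norm 1. Parseval and the invariance of the trace
    then remove the frame, and of the Hessian only its trace remains. *)
Lemma frame_sum (Q H : 'M[R]_n) f d T (phi a om : R) : Q^T *m Q = 1%:M -> dot T T = 1 -> f != 0 ->
  \sum_k (let e := row k Q in let Y := vfield f d T phi a e in
     2 * (phi * dot d e) ^+ 2 + 4 * f * (phi ^+ 2 * (dot (e *m H) e / 2 + om)) +
     4 * f * (phi * dot d e) * dot T Y + f ^+ 2 * (dot Y Y - dot T Y ^+ 2)) =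
  2 * phi ^+ 2 * dot d d + 2 * f * phi ^+ 2 * \tr H + 4 * n%:R * f * om * phi ^+ 2 +
  4 * f * phi * a * dot d T - 4 * phi ^+ 2 * (dot d d - dot d T ^+ 2) + (n%:R - 1) * f ^+ 2 * a ^+ 2.
Proof.
move=> QQ T1 f0; pose c := 2 * phi / f.
have E k : (let e := row k Q in let Y := vfield f d T phi a e in
     2 * (phi * dot d e) ^+ 2 + 4 * f * (phi ^+ 2 * (dot (e *m H) e / 2 + om)) +
     4 * f * (phi * dot d e) * dot T Y + f ^+ 2 * (dot Y Y - dot T Y ^+ 2)) =
   (2 * phi ^+ 2 - 4 * f * phi * c) * (dot (row k Q) d * dot (row k Q) d) + 2 * f * phi ^+ 2 * dot (row k Q *m H) (row k Q)
   + (4 * f * om * phi ^+ 2 + f ^+ 2 * a ^+ 2)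
   + (4 * f * phi * (a + c * dot d T)) * (dot (row k Q) d * dot (row k Q) T)
   + f ^+ 2 * (c ^+ 2 * dot d d - (a + c * dot d T) ^+ 2) * (dot (row k Q) T * dot (row k Q) T)
   + f ^+ 2 * (- 2 * c ^+ 2 * dot d T + 2 * (a + c * dot d T) * c) * (dot (row k Q) d * dot (row k Q) T).
  move=> /=; rewrite /vfield /omega scalerA.
  have -> : phi * (2 / f) = c by rewrite /c; ring.
  have e1 := orth_unit QQ k; move: (row k Q) e1 => e e1.
  rewrite !dotE e1 T1 (dotC T d) (dotC e T) (dotC e d); move: (dot T e) (dot d e) (dot d T) (dot d d) (dot (e *m H) e) => x y w D h.
  by field.
rewrite (eq_bigr _ (fun k _ => E k)) !big_split /= !sumr_const !card_ord.
rewrite -(mulr_natl (4 * f * om * phi ^+ 2)) -(mulr_natl (f ^+ 2 * a ^+ 2)).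
by rewrite -!mulr_sumr !(orth_sum QQ) (orth_trace QQ) T1 /c; field.
Qed.

(** Put z = dT / f and y = (D - dT^2) / f^2. With equality in the trace bound and om = 0 the left
    side is exactly - 2 ka psi^2 z^2 + (2n - 4) psi'^2 - (n - 3) (psi z + psi')^2 - 2 (n - 3 + ka)
    psi^2 y - 2 psi^2 y. For n >= 3 the last three terms are nonpositive. Here [a] is the derivative
    of psi / f along the path. *)
Lemma form_bound f (D dT trH psi psi' ka om : R) : (3 <= n)%N -> 1 <= f -> 0 <= ka -> dT ^+ 2 <= D ->
  f * trH <= - (n%:R - 3 + ka) * D -> 0 <= om ->
  let phi := psi / f in let a := psi' / f - psi * dT / f ^+ 2 in
  2 * phi ^+ 2 * D + 2 * f * phi ^+ 2 * trH + 4 * n%:R * f * om * phi ^+ 2 +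
  4 * f * phi * a * dT - 4 * phi ^+ 2 * (D - dT ^+ 2) + (n%:R - 1) * f ^+ 2 * a ^+ 2
  <= - 2 * ka * psi ^+ 2 * (dT / f) ^+ 2 + (2 * n%:R - 4) * psi' ^+ 2 + 4 * n%:R * om * psi ^+ 2.
Proof.
move=> n3 f1 ka0 DT trL om0 /=; set phi := psi / f; set a := psi' / f - _.
have f0 : 0 < f by lra.
have n3R : 3 <= n%:R :> R by rewrite (ler_nat R 3 n).
pose z := dT / f; pose y := (D - dT ^+ 2) / f ^+ 2.
have y0 : 0 <= y by rewrite divr_ge0 ?subr_ge0 // sqr_ge0.
have DE : D = f ^+ 2 * (z ^+ 2 + y) by rewrite /z /y; field; rewrite gt_eqF.
have TE : dT = f * z by rewrite /z mulrCA divff ?mulr1 // gt_eqF.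
have aE : a = (psi' - psi * z) / f by rewrite /a /z; field; rewrite gt_eqF.
have trL' : trH / f <= - (n%:R - 3 + ka) * (z ^+ 2 + y).
  rewrite ler_pdivrMr // -(ler_pM2l f0); apply: le_trans trL _; rewrite DE.
  by rewrite le_eqVlt; apply/orP; left; apply/eqP; ring.
have -> : 2 * phi ^+ 2 * D + 2 * f * phi ^+ 2 * trH + 4 * n%:R * f * om * phi ^+ 2 +
  4 * f * phi * a * dT - 4 * phi ^+ 2 * (D - dT ^+ 2) + (n%:R - 1) * f ^+ 2 * a ^+ 2
  = 2 * psi ^+ 2 * (z ^+ 2 + y) + 2 * psi ^+ 2 * (trH / f) + 4 * n%:R * om * psi ^+ 2 / f
    + 4 * psi * (psi' - psi * z) * z - 4 * psi ^+ 2 * y + (n%:R - 1) * (psi' - psi * z) ^+ 2.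
  by rewrite aE DE TE /phi; field; rewrite gt_eqF.
have h1 : psi ^+ 2 * (trH / f) <= psi ^+ 2 * (- (n%:R - 3 + ka) * (z ^+ 2 + y)).
  by rewrite ler_wpM2l // sqr_ge0.
have h2 : 4 * n%:R * om * psi ^+ 2 / f <= 4 * n%:R * om * psi ^+ 2.
  have x0 : 0 <= 4 * n%:R * om * psi ^+ 2.
    by apply: mulr_ge0; [apply: mulr_ge0; [apply: mulr_ge0; exact: ler0n|]|exact: sqr_ge0].
  by rewrite ler_pdivrMr // ler_peMr.
have h3 : 0 <= (n%:R - 3) * (psi * z + psi') ^+ 2 by rewrite mulr_ge0 ?sqr_ge0 // subr_ge0.
have h4 : 0 <= (n%:R - 3 + ka) * (psi ^+ 2 * y).
  by apply: mulr_ge0; [lra|rewrite mulr_ge0 ?sqr_ge0].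
have h5 : 0 <= psi ^+ 2 * y by rewrite mulr_ge0 ?sqr_ge0.
rewrite -/z; nra.
Qed.

(** The discrete product rule for the field psi e / f along a step of length [l]: the coefficient of
    [e] in [vfield] is the derivative of psi / f, and [omega] is the infinitesimal rotation of e. *)
Lemma field_difference f f' d T e (S : 'M[R]_n) (psi psi' l K : R) :
  1 <= K -> dot T T = 1 -> dot e e = 1 -> 1 <= f -> 1 <= f' -> enorm d <= K ->
  0 < l <= 1 -> `|psi| <= 1 -> `|psi'| <= 1 -> `|psi + l * psi'| <= 1 ->
  `|f' - f - l * dot d T| <= K * l ^+ 2 ->
  enorm (e *m S - e - l *: omega f d T e) <= 30 * K ^+ 2 * l ^+ 2 ->
  enorm (((psi + l * psi') / f') *: (e *m S) - (psi / f) *: e -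
     l *: vfield f d T (psi / f) (psi' / f - psi * dot d T / f ^+ 2) e) <= 120 * K ^+ 3 * l ^+ 2.
Proof.
move=> K1 T1 e1 f1 f1' dK /andP[l0 l1] p1 p1' p2 fL SL.
set dT := dot d T in fL *.
have K0 : 0 <= K by lra.
have eT : enorm T = 1 by rewrite /enorm T1 sqrtr1.
have ee : enorm e = 1 by rewrite /enorm e1 sqrtr1.
have dTK : `|dT| <= K by have := dot_le d T; rewrite eT mulr1 -/dT => /le_trans; apply.
have deK : `|dot d e| <= K by have := dot_le d e; rewrite ee mulr1 => /le_trans; apply.
have Te1 : `|dot T e| <= 1 by have := dot_le T e; rewrite ee eT mulr1.
have fp : 0 < f by lra. have fp' : 0 < f' by lra.
have fi1 : f^-1 <= 1 by rewrite invf_le1.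
have fi1' : f'^-1 <= 1 by rewrite invf_le1.
have fi0 : 0 <= f^-1 by rewrite invr_ge0 ltW.
have fi0' : 0 <= f'^-1 by rewrite invr_ge0 ltW.
have OmL : enorm (omega f d T e) <= 4 * K.
  rewrite /omega enormZ; apply: (@le_trans _ _ (2 * (2 * K))); last by lra.
  apply: ler_pM => //; first exact: enorm_ge0.
    by rewrite normrM normfV normr_nat (gtr0_norm fp) ler_piMr.
  apply: le_trans (enormD _ _) _; rewrite enormN !enormZ eT mulr1.
  have h : `|dot T e| * enorm d <= 1 * K by rewrite ler_pM ?enorm_ge0.
  lra.
have K2 : K <= K ^+ 2 by rewrite expr2 ler_peMl.
have K3 : K ^+ 2 <= K ^+ 3 by rewrite [K ^+ 3]exprS ler_peMl // sqr_ge0.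
have l2 : l ^+ 2 <= l by rewrite expr2 ler_piMl // ltW.
have l20 : 0 <= l ^+ 2 by rewrite sqr_ge0.
(* The error of the first order expansion of 1 / f. *)
pose ep := f'^-1 - f^-1 + l * dT / f ^+ 2.
have epE : ep = - (f' - f - l * dT) * (f^-1 * f'^-1) + l * dT * (f' - f) * (f^-1 * f^-1 * f'^-1).
  by rewrite /ep; field; rewrite !gt_eqF.
have ff : `|f' - f| <= 2 * K * l.
  have -> : f' - f = (f' - f - l * dT) + l * dT by ring.
  apply: le_trans (ler_normD _ _) _; rewrite normrM (gtr0_norm l0).
  have h1 : K * l ^+ 2 <= K * l by rewrite ler_wpM2l.
  have h2 : l * `|dT| <= l * K by rewrite ler_wpM2l // ltW.
  lra.
have epL : `|ep| <= 3 * K ^+ 2 * l ^+ 2.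
  rewrite epE; apply: le_trans (ler_normD _ _) _; rewrite !normrM normrN (gtr0_norm l0).
  rewrite !(ger0_norm fi0) !(ger0_norm fi0').
  have g1 : f^-1 * f'^-1 <= 1 by rewrite mulr_ile1.
  have g2 : f^-1 * f^-1 * f'^-1 <= 1 by rewrite !mulr_ile1 // mulr_ge0.
  have h1 : `|f' - f - l * dT| * (f^-1 * f'^-1) <= K * l ^+ 2 * 1 by rewrite ler_pM // mulr_ge0.
  have h2 : l * `|dT| * `|f' - f| * (f^-1 * f^-1 * f'^-1) <= (l * K) * (2 * K * l) * 1.
    rewrite ler_pM //; rewrite ?mulr_ge0 // ?(ltW l0) //.
    by rewrite ler_pM // ?mulr_ge0 ?(ltW l0) // ler_wpM2l // ltW.
  have h3 : K * l ^+ 2 <= K ^+ 2 * l ^+ 2 by rewrite ler_wpM2r.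
  have -> : 3 * K ^+ 2 * l ^+ 2 = K ^+ 2 * l ^+ 2 + (l * K) * (2 * K * l) by ring.
  lra.
pose phi := psi / f; pose phi' := (psi + l * psi') / f'; pose a := psi' / f - psi * dT / f ^+ 2.
have dphi : phi' - phi - l * a = psi * ep + l * psi' * (ep - l * dT * (f^-1 * f^-1)).
  by rewrite /phi' /phi /a /ep; field; rewrite !gt_eqF.
have g1 : f^-1 * f^-1 <= 1 by rewrite mulr_ile1.
have dphiL : `|phi' - phi - l * a| <= 7 * K ^+ 2 * l ^+ 2.
  rewrite dphi; apply: le_trans (ler_normD _ _) _; rewrite !normrM (gtr0_norm l0).
  have h1 : `|psi| * `|ep| <= 1 * (3 * K ^+ 2 * l ^+ 2) by rewrite ler_pM.
  have h0 : `|ep - l * dT * (f^-1 * f^-1)| <= 3 * K ^+ 2 * l ^+ 2 + l * K.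
    apply: le_trans (ler_normB _ _) _; rewrite !normrM (gtr0_norm l0) (ger0_norm fi0).
    apply: lerD => //; rewrite -[leRHS]mulr1 ler_pM // ?mulr_ge0 ?(ltW l0) //.
    by rewrite ler_wpM2l // ltW.
  have h2 : l * `|psi'| * `|ep - l * dT * (f^-1 * f^-1)| <= (l * 1) * (3 * K ^+ 2 * l ^+ 2 + l * K).
    by rewrite ler_pM // ?mulr_ge0 ?(ltW l0) // ler_wpM2l // ltW.
  have h3 : l * (K ^+ 2 * l ^+ 2) <= K ^+ 2 * l ^+ 2 by rewrite ler_piMl // mulr_ge0 // sqr_ge0.
  have h4 : l * (l * K) <= K ^+ 2 * l ^+ 2.
    by rewrite mulrA -expr2 mulrC ler_wpM2r.
  apply: le_trans (lerD h1 h2) _; set Z := K ^+ 2 * l ^+ 2 in h3 h4 *.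
  have -> : 1 * (3 * K ^+ 2 * l ^+ 2) + l * 1 * (3 * K ^+ 2 * l ^+ 2 + l * K) =
    3 * Z + 3 * (l * Z) + l * (l * K) by rewrite /Z; ring.
  have -> : 7 * K ^+ 2 * l ^+ 2 = 7 * Z by rewrite /Z; ring.
  move: (l * Z) (l * (l * K)) h3 h4 => z1 z2 h3 h4; clearbody Z; lra.
have aL : `|a| <= 2 * K.
  rewrite /a; apply: le_trans (ler_normB _ _) _; rewrite !normrM !normfV normrX (gtr0_norm fp).
  have h1 : `|psi'| * f^-1 <= 1 * 1 by rewrite ler_pM.
  have h2 : `|psi| * `|dT| * (f ^+ 2)^-1 <= (1 * K) * 1.
    rewrite ler_pM ?mulr_ge0 ?ler_pM //; first by rewrite invr_ge0 exprn_ge0 // ltW.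
    by rewrite -exprVn expr2.
  lra.
have phiL : `|phi'| <= 1.
  by rewrite /phi' normrM (ger0_norm fi0') mulr_ile1.
have -> : phi' *: (e *m S) - phi *: e - l *: vfield f d T phi a e =
   phi' *: (e *m S - e - l *: omega f d T e) + (phi' - phi - l * a) *: e + (l * (phi' - phi)) *: omega f d T e.
  rewrite /vfield; move: (e *m S) (omega f d T e) => u w; apply/rowP => j; rewrite !mxE; ring.
have dphi2 : `|phi' - phi| <= 9 * K ^+ 2 * l.
  have -> : phi' - phi = (phi' - phi - l * a) + l * a by ring.
  apply: le_trans (ler_normD _ _) _; rewrite [`|l * a|]normrM (gtr0_norm l0).
  have h1 : l * `|a| <= l * (2 * K) by rewrite ler_wpM2l // ltW.
  have h2 : K ^+ 2 * l ^+ 2 <= K ^+ 2 * l by rewrite ler_wpM2l // sqr_ge0.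
  have h3 : l * K <= K ^+ 2 * l by rewrite mulrC ler_wpM2r // ltW.
  lra.
apply: le_trans (enormD _ _) _; apply: le_trans (lerD (enormD _ _) (lexx _)) _.
rewrite (enormZ phi') (enormZ (phi' - phi - l * a)) (enormZ (l * (phi' - phi))) ee [`|l * _|]normrM (gtr0_norm l0).
have h1 : `|phi'| * enorm (e *m S - e - l *: omega f d T e) <= 1 * (30 * K ^+ 2 * l ^+ 2).
  by rewrite ler_pM // enorm_ge0.
have h2 : l * `|phi' - phi| * enorm (omega f d T e) <= l * (9 * K ^+ 2 * l) * (4 * K).
  by rewrite ler_pM // ?enorm_ge0 ?mulr_ge0 ?(ltW l0) // ler_wpM2l // ltW.
have h3 : K ^+ 2 * l ^+ 2 <= K ^+ 3 * l ^+ 2 by rewrite ler_wpM2r.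
have h4 : l * (9 * K ^+ 2 * l) * (4 * K) = 36 * (K ^+ 3 * l ^+ 2) by ring.
have h5 : 0 <= K ^+ 3 * l ^+ 2 by rewrite mulr_ge0 // exprn_ge0.
have h6 : `|phi' - phi - l * a| * 1 <= 7 * K ^+ 2 * l ^+ 2 by rewrite mulr1.
apply: le_trans (lerD (lerD h1 h6) h2) _; rewrite h4.
have -> : 1 * (30 * K ^+ 2 * l ^+ 2) + 7 * K ^+ 2 * l ^+ 2 + 36 * (K ^+ 3 * l ^+ 2) =
  37 * (K ^+ 2 * l ^+ 2) + 36 * (K ^+ 3 * l ^+ 2) by ring.
rewrite -mulrA; move: (K ^+ 2 * l ^+ 2) (K ^+ 3 * l ^+ 2) h3 h5 => Z2 Z3 h3' h5'.
clear -h3' h5'; lra.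
Qed.

End StepVariation.

(** * Chains of straight segments in a flat manifold *)

(** Connectedness of the interval as an induction principle: at the supremum of the times up to
    which [P] holds, the local condition carries P past it unless it is 1. *)
Lemma itv01_ind {R : realType} (P : R -> Prop) : P 0 ->
  (forall s, 0 <= s <= 1 -> exists2 d : R, 0 < d & forall t t', 0 <= t <= 1 -> 0 <= t' <= 1 ->
     `|t - s| < d -> `|t' - s| < d -> P t -> P t') ->
  forall t, 0 <= t <= 1 -> P t.
Proof.
move=> P0 H; pose E := [set t | 0 <= t <= 1 /\ forall u, 0 <= u <= t -> P u].
have E0 : E 0.
  by split; [rewrite lexx ler01|move=> u; rewrite -eq_le => /eqP <-].
have Eb : has_sup E by split; [exists 0|exists 1 => t [/andP[]]].
pose c := sup E.
have c0 : 0 <= c by exact: sup_upper_bound.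
have c1 : c <= 1 by apply: ge_sup; [exists 0|move=> t [/andP[]]].
have [d d0 Hd] := H c (introT andP (conj c0 c1)).
have [t [t01 tP] ct] : exists2 t, E t & c - d / 2 < t by apply: sup_adherent => //; rewrite divr_gt0.
have tc : t <= c by apply: sup_upper_bound.
have key u : 0 <= u <= 1 -> u < c + d -> P u.
  move=> u01 uc; have [ut|tu] := leP u t; first by apply: tP; case/andP: u01 => -> _.
  apply: (Hd t u) => //; rewrite ?ltr_norml; last 1 first.
  - by apply: tP; rewrite lexx andbT; case/andP: t01.
  - by apply/andP; split; lra.
  - by apply/andP; split; lra.
have [c11|c11] := ltP c 1; last first.
  by move=> u u01; apply: key => //; case/andP: u01 => _ u1; lra.
have : E (Num.min 1 (c + d / 2)).
  have m1 : Num.min 1 (c + d / 2) <= 1 by rewrite ge_min lexx.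
  have m2 : Num.min 1 (c + d / 2) <= c + d / 2 by rewrite ge_min lexx orbT.
  split; first by rewrite m1 andbT le_min ler01 addr_ge0 // divr_ge0 // ltW.
  by move=> u /andP[u0 um]; apply: key; [rewrite u0 /=|]; lra.
move=> /(sup_upper_bound Eb); rewrite -/c ge_min => /orP[|]; lra.
Qed.

(** If [P] failed for [K], the sets whose complement in K satisfies P would form a proper filter,
    and its cluster point in K would contradict the local condition. This serves wherever constants
    have to be uniform on a compact set. *)
Lemma compact_ideal {M : topologicalType} (K : set M) (P : set M -> Prop) :
  compact K -> P set0 -> (forall A B, P A -> P B -> P (A `|` B)) ->
  (forall A B, A `<=` B -> P B -> P A) ->
  (forall x, K x -> exists2 U, nbhs x U & P U) -> P K.
Proof.
move=> cK P0 PU PS Px; apply: contrapT => nPK.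
pose F : set_system M := [set A | P (K `\` A)].
have FF : ProperFilter F.
  split; first by rewrite /F /= setD0.
  split; first by rewrite /F /= setDT.
    by move=> A B FA FB; rewrite /F /= setDIr; exact: PU.
  by move=> A B AB FA; apply: PS FA => x [Kx nB]; split => // /AB.
have FK : F K by rewrite /F /= setDv.
have [x [Kx cl]] := cK F FF FK; have [U Ux PUx] := Px x Kx.
have FU : F (~` U) by apply: PS PUx => y [_ /contrapT].
by have [y [nU yU]] := cl _ _ FU Ux.
Qed.

Lemma nbhs_dist {R : realType} {V : normedModType R} (x : V) (A : set V) : nbhs x A ->
  exists2 d : R, 0 < d & forall y, `|y - x| < d -> A y.
Proof.
move=> /nbhs_ballP [d /= d0 B]; exists d => // y yx.
by apply: B; rewrite -ball_normE /= distrC.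
Qed.

Section Flat.
Context {R : realType} {n : nat} {M : topologicalType}.
Local Notation V := 'rV[R]_n.
Variables (M0 : set M) (X : M -> V) (W : M -> R).
Implicit Types (p q : M) (v x : V).

Definition nball x (r : R) : set V := [set y | `|y - x| < r].

Definition section_on (D : set V) (s : V -> M) :=
  forall x, D x -> [/\ {for x, continuous s}, M0 (s x) & X (s x) = x].

(** [X] is a local homeomorphism, inverted over balls. It need not be injective, so points are
    followed by lifting segments and not by their coordinates. *)
Definition flat := forall p, M0 p -> exists (r : R) (s : V -> M) (U : set M),
  [/\ 0 < r, section_on (nball (X p) r) s, open U, U p &
      forall q, U q -> nball (X p) r (X q) /\ s (X q) = q].

Definition is_lift p v (pi : R -> M) := pi 0 = p /\
  forall t, 0 <= t <= 1 -> [/\ {for t, continuous pi}, M0 (pi t) & X (pi t) = X p + t *: v].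

(** [v] is nonzero because the variation uses its unit direction. As [w] bounds [W] on the whole
    lifted segment, every piece of a step is a step with the same w, and subdivision does not change
    the cost. *)
Definition step p v q (w : R) := v != 0 /\
  exists pi, [/\ is_lift p v pi, pi 1 = q & forall t, 0 <= t <= 1 -> W (pi t) <= w].

(* Chains from p to q with steps of length at most h and cost at most c. The cost
   bounds the length for the metric W |dX| from above. *)
Inductive reach (h : R) : M -> M -> R -> Prop :=
| reach0 p c : M0 p -> 0 <= c -> reach h p p c
| reachS p v p' w q c c' : step p v p' w -> enorm v <= h -> reach h p' q c ->
    enorm v * w + c <= c' -> reach h p q c'.

Definition good (A : set M) := exists K : set M, [/\ compact K, K `<=` M0 & A `<=` K].

Hypothesis hM : hausdorff_space M.
Hypothesis fM : flat.
Hypothesis XC : forall p, M0 p -> {for p, continuous X}.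
Hypothesis WC : forall p, M0 p -> {for p, continuous W}.
Hypothesis W1 : forall p, M0 p -> 1 <= W p.

Lemma nballP x (r : R) (y : V) : nball x r y -> nbhs y (nball x r).
Proof.
move=> yx; apply/nbhs_ballP; exists (r - `|y - x|); first by rewrite /= subr_gt0.
move=> z; rewrite -ball_normE /= distrC => zy; rewrite /nball /=.
have := ler_distD y z x; lra.
Qed.

Lemma nball_line x (r : R) (y z : V) (t : R) : 0 <= t <= 1 -> nball x r y -> nball x r (y + z) ->
  nball x r (y + t *: z).
Proof.
rewrite /nball /= => /andP[t0 t1] yr zr.
have -> : y + t *: z - x = (1 - t) *: (y - x) + t *: (y + z - x).
  by apply/rowP => j; rewrite !mxE; ring.
apply: le_lt_trans (ler_normD _ _) _; rewrite !normrZ (ger0_norm t0) ger0_norm ?subr_ge0 //.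
have [->|tn] := eqVneq t 0; first by rewrite subr0 mul1r mul0r addr0.
have tp : 0 < t by rewrite lt_neqAle eq_sym tn.
have h1 : (1 - t) * `|y - x| <= (1 - t) * r by rewrite ler_wpM2l ?subr_ge0 // ltW.
have h2 : t * `|y + z - x| < t * r by rewrite ltr_pM2l.
lra.
Qed.

Lemma section_lift x (r : R) s (y z : V) : section_on (nball x r) s ->
  nball x r y -> nball x r (y + z) -> is_lift (s y) z (fun t => s (y + t *: z)).
Proof.
move=> sS yr zr; split; first by rewrite scale0r addr0.
move=> t t01; have [sc sM sX] := sS _ (nball_line t01 yr zr).
have [_ _ E] := sS _ yr; rewrite E; split => //.
apply: (@continuous_comp _ _ _ (fun t : R => y + t *: z) s); last exact: sc.
by apply: cvgD; [exact: cvg_cst|apply: cvgZl; exact: cvg_id].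
Qed.

(** The times at which the lifts agree and those at which they differ both form open sets, the
    former by local injectivity of [X], the latter because [M] is Hausdorff. *)
Lemma lift_unique p v pi pi' : is_lift p v pi -> is_lift p v pi' ->
  forall t, 0 <= t <= 1 -> pi t = pi' t.
Proof.
move=> [i0 il] [i0' il']; apply: itv01_ind; first by rewrite i0 i0'.
move=> t t01; have [c m x] := il t t01; have [c' m' x'] := il' t t01.
have [E|NE] := pselect (pi t = pi' t).
  have [r [s [U [r0 sS oU Up sU]]]] := fM m.
  have n1 : nbhs t (pi @^-1` U) by apply: c; exact: open_nbhs_nbhs.
  have n2 : nbhs t (pi' @^-1` U) by apply: c'; rewrite -E; exact: open_nbhs_nbhs.
  have [d d0 B] := nbhs_dist (filterI n1 n2).
  exists d => // u u' u01 u01' _ ud' _; have [b1 b2] := B u' ud'.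
  have [_ <-] := sU _ b1; have [_ <-] := sU _ b2.
  by have [_ _ ->] := il u' u01'; have [_ _ ->] := il' u' u01'.
have [A [B [oA oB AB]]] : exists A B, [/\ nbhs (pi t) A, nbhs (pi' t) B & A `&` B = set0].
  have := hM; rewrite open_hausdorff => /(_ (pi t) (pi' t)).
  move=> /(_ (introN eqP NE))[[A B]] /= [/set_mem Aa /set_mem Bb] [oA oB AB].
  by exists A, B; split; [exact: open_nbhs_nbhs|exact: open_nbhs_nbhs|exact/eqP].
have n1 : nbhs t (pi @^-1` A) by exact: c.
have n2 : nbhs t (pi' @^-1` B) by exact: c'.
have [d d0 BB] := nbhs_dist (filterI n1 n2).
exists d => // u u' u01 u01' ud _ Eu; have [b1 b2] := BB u ud.
by exfalso; have : (A `&` B) (pi u) by [split => //; rewrite Eu]; rewrite AB.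
Qed.

Lemma lift_sub p v pi (a b : R) : is_lift p v pi -> 0 <= a -> a <= b -> b <= 1 ->
  is_lift (pi a) ((b - a) *: v) (fun t => pi (a + t * (b - a))).
Proof.
move=> [i0 il] a0 ab b1; split; first by rewrite mul0r addr0.
move=> t /andP[t0 t1]; have t01 : 0 <= a + t * (b - a) <= 1.
  have : 0 <= t * (b - a) by rewrite mulr_ge0 // subr_ge0.
  have : t * (b - a) <= b - a by rewrite ler_piMl // subr_ge0.
  by move=> h1 h2; apply/andP; split; lra.
have [c m x] := il _ t01; split => //.
  apply: (@continuous_comp _ _ _ (fun t : R => a + t * (b - a)) pi); last exact: c.
  by apply: cvgD; [exact: cvg_cst|apply: cvgM; [exact: cvg_id|exact: cvg_cst]].
have a01 : 0 <= a <= 1 by apply/andP; split; lra.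
have [_ _ ->] := il _ a01; rewrite x scalerA -addrA -scalerDl; congr (_ + _ *: _).
Qed.

Lemma lift_rev p v pi : is_lift p v pi -> is_lift (pi 1) (- v) (fun t => pi (1 - t)).
Proof.
move=> [i0 il]; split; first by rewrite subr0.
move=> t /andP[t0 t1]; have t01 : 0 <= 1 - t <= 1 by apply/andP; split; lra.
have [c m x] := il _ t01; split => //.
  apply: (@continuous_comp _ _ _ (fun t : R => 1 - t) pi); last exact: c.
  by apply: cvgB; [exact: cvg_cst|exact: cvg_id].
have [_ _ ->] := il 1 (introT andP (conj ler01 (lexx 1))).
by rewrite x -addrA; congr (_ + _); rewrite scalerN -scalerBl.
Qed.

Lemma itv01_0 : 0 <= (0 : R) <= 1. Proof. by rewrite lexx ler01. Qed.
Lemma itv01_1 : 0 <= (1 : R) <= 1. Proof. by rewrite lexx ler01. Qed.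

Lemma stepM p v q w : step p v q w -> [/\ M0 p, M0 q, 1 <= w & X q = X p + v].
Proof.
move=> [v0 [pi [[i0 il] i1 iw]]].
have [_ m0 _] := il 0 itv01_0; have [_ m1 x1] := il 1 itv01_1.
rewrite -i1 x1 scale1r -i0; split => //.
by apply: le_trans (W1 m0) (iw 0 itv01_0).
Qed.

Lemma step_sym p v q w : step p v q w -> step q (- v) p w.
Proof.
move=> [v0 [pi [il i1 iw]]]; split; first by rewrite oppr_eq0.
exists (fun t => pi (1 - t)); split.
- by have := lift_rev il; rewrite i1.
- by rewrite subrr; case: il.
- by move=> t /andP[t0 t1]; apply: iw; apply/andP; split; lra.
Qed.

Lemma step_sub p v pi w (a b : R) : v != 0 -> is_lift p v pi -> (forall t, 0 <= t <= 1 -> W (pi t) <= w) ->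
  0 <= a -> a < b -> b <= 1 -> step (pi a) ((b - a) *: v) (pi b) w.
Proof.
move=> v0 il iw a0 ab b1; split.
  by rewrite scaler_eq0 negb_or v0 andbT subr_eq0 gt_eqF.
exists (fun t => pi (a + t * (b - a))); split.
- by apply: lift_sub il _ _ _ => //; exact: ltW.
- by rewrite mul1r addrC subrK.
move=> t /andP[t0 t1]; apply: iw.
have : 0 <= t * (b - a) by rewrite mulr_ge0 // subr_ge0 ltW.
have : t * (b - a) <= b - a by rewrite ler_piMl // subr_ge0 ltW.
by move=> h1 h2; apply/andP; split; lra.
Qed.

Lemma reachM h p q c : reach h p q c -> [/\ M0 p, M0 q & 0 <= c].
Proof.
elim=> [{}p {}c m c0|{}p v p' w {}q {}c c' st vh _ [m m' c0] le]; first by [].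
have [mp _ w1 _] := stepM st; split => //; apply: le_trans le.
by rewrite addr_ge0 // mulr_ge0 ?enorm_ge0 //; lra.
Qed.

Lemma reach_mono h p q c c' : reach h p q c -> c <= c' -> reach h p q c'.
Proof.
case=> [{}p {}c m c0|{}p v p' w {}q {}c c2 st vh r le] cc.
  by apply: reach0 => //; apply: le_trans cc.
by apply: (reachS st vh r); apply: le_trans cc.
Qed.

Lemma reach_trans h p q r c d : reach h p q c -> reach h q r d -> reach h p r (c + d).
Proof.
elim=> [{}p {}c m c0|{}p v p' w {}q {}c c2 st vh _ IH le] rd.
  by apply: reach_mono rd _; rewrite lerDr.
by apply: (reachS st vh (IH rd)); rewrite addrA lerD2r.
Qed.

Lemma step_reach h p v q w : step p v q w -> enorm v <= h -> reach h p q (enorm v * w).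
Proof.
move=> st vh; have [_ mq _ _] := stepM st.
by apply: (reachS st vh (reach0 h mq (lexx 0))); rewrite addr0.
Qed.

Lemma reach_sym h p q c : reach h p q c -> reach h q p c.
Proof.
elim=> [{}p {}c m c0|{}p v p' w {}q {}c c2 st vh _ IH le]; first exact: reach0.
have := step_reach (step_sym st); rewrite enormN => /(_ h vh) r.
by apply: reach_mono (reach_trans IH r) _; rewrite addrC.
Qed.

Lemma step_refine h p v q w : 0 < h -> step p v q w -> reach h p q (enorm v * w).
Proof.
move=> h0 [v0 [pi [il i1 iw]]].
have st : step p v q w by split => //; exists pi.
have [_ mq w1 _] := stepM st.
have e0 := enorm_ge0 v.
pose N := (Num.truncn (enorm v / h)).+1.
have N0 : 0 < N%:R :> R by rewrite ltr0n.
have Nh : enorm v / N%:R <= h.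
  rewrite ler_pdivrMr // mulrC -ler_pdivrMr //; apply: ltW.
  exact: truncnS_gt.
suff H j : (j <= N)%N -> reach h (pi (1 - j%:R / N%:R)) q (j%:R / N%:R * (enorm v * w)).
  have := H N (leqnn _); rewrite divff ?gt_eqF // mul1r subrr.
  by have [-> _] := il.
elim: j => [|j IH] jN.
  by rewrite !mul0r subr0 i1; exact: reach0.
have jN' : j.+1%:R / N%:R <= 1 :> R by rewrite ler_pdivrMr // mul1r ler_nat.
have jE : j.+1%:R / N%:R = j%:R / N%:R + N%:R^-1 :> R by rewrite -natr1 mulrDl mul1r.
have Ni : 0 < N%:R^-1 :> R by rewrite invr_gt0.
have j0 : 0 <= j%:R / N%:R :> R by rewrite divr_ge0.
have := @step_sub p v pi w (1 - j.+1%:R / N%:R) (1 - j%:R / N%:R) v0 il iw.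
have -> : 1 - j%:R / N%:R - (1 - j.+1%:R / N%:R) = N%:R^-1 :> R by rewrite jE; ring.
move=> /(_ _ _ _) st'.
have {}st' := st' (ltac:(by rewrite subr_ge0)) (ltac:(by rewrite jE; lra)) (ltac:(lra)).
apply: (reachS st' _ (IH (ltnW jN))).
  by rewrite enormZ ger0_norm ?(ltW Ni) // mulrC.
rewrite enormZ (ger0_norm (ltW Ni)) jE.
by rewrite le_eqVlt; apply/orP; left; apply/eqP; ring.
Qed.

Lemma reach_refine h h' p q c : 0 < h' -> reach h p q c -> reach h' p q c.
Proof.
move=> h0; elim=> [{}p {}c m c0|{}p v p' w {}q {}c c2 st vh _ IH le]; first exact: reach0.
by apply: reach_mono (reach_trans (step_refine h0 st) IH) le.
Qed.

(** The step that straddles the prescribed cost is cut at the corresponding fraction of its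
    length. *)
Lemma reach_split h p q c c1 : 0 < h -> reach h p q c -> 0 <= c1 <= c ->
  exists2 q', reach h p q' c1 & reach h q' q (c - c1).
Proof.
move=> h0 r; elim: r c1 => [{}p {}c m c0|{}p v p' w {}q {}c c2 st vh r IH le] c1 /andP[c10 c1c].
  by exists p; apply: reach0 => //; rewrite subr_ge0.
have [mp _ w1 _] := stepM st.
have e0 := enorm_ge0 v.
have [H|H] := leP (enorm v * w) c1.
  have [_ _ c0] := reachM r.
  have [|q' r1 r2] := IH (Num.min c (c1 - enorm v * w)).
    by rewrite le_min ge_min lexx subr_ge0 H c0.
  exists q'; first by apply: (reachS st vh r1); rewrite -lerBrDl ge_min lexx orbT.
  apply: reach_mono r2 _; rewrite lerBlDr; case: (leP c (c1 - enorm v * w)); lra.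
have v0 : v != 0 by case: st.
have ew : 0 < enorm v * w by rewrite mulr_gt0 ?enorm_gt0 //; lra.
have [c1z|c1n] := eqVneq c1 0.
  exists p; first by apply: reach0.
  by apply: (reachS st vh r); rewrite c1z subr0.
have c1p : 0 < c1 by rewrite lt_neqAle eq_sym c1n.
have [_ [pi [il i1 iw]]] := st.
pose s := c1 / (enorm v * w).
have s0 : 0 < s by rewrite divr_gt0.
have s1 : s < 1 by rewrite ltr_pdivrMr // mul1r.
have sE : s * (enorm v * w) = c1 by rewrite /s divfK // gt_eqF.
have st1 := step_sub v0 il iw (lexx 0) s0 (ltW s1).
have st2 := step_sub v0 il iw (ltW s0) s1 (lexx 1).
have [i0 _] := il; rewrite i0 i1 subr0 in st1 st2.
have r1 := step_refine h0 st1; have r2 := step_refine h0 st2.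
exists (pi s); first by apply: reach_mono r1 _; rewrite enormZ gtr0_norm // -mulrA sE.
apply: reach_mono (reach_trans r2 r) _.
rewrite enormZ ger0_norm ?subr_ge0 ?(ltW s1) // -mulrA mulrBl mul1r sE; lra.
Qed.

Lemma reach_dist h p q c : reach h p q c -> `|X q - X p| <= c.
Proof.
elim=> [{}p {}c m c0|{}p v p' w {}q {}c c2 st vh _ IH le]; first by rewrite subrr normr0.
have [_ _ w1 xE] := stepM st; apply: le_trans le.
have h1 : `|v| <= enorm v * w.
  by apply: le_trans (norm_enorm v) _; rewrite ler_peMr // enorm_ge0.
have := ler_distD (X p') (X q) (X p); rewrite {2}xE [X p + v]addrC addrK; lra.
Qed.

Lemma segment_reach x (r : R) s (y z : V) w h : 0 < h -> section_on (nball x r) s ->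
  nball x r y -> nball x r z -> (forall t, 0 <= t <= 1 -> W (s (y + t *: (z - y))) <= w) ->
  reach h (s y) (s z) (enorm (z - y) * w).
Proof.
move=> h0 sS yr zr sw; have [->|yz] := eqVneq z y.
  have [_ m _] := sS _ yr; apply: reach0 => //; rewrite mulr_ge0 ?enorm_ge0 //.
  have := sw 0 itv01_0; rewrite scale0r addr0; apply: le_trans.
  by apply: le_trans (W1 m).
have zE : y + (z - y) = z by rewrite addrC subrK.
apply: step_refine => //; split; first by rewrite subr_eq0.
exists (fun t => s (y + t *: (z - y))); split => //.
- by apply: section_lift sS _ _ => //; rewrite zE.
- by rewrite scale1r zE.
Qed.

Lemma section_reach x (r : R) s (y z : V) w h : 0 < h -> section_on (nball x r) s ->
  (forall y, nball x r y -> W (s y) <= w) -> nball x r y -> nball x r z ->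
  reach h (s y) (s z) (enorm (z - y) * w).
Proof.
move=> h0 sS sw yr zr; apply: (segment_reach h0 sS yr zr) => t t01.
by apply: sw; apply: nball_line => //; rewrite addrC subrK.
Qed.

Lemma local_section p : M0 p -> exists (r : R) (s : V -> M) (U : set M),
  [/\ 0 < r, section_on (nball (X p) r) s, open U, U p &
   (forall q, U q -> nball (X p) r (X q) /\ s (X q) = q) /\
   (forall y, nball (X p) r y -> W (s y) <= W p + 1)].
Proof.
move=> mp; have [r [s [U [r0 sS oU Up sU]]]] := fM mp.
have sp : s (X p) = p by have [] := sU _ Up.
have xp : nball (X p) r (X p) by rewrite /nball /= subrr normr0.
have [sc _ _] := sS _ xp.
have Wc : {for X p, continuous (W \o s)}.
  by apply: continuous_comp => //; rewrite sp; exact: WC.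
have [d d0 B] := continuous_dist Wc ltr01.
have nU : nbhs p (U `&` (X @^-1` nball (X p) (Num.min r d))).
  apply: filterI; first exact: open_nbhs_nbhs.
  by apply: XC => //; apply: nballP; rewrite /nball /= subrr normr0 lt_min r0.
exists (Num.min r d), s, (U `&` (X @^-1` nball (X p) (Num.min r d)))^°; split.
- by rewrite lt_min r0.
- move=> y yr; apply: sS; move: yr; rewrite /nball /= lt_min => /andP[].
  by [].
- exact: open_interior.
- exact: nU.
split; first by move=> q /interior_subset [/sU [_ sq] xq].
move=> y; rewrite /nball /= lt_min => /andP[_ /B] /=; rewrite sp ltr_norml => /andP[_]; lra.
Qed.

Lemma local_reach p (e h : R) : M0 p -> 0 < e -> 0 < h -> exists2 U, nbhs p U &
  forall q q', U q -> U q' -> reach h q q' e.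
Proof.
move=> mp e0 h0; have [r [s [U [r0 sS oU Up [sU sW]]]]] := local_section mp.
pose w := W p + 1; have w0 : 0 < w by have := W1 mp; rewrite /w; lra.
pose r' := Num.min r (e / (2 * (n%:R + 1) * w)).
have n1 : 0 < n%:R + 1 :> R by rewrite ltr_wpDl.
have r'0 : 0 < r' by rewrite lt_min r0 divr_gt0 // !mulr_gt0.
exists (U `&` (X @^-1` nball (X p) r')).
  apply: filterI; first exact: open_nbhs_nbhs.
  by apply: XC => //; apply: nballP; rewrite /nball /= subrr normr0.
move=> q q' [/sU[qr qs] qx] [/sU[qr' qs'] qx'].
rewrite -qs -qs'; apply: reach_mono (section_reach h0 sS sW qr qr') _.
move: qx qx'; rewrite /nball /= !lt_min => /andP[_ qx] /andP[_ qx'].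
have : enorm (X q' - X q) <= n%:R * (2 * (e / (2 * (n%:R + 1) * w))).
  apply: le_trans (enorm_norm _) _; rewrite ler_wpM2l //.
  by have := ler_distD (X p) (X q') (X q); rewrite (distrC (X p)); lra.
rewrite -/w => H; apply: (@le_trans _ _ ((n%:R + 1) * (2 * (e / (2 * (n%:R + 1) * w))) * w)).
  rewrite ler_wpM2r ?(ltW w0) //; apply: le_trans H _; rewrite ler_wpM2r ?lerDl //.
  by rewrite mulr_ge0 // divr_ge0 ?(ltW e0) // !mulr_ge0 ?(ltW n1) ?(ltW w0).
by rewrite le_eqVlt; apply/orP; left; apply/eqP; field; rewrite !gt_eqF.
Qed.

Lemma good0 : good set0. Proof. by exists set0; split => //; exact: compact0. Qed.

Lemma goodU A B : good A -> good B -> good (A `|` B).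
Proof.
move=> [K [cK KM AK]] [L [cL LM BL]]; exists (K `|` L); split.
- exact: compactU.
- by move=> x [/KM|/LM].
- by move=> x [/AK|/BL]; [left|right].
Qed.

Lemma goodS A B : A `<=` B -> good B -> good A.
Proof. by move=> AB [K [cK KM BK]]; exists K; split => // x /AB /BK. Qed.

Definition rball p (r : R) : set M := [set q | exists2 c, c < r & reach 1 p q c].

(** Since W >= 1, cost bounds displacement in [X]. A chain cheaper than the distance to the boundary
    of the ball therefore never leaves the domain of the section, and by unique lifting its vertices
    are values of [s]. *)
Lemma section_reach_mem x (r : R) s p q c : section_on (nball x r) s ->
  reach 1 p q c -> forall y, p = s y -> `|y - x| + c < r -> exists2 z, q = s z & `|z - x| <= `|y - x| + c.
Proof.
move=> sS; elim=> [{}p {}c m c0|{}p v p' w {}q {}c c2 st vh r' IH le] y py yc.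
  by exists y => //; rewrite lerDl.
have [_ _ w1 xE] := stepM st; have [_ _ c0] := reachM r'.
have h1 : `|v| <= enorm v * w.
  by apply: le_trans (norm_enorm v) _; rewrite ler_peMr // enorm_ge0.
have h2 : `|y + v - x| <= `|y - x| + `|v| by rewrite addrAC; exact: ler_normD.
have v0 := normr_ge0 v.
have yr : nball x r y by rewrite /nball /=; lra.
have yvr : nball x r (y + v) by rewrite /nball /=; lra.
have [_ [pi [il i1 _]]] := st.
have p'E : p' = s (y + v).
  rewrite -i1 -[v in RHS]scale1r.
  apply: (@lift_unique p v pi (fun t => s (y + t *: v))) => //; last exact: itv01_1.
  by rewrite py; apply: section_lift sS _ _.
have [|z zq zx] := IH _ p'E; first lra.
by exists z => //; lra.
Qed.

Lemma local_good p : M0 p -> exists2 r : R, 0 < r & good (rball p r).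
Proof.
move=> mp; have [r [s [U [r0 sS oU Up sU]]]] := fM mp.
have sp : s (X p) = p by have [] := sU _ Up.
pose K : set V := [set y | `|y - X p| <= r / 2].
have KB : K `<=` nball (X p) r by move=> y; rewrite /K /nball /=; lra.
have cK : compact K.
  apply: bounded_closed_compact.
    exists (r / 2 + `|X p|); split; first exact: num_real.
    move=> z zr y /= yK; rewrite -(subrK (X p) y).
    by apply: le_trans (ler_normD _ _) _; apply: le_trans (ltW zr); rewrite lerD2r.
  apply: (closed_comp (f := fun x : V => `|x - X p|) (D := [set y | y <= r / 2])); last exact: closed_le.
  by move=> x _; apply: continuous_comp; [apply: continuousB; [exact: cvg_id|exact: cst_continuous]|exact: norm_continuous].
exists (r / 2); first by rewrite divr_gt0.
exists (s @` K); split.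
- apply: continuous_compact => //; apply: continuous_in_subspaceT => y; rewrite inE => /KB yr.
  by have [] := sS _ yr.
- by move=> _ [y /KB yr <-]; have [] := sS _ yr.
move=> q [c cr rq]; have [|z zq zx] := section_reach_mem sS rq (esym sp).
  by rewrite subrr normr0; lra.
exists z => //; move: zx; rewrite subrr normr0 /K /=; lra.
Qed.

Hypothesis complete_reach : forall y : nat -> M,
  (forall k, reach 1 (y k) (y k.+1) (2^-1 ^+ k)) -> exists2 l, M0 l & y @ \oo --> l.

(** Contrapositive of a growth argument: if all [e]-balls centred in [rball p r] are relatively
    compact, then relative compactness of balls around [p] persists as the radius grows by e / 2 at
    a time, up to [r]. *)
Lemma bad_ball p (r e : R) : M0 p -> 0 < e -> ~ good (rball p r) ->
  exists2 q, rball p r q & ~ good (rball q e).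
Proof.
move=> mp e0 bad; apply: contrapT => H.
have gq q : rball p r q -> good (rball q e).
  by move=> qr; apply: contrapT => nq; apply: H; exists q.
apply: bad.
(* The compact set around the smaller ball is covered by finitely many sets of mutual cost at most e
   / 2. What lies at cost less than e / 2 from such a set is inside one [e]-ball, hence good. *)
have grow (r1 : R) : 0 < r1 -> r1 <= r -> good (rball p r1) -> good (rball p (Num.min r (r1 + e / 2))).
  move=> r10 r1r [K [cK KM BK]].
  pose P A := good [set q | exists2 q', (A `&` rball p r1) q' & exists2 c, c < e / 2 & reach 1 q' q c].
  have PK : P K.
    apply: compact_ideal cK _ _ _ _.
    - by apply: goodS good0 => q [q' [[]]].
    - move=> A B PA PB; apply: goodS (goodU PA PB) => q [q' [[Aq'|Bq'] rq'] Hq].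
        by left; exists q'.
      by right; exists q'.
    - by move=> A B AB; apply: goodS => q [q' [/AB Aq' rq'] Hq]; exists q'.
    move=> x Kx; have [U nU Ur] := @local_reach x (e / 2) 1 (KM _ Kx) (ltac:(by rewrite divr_gt0)) ltr01.
    exists U => //; have [[p1 [Up1 rp1]]|ne] := pselect (exists p1, U p1 /\ rball p r1 p1).
      have gp1 : good (rball p1 e).
        by apply: gq; case: rp1 => c cr rc; exists c => //; apply: lt_le_trans r1r.
      apply: goodS gp1 => q [q' [Uq' _] [c ce rc]].
      exists (e / 2 + c); first lra.
      exact: reach_trans (Ur _ _ Up1 Uq') rc.
    by apply: goodS good0 => q [q' [Uq' rq'] _]; apply: ne; exists q'.
  apply: goodS (goodU PK (ex_intro _ K (And3 cK KM BK))) => q [c].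
  rewrite lt_min => /andP[cr c1] rc.
  have [_ _ c0] := reachM rc.
  have [cr1|r1c] := ltP c r1; first by right; exists c.
  (* The chain is cut at cost r1 - d, strictly inside the smaller ball, with [d] so small that less
     than e / 2 is left. *)
  pose d := Num.min r1 ((r1 + e / 2 - c) / 2).
  have d0 : 0 < d by rewrite lt_min r10 /=; lra.
  have d1 : d <= r1 by rewrite ge_min lexx.
  have d2 : d <= (r1 + e / 2 - c) / 2 by rewrite ge_min lexx orbT.
  have [|q' rq' rq] := @reach_split _ _ _ _ (r1 - d) ltr01 rc.
    by rewrite subr_ge0 d1 /=; lra.
  have q'B : rball p r1 q' by exists (r1 - d) => //; lra.
  left; exists q'; first by split => //; exact: BK.
  by exists (c - (r1 - d)) => //; lra.
have [rho rho0 grho] := local_good mp.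
have mono (a b : R) : a <= b -> rball p a `<=` rball p b.
  by move=> ab q [c ca rc]; exists c => //; apply: lt_le_trans ab.
have [r0|r0] := leP r 0.
  by apply: goodS good0 => q [c cr rc]; have [_ _ c0] := reachM rc; lra.
have H2 k : good (rball p (Num.min r (rho + k%:R * (e / 2)))).
  elim: k => [|k IH].
    by apply: goodS grho; apply: mono; rewrite mul0r addr0 ge_min lexx orbT.
  have e20 : 0 < e / 2 by rewrite divr_gt0.
  have k0 : 0 <= k%:R * (e / 2) by rewrite mulr_ge0 // ltW.
  have := grow (Num.min r (rho + k%:R * (e / 2))).
  rewrite lt_min r0 ge_min lexx => /(_ (ltac:(lra)) isT IH); apply: goodS; apply: mono.
  rewrite -natr1 mulrDl mul1r addrA; case: (leP r (rho + k%:R * (e / 2))) => h.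
    by rewrite le_min !ge_min !lexx /=; lra.
  by [].
have := H2 (Num.truncn (r / (e / 2))).+1; rewrite min_l //.
have : r / (e / 2) < (Num.truncn (r / (e / 2))).+1%:R by exact: truncnS_gt.
by rewrite ltr_pdivrMr ?divr_gt0 //; lra.
Qed.

(* Hopf-Rinow: a failure of relative compactness persists in balls of radius 2^-k
   around a Cauchy sequence of points, which contradicts completeness at its limit. *)
Lemma proper p (r : R) : M0 p -> good (rball p r).
Proof.
move=> mp; apply: contrapT => bad.
have [q0 [c0 _ rq0] bad0] := bad_ball mp ltr01 bad.
have [_ mq0 _] := reachM rq0.
have nxt (kq : nat * M) : exists q', M0 kq.2 -> ~ good (rball kq.2 (2^-1 ^+ kq.1)) ->
   reach 1 kq.2 q' (2^-1 ^+ kq.1) /\ ~ good (rball q' (2^-1 ^+ kq.1.+1)).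
  case: kq => k q /=; have [[mq b]|nb] := pselect (M0 q /\ ~ good (rball q (2^-1 ^+ k))); last first.
    by exists q => mq b; exfalso; apply: nb.
  have e0 : 0 < 2^-1 ^+ k.+1 :> R by rewrite exprn_gt0.
  have [q' [c cr rc] b'] := bad_ball mq e0 b; exists q' => _ _; split => //.
  by apply: reach_mono rc _; exact: ltW.
have [f Hf] := choice nxt.
pose y := fix y k := if k is k'.+1 then f (k', y k') else q0.
have yP k : M0 (y k) /\ ~ good (rball (y k) (2^-1 ^+ k)).
  elim: k => [|k [mk bk]]; first by rewrite expr0.
  have [rk b] := Hf (k, y k) mk bk; have [_ m _] := reachM rk.
  by split.
have yr k : reach 1 (y k) (y k.+1) (2^-1 ^+ k).
  by have [mk bk] := yP k; have [] := Hf (k, y k) mk bk.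
have [l ml yl] := complete_reach yr.
have [rho rho0 grho] := local_good ml.
have [U nU Ur] := @local_reach l (rho / 2) 1 ml (ltac:(by rewrite divr_gt0)) ltr01.
have Ul := nbhs_singleton nU.
have n1 : \forall k \near \oo, U (y k) by exact: yl.
have n2 : \forall k \near \oo, (2^-1 : R) ^+ k < rho / 2.
  have g : (fun k => (2^-1 : R) ^+ k) @ \oo --> (0 : R).
    by apply: cvg_expr; rewrite ger0_norm // invf_lt1 // ltr1n.
  have /cvgrPdist_lt /(_ (rho / 2)) := g; rewrite divr_gt0 // => /(_ isT).
  by apply: filterS => k; rewrite sub0r normrN ger0_norm // exprn_ge0.
have [k [Uk k2]] : exists k, U (y k) /\ (2^-1 : R) ^+ k < rho / 2.
  by have [k kP] := filter_ex (filterI n1 n2); exists k.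
have [_ bk] := yP k; apply: bk; apply: goodS grho => q [c ck rc].
exists (rho / 2 + c); first lra.
exact: reach_trans (Ur _ _ Ul Uk) rc.
Qed.

End Flat.

Lemma dist_nbhs {R : realType} {V : normedModType R} (x : V) (A : set V) (d : R) : 0 < d ->
  (forall y, `|y - x| < d -> A y) -> nbhs x A.
Proof.
move=> d0 B; apply/nbhs_ballP; exists d => // y; rewrite -ball_normE /= distrC; exact: B.
Qed.

(** * Second order Taylor expansions, uniform on compact sets *)

Section Taylor.
Context {R : realType} {n : nat}.
Local Notation V := 'rV[R]_n.

Definition grad (g : V -> R) (x : V) : V := \row_j 'D_(bas j) g x.
Definition hess (g : V -> R) (x : V) : 'M[R]_n := \matrix_(i, j) 'D_(bas i) ('D_(bas j) g) x.

Lemma grad_dot (g : V -> R) (U : set V) x v : open U -> Ck_on 1 U g -> U x ->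
  'D_v g x = dot (grad g x) v.
Proof.
move=> oU hg Ux; rewrite (C1_derive_sum _ oU hg Ux); apply: eq_bigr => j _.
by rewrite mxE mulrC.
Qed.

Lemma hess_dot (g : V -> R) (U : set V) x v : open U -> Ck_on 2 U g -> U x ->
  'D_v ('D_v g) x = dot (v *m hess g x) v.
Proof.
move=> oU hg Ux; have hg1 := CkS hg.
have -> : 'D_v ('D_v g) x = 'D_v (fun y => \sum_j v 0 j * 'D_(bas j) g y) x.
  apply: near_eq_derive; apply: filterS (open_nbhs_nbhs (conj oU Ux)) => y Uy.
  exact: (C1_derive_sum _ oU hg1 Uy).
have D j : is_derive x v ('D_(bas j) g) ('D_v ('D_(bas j) g) x).
  by apply: derivableP; apply: (Ck_derivable (Ck_deriv _ hg)).
rewrite (@derive_val _ _ _ _ _ _ _ (isd_sum (index_enum _) (fun j => isdZ (v 0 j) (D j)))).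
apply: eq_bigr => j _; rewrite mulrC; congr (_ * _).
rewrite (C1_derive_sum _ oU (Ck_deriv _ hg) Ux) mxE; apply: eq_bigr => i _.
by rewrite mxE.
Qed.

(** The mean value theorem is used twice, first for 'D_v g and then for the remainder [k]; [A] may
    be any number close to the second derivative along the whole segment. *)
Lemma taylor2 (g : V -> R) (U : set V) x v (A E : R) : open U -> Ck_on 2 U g ->
  (forall t : R, 0 <= t <= 1 -> U (x + t *: v) /\ `|'D_v ('D_v g) (x + t *: v) - A| <= E) ->
  `|g (x + v) - g x - 'D_v g x - A / 2| <= E.
Proof.
move=> oU hg H.
have D1 (t : R) : 0 <= t <= 1 -> `|'D_v g (x + t *: v) - 'D_v g x - t * A| <= E.
  move=> /andP[t0 t1].
  have E0 : 0 <= E by have [_] := H 0 itv01_0; apply: le_trans.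
  have in01 (s : R) : 0 <= s <= 1 -> 0 <= s * t <= 1.
    by move=> /andP[s0 s1]; rewrite mulr_ge0 //= mulr_ile1.
  have [|c c01 e] := @line_MVT _ _ ('D_v g) x (t *: v).
    move=> s s01; rewrite scalerA; apply: (Ck_derivable (Ck_deriv v hg)).
    by have [] := H _ (in01 _ s01).
  have [Uc Hc] := H _ (in01 _ c01); rewrite scalerA in e.
  rewrite e (C1_deriveZ _ _ (Ck_deriv v hg) Uc) -mulrBr normrM ger0_norm //.
  by apply: le_trans Hc; rewrite ler_piMl.
pose k (t : R) := g (x + t *: v) - t * 'D_v g x - t ^+ 2 * (A / 2).
have dk (t : R) : 0 <= t <= 1 -> is_derive t (1 : R) k ('D_v g (x + t *: v) - 'D_v g x - t * A).
  move=> t01; have [Ut _] := H t t01.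
  have d1 := is_derive_line (Ck_derivable hg Ut (v := v)).
  have did : is_derive t (1 : R) (fun s : R => s) 1 by exact: is_derive_id.
  by refine (isd_eq (isdB (isdB d1 (isdM did (isdC ('D_v g x) t 1))) (isdM (isdM did did) (isdC (A / 2) t 1))) _); field.
have [||c c01] := @MVT_segment R k (fun t => 'D_v g (x + t *: v) - 'D_v g x - t * A) 0 1 ler01.
- by move=> t; rewrite in_itv /= => /andP[t0 t1]; apply: dk; rewrite !ltW.
- apply: derivable_within_continuous => t; rewrite in_itv /= => t01.
  exact: (@ex_derive _ _ _ _ _ _ _ (dk t t01)).
rewrite /k scale1r scale0r !addr0 subr0 mulr1 => e.
have -> : g (x + v) - g x - 'D_v g x - A / 2 = 'D_v g (x + c *: v) - 'D_v g x - c * A.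
  by rewrite -e; ring.
by apply: D1; move: c01; rewrite in_itv.
Qed.

End Taylor.

Section Chains.
Context {R : realType} {n : nat} {M : topologicalType}.
Local Notation V := 'rV[R]_n.
Variables (M0 : set M) (X : M -> V) (f ka : M -> R).
Let W p := f p ^+ 2.
Implicit Types (p q : M) (v x : V).

(** For ka = 0 the inequality says that f^(n-2) is superharmonic in the coordinates, i.e. that f^4
    |dX|^2 has nonnegative scalar curvature; [ka] measures the strict gain. *)
Definition flat2 := forall p, M0 p -> exists (r : R) (s : V -> M) (U : set M),
  [/\ 0 < r, section_on M0 X (nball (X p) r) s, open U & U p] /\
  [/\ forall q, U q -> nball (X p) r (X q) /\ s (X q) = q,
      Ck_on 2 (nball (X p) r) (f \o s) &
      forall x, nball (X p) r x ->
        (f \o s) x * \tr (hess (f \o s) x) <=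
          - (n%:R - 3 + ka (s x)) * dot (grad (f \o s) x) (grad (f \o s) x)].

Hypothesis n3 : (3 <= n)%N.
Hypothesis hM : hausdorff_space M.
Hypothesis fM : flat2.
Hypothesis XC : forall p, M0 p -> {for p, continuous X}.
Hypothesis fC : forall p, M0 p -> {for p, continuous f}.
Hypothesis f1 : forall p, M0 p -> 1 <= f p.
Hypothesis ka0 : forall p, M0 p -> 0 <= ka p.

Lemma flat2_flat : flat M0 X.
Proof.
move=> p mp; have [r [s [U [[r0 sS oU Up] [sU _ _]]]]] := fM mp.
by exists r, s, U; split.
Qed.

(* The radius r, the constant C and the Taylor remainder om do not depend on q,
   which makes the errors summable along a chain. *)
Definition local_data (om r C : R) q := exists (s : V -> M) (d : V) (H : 'M[R]_n),
  [/\ section_on M0 X (nball (X q) r) s, s (X q) = q,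
      enorm d <= C, f q <= C & f q * \tr H <= - (n%:R - 3 + ka q) * dot d d] /\
  [/\ forall e, `|dot (e *m H) e| <= C * dot e e,
      forall v, `|v| < r -> f (s (X q + v)) <= f q + dot d v + dot (v *m H) v / 2 + om * dot v v,
      forall v, `|v| < r -> `|f (s (X q + v)) - f q - dot d v| <= C * dot v v &
      forall x y, nball (X q) r x -> nball (X q) r y -> `|f (s x) - f (s y)| <= C * enorm (x - y)].

Lemma dotxx_norm (v : V) : `|v| ^+ 2 <= dot v v.
Proof. by rewrite -enorm_sq lerXn2r ?nnegrE ?enorm_ge0 // norm_enorm. Qed.

(** Around each point of [K] the derivatives of [f] in one section vary so little that a single
    radius and constant serve all nearby points; [compact_ideal] then makes them uniform. *)
Lemma uniform_data (K : set M) (om : R) : compact K -> K `<=` M0 -> 0 < om ->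
  exists r C : R, [/\ 0 < r, 1 <= C & forall q, K q -> local_data om r C q].
Proof.
move=> cK KM om0.
pose P A := exists r C : R, [/\ 0 < r, 1 <= C & forall q, A q -> M0 q -> local_data om r C q].
suff [r [C [r0 C1 H]]] : P K by exists r, C; split => // q Kq; apply: H => //; exact: KM.
have mono r r' C C' q : r' <= r -> C <= C' -> local_data om r C q -> local_data om r' C' q.
  move=> rr CC [s [d [H [[sS sq dC fq tr] [h1 h2 h3 h4]]]]].
  have bb x y : nball x r' y -> nball x r y by rewrite /nball /= => h; apply: lt_le_trans rr.
  have b2 v : `|v| < r' -> `|v| < r by move=> h; apply: lt_le_trans rr.
  exists s, d, H; split; split => //.
  - by move=> x /bb; apply: sS.
  - exact: le_trans CC.
  - exact: le_trans CC.
  - by move=> e; apply: le_trans (h1 e) _; rewrite ler_wpM2r ?dot_ge0.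
  - by move=> v /b2; apply: h2.
  - by move=> v /b2 /h3 h; apply: le_trans h _; rewrite ler_wpM2r ?dot_ge0.
  - by move=> x y /bb xb /bb yb; apply: le_trans (h4 _ _ xb yb) _; rewrite ler_wpM2r ?enorm_ge0.
apply: compact_ideal cK _ _ _ _.
- by exists 1, 1; split => // q [].
- move=> A B [r [C [r0 C1 HA]]] [r' [C' [r0' C1' HB]]].
  exists (Num.min r r'), (Num.max C C'); split; rewrite ?lt_min ?le_max ?r0 ?C1 //.
  move=> q [Aq|Bq] mq.
    by apply: mono (HA q Aq mq); rewrite ?ge_min ?le_max lexx.
  by apply: mono (HB q Bq mq); rewrite ?ge_min ?le_max lexx orbT.
- by move=> A B AB [r [C [r0 C1 H]]]; exists r, C; split => // q /AB; apply: H.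
move=> p /KM mp; have [r [s [U [[r0 sS oU Up] [sU gC ineq]]]]] := fM mp.
set g := f \o s in gC ineq; set xp := X p in r0 sS sU gC ineq.
have oB : open (nball xp r) by rewrite openE => y; exact: nballP.
have xpB : nball xp r xp by rewrite /nball /= subrr normr0.
have sp : s xp = p by have [] := sU _ Up.
have gC1 := CkS gC.
(* Entries of the Hessian may vary by [eta]; in the quadratic form this amounts to at most n^2 eta
   <= om. *)
pose eta := om / (n%:R ^+ 2 + 1).
have n21 : 0 < n%:R ^+ 2 + 1 :> R by rewrite ltr_wpDl // sqr_ge0.
have eta0 : 0 < eta by rewrite divr_gt0.
have [dl [dl0 dlr Hg1 Hg2]] : exists dl : R, [/\ 0 < dl, dl <= r,
    forall x j, nball xp dl x -> `|'D_(bas j) g x| <= `|'D_(bas j) g xp| + 1 &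
    forall x i j, nball xp dl x -> `|'D_(bas i) ('D_(bas j) g) x - 'D_(bas i) ('D_(bas j) g) xp| <= eta / 2].
  have e20 : 0 < eta / 2 by rewrite divr_gt0.
  have n1' j : \forall x \near xp, `|'D_(bas j) g x - 'D_(bas j) g xp| < 1.
    have := Ck_cont (Ck_deriv (bas j) gC) xpB.
    by move=> /cvgrPdist_lt /(_ 1 ltr01); apply: filterS => x; rewrite distrC.
  have n2' (ij : 'I_n * 'I_n) : \forall x \near xp, `|'D_(bas ij.1) ('D_(bas ij.2) g) x - 'D_(bas ij.1) ('D_(bas ij.2) g) xp| < eta / 2.
    have [d d0 B] := continuous_dist (Ck_cont (Ck_deriv (bas ij.1) (Ck_deriv (bas ij.2) gC)) xpB) e20.
    exact: (dist_nbhs d0 B).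
  have n1 := filter_forall (nbhs_filter xp) n1'; have n2 := filter_forall (nbhs_filter xp) n2'.
  have [d d0 B] := nbhs_dist (filterI n1 n2).
  exists (Num.min d r); split; rewrite ?lt_min ?d0 ?ge_min ?lexx ?orbT //.
    move=> x j; rewrite /nball /= lt_min => /andP[/B [/(_ j) h _] _].
    have := ler_normD ('D_(bas j) g x - 'D_(bas j) g xp) ('D_(bas j) g xp); rewrite subrK; lra.
  move=> x i j; rewrite /nball /= lt_min => /andP[/B [_ /(_ (i, j)) h] _]; exact: ltW.
have dlB x : nball xp dl x -> nball xp r x by rewrite /nball /= => h; apply: lt_le_trans dlr.
have entry_le (A : 'M[R]_n) (a : R) (v : V) : 0 <= a -> (forall i j, `|A i j| <= a) ->
    `|dot (v *m A) v| <= n%:R ^+ 2 * a * dot v v.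
  move=> a0 Aa; apply: le_trans (ler_norm_sum _ _ _) _.
  apply: (@le_trans _ _ (\sum_(j < n) n%:R * a * dot v v)); last first.
    by rewrite sumr_const card_ord -[leLHS]mulr_natl !mulrA -expr2.
  apply: ler_sum => j _; rewrite normrM mxE.
  apply: (@le_trans _ _ ((\sum_(i < n) a * `|v|) * `|v|)).
    apply: ler_pM => //; last exact: rV_coord_le.
    apply: le_trans (ler_norm_sum _ _ _) _; apply: ler_sum => i _.
    by rewrite normrM mulrC ler_pM // rV_coord_le.
  rewrite sumr_const card_ord -[(_ *+ n)]mulr_natl -!mulrA -expr2 !ler_wpM2l //.
  exact: dotxx_norm.
pose B1 := \sum_j (`|'D_(bas j) g xp| + 1).
pose B2 := \sum_(ij : 'I_n * 'I_n) `|'D_(bas ij.1) ('D_(bas ij.2) g) xp|.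
have B1j j : `|'D_(bas j) g xp| + 1 <= B1.
  by rewrite /B1 (bigD1 j) //= lerDl; apply: sumr_ge0 => i _; rewrite addr_ge0.
have B2ij i j : `|'D_(bas i) ('D_(bas j) g) xp| <= B2.
  rewrite /B2 (bigD1 (i, j)) //= lerDl; apply: sumr_ge0 => k _; exact: normr_ge0.
have B10 : 0 <= B1 by apply: sumr_ge0 => j _; rewrite addr_ge0.
have B20 : 0 <= B2 by apply: sumr_ge0 => k _; exact: normr_ge0.
pose C := n%:R * B1 + n%:R ^+ 2 * (B2 + eta) + om + f p + 2.
have fp := f1 mp.
have nB1 : 0 <= n%:R * B1 by rewrite mulr_ge0.
have nB2 : 0 <= n%:R ^+ 2 * (B2 + eta) by rewrite mulr_ge0 ?sqr_ge0 // addr_ge0 // ltW.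
have gradL x : nball xp dl x -> enorm (grad g x) <= n%:R * B1.
  move=> xd; apply: le_trans (enorm_norm _) _; rewrite ler_wpM2l //.
  by apply: rV_norm_le => // j; rewrite mxE; apply: le_trans (Hg1 _ _ xd) (B1j j).
have near_f : \forall q \near p, f q < f p + 1.
  have /cvgrPdist_lt /(_ 1 ltr01) := fC mp; apply: filterS => q; rewrite ltr_norml => /andP[]; lra.
exists (U `&` (X @^-1` nball xp (dl / 2)) `&` [set q | f q < f p + 1]).
  apply: filterI near_f; apply: filterI; first exact: open_nbhs_nbhs.
  by apply: XC => //; apply: nballP; rewrite /nball /= subrr normr0 divr_gt0.
exists (dl / 2), C; split; [by rewrite divr_gt0|by rewrite /C; lra|].
move=> q [[Uq qx] fq] mq; have [xqr sq] := sU _ Uq; set x := X q in qx xqr sq.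
have bq y : nball x (dl / 2) y -> nball xp dl y.
  by move: qx; rewrite /nball /= => h1 h2; have := ler_distD x y xp; lra.
have xdl : nball xp dl x by apply: bq; rewrite /nball /= subrr normr0 divr_gt0.
have tri2 (a b c : R) : `|a - c| <= eta / 2 -> `|c| <= b -> `|a| <= b + eta.
  by rewrite !ler_norml => /andP[? ?] /andP[? ?]; apply/andP; split; lra.
have hessL (A : V) : `|dot (A *m hess g x) A| <= n%:R ^+ 2 * (B2 + eta) * dot A A.
  apply: entry_le; first by rewrite addr_ge0 // ltW.
  move=> i j; rewrite mxE; exact: tri2 (Hg2 _ i j xdl) (B2ij i j).
have tri (a b c : R) : `|a - c| <= eta / 2 -> `|b - c| <= eta / 2 -> `|a - b| <= eta.
  by rewrite !ler_norml => /andP[? ?] /andP[? ?]; apply/andP; split; lra.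
have T v : `|v| < dl / 2 -> `|g (x + v) - g x - dot (grad g x) v - dot (v *m hess g x) v / 2| <= om * dot v v.
  move=> vd; rewrite -(grad_dot v oB gC1 xqr).
  apply: (taylor2 oB gC) => t /andP[t0 t1].
  have td : nball xp dl (x + t *: v).
    apply: bq; rewrite /nball /= [x + _]addrC addrK normrZ ger0_norm //.
    by apply: le_lt_trans vd; rewrite ler_piMl.
  split; first exact: dlB.
  rewrite (hess_dot v oB gC (dlB _ td)).
  rewrite -dotNl -dotDl -mulmxN -mulmxDr.
  apply: le_trans (entry_le _ eta v (ltW eta0) _) _; last first.
    rewrite ler_wpM2r ?dot_ge0 // /eta mulrCA ler_piMr ?(ltW om0) // ler_pdivrMr //.
    by rewrite mul1r lerDl.
  move=> i j; rewrite !mxE; have h1 := Hg2 _ i j td; have h2 := Hg2 _ i j xdl.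
  exact: tri h1 h2.
have gx : g x = f q by rewrite /g /= sq.
exists s, (grad g x), (hess g x); split; split.
- by move=> y yb; apply: sS; apply: dlB; exact: bq.
- exact: sq.
- by apply: le_trans (gradL _ xdl) _; rewrite /C; lra.
- by rewrite /C; move: fq => /=; lra.
- by have := ineq _ xqr; rewrite sq gx.
- move=> e; apply: le_trans (hessL e) _; rewrite ler_wpM2r ?dot_ge0 // /C; lra.
- move=> v vd; have := T v vd; rewrite gx ler_norml => /andP[_]; rewrite /g /=; lra.
- move=> v vd; have h1 := T v vd; have h2 := hessL v; rewrite gx in h1.
  have h3 := dot_ge0 v.
  have h4 : (n%:R ^+ 2 * (B2 + eta) + om) * dot v v <= C * dot v v.
    by rewrite ler_wpM2r // /C; lra.
  have h5 : 0 <= n%:R ^+ 2 * (B2 + eta) * dot v v by rewrite mulr_ge0.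
  move: h1 h2; rewrite !ler_norml /g /= => /andP[a1 a2] /andP[b1 b2]; rewrite mulrDl in h4.
  by apply/andP; split; lra.
- move=> y z yb zb; have yd := bq _ yb; have zd := bq _ zb.
  have zE : z + (y - z) = y by rewrite addrC subrK.
  have zl (t : R) : 0 <= t <= 1 -> nball xp dl (z + t *: (y - z)).
    by move=> t01; apply: nball_line => //; rewrite zE.
  have [|c c01 e] := @line_MVT _ _ g z (y - z).
    by move=> t t01; apply: (Ck_derivable gC1); apply: dlB; exact: zl.
  rewrite zE in e; rewrite -[f (s y) - f (s z)]/(g y - g z) e.
  rewrite (grad_dot _ oB gC1 (dlB _ (zl _ c01))).
  apply: le_trans (dot_le _ _) _; rewrite ler_wpM2r ?enorm_ge0 //.
  by apply: le_trans (gradL _ (zl _ c01)) _; rewrite /C; lra.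
Qed.

Lemma reach_chain h p q c : reach M0 X W h p q c -> exists (m : nat) (P : nat -> M) (v : nat -> V) (w : nat -> R),
  [/\ P 0%N = p, P m = q, forall i, (i < m)%N -> step M0 X W (P i) (v i) (P i.+1) (w i) /\ enorm (v i) <= h &
   \sum_(i < m) enorm (v i) * w i <= c].
Proof.
elim=> [{}p {}c m c0|{}p v p' w {}q {}c c2 st vh _ [m [P [vs [ws [P0 Pm Ps Pc]]]]] le].
  by exists 0%N, (fun=> p), (fun=> 0), (fun=> 0); split => //; rewrite big_ord0.
exists m.+1, (fun i => if i is i'.+1 then P i' else p), (fun i => if i is i'.+1 then vs i' else v),
  (fun i => if i is i'.+1 then ws i' else w); split => //.
  by case=> [|i] im; [rewrite P0|apply: Ps].
by rewrite big_ord_recl /=; apply: le_trans le; rewrite lerD2l.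
Qed.

End Chains.

(** * Second variation of chain length *)

Section StepCost.
Context {R : realType} {n : nat}.
Local Notation V := 'rV[R]_n.

Lemma vfield_bounds (f K : R) (d T e : V) (psi psi' : R) : 1 <= K -> dot T T = 1 -> dot e e = 1 ->
  1 <= f -> enorm d <= K -> `|psi| <= 1 -> `|psi'| <= 1 ->
  let Y := vfield f d T (psi / f) (psi' / f - psi * dot d T / f ^+ 2) e in
  [/\ enorm Y <= 6 * K, `|psi / f| <= 1 & `|psi / f * dot d e| <= K].
Proof.
move=> K1 T1 e1 f1 dK p1 p1' /=.
have K0 : 0 <= K by lra.
have eT : enorm T = 1 by rewrite /enorm T1 sqrtr1.
have ee : enorm e = 1 by rewrite /enorm e1 sqrtr1.
have dTK : `|dot d T| <= K by have := dot_le d T; rewrite eT mulr1 => /le_trans; apply.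
have deK : `|dot d e| <= K by have := dot_le d e; rewrite ee mulr1 => /le_trans; apply.
have Te1 : `|dot T e| <= 1 by have := dot_le T e; rewrite ee eT mulr1.
have fp : 0 < f by lra.
have fi1 : f^-1 <= 1 by rewrite invf_le1.
have fi0 : 0 <= f^-1 by rewrite invr_ge0 ltW.
have phi1 : `|psi / f| <= 1 by rewrite normrM (ger0_norm fi0) mulr_ile1.
have OmL : enorm (omega f d T e) <= 4 * K.
  rewrite /omega enormZ; apply: (@le_trans _ _ (2 * (2 * K))); last by lra.
  apply: ler_pM => //; first exact: enorm_ge0.
    by rewrite normrM normfV normr_nat (gtr0_norm fp) ler_piMr.
  apply: le_trans (enormD _ _) _; rewrite enormN !enormZ eT mulr1.
  have h : `|dot T e| * enorm d <= 1 * K by rewrite ler_pM ?enorm_ge0.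
  lra.
have aL : `|psi' / f - psi * dot d T / f ^+ 2| <= 2 * K.
  apply: le_trans (ler_normB _ _) _; rewrite !normrM !normfV normrX (gtr0_norm fp).
  have h1 : `|psi'| * f^-1 <= 1 * 1 by rewrite ler_pM.
  have h2 : `|psi| * `|dot d T| * (f ^+ 2)^-1 <= (1 * K) * 1.
    rewrite ler_pM ?mulr_ge0 ?ler_pM //; first by rewrite invr_ge0 exprn_ge0 // ltW.
    by rewrite -exprVn expr2 mulr_ile1.
  lra.
split => //; last by rewrite normrM -[leRHS]mul1r ler_pM.
rewrite /vfield; apply: le_trans (enormD _ _) _; rewrite (enormZ (_ - _)) (enormZ (psi / f)) ee mulr1.
have h : `|psi / f| * enorm (omega f d T e) <= 1 * (4 * K) by rewrite ler_pM ?enorm_ge0.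
lra.
Qed.

(* E is the length of a varied step, N the norm of T + tY, and w the square of f at
   the far end of the step. *)
Lemma cost_step (l t N F w C E h : R) : 1 <= C -> 0 < l <= h -> 0 <= E -> h <= 1 -> 0 < t <= 1 ->
  0 <= N <= 2 -> 0 <= F <= 2 * C -> E <= l * (N + 120 * C ^+ 3 * l) -> E <= 3 * l ->
  w = (F + C * E) ^+ 2 ->
  E * w <= l * (F ^+ 2 * N) + 4000 * C ^+ 5 * h * l.
Proof.
move=> C1 /andP[l0 lh] E0 h1 /andP[t0 t1] /andP[N0 N2] /andP[F0 FC] EL E3 ->.
have C0 : 0 <= C by lra.
have l1 : l <= 1 by lra.
have wL : (F + C * E) ^+ 2 <= F ^+ 2 + 21 * C ^+ 2 * l.
  have CE : C * E <= C * (3 * l) by rewrite ler_wpM2l.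
  have CE0 : 0 <= C * E by rewrite mulr_ge0.
  have h2 : (C * E) ^+ 2 <= 9 * C ^+ 2 * l.
    apply: (@le_trans _ _ ((C * (3 * l)) ^+ 2)).
      by rewrite lerXn2r ?nnegrE // mulr_ge0 // mulr_ge0 // ltW.
    have -> : (C * (3 * l)) ^+ 2 = 9 * C ^+ 2 * (l * l) by ring.
    by rewrite ler_wpM2l ?mulr_ge0 ?sqr_ge0 // ler_piMr // ltW.
  have h3 : F * (C * E) <= (2 * C) * (C * (3 * l)) by rewrite ler_pM.
  have -> : (F + C * E) ^+ 2 = F ^+ 2 + 2 * (F * (C * E)) + (C * E) ^+ 2 by ring.
  have -> : 21 * C ^+ 2 * l = 2 * ((2 * C) * (C * (3 * l))) + 9 * C ^+ 2 * l by ring.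
  lra.
have w0 : 0 <= (F + C * E) ^+ 2 by rewrite sqr_ge0.
apply: (@le_trans _ _ (l * (N + 120 * C ^+ 3 * l) * (F ^+ 2 + 21 * C ^+ 2 * l))).
  by rewrite ler_pM.
have -> : l * (N + 120 * C ^+ 3 * l) * (F ^+ 2 + 21 * C ^+ 2 * l) =
  l * (F ^+ 2 * N) + l * l * (21 * C ^+ 2 * N + 120 * C ^+ 3 * (F ^+ 2 + 21 * C ^+ 2 * l)) by ring.
rewrite lerD2l.
have F2 : F ^+ 2 <= 4 * C ^+ 2.
  have -> : 4 * C ^+ 2 = (2 * C) ^+ 2 by ring.
  by rewrite lerXn2r ?nnegrE // mulr_ge0.
have C25 : C ^+ 2 <= C ^+ 5 by rewrite -[5%N]/(2 + 3)%N exprD ler_peMr ?sqr_ge0 // expr_ge1.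
have a1 : 21 * C ^+ 2 * N <= 42 * C ^+ 5.
  have : C ^+ 2 * N <= C ^+ 5 * 2 by rewrite ler_pM ?sqr_ge0.
  lra.
have a2 : F ^+ 2 + 21 * C ^+ 2 * l <= 25 * C ^+ 2.
  have : C ^+ 2 * l <= C ^+ 2 by rewrite ler_piMr ?sqr_ge0.
  lra.
have a3 : 120 * C ^+ 3 * (F ^+ 2 + 21 * C ^+ 2 * l) <= 3000 * C ^+ 5.
  have -> : 3000 * C ^+ 5 = 120 * C ^+ 3 * (25 * C ^+ 2) by ring.
  by rewrite ler_wpM2l // mulr_ge0 // exprn_ge0.
have c5 : 0 <= C ^+ 5 by rewrite exprn_ge0.
have -> : 4000 * C ^+ 5 * h * l = h * l * (4000 * C ^+ 5) by ring.
apply: (@le_trans _ _ (l * l * (4000 * C ^+ 5))).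
  apply: ler_wpM2l; first by rewrite mulr_ge0 // ltW.
  lra.
apply: ler_wpM2r; first exact: (mulr_ge0 (ler0n _ _) c5).
by apply: ler_wpM2r => //; exact: ltW.
Qed.

Lemma perp_bound (g L C : R) (D U : V) : 1 <= g -> enorm D <= C -> dot U U = 1 ->
  let z := (L / g) *: (D - dot D U *: U) in dot z z <= C ^+ 2 * L ^+ 2.
Proof.
move=> g1 DC U1 /=; rewrite !dotE U1 (dotC U) mulr1.
have DD : dot D D <= C ^+ 2 by rewrite -enorm_sq lerXn2r ?nnegrE ?enorm_ge0 // (le_trans _ DC) ?enorm_ge0.
have gi : (g^-1) ^+ 2 <= 1.
  have g0 : 0 < g by lra.
  by rewrite exprn_ile1 // ?invr_ge0 ?invf_le1 // ltW.
have q0 : 0 <= dot D D - dot D U ^+ 2 by have := dot_CS D U; rewrite U1 mulr1 subr_ge0.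
apply: (@le_trans _ _ (g^-1 ^+ 2 * (L ^+ 2 * (dot D D - dot D U ^+ 2)))).
  by rewrite le_eqVlt; apply/orP; left; apply/eqP; ring.
apply: (@le_trans _ _ (1 * (L ^+ 2 * (dot D D - dot D U ^+ 2)))).
  by rewrite ler_wpM2r // mulr_ge0 // sqr_ge0.
rewrite mul1r mulrC ler_wpM2r ?sqr_ge0 //; have := sqr_ge0 (dot D U); lra.
Qed.

(** The closing bookkeeping of [second_variation]: [a4] is 2n times the infimum, [a2] comes from the
    displaced chains, [a3] is 2n times the cost of the original chain, [a6] is the gain and [a7] the
    term with the slope of psi. Each of the four errors is at most [a10]. *)
Lemma variation_arith (a1 a2 a3 a4 a5 a6 a7 a8 a9 a10 : R) : a4 <= a2 + a1 ->
  a2 <= a3 + (- a6 + a7 + a8) + a9 -> a3 <= a4 + a5 -> a5 = a10 -> a1 <= a10 -> a9 <= a10 ->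
  a8 <= a10 -> a6 <= a7 + 4 * a10.
Proof. lra. Qed.

(** [pair_bound] for each frame vector, summed by [frame_sum], with the second order coefficient
    estimated by [form_bound]. The number 6 C bounds all first and second order coefficients at
    once. *)
Lemma frame_variation (Q H : 'M[R]_n) (f C t om ka psi psi' : R) (d T : V) (Fp Fm : 'I_n -> R) :
  (3 <= n)%N -> Q^T *m Q = 1%:M -> dot T T = 1 -> 1 <= C -> 1 <= f <= C -> 0 <= ka -> enorm d <= C ->
  f * \tr H <= - (n%:R - 3 + ka) * dot d d -> (forall e, `|dot (e *m H) e| <= C * dot e e) ->
  0 <= om <= 1 -> 0 < t <= 1 -> 2 * t * (6 * C) <= 1 -> `|psi| <= 1 -> `|psi'| <= 1 ->
  let X k := (psi / f) *: row k Q in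
  let Y k := vfield f d T (psi / f) (psi' / f - psi * dot d T / f ^+ 2) (row k Q) in
  (forall k, 0 <= Fp k <= f + dot d (t *: X k) + dot ((t *: X k) *m H) (t *: X k) / 2 + om * dot (t *: X k) (t *: X k)) ->
  (forall k, 0 <= Fm k <= f + dot d (- t *: X k) + dot ((- t *: X k) *m H) (- t *: X k) / 2 + om * dot (- t *: X k) (- t *: X k)) ->
  \sum_k (Fp k ^+ 2 * enorm (T + t *: Y k) + Fm k ^+ 2 * enorm (T + - t *: Y k)) <=
    2 * n%:R * f ^+ 2 + t ^+ 2 * (- 2 * ka * psi ^+ 2 * (dot d T / f) ^+ 2 + (2 * n%:R - 4) * psi' ^+ 2 + 4 * n%:R * om * psi ^+ 2)
    + n%:R * (60 * (6 * C) ^+ 5) * t ^+ 3.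
Proof.
move=> n3 QQ T1 C1 /andP[f1 fC] ka0 dC trL HL /andP[om0 om1] t01 tK p1 p1' X Y FpL FmL.
have [t0 t1] := andP t01.
set K := 6 * C; have K1 : 1 <= K by rewrite /K; lra.
have f0 : f != 0 by rewrite gt_eqF //; lra.
pose phi := psi / f; pose a := psi' / f - psi * dot d T / f ^+ 2.
pose al k := phi * dot d (row k Q).
pose be k := phi ^+ 2 * (dot (row k Q *m H) (row k Q) / 2 + om).
pose g k := dot T (Y k).
have pk k : Fp k ^+ 2 * enorm (T + t *: Y k) + Fm k ^+ 2 * enorm (T + - t *: Y k) <=
   2 * f ^+ 2 + t ^+ 2 * (2 * al k ^+ 2 + 4 * f * be k + 4 * f * al k * g k + f ^+ 2 * (dot (Y k) (Y k) - g k ^+ 2)) + 60 * K ^+ 5 * t ^+ 3.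
  have e1 := orth_unit QQ k.
  have [YK phi1 dK] := vfield_bounds C1 T1 e1 f1 dC p1 p1'.
  rewrite -/(Y k) -/K in YK; rewrite -/phi in phi1 dK.
  have phi2 : phi ^+ 2 <= 1 by rewrite -real_normK ?num_real // exprn_ile1.
  have YY : dot (Y k) (Y k) <= K ^+ 2.
    by rewrite -enorm_sq lerXn2r ?nnegrE ?enorm_ge0 //; lra.
  have gK : `|g k| <= K.
    by apply: le_trans (dot_le _ _) _; rewrite /enorm T1 sqrtr1 mul1r.
  have B0 : 0 <= dot (Y k) (Y k) - g k ^+ 2.
    by have := dot_CS T (Y k); rewrite T1 mul1r subr_ge0.
  have BK : dot (Y k) (Y k) - g k ^+ 2 <= K ^+ 2 by have := sqr_ge0 (g k); lra.
  have beK : `|be k| <= K.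
    rewrite /be normrM ger0_norm ?sqr_ge0 //.
    apply: (@le_trans _ _ (1 * K)); last by rewrite mul1r.
    apply: ler_pM; rewrite ?sqr_ge0 //.
    have := HL (row k Q); rewrite e1 mulr1 !ler_norml /K => /andP[h1 h2]; apply/andP; split; lra.
  apply: (@pair_bound R f (al k) (be k) (g k) (dot (Y k) (Y k) - g k ^+ 2) t K) => //.
  - by rewrite f1 /= /K; lra.
  - by rewrite /al; apply: le_trans dK _; rewrite /K; lra.
  - by rewrite B0.
  - have := FpL k; rewrite /X !dotE -!scalemxAl !dotE e1 => /andP[-> h] /=.
    by apply: le_trans h _; rewrite le_eqVlt; apply/orP; left; apply/eqP; rewrite /al /be -/phi; field.
  - have := FmL k; rewrite /X !dotE -!scalemxAl !dotE e1 => /andP[-> h] /=.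
    by apply: le_trans h _; rewrite le_eqVlt; apply/orP; left; apply/eqP; rewrite /al /be -/phi; field.
  - rewrite enorm_ge0 /=; exact: (enorm_unitD T1 gK YY K1 t0 tK).
  - rewrite enorm_ge0 /= scaleNr -scalerN.
    have gE : dot T (- Y k) = - g k by rewrite dotC dotNl dotC.
    have YE : dot (- Y k) (- Y k) = dot (Y k) (Y k) by rewrite dotNl dotC dotNl opprK.
    have := @enorm_unitD R n T (- Y k) t K T1; rewrite gE YE normrN sqrrN => /(_ gK YY K1 t0 tK).
    by rewrite mulrN.
apply: le_trans (ler_sum _ (fun k _ => pk k)) _.
have DT : dot d T ^+ 2 <= dot d d by have := dot_CS d T; rewrite T1 mulr1.
have FB := @form_bound R n f (dot d d) (dot d T) (\tr H) psi psi' ka om n3 f1 ka0 DT trL om0.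
have FS := frame_sum H d phi a om QQ T1 f0.
rewrite /= in FS.
have -> : \sum_k (2 * f ^+ 2 + t ^+ 2 * (2 * al k ^+ 2 + 4 * f * be k + 4 * f * al k * g k + f ^+ 2 * (dot (Y k) (Y k) - g k ^+ 2)) + 60 * K ^+ 5 * t ^+ 3) =
  2 * n%:R * f ^+ 2 + t ^+ 2 * (\sum_k (2 * al k ^+ 2 + 4 * f * be k + 4 * f * al k * g k + f ^+ 2 * (dot (Y k) (Y k) - g k ^+ 2))) + n%:R * (60 * K ^+ 5) * t ^+ 3.
  rewrite big_split [in LHS]big_split /= !sumr_const card_ord -mulr_sumr.
  rewrite -(mulr_natl (2 * f ^+ 2)) -(mulr_natl (60 * K ^+ 5 * t ^+ 3)).
  by move: (\sum_k _) => Z; ring.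
rewrite lerD2r lerD2l; apply: ler_wpM2l; first by rewrite sqr_ge0.
by rewrite /al /be /g FS.
Qed.

End StepCost.

Section Variation.
Context {R : realType} {n : nat} {M : topologicalType}.
Local Notation V := 'rV[R]_n.
Variables (M0 : set M) (X : M -> V) (f ka : M -> R).
Local Notation W := (fun p => f p ^+ 2).
Implicit Types (p q : M) (v x : V).
Hypothesis n3 : (3 <= n)%N.
Hypothesis hM : hausdorff_space M.
Hypothesis fM : flat2 M0 X f ka.
Hypothesis XC : forall p, M0 p -> {for p, continuous X}.
Hypothesis fC : forall p, M0 p -> {for p, continuous f}.
Hypothesis f1 : forall p, M0 p -> 1 <= f p.
Hypothesis ka0 : forall p, M0 p -> 0 <= ka p.

Let flM : flat M0 X := flat2_flat fM.
Let W1 p : M0 p -> 1 <= W p.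
Proof. by move=> /f1 h; rewrite expr_ge1 //; lra. Qed.

Ltac cl := try clear -R n M M0 X f ka n3 hM fM XC fC f1 ka0 flM W1.

(* Discrete parallel transport of an orthonormal frame along a chain. *)
Lemma frames (m : nat) (T z : nat -> V) :
  (forall i, (i < m)%N -> [/\ dot (T i) (T i) = 1, dot (z i) (T i) = 0 & dot (z i) (z i) <= 1]) ->
  exists Q S : nat -> 'M[R]_n, [/\ forall i, (Q i)^T *m Q i = 1%:M,
    forall i, Q i.+1 = Q i *m S i &
    forall i e, (i < m)%N -> enorm (e *m S i - e - (2 * dot (T i) e *: z i - 2 * dot (z i) e *: T i)) <= 30 * dot (z i) (z i) * enorm e].
Proof.
move=> H.
have ex i : exists S : 'M[R]_n, S *m S^T = 1%:M /\ ((i < m)%N ->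
    forall e, enorm (e *m S - e - (2 * dot (T i) e *: z i - 2 * dot (z i) e *: T i)) <= 30 * dot (z i) (z i) * enorm e).
  have [im|im] := boolP (i < m)%N; last by exists 1%:M; rewrite trmx1 mulmx1.
  by have [T1 zT z1] := H i im; have [S SS SL] := rotation T1 zT z1; exists S.
have [S SP] := choice ex.
pose Q := fix Q i := if i is j.+1 then Q j *m S j else 1%:M.
exists Q, S; split => //; last by move=> i e im; exact: (SP i).2.
elim=> [|i IH] /=; first by rewrite trmx1 mulmx1.
by rewrite trmx_mul mulmxA -(mulmxA (S i)^T) IH mulmx1; apply: mulmx1C; exact: (SP i).1.
Qed.

Lemma reach_sum (m : nat) (Z : nat -> M) (c : nat -> R) h : 
  (forall i, (i <= m)%N -> M0 (Z i)) ->
  (forall i, (i < m)%N -> reach M0 X W h (Z i) (Z i.+1) (c i)) ->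
  reach M0 X W h (Z 0%N) (Z m) (\sum_(i < m) c i).
Proof.
elim: m => [|m IH] ZM H; first by rewrite big_ord0; apply: reach0 => //; exact: ZM.
rewrite big_ord_recr /=; apply: reach_trans; last exact: H.
by apply: IH => i im; [apply: ZM; exact: leqW|apply: H; exact: leqW].
Qed.

(** A chain whose cost barely exceeds [Dm] is displaced at each vertex by +t and -t times psi / f
    times each of the n frame vectors. The ends stay fixed because psi vanishes there, so each of
    the 2n displaced chains costs at least Dm. Adding these inequalities cancels the first order,
    and dividing by t^2 gives the claim up to [tau]. The test function comes after the chain in the
    quantifiers, because it has to be fitted to the lengths of the steps. *)
Theorem second_variation p0 q0 (Dm : R) : M0 p0 ->
  (forall r : R, good M0 (rball M0 X W p0 r)) ->
  (forall c, reach M0 X W 1 p0 q0 c -> Dm <= c) ->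
  (forall e : R, 0 < e -> exists2 c, c < Dm + e & reach M0 X W 1 p0 q0 c) ->
  forall tau : R, 0 < tau -> tau <= 1 ->
  exists (m : nat) (P : nat -> M) (v d : nat -> V),
  [/\ P 0%N = p0, P m = q0,
      forall i, (i < m)%N -> (exists w, step M0 X W (P i) (v i) (P i.+1) w) /\ enorm (v i) <= tau,
      \sum_(i < m) enorm (v i) <= Dm + tau &
      forall i, (i < m)%N -> `|f (P i.+1) - f (P i) - dot (d i) (v i)| <= tau * enorm (v i)] /\
  forall (psi : nat -> R) (be : R), 0 <= be <= 1 -> psi 0%N = 0 -> psi m = 0 ->
    (forall i, 0 <= psi i <= 1) -> (forall i, (i < m)%N -> `|psi i.+1 - psi i| <= be * enorm (v i)) ->
    \sum_(i < m) 2 * ka (P i) * psi i ^+ 2 * (dot (d i) (v i) / f (P i)) ^+ 2 / enorm (v i) <=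
      (2 * n%:R - 4) * be ^+ 2 * \sum_(i < m) enorm (v i) + tau.
Proof.
move=> mp0 prop Dle Dinf tau tau0 tau1.
have n3R : 3 <= n%:R :> R by rewrite (ler_nat R 3 n).
have n0R : 0 < n%:R :> R by lra.
have Dm0 : 0 <= Dm + 1.
  have [c cD rc] := Dinf 1 ltr01; have [_ _ c0] := reachM W1 rc; lra.
have [B BE] : exists B, B = Dm + 2 by exists (Dm + 2).
have B0 : 0 < B by lra.
have [K [cK KM BK]] := prop B.
have nB : 0 < 16 * n%:R * B by rewrite !mulr_gt0.
(* Four errors may each cost tau / 4 after division by t^2: the Taylor error [om], the cubic terms
   in [t], the discretization error in [h] and the excess [ep] over the infimum. They are fixed in
   this order, each depending on the previous ones. *)
have [om [om0 om1 omL]] : exists om : R, [/\ 0 < om, om <= 1 & 4 * n%:R * om * B <= tau / 4].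
  exists (Num.min 1 (tau / (16 * n%:R * B))); split; rewrite ?lt_min ?ltr01 ?divr_gt0 ?ge_min ?lexx //.
  have : Num.min 1 (tau / (16 * n%:R * B)) <= tau / (16 * n%:R * B) by rewrite ge_min lexx orbT.
  by rewrite ler_pdivlMr //; lra.
have [r [C [r0 C1 data]]] := uniform_data fM XC fC f1 cK KM om0.
have C0 : 0 < C by lra.
have [Kc KcE] : exists Kc, Kc = 6 * C by exists (6 * C).
have Kc1 : 1 <= Kc by lra.
have [CK CKE] : exists CK, CK = 60 * Kc ^+ 5 by exists (60 * Kc ^+ 5).
have CK0 : 0 < CK by rewrite CKE; apply: mulr_gt0; [exact: ltr0Sn|rewrite exprn_gt0 //; lra].
have nCB : 0 < 4 * n%:R * CK * B by rewrite !mulr_gt0.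
have [t [t0 t1 tK [tr tL]]] : exists t : R, [/\ 0 < t, t <= 1, 2 * t * Kc <= 1 & t <= r / 8 /\ n%:R * CK * B * t <= tau / 4].
  have k0 : 0 < 2 * Kc by lra.
  exists (Num.min 1 (Num.min ((2 * Kc)^-1) (Num.min (r / 8) (tau / (4 * n%:R * CK * B))))); split => //.
  - by rewrite !lt_min ltr01 invr_gt0 k0 !divr_gt0.
  - by rewrite ge_min lexx.
  - set t := Num.min _ _; have : t <= (2 * Kc)^-1 by rewrite !ge_min lexx !orbT.
    by rewrite -[(_)^-1]mul1r ler_pdivlMr //; clearbody t; lra.
  set t := Num.min _ _; split; first by rewrite !ge_min lexx !orbT.
  have : t <= tau / (4 * n%:R * CK * B) by rewrite !ge_min lexx !orbT.
  by rewrite ler_pdivlMr //; clearbody t; lra.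
have [C4 C4E] : exists C4, C4 = 4000 * C ^+ 5 by exists (4000 * C ^+ 5).
have C40 : 0 < C4 by rewrite C4E; apply: mulr_gt0; [exact: ltr0Sn|rewrite exprn_gt0].
have t20 : 0 < t ^+ 2 by rewrite exprn_gt0.
have n4 : 0 < 8 * n%:R * C4 * B.
  by apply: mulr_gt0 => //; apply: mulr_gt0 => //; apply: mulr_gt0.
have C3 : 0 < 120 * C ^+ 3 by apply: mulr_gt0; [exact: ltr0Sn|rewrite exprn_gt0].
(* The chain is refined only after [t] is fixed: the discretization error is proportional to [h] and
   must be small compared with t^2. *)
have [h [h0 ht hC [hr h3 hL]]] : exists h : R, [/\ 0 < h, h <= tau, C * h <= tau &
    [/\ h <= r / 8, 120 * C ^+ 3 * h <= 1 & 8 * n%:R * C4 * B * h <= t ^+ 2 * tau]].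
  exists (Num.min (Num.min tau (C^-1 * tau)) (Num.min (r / 8) (Num.min ((120 * C ^+ 3)^-1) (t ^+ 2 * tau / (8 * n%:R * C4 * B))))).
  set h := Num.min _ _; split.
  - by rewrite !lt_min tau0 mulr_gt0 ?invr_gt0 // !divr_gt0 //= ?mulr_gt0.
  - by rewrite !ge_min lexx.
  - have : h <= C^-1 * tau by rewrite !ge_min lexx orbT.
    by rewrite -(ler_pM2l C0) mulrA divff ?mul1r // gt_eqF.
  split; first by rewrite !ge_min lexx !orbT.
    have : h <= (120 * C ^+ 3)^-1 by rewrite !ge_min lexx !orbT.
    by rewrite -[(_)^-1]mul1r ler_pdivlMr // mulrC.
  have : h <= t ^+ 2 * tau / (8 * n%:R * C4 * B) by rewrite !ge_min lexx !orbT.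
  by rewrite ler_pdivlMr // [h * _]mulrC.
have h1 : h <= 1 by exact: le_trans ht tau1.
have [ep epE] : exists ep, ep = t ^+ 2 * tau / (8 * n%:R) by exists (t ^+ 2 * tau / (8 * n%:R)).
have ep0 : 0 < ep by rewrite epE divr_gt0 ?mulr_gt0.
have [c cD rc] := Dinf (Num.min tau ep) (ltac:(by rewrite lt_min tau0)).
have ct : c < Dm + tau by apply: lt_le_trans cD _; rewrite lerD2l ge_min lexx.
have ce : c < Dm + ep by apply: lt_le_trans cD _; rewrite lerD2l ge_min lexx orbT.
have [m [P [v [w [P0 Pm st Sc]]]]] := reach_chain (reach_refine W1 h0 rc).
have vl i : (i < m)%N -> 0 < enorm (v i) /\ enorm (v i) <= h.
  by move=> /st [[v0 _] vh]; split => //; exact: enorm_gt0.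
have w1 i : (i < m)%N -> 1 <= w i by move=> /st [s _]; have [] := stepM W1 s.
have Ple i : (i <= m)%N -> reach M0 X W 1 p0 (P i) (\sum_(j < i) enorm (v j) * w j).
  elim: i => [|i IH] im; first by rewrite big_ord0 P0; apply: reach0.
  rewrite big_ord_recr /=; apply: (reach_trans (IH (ltnW im))).
  by have [s sh] := st i im; apply: (step_reach W1 s); apply: le_trans sh _.
have sumle i : (i <= m)%N -> \sum_(j < i) enorm (v j) * w j <= c.
  move=> im; apply: le_trans Sc; rewrite -(subnKC im) big_split_ord /= lerDl.
  apply: sumr_ge0 => j _; have jm : (i + j < m)%N by rewrite -ltn_subRL.
  by rewrite mulr_ge0 ?enorm_ge0 // (le_trans ler01) ?w1.
have PK i : (i <= m)%N -> K (P i).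
  move=> im; apply: BK; exists (\sum_(j < i) enorm (v j) * w j); last exact: Ple.
  by have := sumle i im; move: ct tau1 BE; cl; lra.
have data' i : exists sdH : (V -> M) * V * 'M[R]_n, (i <= m)%N ->
  [/\ section_on M0 X (nball (X (P i)) r) sdH.1.1, sdH.1.1 (X (P i)) = P i,
      enorm sdH.1.2 <= C, f (P i) <= C & f (P i) * \tr sdH.2 <= - (n%:R - 3 + ka (P i)) * dot sdH.1.2 sdH.1.2] /\
  [/\ forall e, `|dot (e *m sdH.2) e| <= C * dot e e,
      forall v, `|v| < r -> f (sdH.1.1 (X (P i) + v)) <= f (P i) + dot sdH.1.2 v + dot (v *m sdH.2) v / 2 + om * dot v v,
      forall v, `|v| < r -> `|f (sdH.1.1 (X (P i) + v)) - f (P i) - dot sdH.1.2 v| <= C * dot v v &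
      forall x y, nball (X (P i)) r x -> nball (X (P i)) r y -> `|f (sdH.1.1 x) - f (sdH.1.1 y)| <= C * enorm (x - y)].
  have [im|im] := boolP (i <= m)%N; last by exists (fun=> p0, 0, 0).
  by have [s [d [H HH]]] := data _ (PK i im); exists (s, d, H).
have [sdH sdHP] := choice data'.
pose s i := (sdH i).1.1; pose d i := (sdH i).1.2; pose H i := (sdH i).2.
have [l lE] : exists l : nat -> R, forall i, l i = enorm (v i) by exists (fun i => enorm (v i)).
have [T TE] : exists T : nat -> V, forall i, T i = (l i)^-1 *: v i by exists (fun i => (l i)^-1 *: v i).
have T1 i : (i < m)%N -> dot (T i) (T i) = 1.
  move=> im; have [l0 _] := vl i im.
  by rewrite TE !dotE -enorm_sq lE; field; rewrite gt_eqF.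
have vT i : (i < m)%N -> v i = l i *: T i.
  move=> im; have [l0 _] := vl i im.
  by rewrite TE scalerA lE divff ?scale1r // gt_eqF.
(* By unique lifting the next vertex is read off in the section around P i. *)
have P1 i : (i < m)%N -> P i.+1 = s i (X (P i) + v i).
  move=> im; have [[_ [pi [il i1 _]]] _] := st i im; have [l0 lh] := vl i im.
  have [[sS sP _ _ _] _] := sdHP i (ltnW im).
  have b0 : nball (X (P i)) r (X (P i)) by rewrite /nball /= subrr normr0.
  have b1 : nball (X (P i)) r (X (P i) + v i).
    rewrite /nball /= [X _ + _]addrC addrK; apply: le_lt_trans (norm_enorm _) _; move: lh hr r0; cl; lra.
  rewrite -i1 -[v i in RHS]scale1r.
  apply: (@lift_unique _ _ _ M0 X hM flM (P i) (v i) pi (fun t => s i (X (P i) + t *: v i))) => //; last exact: itv01_1.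
  by rewrite -{1}sP; exact: section_lift sS b0 b1.
have dv i : (i < m)%N -> `|f (P i.+1) - f (P i) - dot (d i) (v i)| <= C * l i ^+ 2.
  move=> im; have [l0 lh] := vl i im; have [_ [_ _ h4 _]] := sdHP i (ltnW im).
  rewrite P1 // lE enorm_sq; apply: h4; apply: le_lt_trans (norm_enorm _) _; move: lh hr r0; cl; lra.
exists m, P, v, d; split; first split => //.
- by move=> i im; have [s1 _] := st i im; have [_ lh] := vl i im; split; [exists (w i)|exact: le_trans lh ht].
- apply: le_trans (_ : c <= _); last exact: ltW.
  apply: le_trans Sc; apply: ler_sum => i _; rewrite ler_peMr ?enorm_ge0 //; exact: w1.
- move=> i im; apply: le_trans (dv i im) _; have [l0 lh] := vl i im.
  rewrite lE expr2 mulrA ler_wpM2r ?(ltW l0) //; apply: le_trans hC.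
  by rewrite ler_wpM2l // ltW.
move=> psi be be01 psi0 psim psi01 psiL.
have l0 i : (i < m)%N -> 0 < l i by rewrite lE => /vl[].
have lh i : (i < m)%N -> l i <= h by rewrite lE => /vl[].
have l1 i : (i < m)%N -> l i <= 1 by move=> /lh /le_trans; apply.
have mP i : (i <= m)%N -> M0 (P i) by move=> /PK; exact: KM.
have fP1 i : (i <= m)%N -> 1 <= f (P i) by move=> /mP /f1.
have fPC i : (i <= m)%N -> f (P i) <= C by move=> im; have [[_ _ _ ? _] _] := sdHP i im.
have dC i : (i <= m)%N -> enorm (d i) <= C by move=> im; have [[_ _ ? _ _] _] := sdHP i im.
have lC i : (i < m)%N -> C * l i <= 1.
  by move=> im; apply: (@le_trans _ _ (C * h)); [rewrite ler_wpM2l ?(ltW C0) ?lh|exact: le_trans hC tau1].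
have dvE i : (i < m)%N -> dot (d i) (v i) = l i * dot (d i) (T i) by move=> im; rewrite {1}(vT _ im) dotC dotZl dotC.
pose dp i := (psi i.+1 - psi i) / l i.
have dpE i : (i < m)%N -> psi i.+1 = psi i + l i * dp i.
  by move=> im; rewrite /dp mulrCA divff ?mulr1 ?gt_eqF ?l0 // addrC subrK.
have dpb i : (i < m)%N -> `|dp i| <= be.
  move=> im; rewrite /dp normrM normfV (gtr0_norm (l0 _ im)) ler_pdivrMr ?l0 //; rewrite lE; exact: psiL.
have [be0 be1] := andP be01.
have ps1 i : `|psi i| <= 1 by have /andP[a b] := psi01 i; rewrite ger0_norm.
have dp1 i : (i < m)%N -> `|dp i| <= 1 by move=> /dpb /le_trans; apply.
(* Chosen so that the rotation produced by [frames] is l times [omega] to first order. *)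
pose z i := (l i / f (P i)) *: (d i - dot (d i) (T i) *: T i).
have zz i : (i < m)%N -> dot (z i) (z i) <= C ^+ 2 * l i ^+ 2.
  by move=> im; apply: perp_bound; [exact: fP1 (ltnW im)|exact: dC (ltnW im)|exact: T1].
have zT i : (i < m)%N -> dot (z i) (T i) = 0.
  by move=> im; rewrite /z !dotE T1 // mulr1 subrr mulr0.
have [|Q [S [QQ QS SL]]] := @frames m T z.
  move=> i im; split; [exact: T1|exact: zT|apply: le_trans (zz _ im) _].
  by rewrite -exprMn exprn_ile1 ?lC // mulr_ge0 // ltW // l0.
have SL' i e : (i < m)%N -> enorm (e *m S i - e - l i *: omega (f (P i)) (d i) (T i) e) <= 30 * C ^+ 2 * l i ^+ 2 * enorm e.
  move=> im; have -> : l i *: omega (f (P i)) (d i) (T i) e = 2 * dot (T i) e *: z i - 2 * dot (z i) e *: T i.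
    rewrite /omega /z !dotE; move: (dot (T i) e) (dot (d i) e) (dot (d i) (T i)) => a b w'.
    by apply/rowP => j; rewrite !mxE; ring.
  apply: le_trans (SL _ e im) _; rewrite ler_wpM2r ?enorm_ge0 //.
  by rewrite -[30 * C ^+ 2 * _]mulrA ler_wpM2l // zz.
pose x k i := (psi i / f (P i)) *: row k (Q i).
pose Y k i := vfield (f (P i)) (d i) (T i) (psi i / f (P i)) (dp i / f (P i) - psi i * dot (d i) (T i) / f (P i) ^+ 2) (row k (Q i)).
have rQ k i : enorm (row k (Q i)) = 1 by rewrite /enorm (orth_unit (QQ i)) sqrtr1.
have xY k i : (i < m)%N -> enorm (x k i.+1 - x k i - l i *: Y k i) <= 120 * C ^+ 3 * l i ^+ 2.
  move=> im; rewrite /x /Y QS row_mul (dpE _ im).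
  apply: (@field_difference R n (f (P i)) (f (P i.+1)) (d i) (T i) (row k (Q i)) (S i) (psi i) (dp i) (l i) C) => //.
  - exact: T1.
  - exact: orth_unit (QQ i) k.
  - exact/fP1/ltnW.
  - exact: fP1.
  - exact/dC/ltnW.
  - by rewrite l0 // l1.
  - exact: dp1.
  - by rewrite -dpE.
  - by rewrite -dvE //; exact: dv.
  - by have := SL' i (row k (Q i)) im; rewrite rQ mulr1.
have x1 k i : (i <= m)%N -> enorm (x k i) <= 1.
  move=> im; rewrite /x enormZ rQ mulr1 normrM normfV; have g0 : 0 < f (P i) by apply: lt_le_trans ltr01 (fP1 _ im).
  by rewrite mulr_ile1 // (gtr0_norm g0) ?invr_ge0 ?(ltW g0) // invf_le1 // fP1.
pose Z (sg : R) k i := s i (X (P i) + sg *: x k i).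
have sS i : (i <= m)%N -> section_on M0 X (nball (X (P i)) r) (s i) by move=> im; have [[? _ _ _ _] _] := sdHP i im.
have sP i : (i <= m)%N -> s i (X (P i)) = P i by move=> im; have [[_ ? _ _ _] _] := sdHP i im.
have sgx sg k i : `|sg| = t -> (i <= m)%N -> enorm (sg *: x k i) <= t.
  by move=> sgt im; rewrite enormZ sgt ler_piMr ?x1 // ltW.
have nb i y : enorm y < r -> nball (X (P i)) r (X (P i) + y).
  by move=> yr; rewrite /nball /= [X _ + _]addrC addrK; apply: le_lt_trans (norm_enorm _) _.
have tr' : t < r by move: tr r0; cl; lra.
have hr2 (a b : R) : a <= h -> b <= t -> a + b < r by move: hr tr r0; cl; lra.
have hr1 (a : R) : a <= h -> a < r by move: hr r0; cl; lra.
have ZM sg k i : `|sg| = t -> (i <= m)%N -> M0 (Z sg k i).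
  move=> sgt im; have [] // := sS i im (X (P i) + sg *: x k i).
  by apply: nb; apply: le_lt_trans (sgx _ _ _ sgt im) _.
have YK k i : (i < m)%N -> enorm (Y k i) <= 6 * C.
  move=> im; have [] // := @vfield_bounds R n (f (P i)) C (d i) (T i) (row k (Q i)) (psi i) (dp i) C1 (T1 _ im) (orth_unit (QQ i) k) (fP1 _ (ltnW im)) (dC _ (ltnW im)) (ps1 i) (dp1 _ im).
have TY sg k i : `|sg| = t -> (i < m)%N -> enorm (T i + sg *: Y k i) <= 2.
  move=> sgt im; apply: le_trans (enormD _ _) _; rewrite enormZ sgt {1}/enorm T1 // sqrtr1.
  have : t * enorm (Y k i) <= t * (6 * C) by rewrite ler_wpM2l ?YK // ltW.
  by move: tK; rewrite KcE; cl; lra.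
have stepZ sg k i : `|sg| = t -> (i < m)%N ->
    reach M0 X W 1 (Z sg k i) (Z sg k i.+1) (l i * (f (Z sg k i) ^+ 2 * enorm (T i + sg *: Y k i)) + C4 * h * l i).
  move=> sgt im; have im' := ltnW im.
  have [[_ [pi [il i1 _]]] _] := st i im; have [_ _ _ XP] := stepM W1 (st i im).1.
  have sx := sgx sg k i sgt im'; have sx' := sgx sg k i.+1 sgt im.
  (* This vertex is defined in the section around P i.+1. Both sections lift the same segment from P
     i.+1, so it can also be read in the section around P i, where both ends of the displaced step
     are then available. *)
  have Zn : Z sg k i.+1 = s i (X (P i) + (v i + sg *: x k i.+1)).
    have b0 : nball (X (P i.+1)) r (X (P i.+1)) by rewrite /nball /= subrr normr0.
    have b1 : nball (X (P i.+1)) r (X (P i.+1) + sg *: x k i.+1) by apply: nb; apply: le_lt_trans tr'.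
    have b2 : nball (X (P i)) r (X (P i) + v i) by apply: nb; apply: hr1; rewrite -lE; exact: lh.
    have b3 : nball (X (P i)) r (X (P i) + v i + sg *: x k i.+1).
      by rewrite -addrA; apply: nb; apply: le_lt_trans (enormD _ _) _; apply: hr2 => //; rewrite -lE; exact: lh.
    have L1 := section_lift (sS _ im) b0 b1; rewrite (sP _ im) in L1.
    have L2 := section_lift (sS _ im') b2 b3; rewrite -(P1 _ im) in L2.
    by have := lift_unique hM flM L1 L2 itv01_1; rewrite !scale1r addrA.
  pose F := f (Z sg k i); pose E := enorm (v i + sg *: (x k i.+1 - x k i)).
  have b0 : nball (X (P i)) r (X (P i) + sg *: x k i) by apply: nb; apply: le_lt_trans tr'.
  have b1 : nball (X (P i)) r (X (P i) + (v i + sg *: x k i.+1)).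
    by apply: nb; apply: le_lt_trans (enormD _ _) _; apply: hr2 => //; rewrite -lE; exact: lh.
  have dE : X (P i) + (v i + sg *: x k i.+1) - (X (P i) + sg *: x k i) = v i + sg *: (x k i.+1 - x k i).
    by rewrite scalerBr opprD addrACA subrr add0r addrA.
  have E0 : 0 <= E by exact: enorm_ge0.
  have [_ [_ _ _ hLip]] := sdHP i im'; rewrite -/(s i) in hLip.
  have Fp0 := f1 (ZM sg k i sgt im').
  (* [f] is C-Lipschitz in the section, hence at most F + C E along the displaced step, whose length
     is [E]. *)
  have seg := segment_reach W1 ltr01 (sS _ im') b0 b1 (w := (F + C * E) ^+ 2).
  rewrite dE in seg; rewrite Zn; apply: reach_mono (seg _) _.
    move=> u u01; have u01' := andP u01.
    have bu : nball (X (P i)) r (X (P i) + sg *: x k i + u *: (v i + sg *: (x k i.+1 - x k i))).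
      by apply: nball_line => //; rewrite -dE addrC subrK.
    have [_ mu _] := sS _ im' _ bu; have fu := f1 mu.
    have CE0 : 0 <= C * E by rewrite mulr_ge0 // ltW.
    rewrite lerXn2r ?nnegrE //=; first (by exact: le_trans ler01 fu); first (by rewrite addr_ge0 // (le_trans ler01 Fp0)).
    have := hLip _ _ bu b0; rewrite [_ + _ *: (v i + _) ]addrC addrK enormZ => hL'.
    have uE : C * (`|u| * E) <= C * E.
      by rewrite ler_wpM2l ?(ltW C0) // ler_piMl // ger0_norm ?u01'.1 ?u01'.2.
    move: hL'; rewrite ler_norml -/(Z sg k i) -/F -/E => /andP[_]; rewrite [u *: _ + _]addrC; move: uE; cl; lra.
  have N0 := enorm_ge0 (T i + sg *: Y k i).
  have EL : E <= l i * (enorm (T i + sg *: Y k i) + 120 * C ^+ 3 * l i).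
    rewrite /E {1}(vT _ im); have -> : l i *: T i + sg *: (x k i.+1 - x k i) = l i *: (T i + sg *: Y k i) + sg *: (x k i.+1 - x k i - l i *: Y k i).
      by apply/rowP => j; rewrite !mxE; ring.
    apply: le_trans (enormD _ _) _; rewrite !enormZ sgt (gtr0_norm (l0 _ im)) mulrDr lerD2l.
    apply: (@le_trans _ _ (1 * (120 * C ^+ 3 * l i ^+ 2))).
      by rewrite ler_pM ?enorm_ge0 ?xY // ltW.
    by rewrite le_eqVlt; apply/orP; left; apply/eqP; ring.
  have N2 := TY sg k i sgt im.
  have C3l : 120 * C ^+ 3 * l i <= 1 by apply: le_trans h3; rewrite ler_wpM2l ?lh // ltW.
  rewrite C4E; apply: (@cost_step R (l i) t (enorm (T i + sg *: Y k i)) F ((F + C * E) ^+ 2) C E h) => //.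
  - by rewrite l0 // lh.
  - by rewrite t0.
  - by rewrite N0.
  - rewrite (le_trans ler01 Fp0) /=.
    have bP : nball (X (P i)) r (X (P i)) by rewrite /nball /= subrr normr0.
    have := hLip _ _ b0 bP; rewrite [X _ + _]addrC addrK (sP _ im') ler_norml => /andP[_].
    rewrite [_ + X _]addrC -/(Z sg k i); have fc := fPC _ im'.
    have : C * enorm (sg *: x k i) <= C * 1 by rewrite ler_wpM2l ?(ltW C0) // (le_trans sx).
    rewrite -/F; move: fc; cl; lra.
  - apply: le_trans EL _; rewrite mulrC ler_wpM2r ?(ltW (l0 _ im)) //; move: N2 C3l; cl; lra.
have Z0 sg k : Z sg k 0%N = p0.
  by rewrite /Z /x psi0 mul0r scale0r scaler0 addr0 sP // P0.
have Zm sg k : Z sg k m = q0.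
  by rewrite /Z /x psim mul0r scale0r scaler0 addr0 sP.
have DL sg k : `|sg| = t -> Dm <= \sum_(i < m) (l i * (f (Z sg k i) ^+ 2 * enorm (T i + sg *: Y k i)) + C4 * h * l i).
  move=> sgt; apply: Dle; have := @reach_sum m (Z sg k) (fun i => l i * (f (Z sg k i) ^+ 2 * enorm (T i + sg *: Y k i)) + C4 * h * l i) 1 (fun i => ZM sg k i sgt) (fun i => stepZ sg k i sgt).
  by rewrite Z0 Zm.
have tN : `|t| = t by rewrite gtr0_norm.
have tN' : `|- t| = t by rewrite normrN.
pose q i := \sum_k (f (Z t k i) ^+ 2 * enorm (T i + t *: Y k i) + f (Z (- t) k i) ^+ 2 * enorm (T i + - t *: Y k i)).
pose A i := 2 * ka (P i) * psi i ^+ 2 * (dot (d i) (T i) / f (P i)) ^+ 2.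
have tKC : 2 * t * (6 * C) <= 1 by rewrite -KcE.
have qL i : (i < m)%N -> q i <= 2 * n%:R * f (P i) ^+ 2 + t ^+ 2 * (- A i + (2 * n%:R - 4) * be ^+ 2 + 4 * n%:R * om) + n%:R * CK * t ^+ 3.
  move=> im; have im' := ltnW im; have [[_ _ _ _ tr2] [h5 h6 _ _]] := sdHP i im'.
  rewrite -/(d i) -/(H i) -/(s i) in tr2 h5 h6.
  have FZ sg k : `|sg| = t -> 0 <= f (Z sg k i) <= f (P i) + dot (d i) (sg *: x k i) + dot ((sg *: x k i) *m H i) (sg *: x k i) / 2 + om * dot (sg *: x k i) (sg *: x k i).
    move=> sgt; rewrite (le_trans ler01 (f1 (ZM sg k i sgt im'))) /=; apply: h6.
    by apply: le_lt_trans (norm_enorm _) _; apply: le_lt_trans (sgx sg k i sgt im') _.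
  have := @frame_variation R n (Q i) (H i) (f (P i)) C t om (ka (P i)) (psi i) (dp i) (d i) (T i) (fun k => f (Z t k i)) (fun k => f (Z (- t) k i)) n3 (QQ i) (T1 _ im) C1.
  move=> /(_ _ (ka0 (mP _ im')) (dC _ im') tr2 h5 _ _ tKC (ps1 i) (dp1 _ im) (fun k => FZ t k tN) (fun k => FZ (- t) k tN')).
  rewrite fP1 // fPC // om1 (ltW om0) t0 t1 => /(_ isT isT isT) fv.
  apply: le_trans fv _; rewrite -KcE -CKE lerD2r lerD2l ler_wpM2l ?sqr_ge0 //.
  have p2 : psi i ^+ 2 <= 1 by rewrite -(real_normK (num_real _)) exprn_ile1.
  have d2 : dp i ^+ 2 <= be ^+ 2 by rewrite -(real_normK (num_real _)) lerXn2r ?nnegrE // dpb.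
  have e1 : (2 * n%:R - 4) * dp i ^+ 2 <= (2 * n%:R - 4) * be ^+ 2 by rewrite ler_wpM2l //; move: n3R; cl; lra.
  have e2 : 4 * n%:R * om * psi i ^+ 2 <= 4 * n%:R * om by rewrite ler_piMr // mulr_ge0 ?mulr_ge0 // ltW.
  have -> : - A i = - 2 * ka (P i) * psi i ^+ 2 * (dot (d i) (T i) / f (P i)) ^+ 2 by rewrite /A; ring.
  by apply: lerD => //; rewrite lerD2l.
have [L LE] : exists L, L = \sum_(i < m) enorm (v i) by exists (\sum_(i < m) enorm (v i)).
have LE' : \sum_(i < m) l i = L by rewrite LE; apply: eq_bigr => i _; exact: lE.
have LB : L <= B.
  apply: le_trans (_ : c <= B); last by move: ct tau1 BE; cl; lra.
  rewrite LE; apply: le_trans Sc; apply: ler_sum => i _; rewrite ler_peMr ?enorm_ge0 //; exact: w1.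
have L0 : 0 <= L by rewrite LE; apply: sumr_ge0 => i _; exact: enorm_ge0.
have Wsum : \sum_(i < m) l i * f (P i) ^+ 2 <= c.
  apply: le_trans Sc; apply: ler_sum => i _; rewrite lE ler_wpM2l ?enorm_ge0 //.
  by have [[_ [pi [[<- _] _ iw]]] _] := st i (ltn_ord i); apply: iw; exact: itv01_0.
have tot : 2 * n%:R * Dm <= \sum_(i < m) l i * q i + 2 * n%:R * (C4 * h * L).
  have hs : \sum_(k < n) (Dm + Dm) <= \sum_(k < n) (\sum_(i < m) (l i * (f (Z t k i) ^+ 2 * enorm (T i + t *: Y k i)) + C4 * h * l i) + \sum_(i < m) (l i * (f (Z (- t) k i) ^+ 2 * enorm (T i + - t *: Y k i)) + C4 * h * l i)).
    by apply: ler_sum => k _; apply: lerD; exact: DL.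
  rewrite sumr_const card_ord -[_ *+ n]mulr_natl in hs.
  have -> : 2 * n%:R * Dm = n%:R * (Dm + Dm) by ring.
  apply: le_trans hs _; rewrite le_eqVlt; apply/orP; left; apply/eqP.
  transitivity (\sum_(k < n) (\sum_(i < m) l i * (f (Z t k i) ^+ 2 * enorm (T i + t *: Y k i) + f (Z (- t) k i) ^+ 2 * enorm (T i + - t *: Y k i)) + 2 * (C4 * h * L))).
    apply: eq_bigr => k _; rewrite -big_split /=.
    have -> : 2 * (C4 * h * L) = \sum_(i < m) 2 * (C4 * h) * l i by rewrite -mulr_sumr LE'; ring.
    rewrite -big_split /=; apply: eq_bigr => i _; ring.
  rewrite big_split /= sumr_const card_ord -[(_ *+ n)]mulr_natl exchange_big /=; congr (_ + _); last by ring.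
  by apply: eq_bigr => i _; rewrite mulr_sumr.
have qs : \sum_(i < m) l i * q i <= 2 * n%:R * c + t ^+ 2 * (- (\sum_(i < m) l i * A i) + (2 * n%:R - 4) * be ^+ 2 * L + 4 * n%:R * om * L) + n%:R * CK * t ^+ 3 * L.
  apply: le_trans (_ : 2 * n%:R * (\sum_(i < m) l i * f (P i) ^+ 2) + t ^+ 2 * (- (\sum_(i < m) l i * A i) + (2 * n%:R - 4) * be ^+ 2 * L + 4 * n%:R * om * L) + n%:R * CK * t ^+ 3 * L <= _); last first.
    by rewrite !lerD2r ler_wpM2l // mulr_ge0.
  apply: le_trans (ler_sum _ (fun i _ => ler_wpM2l (ltW (l0 _ (ltn_ord i))) (qL i (ltn_ord i)))) _.
  rewrite -LE' -sumrN !mulr_sumr -!big_split /= !mulr_sumr -!big_split /=.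
  by apply: ler_sum => i _; rewrite le_eqVlt; apply/orP; left; apply/eqP; ring.
have -> : \sum_(i < m) 2 * ka (P i) * psi i ^+ 2 * (dot (d i) (v i) / f (P i)) ^+ 2 / enorm (v i) = \sum_(i < m) l i * A i.
  apply: eq_bigr => i _; have li := l0 _ (ltn_ord i); have fi := fP1 _ (ltnW (ltn_ord i)).
  have li0 : l i != 0 by rewrite gt_eqF.
  have fi0 : f (P i) != 0 by rewrite gt_eqF // (lt_le_trans ltr01 fi).
  rewrite dvE // /A -lE; move: li0 fi0.
  by move: (l i) (f (P i)) (ka (P i)) (psi i) (dot (d i) (T i)); cl => a1 a2 a3 a4 a5 h1' h2'; field; rewrite h1' h2'.
set SA := \sum_(i < m) l i * A i in qs *; rewrite -LE.
have b1 : 2 * n%:R * ep = t ^+ 2 * (tau / 4) by rewrite epE; field; rewrite gt_eqF.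
have b2 : 2 * n%:R * (C4 * h * L) <= t ^+ 2 * (tau / 4).
  have : 2 * n%:R * (C4 * h * L) <= 2 * n%:R * (C4 * h * B).
    by rewrite !ler_wpM2l // ?mulr_ge0 // ltW.
  lra.
have b3 : n%:R * CK * t ^+ 3 * L <= t ^+ 2 * (tau / 4).
  apply: (@le_trans _ _ (t ^+ 2 * (n%:R * CK * B * t))); last by rewrite ler_wpM2l // ltW.
  have -> : t ^+ 2 * (n%:R * CK * B * t) = n%:R * CK * t ^+ 3 * B by ring.
  by rewrite ler_wpM2l // !mulr_ge0 // ?exprn_ge0 // ltW.
have b4 : 4 * n%:R * om * L <= tau / 4.
  by apply: le_trans omL; rewrite ler_wpM2l // !mulr_ge0 // ltW.
have c2 : 2 * n%:R * c <= 2 * n%:R * Dm + 2 * n%:R * ep.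
  by rewrite -mulrDr ler_wpM2l ?mulr_ge0 // ltW.
have b5 : t ^+ 2 * (4 * n%:R * om * L) <= t ^+ 2 * (tau / 4) by rewrite ler_wpM2l // ltW.
rewrite -(ler_pM2l t20).
have e1 : t ^+ 2 * (- SA + (2 * n%:R - 4) * be ^+ 2 * L + 4 * n%:R * om * L) =
  - (t ^+ 2 * SA) + t ^+ 2 * ((2 * n%:R - 4) * be ^+ 2 * L) + t ^+ 2 * (4 * n%:R * om * L) by ring.
rewrite e1 in qs; rewrite mulrDr.
have e2 : t ^+ 2 * tau = 4 * (t ^+ 2 * (tau / 4)) by field.
rewrite e2; move: tot qs c2 b1 b2 b3 b5.
exact: variation_arith.
Qed.

End Variation.

(** * A complete metric has no two Euclidean ends *)

Section Sums.
Context {R : realType}.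
Implicit Types (l y : nat -> R).

(** Sum of (|y| - lam l)^2 / l >= 0. This is Cauchy-Schwarz with a free parameter, so that an upper
    bound for the sum of [l] is enough to use it. *)
Lemma weighted_square a b l y (lam : R) : (forall k, (a <= k < b)%N -> 0 < l k) ->
  2 * lam * (\sum_(a <= k < b) `|y k|) - lam ^+ 2 * (\sum_(a <= k < b) l k) <= \sum_(a <= k < b) y k ^+ 2 / l k.
Proof.
move=> l0; rewrite !mulr_sumr -sumrB !big_nat; apply: ler_sum => k kab.
have l1 := l0 k kab; rewrite ler_pdivlMr // -(real_normK (num_real (y k))).
move: (`|y k|) (l k) l1 => Y L L0; have := sqr_ge0 (Y - lam * L); nra.
Qed.

(** The witness is 2 / S times the length to the nearer end of the chain. With S / 8 left on both
    sides it is at least 2 / S * S / 8 = 1 / 4. *)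
Lemma tent (m : nat) l (S : R) : (forall i, (i < m)%N -> 0 <= l i) -> S = \sum_(0 <= k < m) l k -> 2 <= S ->
  exists psi : nat -> R, [/\ psi 0%N = 0, psi m = 0, forall i, 0 <= psi i <= 1,
    forall i, (i < m)%N -> `|psi i.+1 - psi i| <= 2 / S * l i &
    forall i, (i <= m)%N -> S / 8 <= \sum_(0 <= k < i) l k -> S / 8 <= \sum_(i <= k < m) l k -> 4^-1 <= psi i].
Proof.
move=> l0 SE S2; have S0 : 0 < S by lra.
(* [minn] freezes the length after the last vertex, so that the bounds on psi hold for every
   index. *)
pose s i := \sum_(0 <= k < minn i m) l k.
have s0 i : 0 <= s i.
  rewrite /s big_nat; apply: sumr_ge0 => k /andP[_]; rewrite leq_min => /andP[_]; exact: l0.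
have sS i : s i <= S.
  rewrite SE (big_cat_nat _ (n := minn i m)) ?geq_minr //= lerDl big_nat.
  by apply: sumr_ge0 => k /andP[_]; exact: l0.
have sm : s m = S by rewrite /s minnn SE.
have st i : (i < m)%N -> s i.+1 = s i + l i.
  by move=> im; rewrite /s (minn_idPl im) (minn_idPl (ltnW im)) big_nat_recr.
exists (fun i => 2 / S * Num.min (s i) (S - s i)).
have S2' : 0 < 2 / S by rewrite divr_gt0.
split.
- by rewrite /s min0n big_geq // subr0 min_l ?mulr0 // ltW.
- by rewrite sm subrr min_r ?mulr0 // ltW.
- move=> i; apply/andP; split.
    by rewrite mulr_ge0 ?(ltW S2') // le_min s0 subr_ge0 sS.
  rewrite mulrAC ler_pdivrMr // mul1r; case: (leP (s i) (S - s i)); lra.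
- move=> i im; rewrite -mulrBr normrM gtr0_norm // ler_pM2l // (st _ im).
  have := l0 _ im; rewrite ler_norml => h; apply/andP; split.
    case: (leP (s i) (S - s i)); case: (leP (s i + l i) (S - (s i + l i))); lra.
  case: (leP (s i) (S - s i)); case: (leP (s i + l i) (S - (s i + l i))); lra.
move=> i im h1 h2; have si : s i = \sum_(0 <= k < i) l k by rewrite /s (minn_idPl im).
have s2 : S - s i = \sum_(i <= k < m) l k.
  by rewrite SE si (big_cat_nat _ (n := i)) //= addrC addrK.
have h : S / 8 <= Num.min (s i) (S - s i) by rewrite le_min s2 h2 si h1.
apply: (@le_trans _ _ (2 / S * (S / 8))); last by rewrite ler_pM2l.
by rewrite le_eqVlt; apply/orP; left; apply/eqP; field; rewrite gt_eqF.
Qed.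

End Sums.

Section Ends.
Context {R : realType} {n : nat} {M : topologicalType}.
Local Notation V := 'rV[R]_n.
Variables (M0 : set M) (X : M -> V) (f ka : M -> R).
Local Notation W := (fun p => f p ^+ 2).
Implicit Types (p q : M) (v x : V).

Lemma bas_norm (j : 'I_n) (t : R) : `|t *: bas j : V| = `|t| /\ enorm (t *: bas j : V) = `|t|.
Proof.
have e1 : enorm (bas j : V) = 1.
  rewrite /enorm /dot (bigD1 j) //= big1 ?addr0; last first.
    by move=> i /negPf ij; rewrite !mxE ij andbF mulr0.
  by rewrite !mxE !eqxx mulr1 sqrtr1.
split; last by rewrite enormZ e1 mulr1.
rewrite normrZ; suff -> : `|bas j : V| = 1 by rewrite mulr1.
apply/eqP; rewrite eq_le -{1}e1 norm_enorm /=.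
by have := rV_coord_le (bas j : V) j; rewrite !mxE !eqxx normr1.
Qed.

Hypothesis n3 : (3 <= n)%N.
Hypothesis hM : hausdorff_space M.
Hypothesis fM : flat2 M0 X f ka.
Hypothesis XC : forall p, M0 p -> {for p, continuous X}.
Hypothesis fC : forall p, M0 p -> {for p, continuous f}.
Hypothesis f1 : forall p, M0 p -> 1 < f p.
Hypothesis kaL : forall p, M0 p -> (2 * (1 + f p) ^+ 3)^-1 <= ka p.
Hypothesis prop : forall p r, M0 p -> good M0 (rball M0 X W p r).
Hypothesis conn : forall p q, M0 p -> M0 q -> exists c, reach M0 X W 1 p q c.

Let flM : flat M0 X := flat2_flat fM.
Let W1 p : M0 p -> 1 <= W p.
Proof. by move=> /f1 h; rewrite expr_ge1 //; lra. Qed.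
Let ka0 p : M0 p -> 0 <= ka p.
Proof.
move=> mp; apply: le_trans (kaL mp); have := f1 mp => h.
by rewrite invr_ge0 mulr_ge0 // exprn_ge0 //; lra.
Qed.

Ltac cl := try clear -R n M M0 X f ka n3 hM fM XC fC f1 kaL prop conn flM W1 ka0.

Lemma line_lift (D : set V) s (y z : V) : section_on M0 X D s ->
  (forall t, 0 <= t <= 1 -> D (y + t *: z)) -> is_lift M0 X (s y) z (fun t => s (y + t *: z)).
Proof.
move=> sS Dl; split; first by rewrite scale0r addr0.
move=> t t01; have [sc sM sX] := sS _ (Dl t t01).
have [_ _ E] := sS _ (Dl 0 itv01_0); rewrite scale0r addr0 in E; rewrite E; split => //.
apply: (@continuous_comp _ _ _ (fun t : R => y + t *: z) s); last exact: sc.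
by apply: cvgD; [exact: cvg_cst|apply: cvgZl; exact: cvg_id].
Qed.

Definition exterior (r : R) : set V := [set x | r < `|x|].

(** The norm is the sup norm, so the end is a copy of the exterior of a cube, inverted by [s].
    Together with f > 1 the last clause makes the metric asymptotic to the flat one. *)
Record is_end (R0 : R) (s : V -> M) : Prop := {
  end_section : section_on M0 X (exterior R0) s;
  end_le2 : forall x, R0 < `|x| -> f (s x) <= 2;
  end_lim : forall e : R, 0 < e -> exists r, forall x, R0 < `|x| -> r < `|x| -> f (s x) < 1 + e }.

(** A segment of length at most 1 starting beyond R0 + 1 stays in the exterior, and its lift is
    unique. *)
Lemma end_step R0 s x v w q : is_end R0 s -> R0 + 1 < `|x| -> `|v| <= 1 -> step M0 X W (s x) v q w ->
  q = s (x + v).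
Proof.
move=> E xR v1 [_ [pi [il <- _]]].
have L := @line_lift _ s x v (end_section E); rewrite -[v in RHS]scale1r.
apply: (lift_unique hM flM il (L _) itv01_1) => t /andP[t0 t1]; rewrite /exterior /=.
have := ler_normB (x + t *: v) (t *: v); rewrite addrK normrZ (ger0_norm t0).
have : t * `|v| <= 1 by rewrite mulr_ile1.
lra.
Qed.

Lemma end_radial R0 s (j : 'I_n) (r r' c : R) : is_end R0 s -> 0 <= R0 -> R0 < r -> r < r' -> 0 <= c ->
  (forall x, r <= `|x| -> f (s x) ^+ 2 <= c) ->
  reach M0 X W 1 (s (r *: bas j)) (s (r' *: bas j)) ((r' - r) * c).
Proof.
move=> E R00 rR rr c0 fc; have := @step_refine R n M M0 X W W1 1 (s (r *: bas j)) ((r' - r) *: bas j) (s (r' *: bas j)) c ltr01.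
rewrite (bas_norm j (r' - r)).2 ger0_norm ?subr_ge0 ?(ltW rr) //; apply.
have nrm t : 0 <= t <= 1 -> r <= `|r *: bas j + t *: ((r' - r) *: bas j) : V|.
  move=> /andP[t0 t1]; rewrite scalerA -scalerDl (bas_norm j _).1.
  have : 0 <= t * (r' - r) by rewrite mulr_ge0 // subr_ge0 ltW.
  by move=> h; rewrite ger0_norm; lra.
split.
  have := (bas_norm j (r' - r)).1 => h; rewrite -normr_gt0 h normr_gt0 subr_eq0 gt_eqF //.
exists (fun t => s (r *: bas j + t *: ((r' - r) *: bas j))); split.
- apply: line_lift (end_section E) _ => t t01; exact: lt_le_trans (nrm t t01).
- by rewrite scale1r -scalerDl addrC subrK.
- by move=> t t01; apply: fc; exact: nrm.
Qed.

(** [f] exceeds 1 everywhere, hence by a fixed amount on a compact shell. This is the amount by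
    which f has to rise along a path leaving the end. *)
Lemma shell_bound R0 s : is_end R0 s -> 0 <= R0 -> exists2 m0 : R, 1 < m0 &
  forall x, R0 + 1 <= `|x| <= R0 + 2 -> m0 <= f (s x).
Proof.
move=> E R00; pose K : set V := [set x | R0 + 1 <= `|x| <= R0 + 2].
have cK : compact K.
  apply: bounded_closed_compact.
    exists (R0 + 2); split; first exact: num_real.
    by move=> z zr y /= /andP[_ yK]; apply: le_trans yK (ltW zr).
  have -> : K = (fun x : V => `|x|) @^-1` [set y | R0 + 1 <= y] `&` (fun x : V => `|x|) @^-1` [set y | y <= R0 + 2].
    by apply/seteqP; split => x /=; [move=> /andP[]|move=> [a b]; apply/andP].
  apply: closedI.
    by apply: (closed_comp (f := fun x : V => `|x|)); [move=> x _; exact: norm_continuous|exact: closed_ge].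
  by apply: (closed_comp (f := fun x : V => `|x|)); [move=> x _; exact: norm_continuous|exact: closed_le].
have KE x : K x -> R0 < `|x| by move=> /andP[h _]; lra.
pose P (A : set V) := exists2 m0 : R, 1 < m0 & forall x, A x -> K x -> m0 <= f (s x).
suff [m0 m1 H] : P K by exists m0 => // x Kx; apply: H.
apply: compact_ideal cK _ _ _ _.
- by exists 2 => //; rewrite ltr1n.
- move=> A B [a a1 HA] [b b1 HB]; exists (Num.min a b); first by rewrite lt_min a1.
  by move=> x [Ax|Bx] Kx; rewrite ge_min ?(HA x Ax Kx) // (HB x Bx Kx) orbT.
- by move=> A B AB [a a1 H]; exists a => // x /AB; apply: H.
move=> x /KE xR; have [sc sM _] := end_section E xR.
have gt1 := f1 sM.
have fsc : {for x, continuous (f \o s)} by apply: continuous_comp => //; exact: fC.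
have [|d d0 B] := continuous_dist fsc (e := (f (s x) - 1) / 2); first by rewrite divr_gt0 // subr_gt0.
exists (nball x d); first by apply: nballP; rewrite /nball /= subrr normr0.
exists ((1 + f (s x)) / 2); first lra.
by move=> y /B /=; rewrite ltr_norml => /andP[]; lra.
Qed.

(** [b] is the first vertex within R0 + 2, and [a] the last one before b beyond R1; steps of length
    at most 1 cannot jump over the shells. Such a b exists, since otherwise the whole chain, its
    last vertex included, would stay in the end. *)
Lemma end_crossing R0 R1 s x0 m (P : nat -> M) (v : nat -> V) : is_end R0 s -> R0 + 2 < R1 ->
  R1 <= `|x0| -> R0 < `|x0| -> P 0%N = s x0 -> (forall x, R0 < `|x| -> P m <> s x) ->
  (forall i, (i < m)%N -> (exists w, step M0 X W (P i) (v i) (P i.+1) w) /\ `|v i| <= 1) ->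
  exists a b, [/\ (a < b <= m)%N, R1 <= `|X (P a)| <= R1 + 1, R0 + 1 <= `|X (P b)| <= R0 + 2,
    P b = s (X (P b)) & forall k, (k < b)%N -> P k = s (X (P k)) /\ R0 < `|X (P k)|].
Proof.
move=> E R01 R1x R0x P0 Pm st.
have XP0 : X (P 0%N) = x0.
  by rewrite P0; have [] := end_section E R0x.
have XS i : (i < m)%N -> X (P i.+1) = X (P i) + v i.
  by move=> /st[[w sw] _]; have [] := stepM W1 sw.
have dX i : (i < m)%N -> `|X (P i)| <= `|X (P i.+1)| + 1.
  move=> im; rewrite (XS _ im); have [_ v1] := st i im.
  have := ler_normB (X (P i) + v i) (v i); rewrite addrK; lra.
have inE j : (j <= m)%N -> (forall i, (i < j)%N -> R0 + 2 < `|X (P i)|) -> P j = s (X (P j)).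
  elim: j => [|j IH] jm H; first by rewrite XP0.
  have Pj : P j = s (X (P j)) by apply: IH (ltnW jm) _ => i ij; apply: H; exact: leqW.
  have [[w sw] v1] := st j jm; rewrite Pj in sw.
  rewrite (XS _ jm); apply: end_step E _ v1 sw; have := H j (ltnSn j); lra.
pose Q b := (b <= m)%N && (`|X (P b)| <= R0 + 2).
have exQ : exists b, Q b.
  apply: contrapT => nQ; have H i : (i <= m)%N -> R0 + 2 < `|X (P i)|.
    by move=> im; rewrite ltNge; apply/negP => h; apply: nQ; exists i; rewrite /Q im.
  apply: (Pm (X (P m))); first by have := H m (leqnn m); lra.
  by apply: inE => // i im; apply: H; exact: ltnW.
have [b /andP[bm bR] bmin] := ex_minnP exQ.
have bB i : (i < b)%N -> R0 + 2 < `|X (P i)|.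
  move=> ib; rewrite ltNge; apply/negP => h; have := bmin i.
  by rewrite /Q h (leq_trans (ltnW ib) bm) => /(_ isT); rewrite leqNgt ib.
have b0 : (0 < b)%N by case: (b) bR => // h; move: h; rewrite XP0; lra.
have exA : exists a, (a < b)%N && (R1 <= `|X (P a)|) by exists 0%N; rewrite b0 XP0.
have ubA a : (a < b)%N && (R1 <= `|X (P a)|) -> (a <= b)%N by move=> /andP[/ltnW].
have [a /andP[ab aR] amax] := ex_maxnP exA ubA.
exists a, b; split.
- by rewrite ab.
- rewrite aR /=; have := dX a (leq_trans ab bm).
  have [ab1|ab1] := ltnP a.+1 b; last first.
    have -> : a.+1 = b by apply/eqP; rewrite eqn_leq ab.
    lra.
  have : `|X (P a.+1)| < R1.
    rewrite ltNge; apply/negP => h; have := amax a.+1.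
    by rewrite ab1 h => /(_ isT); rewrite ltnn.
  lra.
- rewrite bR andbT; have bp : (b.-1 < b)%N by rewrite prednK.
  have := dX b.-1 (leq_trans bp bm); rewrite prednK //; have := bB _ bp; lra.
- exact: inE bm bB.
move=> k kb; split; last by have := bB k kb; lra.
apply: inE; first exact: leq_trans (ltnW kb) bm.
by move=> i ik; apply: bB; exact: ltn_trans kb.
Qed.

(** A nearly shortest chain between points at radius [r] in the two ends has length at most 2 (1 +
    eta) r plus a constant. Displacement in [X] forces at least r - R1 - 1 of it before [a] and r -
    R0 - 2 after [b], so the stretch from a to b is at most 2 eta r + C' long. There [f] rises by a
    fixed amount, and the gain in [second_variation] is at least a multiple of de^2 / (2 eta r +
    C'), whereas the tent function makes the other side at most 8 n / r. For small eta and large r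
    these are incompatible. *)
Theorem two_ends R0 s1 s2 : 0 <= R0 -> is_end R0 s1 -> is_end R0 s2 ->
  (forall x y, R0 < `|x| -> R0 < `|y| -> s1 x <> s2 y) -> False.
Proof.
move=> R00 E1 E2 E12.
have n0 : (0 < n)%N by exact: leq_trans n3.
have n0R : 0 < n%:R :> R by rewrite ltr0n.
pose j := Ordinal n0.
have [m0 m01 m0L] := shell_bound E1 R00.
have [de de0 deE] : exists2 de : R, 0 < de & m0 = 1 + 2 * de.
  by exists ((m0 - 1) / 2); [rewrite divr_gt0 // subr_gt0|field].
(* 12^3 = 54 * 16 * 4 / 2 collects ka >= 1 / 54, which is 1 / (2 * 3^3) from f <= 2, then psi^2 >= 1
   / 16 and f^2 <= 4. The further factors are 4 from (de / 2)^2 and 8 n from the right-hand side. *)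
have [N N0 NE] : exists2 N : R, 0 < N & N = 12 * 12 * 12 * (4 * (8 * n%:R)).
  by exists (12 * 12 * 12 * (4 * (8 * n%:R))) => //; rewrite !mulr_gt0.
(* The inequality to be refuted is de^2 r <= N (2 eta r + C'). [eta] makes the part linear in r at
   most de^2 r / 8, and [r] will do the same for N C'. *)
have [eta [eta0 eta1 etaL]] : exists eta : R, [/\ 0 < eta, eta <= 1 & N * (2 * eta) <= de ^+ 2 / 8].
  exists (Num.min 1 (de ^+ 2 / (16 * N))); split.
  - by rewrite lt_min ltr01 divr_gt0 ?exprn_gt0 // mulr_gt0.
  - by rewrite ge_min lexx.
  have : Num.min 1 (de ^+ 2 / (16 * N)) <= de ^+ 2 / (16 * N) by rewrite ge_min lexx orbT.
  by rewrite ler_pdivlMr ?mulr_gt0 //; lra.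
have [e [e0 e1 e2]] : exists e : R, [/\ 0 < e, e <= de & e <= eta / 3].
  exists (Num.min de (eta / 3)); rewrite lt_min de0 divr_gt0 // !ge_min !lexx orbT; by split.
have [r1 r1L] := end_lim E1 e0; have [r2 r2L] := end_lim E2 e0.
have [R1 [R10 R1r R1r']] : exists R1 : R, [/\ R0 + 3 <= R1, r1 < R1 & r2 < R1].
  exists (Num.max (R0 + 3) (Num.max (r1 + 1) (r2 + 1))); split; first by rewrite le_max lexx.
    by rewrite !lt_max; apply/orP; right; apply/orP; left; lra.
  by rewrite !lt_max; apply/orP; right; apply/orP; right; lra.
have fL1 x : R1 <= `|x| -> f (s1 x) < 1 + e by move=> h; apply: r1L; lra.
have fL2 x : R1 <= `|x| -> f (s2 x) < 1 + e by move=> h; apply: r2L; lra.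
have mE1 x : R0 < `|x| -> M0 (s1 x) by move=> /(end_section E1)[].
have mE2 x : R0 < `|x| -> M0 (s2 x) by move=> /(end_section E2)[].
have sq y : 1 < y -> y < 1 + e -> y ^+ 2 <= 1 + eta.
  move=> y1 ye; have h : y ^+ 2 <= (1 + eta / 3) ^+ 2 by rewrite lerXn2r ?nnegrE; lra.
  apply: le_trans h _; have : eta ^+ 2 <= eta by rewrite expr2 ler_piMl // ltW.
  lra.
have WL1 x : R1 <= `|x| -> f (s1 x) ^+ 2 <= 1 + eta by move=> h; apply: sq (fL1 _ h); apply: f1; apply: mE1; lra.
have WL2 x : R1 <= `|x| -> f (s2 x) ^+ 2 <= 1 + eta by move=> h; apply: sq (fL2 _ h); apply: f1; apply: mE2; lra.
have nb r : 0 <= r -> `|r *: bas j : V| = r by move=> r0; rewrite (bas_norm j r).1 ger0_norm.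
have R1p : 0 <= R1 by lra.
have [C0 rC0] : exists c, reach M0 X W 1 (s1 (R1 *: bas j)) (s2 (R1 *: bas j)) c.
  by apply: conn; [apply: mE1|apply: mE2]; rewrite nb //; lra.
have [_ _ C00] := reachM W1 rC0.
have [C' C'0 C'L] : exists2 C' : R, 0 < C' & C' = C0 + R1 + R0 + 5 by exists (C0 + R1 + R0 + 5) => //; lra.
(* The first bound leaves at least S / 8 of length on both sides of the crossing, so that the tent
   function is at least 1 / 4 on it. *)
have [r [rL1 rL2]] : exists r : R, 4 * C' + 8 * R1 + 20 <= r /\ N * C' < de ^+ 2 / 8 * r.
  have d8 : 0 < de ^+ 2 / 8 by rewrite divr_gt0 // exprn_gt0.
  exists (4 * C' + 8 * R1 + 20 + N * C' / (de ^+ 2 / 8)); split.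
    by rewrite lerDl divr_ge0 ?(ltW d8) // mulr_ge0 // ltW.
  move: d8; set Z := de ^+ 2 / 8 => Z0.
  have -> : Z * (4 * C' + 8 * R1 + 20 + N * C' / Z) = Z * (4 * C' + 8 * R1 + 20) + N * C' by field; rewrite gt_eqF.
  by rewrite ltrDr mulr_gt0 //; lra.
pose x0 := r *: bas j : V; have nx0 : `|x0| = r by apply: nb; lra.
pose A := [set c | reach M0 X W 1 (s1 x0) (s2 x0) c]; pose Dm := inf A.
pose D1 := (r - R1) * (1 + eta).
have AD : A (D1 + C0 + D1).
  apply: reach_trans; last by apply: (end_radial j E2) => //; lra.
  apply: reach_trans rC0; apply: (reach_sym W1); apply: (end_radial j E1) => //; lra.
have lbA : has_lbound A by exists 0 => c Ac; have [_ _] := reachM W1 Ac.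
have hA : has_inf A by split => //; exists (D1 + C0 + D1).
have DmL : Dm <= D1 + C0 + D1 by apply: ge_inf.
have Dle c : reach M0 X W 1 (s1 x0) (s2 x0) c -> Dm <= c by move=> Ac; apply: ge_inf.
have Dinf e' : 0 < e' -> exists2 c, c < Dm + e' & reach M0 X W 1 (s1 x0) (s2 x0) c.
  by move=> e'0; have [c Ac cD] := inf_adherent e'0 hA; exists c.
have r0 : 0 < r by lra.
have Dmr : Dm <= 2 * (1 + eta) * r + C0.
  apply: le_trans DmL _; have : 0 <= R1 * (1 + eta) by rewrite mulr_ge0 //; lra.
  rewrite /D1; lra.
clearbody Dm; clear DmL AD hA lbA D1.
have B1 : 0 < 2 * (1 + eta) * r + C0 + 1.
  have : 0 <= 2 * (1 + eta) * r by rewrite mulr_ge0 ?(ltW r0) //; lra.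
  lra.
have [tau [tau0 tau1 taur tauD]] : exists tau : R, [/\ 0 < tau, tau <= 1, tau <= r^-1 &
    tau * (2 * (1 + eta) * r + C0 + 1) <= de / 2].
  exists (Num.min 1 (Num.min r^-1 (de / 2 / (2 * (1 + eta) * r + C0 + 1)))); split.
  - by rewrite !lt_min ltr01 invr_gt0 r0 !divr_gt0.
  - by rewrite ge_min lexx.
  - by rewrite !ge_min lexx !orbT.
  - by rewrite -ler_pdivlMr // !ge_min lexx !orbT.
have rR0 : R0 < r by lra.
have f1' p : M0 p -> 1 <= f p by move=> /f1 /ltW.
have [m [P [v [d [[P0 Pm st SD df] H]]]]] := second_variation n3 hM fM XC fC f1' ka0
  (mE1 x0 (ltac:(by rewrite nx0))) (fun r => prop r (mE1 x0 (ltac:(by rewrite nx0)))) Dle Dinf tau0 tau1.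
have vn i : (i < m)%N -> 0 < enorm (v i).
  by move=> /st [[w [v0 _]] _]; exact: enorm_gt0.
have [|||||a [b [/andP[ab bm] aR bR Pb Pk]]] := @end_crossing R0 R1 s1 x0 m P v E1 _ _ _ P0 _ _.
- lra.
- by rewrite nx0; lra.
- by rewrite nx0.
- by move=> x xR; rewrite Pm => h; apply: (E12 x x0 xR); rewrite ?nx0.
- move=> i im; have [sw le] := st i im; split => //.
  by apply: le_trans (norm_enorm _) _; apply: le_trans le tau1.
have Xsum k k' : (k <= k' <= m)%N -> `|X (P k') - X (P k)| <= \sum_(k <= i < k') enorm (v i).
  move=> /andP[kk km]; rewrite -(telescope_sumr (fun i => X (P i)) kk).
  rewrite !big_nat; apply: le_trans (ler_norm_sum _ _ _) _; apply: ler_sum => i /andP[_ ik].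
  have [[w sw] _] := st i (leq_trans ik km); have [_ _ _ ->] := stepM W1 sw.
  by rewrite [X _ + _]addrC addrK norm_enorm.
have XP0 : X (P 0%N) = x0 by rewrite P0; have [] := end_section E1 (x := x0); rewrite /exterior /= ?nx0.
have XPm : X (P m) = x0 by rewrite Pm; have [] := end_section E2 (x := x0); rewrite /exterior /= ?nx0.
have am : (a <= m)%N by exact: leq_trans (ltnW ab) bm.
have sa : r - R1 - 1 <= \sum_(0 <= i < a) enorm (v i).
  have := Xsum 0%N a; rewrite am XP0 => /(_ isT) h.
  have := ler_distD (X (P a)) x0 0; rewrite !subr0 nx0 distrC; case/andP: aR => _; lra.
have sb : r - R0 - 2 <= \sum_(b <= i < m) enorm (v i).
  have := Xsum b m; rewrite bm leqnn XPm => /(_ isT) h.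
  have := ler_distD (X (P b)) x0 0; rewrite !subr0 nx0; case/andP: bR => _; lra.
have [S SE] : exists S, S = \sum_(0 <= i < m) enorm (v i) by exists (\sum_(0 <= i < m) enorm (v i)).
have [SB SBE] : exists SB, SB = \sum_(a <= i < b) enorm (v i) by exists (\sum_(a <= i < b) enorm (v i)).
have SS : S = \sum_(0 <= i < a) enorm (v i) + SB + \sum_(b <= i < m) enorm (v i).
  by rewrite SE SBE -(big_cat_nat (leq0n a) (ltnW ab)) /= -(big_cat_nat (leq0n b) bm).
have SD' : S <= Dm + tau by rewrite SE big_mkord.
have nn (x y : nat) : 0 <= \sum_(x <= i < y) enorm (v i) by apply: sumr_ge0 => i _; exact: enorm_ge0.
have SB0 : 0 <= SB by rewrite SBE.
have SBL : SB <= 2 * eta * r + C' by move: SS SD' Dmr tau1 sa sb C'L; cl; lra.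
have Sr : r <= S by move: SS SB0 sa sb rL1 R10 C00 C'L R00; cl; lra.
have r8 : eta * r <= r by rewrite ler_piMl // ltW.
have S8 : S / 8 <= r - R1 - 1 by move: SD' Dmr tau1 rL1 R10 R00 r8 C'L C00; cl; lra.
have S8' : S / 8 <= r - R0 - 2 by move: S8 R10; cl; lra.
have S2 : 2 <= S by move: Sr rL1 C'0 R1p; cl; lra.
have S0 : 0 < S by move: S2; cl; lra.
have [psi [psi0 psim psi01 psiL psi4]] := tent (fun i im => ltW (vn i im)) SE S2.
have := H psi (2 / S) (ltac:(rewrite divr_ge0 ?(ltW S0) //= ler_pdivrMr // mul1r //)) psi0 psim psi01 psiL.
have -> : \sum_(i < m) enorm (v i) = S by rewrite SE big_mkord.
have -> : (2 * n%:R - 4) * (2 / S) ^+ 2 * S = (8 * n%:R - 16) / S by field; rewrite gt_eqF.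
move=> final.
have rhs : (8 * n%:R - 16) / S + tau <= 8 * n%:R / r.
  have n16 : 0 <= 8 * n%:R - 16 :> R by have : 3 <= n%:R :> R by [rewrite (ler_nat R 3 n)]; cl; lra.
  apply: (@le_trans _ _ ((8 * n%:R - 16) / r + r^-1)).
    by apply: lerD => //; rewrite ler_wpM2l // lef_pV2 ?posrE.
  by rewrite -[X in _ + X]mul1r -mulrDl ler_pM2r ?invr_gt0 //; cl; lra.
pose y k := dot (d k) (v k).
have inB k : (a <= k < b)%N -> [/\ (k < m)%N, f (P k) <= 2, 1 < f (P k) & 4^-1 <= psi k].
  move=> /andP[ak kb]; have km := leq_trans kb bm; have [Pk1 Pk2] := Pk k kb.
  split => //; first by rewrite Pk1; apply: (end_le2 E1).
    by rewrite Pk1; apply: f1; apply: mE1.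
  apply: psi4; first exact: ltnW.
    apply: le_trans S8 _; apply: le_trans sa _; rewrite [leRHS](big_cat_nat _ (n := a)) //= lerDl; exact: nn.
  apply: le_trans S8' _; apply: le_trans sb _; rewrite [leRHS](big_cat_nat _ (n := b)) //= ?(ltnW kb) // lerDr; exact: nn.
(* [f] rises from below 1 + e to at least 1 + 2 de with e <= de, and the linearization errors of the
   steps add up to at most de / 2. *)
have drop : de / 2 <= \sum_(a <= k < b) `|y k|.
  have fa : f (P a) < 1 + e.
    by have [Pa1 _] := Pk a ab; rewrite Pa1; apply: fL1; case/andP: aR.
  have fb : m0 <= f (P b) by rewrite Pb; apply: m0L.
  have tel : f (P b) - f (P a) <= \sum_(a <= k < b) `|y k| + tau * SB.
    rewrite -(telescope_sumr (fun i => f (P i)) (ltnW ab)) SBE mulr_sumr -big_split /= !big_nat.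
    apply: ler_sum => k kab; have [km _ _ _] := inB k kab.
    have := df k km; rewrite ler_norml -/(y k) => /andP[_]; have := ler_norm (y k); cl; lra.
  have : tau * SB <= de / 2.
    apply: le_trans tauD; rewrite ler_wpM2l ?(ltW tau0) //; apply: (@le_trans _ _ S).
      by rewrite SS; have := nn 0%N a; have := nn b m; cl; lra.
    by move: SD' Dmr tau1; cl; lra.
  move: tel fa fb e1 deE; cl; lra.
have low : (12 * 12 * 12)^-1 * \sum_(a <= k < b) y k ^+ 2 / enorm (v k) <=
   \sum_(i < m) 2 * ka (P i) * psi i ^+ 2 * (dot (d i) (v i) / f (P i)) ^+ 2 / enorm (v i).
  pose T k := 2 * ka (P k) * psi k ^+ 2 * (dot (d k) (v k) / f (P k)) ^+ 2 / enorm (v k).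
  have T0 k : (k < m)%N -> 0 <= T k.
    move=> km; have kk : 0 <= ka (P k).
      by apply: ka0; have [[w sw] _] := st k km; have [] := stepM W1 sw.
    by rewrite /T; apply: mulr_ge0; [rewrite mulr_ge0 ?sqr_ge0 // mulr_ge0 ?sqr_ge0 // mulr_ge0|rewrite invr_ge0 enorm_ge0].
  rewrite -(big_mkord xpredT T) (big_cat_nat (leq0n b) bm) (big_cat_nat (leq0n a) (ltnW ab)) /=.
  have h1 : 0 <= \sum_(0 <= k < a) T k.
    by rewrite big_nat; apply: sumr_ge0 => k /andP[_ ka']; apply: T0; exact: leq_trans ka' am.
  have h2 : 0 <= \sum_(b <= k < m) T k.
    by rewrite big_nat; apply: sumr_ge0 => k /andP[_]; exact: T0.
  apply: (@le_trans _ _ (\sum_(a <= k < b) T k)); last by rewrite addrAC lerDr addr_ge0.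
  rewrite mulr_sumr !big_nat; apply: ler_sum => k kab; have [km f2 f1'' p4] := inB k kab.
  have lk := vn k km; rewrite /T -/(y k).
  have mk : M0 (P k) by have [[w sw] _] := st k km; have [] := stepM W1 sw.
  have k54 : 54^-1 <= ka (P k).
    have p1 : 0 < 1 + f (P k) by move: f1''; cl; lra.
    apply: le_trans (kaL mk); rewrite lef_pV2 ?posrE ?mulr_gt0 ?exprn_gt0 //.
    have : (1 + f (P k)) ^+ 3 <= 3 ^+ 3.
      by rewrite lerXn2r ?nnegrE //; move: f1'' f2; cl; lra.
    cl; lra.
  have p16 : 16^-1 <= psi k ^+ 2.
    have : 4^-1 ^+ 2 <= psi k ^+ 2 by rewrite lerXn2r ?nnegrE // (le_trans _ p4).
    apply: le_trans; cl; lra.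
  have f4 : y k ^+ 2 / 4 <= (y k / f (P k)) ^+ 2.
    rewrite expr_div_n ler_wpM2l ?sqr_ge0 // lef_pV2 ?posrE ?exprn_gt0 //; last exact: lt_trans ltr01 f1''.
    have : f (P k) ^+ 2 <= 2 ^+ 2 by rewrite lerXn2r ?nnegrE //; move: f1'' f2; cl; lra.
    cl; lra.
  apply: (@le_trans _ _ (2 * 54^-1 * 16^-1 * (y k ^+ 2 / 4) / enorm (v k))).
    by rewrite le_eqVlt; apply/orP; left; apply/eqP; field; rewrite gt_eqF.
  rewrite ler_pM2r ?invr_gt0 //.
  have i54 : 0 <= 54^-1 :> R by rewrite invr_ge0.
  have i16 : 0 <= 16^-1 :> R by rewrite invr_ge0.
  have y4 : 0 <= y k ^+ 2 / 4 by rewrite divr_ge0 ?sqr_ge0.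
  have q1 : 0 <= 2 * 54^-1 :> R by rewrite mulr_ge0.
  have q2 : 2 * 54^-1 <= 2 * ka (P k) by rewrite ler_wpM2l.
  exact: (ler_pM (mulr_ge0 q1 i16) y4 (ler_pM q1 i16 q2 p16) f4).
have lB k : (a <= k < b)%N -> 0 < enorm (v k) by move=> /inB[km _ _ _]; exact: vn.
have cs := @weighted_square R a b (fun k => enorm (v k)) y ((de / 2) / (2 * eta * r + C')) lB.
rewrite -SBE in cs.
pose Bd := 2 * eta * r + C'; have Bd0 : 0 < Bd by rewrite /Bd ltr_wpDl // !mulr_ge0 // ltW.
have lam0 : 0 <= (de / 2) / Bd by rewrite divr_ge0 ?(ltW Bd0) // divr_ge0 // ltW.
have cs2 : (de / 2) ^+ 2 / Bd <= \sum_(a <= k < b) y k ^+ 2 / enorm (v k).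
  apply: le_trans cs; rewrite -/Bd; set lam := (de / 2) / Bd in lam0 *.
  have g1 : 2 * lam * (de / 2) <= 2 * lam * \sum_(a <= k < b) `|y k| by rewrite ler_wpM2l // mulr_ge0.
  have g2 : lam ^+ 2 * SB <= lam ^+ 2 * Bd by rewrite ler_wpM2l ?sqr_ge0.
  have -> : (de / 2) ^+ 2 / Bd = 2 * lam * (de / 2) - lam ^+ 2 * Bd by rewrite /lam; field; rewrite gt_eqF.
  by rewrite lerB.
have i12 : 0 <= (12 * 12 * 12)^-1 :> R by rewrite invr_ge0 !mulr_ge0.
have := le_trans (ler_wpM2l i12 cs2) (le_trans low (le_trans final rhs)).
rewrite ler_pdivlMr // => fin.
have fin2 : de ^+ 2 * r <= N * Bd.
  have -> : de ^+ 2 * r = ((12 * 12 * 12)^-1 * ((de / 2) ^+ 2 / Bd) * r) * ((12 * 12 * 12) * 4 * Bd).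
    by field; rewrite gt_eqF.
  have -> : N * Bd = (8 * n%:R) * ((12 * 12 * 12) * 4 * Bd) by rewrite NE; ring.
  by rewrite ler_wpM2r // !mulr_ge0 // ltW.
have : N * Bd = N * (2 * eta) * r + N * C' by rewrite /Bd; ring.
have : N * (2 * eta) * r <= de ^+ 2 / 8 * r by rewrite ler_wpM2r // ltW.
have : 0 < de ^+ 2 * r by rewrite mulr_gt0 // exprn_gt0.
move: fin2 rL2; cl; lra.
Qed.

End Ends.

(** * The light cone and the conformal chart *)

Section Lorentz.
Context {R : realType} {m : nat}.
Implicit Types u v w : 'rV[R]_m.+1.

Lemma lorentzC u v : lorentz u v = lorentz v u.
Proof. by rewrite /lorentz mulrC; congr (_ + _); apply: eq_bigr => i _; rewrite mulrC. Qed.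

Lemma lorentzDl u v w : lorentz (u + v) w = lorentz u w + lorentz v w.
Proof.
rewrite /lorentz !mxE (eq_bigr (fun i : 'I_m => u 0 (lift ord0 i) * w 0 (lift ord0 i) + v 0 (lift ord0 i) * w 0 (lift ord0 i))).
  by rewrite big_split /=; ring.
by move=> i _; rewrite mxE mulrDl.
Qed.

Lemma lorentzZl (a : R) u v : lorentz (a *: u) v = a * lorentz u v.
Proof.
rewrite /lorentz !mxE (eq_bigr (fun i : 'I_m => a * (u 0 (lift ord0 i) * v 0 (lift ord0 i)))).
  by rewrite -mulr_sumr; ring.
by move=> i _; rewrite mxE mulrA.
Qed.

Lemma lorentzDr u v w : lorentz w (u + v) = lorentz w u + lorentz w v.
Proof. by rewrite lorentzC lorentzDl !(lorentzC w). Qed.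

Lemma lorentzZr (a : R) u v : lorentz u (a *: v) = a * lorentz u v.
Proof. by rewrite lorentzC lorentzZl (lorentzC u). Qed.

Lemma lorentz0l v : lorentz 0 v = 0.
Proof. by rewrite -[0 : 'rV_ _](scale0r v) lorentzZl mul0r. Qed.

Lemma lorentz_suml n (f : 'I_n -> 'rV[R]_m.+1) v : lorentz (\sum_i f i) v = \sum_i lorentz (f i) v.
Proof.
by elim/big_rec2: _ => [|i a b _ <-]; [exact: lorentz0l|exact: lorentzDl].
Qed.

Lemma isd_lorentz {V : normedModType R} (f g : V -> 'rV[R]_m.+1) (x v : V) (df dg : 'rV[R]_m.+1) :
  is_derive x v f df -> is_derive x v g dg ->
  is_derive x v (fun y => lorentz (f y) (g y)) (lorentz df (g x) + lorentz (f x) dg).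
Proof.
move=> hf hg.
have cf i : is_derive x v (fun y => f y 0 i) (df 0 i).
  by refine (isd_eq (isd_coord 0 i (@ex_derive _ _ _ _ _ _ _ hf)) _); rewrite (@derive_val _ _ _ _ _ _ _ hf).
have cg i : is_derive x v (fun y => g y 0 i) (dg 0 i).
  by refine (isd_eq (isd_coord 0 i (@ex_derive _ _ _ _ _ _ _ hg)) _); rewrite (@derive_val _ _ _ _ _ _ _ hg).
refine (isd_eq (isdD (isdN (isdM (cf ord0) (cg ord0))) (isd_sum (index_enum _) (fun i => isdM (cf (lift ord0 i)) (cg (lift ord0 i))))) _).
by rewrite /lorentz big_split /=; rewrite (eq_bigr (fun i : 'I_m => df 0 (lift ord0 i) * g x 0 (lift ord0 i)) (fun i _ => mulrC _ _)); ring.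
Qed.

Lemma Ck_lorentz {V : normedModType R} k (U : set V) (f g : V -> 'rV[R]_m.+1) : open U ->
  Ck_on k U f -> Ck_on k U g -> Ck_on k U (fun y => lorentz (f y) (g y)).
Proof.
move=> oU /(Ck_rV _ _ oU) hf /(Ck_rV _ _ oU) hg.
apply: (CkD oU); first by apply: (CkN oU); exact: CkM.
by apply: (Ck_sum _ oU) => i _; exact: CkM.
Qed.

End Lorentz.

Section NullFrame.
Context {R : realType} {n : nat}.
Local Notation E := 'rV[R]_n.+2.

(* a Lorentz frame with two null vectors [K], [K'] such that <K, K'> = -2 *)
Definition null_frame (K K' : E) (w : 'I_n -> E) := forall u v,
  lorentz u v = - ((lorentz u K * lorentz v K' + lorentz u K' * lorentz v K) / 2) +
    \sum_j lorentz u (w j) * lorentz v (w j).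

Lemma null_frame_sym K K' w : null_frame K K' w -> null_frame K' K w.
Proof. by move=> H u v; rewrite H; congr (- (_ / 2) + _); rewrite addrC. Qed.

Lemma row_mx0 (a : R) (b : 'rV[R]_n.+1) : (row_mx (const_mx a : 'rV[R]_1) b : E) 0 ord0 = a.
Proof. by rewrite mxE; case: splitP => [j _|j]; [rewrite mxE|]. Qed.

Lemma row_mxS (a : R) (b : 'rV[R]_n.+1) i : (row_mx (const_mx a : 'rV[R]_1) b : E) 0 (lift ord0 i) = b 0 i.
Proof.
rewrite mxE; case: splitP => [j|j]; first by rewrite ord1.
by move=> [e]; congr (b 0 _); apply: val_inj.
Qed.

Lemma lorentz_row (u : E) (a : R) (b : 'rV[R]_n.+1) :
  lorentz u (row_mx (const_mx a : 'rV[R]_1) b) = - (u 0 ord0 * a) + dot (\row_i u 0 (lift ord0 i)) b.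
Proof.
rewrite /lorentz row_mx0; congr (_ + _).
by apply: eq_bigr => i _; rewrite row_mxS mxE.
Qed.

(** A Householder reflection has [y] as its first row; its other rows, placed in the spatial
    coordinates, complete (1, y) and (1, -y) to a frame. When y is already the first basis vector
    the identity serves. *)
Lemma exists_null_frame (y : 'rV[R]_n.+1) : unit_sphere y ->
  exists w, null_frame (null_vector y) (null_vector (- y)) w.
Proof.
move=> yu; have y1 : dot y y = 1 by rewrite -yu; apply: eq_bigr => i _; rewrite expr2.
have e1 : dot (bas ord0 : 'rV[R]_n.+1) (bas ord0) = 1.
  rewrite /dot (bigD1 ord0) //= big1 ?addr0; last by move=> i /negPf ij; rewrite !mxE ij andbF mulr0.
  by rewrite !mxE !eqxx mulr1.
have [Q [QQ Qy]] : exists Q : 'M[R]_n.+1, Q^T *m Q = 1%:M /\ row ord0 Q = y.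
  have [ye|ye] := eqVneq y (bas ord0).
    by exists 1%:M; rewrite trmx1 mulmx1; split => //; rewrite row1.
  pose z := (enorm (y - bas ord0))^-1 *: (y - bas ord0).
  have ez : 0 < enorm (y - bas ord0) by apply: enorm_gt0; rewrite subr_eq0.
  have zz : dot z z = 1 by rewrite /z dotZl dotZr -enorm_sq; field; rewrite gt_eqF.
  exists (reflect z); rewrite reflect_tr reflect_orth //; split => //.
  rewrite rowE reflectE; change (delta_mx 0 ord0) with (bas ord0 : 'rV[R]_n.+1).
  have -> : 2 * dot (bas ord0) z *: z = - (y - bas ord0); last by rewrite opprK addrC subrK.
  have h : 2 * dot (bas ord0) (y - bas ord0) = - enorm (y - bas ord0) ^+ 2.
    by rewrite enorm_sq !dotE y1 e1 (dotC y); ring.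
  rewrite /z dotZr scalerA -[RHS]scaleN1r; congr (_ *: _).
  have -> : 2 * ((enorm (y - bas ord0))^-1 * dot (bas ord0) (y - bas ord0)) / enorm (y - bas ord0) =
    (2 * dot (bas ord0) (y - bas ord0)) / enorm (y - bas ord0) ^+ 2 by field; rewrite gt_eqF.
  by rewrite h mulNr divff // gt_eqF // exprn_gt0.
exists (fun j => row_mx (const_mx 0 : 'rV[R]_1) (row (lift ord0 j) Q)) => u v.
rewrite /null_vector !lorentz_row !dotNr !mulr1.
under eq_bigr do rewrite !lorentz_row !mulr0 oppr0 !add0r.
set u' := \row_i u 0 _; set v' := \row_i v 0 _.
have -> : lorentz u v = - (u 0 ord0 * v 0 ord0) + dot u' v'.
  by rewrite /lorentz; congr (_ + _); apply: eq_bigr => i _; rewrite !mxE.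
rewrite -(orth_sum QQ) big_ord_recl Qy.
rewrite (eq_bigr (fun i : 'I_n => dot u' (row (lift ord0 i) Q) * dot v' (row (lift ord0 i) Q))); last first.
  by move=> i _; rewrite !(dotC (row _ _)).
by move: (\sum_i _) => s; rewrite (dotC y) (dotC y); move: (dot u' y) (dot v' y) => p q; field.
Qed.

End NullFrame.

Lemma Ck_id {R : realType} {n : nat} (U : set 'rV[R]_n) : open U -> Ck_on 1 U (fun x : 'rV[R]_n => x).
Proof.
move=> oU; apply/(Ck_rV _ _ oU) => j; split=> [x _|v]; first exact: coord_continuous.
split=> [x _|]; first exact: (@ex_derive _ _ _ _ _ _ _ (isd_coord_id x v 0 j)).
have -> : 'D_v (fun x : 'rV[R]_n => x 0 j) = fun=> v 0 j.
  by apply/funext => x; exact: (@derive_val _ _ _ _ _ _ _ (isd_coord_id x v 0 j)).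
exact: Ck_cst.
Qed.

Lemma isd_zero {R : realType} {V : normedModType R} (U : set V) (h : V -> R) x v l : open U -> U x ->
  (forall y, U y -> h y = 0) -> is_derive x v h l -> l = 0.
Proof.
move=> oU Ux h0 hh; rewrite -(@derive_val _ _ _ _ _ _ _ hh).
have -> : 'D_v h x = 'D_v (fun=> 0 : R) x.
  by apply: near_eq_derive; apply: filterS (open_nbhs_nbhs (conj oU Ux)) => y /h0.
exact: derive_cst.
Qed.

Section ConformalChart.
Context {R : realType} {n : nat}.
Local Notation V := 'rV[R]_n.
Local Notation E := 'rV[R]_n.+2.
Variables (K K' : E) (w : 'I_n -> E) (U : set V) (N : V -> E) (g : V -> V).
Hypothesis frame : null_frame K K' w.
Hypothesis oU : open U.
Hypothesis NC : Ck_on 1 U N.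
Hypothesis gC : Ck_on 1 U g.
Let F x := - lorentz (N x) K.
Hypothesis NN : forall x, U x -> lorentz (N x) (N x) = 0.
Hypothesis F0 : forall x, U x -> 0 < F x.
Hypothesis Nw : forall x j, U x -> lorentz (N x) (w j) = F x * g x 0 j.

Lemma flat_null x : U x -> lorentz (N x) K' = - (F x * dot (g x) (g x)).
Proof.
move=> Ux; have := NN Ux; rewrite frame (eq_bigr (fun j => F x ^+ 2 * (g x 0 j * g x 0 j))); last first.
  by move=> j _; rewrite Nw //; ring.
rewrite -mulr_sumr -/(dot (g x) (g x)).
have -> : lorentz (N x) K = - F x by rewrite /F opprK.
have f0 := F0 Ux => h.
have : F x * (lorentz (N x) K' + F x * dot (g x) (g x)) = 0 by rewrite -h; field.
move=> /eqP; rewrite mulf_eq0 gt_eqF //= => /eqP h2.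
by apply/eqP; rewrite -addr_eq0 h2.
Qed.

Lemma dN_frame x v : U x -> [/\ lorentz ('D_v N x) K = - 'D_v F x,
  lorentz ('D_v N x) K' = - ('D_v F x * dot (g x) (g x) + 2 * F x * dot (g x) ('D_v g x)) &
  forall j, lorentz ('D_v N x) (w j) = 'D_v F x * g x 0 j + F x * ('D_v g x) 0 j].
Proof.
move=> Ux; have dN : is_derive x v N ('D_v N x) by apply: derivableP; exact: Ck_derivable NC _ _ Ux.
have lK (c : E) : is_derive x v (fun y => lorentz (N y) c) (lorentz ('D_v N x) c).
  by refine (isd_eq (isd_lorentz dN (isdC c x v)) _); rewrite lorentzC (lorentzC (N x)) lorentz0l addr0 lorentzC.
have dF : is_derive x v F ('D_v F x) by apply: derivableP; exact: (@ex_derive _ _ _ _ _ _ _ (isdN (lK K))).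
have xj j : is_derive x v (fun y : V => g y 0 j) (('D_v g x) 0 j).
  exact: (isd_coord 0 j (Ck_derivable gC Ux)).
have xx : is_derive x v (fun y : V => dot (g y) (g y)) (2 * dot (g x) ('D_v g x)).
  refine (isd_eq (isd_sum (index_enum _) (fun j => isdM (xj j) (xj j))) _).
  by rewrite /dot mulr_sumr; apply: eq_bigr => j _; ring.
split.
- have g0 y : U y -> lorentz (N y) K + F y = 0 by rewrite /F addrN.
  have h := isd_zero oU Ux g0 (isdD (lK K) dF).
  by apply/eqP; rewrite -addr_eq0 h.
- have g0 y : U y -> lorentz (N y) K' + F y * dot (g y) (g y) = 0 by move=> Uy; rewrite flat_null // addNr.
  have h := isd_zero oU Ux g0 (isdD (lK K') (isdM dF xx)).
  by apply/eqP; rewrite -addr_eq0 -h; apply/eqP; ring.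
- move=> j; have g0 y : U y -> lorentz (N y) (w j) - F y * g y 0 j = 0 by move=> Uy; rewrite Nw // subrr.
  have h := isd_zero oU Ux g0 (isdB (lK (w j)) (isdM dF (xj j))).
  by apply/eqP; rewrite -subr_eq0 -h; apply/eqP; ring.
Qed.

(** N is F times a null vector depending on [g] alone. A null vector is orthogonal to its own
    derivatives, so the derivatives of F drop out. *)
Lemma conformal_metric x u v : U x -> lorentz ('D_u N x) ('D_v N x) = F x ^+ 2 * dot ('D_u g x) ('D_v g x).
Proof.
move=> Ux; have [a1 b1 c1] := dN_frame u Ux; have [a2 b2 c2] := dN_frame v Ux.
have S : \sum_j lorentz ('D_u N x) (w j) * lorentz ('D_v N x) (w j) =
  'D_u F x * 'D_v F x * dot (g x) (g x) + 'D_u F x * F x * dot (g x) ('D_v g x) +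
  'D_v F x * F x * dot (g x) ('D_u g x) + F x ^+ 2 * dot ('D_u g x) ('D_v g x).
  rewrite /dot !mulr_sumr -!big_split /=; apply: eq_bigr => j _; rewrite c1 c2.
  by move: ('D_u F x) ('D_v F x) ('D_u g x 0 j) ('D_v g x 0 j) => p q s t; ring.
rewrite frame S a1 b1 a2 b2; move: (dot (g x) (g x)) (dot (g x) _) (dot (g x) _) (dot _ _) ('D_u F x) ('D_v F x) => a b c d p q.
by field.
Qed.

End ConformalChart.

Section FlatChart.
Context {R : realType} {n : nat}.
Local Notation V := 'rV[R]_n.
Local Notation E := 'rV[R]_n.+2.
Variables (K K' : E) (w : 'I_n -> E) (U : set V) (phi N : V -> E).
Hypothesis frame : null_frame K K' w.
Hypothesis oU : open U.
Hypothesis phiC : Ck_on 1 U phi.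
Hypothesis NC : Ck_on 2 U N.
Let F x := - lorentz (N x) K.
Hypothesis NN : forall x, U x -> lorentz (N x) (N x) = 0.
Hypothesis F0 : forall x, U x -> 0 < F x.
Hypothesis Nw : forall x j, U x -> lorentz (N x) (w j) = F x * x 0 j.

Lemma F_Ck : Ck_on 2 U F.
Proof. by apply: (CkN oU); apply: (Ck_lorentz oU NC); exact: Ck_cst. Qed.

Let flat_null' x : U x -> lorentz (N x) K' = - (F x * dot x x).
Proof. exact: (flat_null (g := fun x => x) frame NN F0 Nw). Qed.

Let dN_frame' x v : U x -> [/\ lorentz ('D_v N x) K = - 'D_v F x,
  lorentz ('D_v N x) K' = - ('D_v F x * dot x x + 2 * F x * dot x v) &
  forall j, lorentz ('D_v N x) (w j) = 'D_v F x * x 0 j + F x * v 0 j].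
Proof.
move=> Ux; have [h1 h2 h3] := dN_frame frame oU (CkS NC) (Ck_id oU) NN F0 Nw v Ux.
have dv : 'D_v (fun x : V => x) x = v by rewrite derive_id.
by rewrite dv in h2; split=> // j; rewrite h3 dv.
Qed.

Hypothesis pp : forall x, U x -> lorentz (phi x) (phi x) = -1.
Hypothesis pN : forall x, U x -> lorentz (phi x) (N x) = -1.
Hypothesis pdN : forall x v, U x -> lorentz (phi x) ('D_v N x) = 0.

(** The equations <phi, N> = -1, <phi, dN> = 0 and <phi, phi> = -1 express the frame components of
    phi by F and dF; differentiating the first two brings in the Hessian. The right side is n F^2 /
    2 minus the Euclidean trace of the Schouten tensor of F^2 |dX|^2. *)
Lemma flat_trace x : U x -> \sum_j lorentz ('D_(bas j) N x) ('D_(bas j) phi x) =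
  \tr (hess F x) / F x - 2 * dot (grad F x) (grad F x) / F x ^+ 2 +
  n%:R / 2 * (F x ^+ 2 + dot (grad F x) (grad F x) / F x ^+ 2).
Proof.
move=> Ux; pose a y := lorentz (phi y) K; pose b y := lorentz (phi y) K'; pose c j y := lorentz (phi y) (w j).
have dphi v : is_derive x v phi ('D_v phi x) by apply: derivableP; exact: Ck_derivable phiC _ _ Ux.
have lK v (d : E) : is_derive x v (fun y => lorentz (phi y) d) (lorentz ('D_v phi x) d).
  by refine (isd_eq (isd_lorentz (dphi v) (isdC d x v)) _); rewrite lorentzC (lorentzC (phi x)) lorentz0l addr0 lorentzC.
have dF v : is_derive x v F ('D_v F x) by apply: derivableP; exact: Ck_derivable F_Ck _ _ Ux.
have Fn y : U y -> F y != 0 by move=> /F0 h; rewrite gt_eqF.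
(* <phi, N> + 1 = 0 divided by F. *)
have E1 y : U y -> 2^-1 * (a y * dot y y + b y) + \sum_k c k y * y 0 k + (F y)^-1 = 0.
  move=> Uy; have := pN Uy; rewrite frame flat_null' // (eq_bigr (fun j => F y * (c j y * y 0 j))); last first.
    by move=> j _; rewrite Nw // /c; ring.
  have -> : lorentz (N y) K = - F y by rewrite /F opprK.
  rewrite -mulr_sumr -/(a y) -/(b y); move: (\sum_i _) (Fn y Uy) => s f0 h.
  have -> : 2^-1 * (a y * dot y y + b y) + s + (F y)^-1 = (- ((a y * - (F y * dot y y) + b y * - F y) / 2) + F y * s + 1) / F y by field.
  by rewrite h addNr mul0r.
(* <phi, dN> = 0 divided by F, with E1 used to eliminate [b] and the sum over the frame. *)
have E3 y j : U y -> a y * y 0 j + c j y - 'D_(bas j) F y / F y ^+ 2 = 0.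
  move=> Uy; have := pdN (bas j) Uy; have [h1 h2 h3] := dN_frame' (bas j) Uy.
  rewrite frame h1 h2 (eq_bigr (fun k => 'D_(bas j) F y * (c k y * y 0 k) + F y * (c k y * bas j 0 k))); last first.
    by move=> k _; rewrite h3 /c; ring.
  rewrite big_split /= -!mulr_sumr -/(a y) -/(b y).
  have db (g : 'I_n -> R) : \sum_k g k * (bas j : V) 0 k = g j.
    rewrite (bigD1 j) //= big1 ?addr0; last by move=> i /negPf ij; rewrite !mxE ij andbF mulr0.
    by rewrite !mxE !eqxx mulr1.
  have -> : dot y (bas j) = y 0 j by rewrite /dot db.
  rewrite db; have := E1 y Uy; move: (dot y y) (\sum_k _) (Fn y Uy) => yy s f0 e1 h.
  have -> : a y * y 0 j + c j y - 'D_(bas j) F y / F y ^+ 2 =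
    (- ((a y * - ('D_(bas j) F y * yy + 2 * F y * y 0 j) + b y * - 'D_(bas j) F y) / 2) + ('D_(bas j) F y * s + F y * c j y)
    - 'D_(bas j) F y * (2^-1 * (a y * yy + b y) + s + (F y)^-1)) / F y by field.
  by rewrite h e1 mulr0 subr0 mul0r.
pose p j := 'D_(bas j) F x / F x ^+ 2.
have cE j : c j x = p j - a x * x 0 j by have := E3 x j Ux; rewrite -/(p j); lra.
(* With [b] and [c] eliminated by E1 and E3, the equation <phi, phi> = -1 becomes linear in [a]. *)
have aE : a x = - (F x / 2) * (1 + \sum_j p j ^+ 2).
  have s1 : \sum_k c k x * x 0 k = \sum_k p k * x 0 k - a x * dot x x.
    by rewrite mulr_sumr -sumrB; apply: eq_bigr => k _; rewrite cE; ring.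
  have s2 : \sum_k c k x * c k x = \sum_k p k ^+ 2 - 2 * a x * (\sum_k p k * x 0 k) + a x ^+ 2 * dot x x.
    by rewrite !mulr_sumr -sumrB -big_split /=; apply: eq_bigr => k _; rewrite cE; ring.
  have e1 := E1 x Ux.
  have e2 : - ((a x * b x + b x * a x) / 2) + \sum_k c k x * c k x = -1 by have := pp Ux; rewrite frame.
  rewrite s1 in e1; rewrite s2 in e2; move: e1 e2.
  move: (\sum_i p i ^+ 2) (\sum_i p i * x 0 i) (Fn x Ux) => pp' px f0 e1 e2.
  have bE : b x = a x * dot x x - 2 * px - 2 / F x by lra.
  rewrite bE in e2.
  have : 2 * a x / F x + pp' + 1 = 0.
    by rewrite -(subrr (-1)) -[in X in _ = X - _]e2; field.
  move=> h; have -> : a x = (2 * a x / F x + pp' + 1) * (F x / 2) - F x / 2 * (1 + pp') by field.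
  by rewrite h mul0r sub0r mulNr.
have xj v j : is_derive x v (fun y : V => y 0 j) (v 0 j) by exact: isd_coord_id.
have xx v : is_derive x v (fun y : V => dot y y) (2 * dot x v).
  refine (isd_eq (isd_sum (index_enum _) (fun j => isdM (xj v j) (xj v j))) _).
  by rewrite /dot mulr_sumr; apply: eq_bigr => j _; ring.
have db (g : 'I_n -> R) j : \sum_k g k * (bas j : V) 0 k = g j.
  rewrite (bigD1 j) //= big1 ?addr0; last by move=> i /negPf ij; rewrite !mxE ij andbF mulr0.
  by rewrite !mxE !eqxx mulr1.
have bj j : (bas j : V) 0 j = 1 by rewrite !mxE !eqxx.
have Sj j : lorentz ('D_(bas j) N x) ('D_(bas j) phi x) =
   'D_(bas j) ('D_(bas j) F) x / F x - 2 * 'D_(bas j) F x ^+ 2 / F x ^+ 2 - F x * a x.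
  pose v := bas j : V; have f0 := Fn x Ux.
  have [h1 h2 h3] := dN_frame' v Ux.
  pose a' := lorentz ('D_v phi x) K; pose b' := lorentz ('D_v phi x) K'; pose c' k := lorentz ('D_v phi x) (w k).
  (* [D1] and [D3] are E1 and E3 differentiated along [v]; the latter contains the second derivative
     of F. *)
  have D1 := isd_zero oU Ux E1 (isdD (isdD (isdZ 2^-1 (isdD (isdM (lK v K) (xx v)) (lK v K')))
     (isd_sum (index_enum _) (fun k => isdM (lK v (w k)) (xj v k)))) (isdV f0 (dF v))).
  have dFF : is_derive x v ('D_v F) ('D_v ('D_v F) x) by apply: derivableP; exact: Ck_derivable (Ck_deriv _ F_Ck) _ _ Ux.
  have F2 : F x ^+ 2 != 0 by rewrite expf_neq0.
  have dF2 : is_derive x v (fun y => F y ^+ 2) (2 * F x * 'D_v F x).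
    by refine (isd_eq (isdM (dF v) (dF v)) _); ring.
  have dFi := @isdV _ _ (fun y => F y ^+ 2) x v _ F2 dF2.
  have D3 := isd_zero oU Ux (fun y => @E3 y j) (isdB (isdD (isdM (lK v K) (xj v j)) (lK v (w j))) (isdM dFF dFi)).
  rewrite frame h1 h2 -/a' -/b'.
  rewrite (eq_bigr (fun k => 'D_v F x * (x 0 k * c' k) + F x * (c' k * v 0 k))); last by move=> k _; rewrite h3 -/(c' k); ring.
  rewrite big_split /= -!mulr_sumr db.
  move: D1; rewrite (eq_bigr (fun k => c k x * v 0 k + x 0 k * c' k)); last by move=> k _; [].
  rewrite big_split /= db -/a' -/b' -/(a x) -/(b x).
  move: D3; rewrite bj -/a' -/(c' j) -/(a x).
  have := E3 x j Ux; have xv : dot x v = x 0 j by rewrite /dot db.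
  rewrite xv -/v.
  move: (\sum_i _) => s e3 D3 D1.
  have k1 : s = - (dot x x * a' / 2) - b' / 2.
    lra.
  have k2 : 'D_v ('D_v F) x = F x ^+ 2 * (a' * x 0 j + a x + c' j) + 2 * 'D_v F x ^+ 2 / F x.
    have -> : 'D_v ('D_v F) x = F x ^+ 2 * (a' * x 0 j + a x + c' j) + 2 * 'D_v F x ^+ 2 / F x - F x ^+ 2 * 0 by rewrite -D3; field.
    by rewrite mulr0 subr0.
  by rewrite k1 k2; field.
rewrite (eq_bigr _ (fun j _ => Sj j)) aE.
have -> : \tr (hess F x) = \sum_j 'D_(bas j) ('D_(bas j) F) x by apply: eq_bigr => j _; rewrite mxE.
have -> : dot (grad F x) (grad F x) = F x ^+ 4 * \sum_j p j ^+ 2.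
  by rewrite mulr_sumr; apply: eq_bigr => j _; rewrite !mxE /p; field; exact: Fn.
rewrite !sumrB sumr_const card_ord -mulr_suml.
have -> : \sum_i 2 * 'D_(bas i) F x ^+ 2 / F x ^+ 2 = 2 * F x ^+ 2 * \sum_j p j ^+ 2.
  by rewrite mulr_sumr; apply: eq_bigr => j _; rewrite /p; field; exact: Fn.
rewrite -[_ *+ n]mulr_natl; move: (\sum_j _) (\sum_j _) (Fn x Ux) => h q f0.
by field.
Qed.

End FlatChart.

Section VectorC1.
Context {R : realType} {n m : nat}.
Variables (f : 'rV[R]_n -> 'rV[R]_m) (U : set 'rV[R]_n).
Hypothesis oU : open U.
Hypothesis fC1 : Ck_on 1 U f.

Lemma C1_derive_sumV x v : U x -> 'D_v f x = \sum_j v 0 j *: 'D_(bas j) f x.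
Proof.
move=> Ux; apply/rowP => i; rewrite summxE.
have c w : ('D_w f x) 0 i = 'D_w (fun y => f y 0 i) x.
  by rewrite (@derive_val _ _ _ _ _ _ _ (isd_coord 0 i (Ck_derivable fC1 Ux (v := w)))).
have hi : Ck_on 1 U (fun y => f y 0 i) by have /(Ck_rV _ _ oU) := fC1; apply.
by rewrite c (C1_derive_sum v oU hi Ux); apply: eq_bigr => j _; rewrite mxE c.
Qed.

Lemma chain_ruleV {V : normedModType R} (g : V -> 'rV[R]_n) x v : U (g x) -> derivable g x v ->
  is_derive x v (f \o g) ('D_('D_v g x) f (g x)).
Proof.
move=> Ug dg; apply: isd_mx => i j; rewrite ord1.
have hj : Ck_on 1 U (fun y => f y 0 j) by have /(Ck_rV _ _ oU) := fC1; apply.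
refine (isd_eq (chain_rule oU hj Ug dg) _).
have -> : ('D_('D_v g x) f (g x)) 0 j = 'D_('D_v g x) (fun y => f y 0 j) (g x).
  by rewrite (@derive_val _ _ _ _ _ _ _ (isd_coord 0 j (Ck_derivable fC1 Ug))).
rewrite (C1_derive_sum _ oU hj Ug); apply: eq_bigr => k _; congr (_ * _).
by rewrite (@derive_val _ _ _ _ _ _ _ (isd_coord 0 k dg)).
Qed.

End VectorC1.

(** * Linear algebra at a point: [P] is dphi, [Q] is dN, in a basis of principal directions *)

Section Principal.
Context {R : realType} {n : nat}.
Local Notation V := 'rV[R]_n.
Variables (P Q : V -> 'rV[R]_n.+2) (e : 'I_n -> V) (k : 'I_n -> R).
Hypothesis Psum : forall (x : 'I_n -> R), P (\sum_i x i *: e i) = \sum_i x i *: P (e i).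
Hypothesis Qsum : forall (x : 'I_n -> R), Q (\sum_i x i *: e i) = \sum_i x i *: Q (e i).
Hypothesis orth : forall i j, lorentz (P (e i)) (P (e j)) = (i == j)%:R.
Hypothesis Qe : forall i, Q (e i) = (1 - k i) *: P (e i).
Hypothesis k1 : forall i, k i < 1.
Hypothesis ksum : \sum_(i < n) 2 / (1 - k i) <= n%:R.

Lemma orth_lorentz (x y : 'I_n -> R) :
  lorentz (\sum_i x i *: P (e i)) (\sum_i y i *: P (e i)) = \sum_i x i * y i.
Proof.
rewrite lorentz_suml; apply: eq_bigr => i _; rewrite lorentzZl lorentzC lorentz_suml.
rewrite (bigD1 i) //= lorentzZl orth eqxx mulr1 big1 ?addr0 // => j ji.
by rewrite lorentzZl orth (negPf ji) mulr0.
Qed.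

Lemma principal_expand u : exists x : 'I_n -> R, [/\ u = \sum_i x i *: e i, P u = \sum_i x i *: P (e i) &
  Q u = \sum_i (x i * (1 - k i)) *: P (e i)].
Proof.
pose A : 'M[R]_n := \matrix_(i, j) e i 0 j.
have rA (x : V) : x *m A = \sum_i x 0 i *: e i.
  by apply/rowP => j; rewrite summxE mxE; apply: eq_bigr => i _; rewrite !mxE.
have uA : A \in unitmx.
  apply: unitmx_inj => v; rewrite rA => v0; apply/rowP => j.
  have := orth_lorentz (fun i => v 0 i) (fun i => (i == j)%:R); rewrite -Psum v0 => h.
  have P0 : P 0 = 0.
    by have := Psum (fun=> 0); rewrite big1 ?big1 // => i _; rewrite scale0r.
  rewrite P0 lorentz0l in h.
  by move/esym: h; rewrite (bigD1 j) //= eqxx mulr1 big1 ?addr0 ?mxE // => i /negPf ->; rewrite mulr0.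
exists (fun i => (u *m invmx A) 0 i).
have uE : u = \sum_i (u *m invmx A) 0 i *: e i by rewrite -rA mulmxKV.
split => //; first by rewrite [in LHS]uE Psum.
by rewrite [in LHS]uE Qsum; apply: eq_bigr => i _; rewrite Qe scalerA.
Qed.

(** The terms of the curvature sum are positive, so each is at most n. Through [metric_compare] this
    makes <dN, dN> dominate a multiple of the induced metric, so that completeness can be
    transferred. *)
Lemma curvature_inv i : 0 < (1 - k i)^-1 <= n%:R / 2.
Proof.
have k0 j : 0 < 1 - k j by rewrite subr_gt0.
rewrite invr_gt0 k0 /= ler_pdivlMr // mulrC; apply: le_trans ksum.
rewrite (bigD1 i) //= lerDl; apply: sumr_ge0 => j _; rewrite divr_ge0 // ltW //.
Qed.

Lemma metric_compare u : lorentz (P u) (P u) <= (n%:R / 2) ^+ 2 * lorentz (Q u) (Q u).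
Proof.
have [x [_ -> ->]] := principal_expand u; rewrite !orth_lorentz mulr_sumr; apply: ler_sum => i _.
have /andP[h1 h2] := curvature_inv i; have k0 : 0 < 1 - k i by rewrite subr_gt0.
have h : 1 <= n%:R / 2 * (1 - k i) by rewrite -ler_pdivrMr // mul1r.
have -> : (n%:R / 2) ^+ 2 * (x i * (1 - k i) * (x i * (1 - k i))) = (n%:R / 2 * (1 - k i)) ^+ 2 * (x i * x i) by ring.
by apply: ler_peMl; [rewrite -expr2 sqr_ge0|rewrite expr_ge1 // (le_trans ler01 h)].
Qed.

Lemma metric_nondegenerate u : lorentz (Q u) (Q u) = 0 -> u = 0.
Proof.
have [x [uE _ ->]] := principal_expand u; rewrite orth_lorentz => h.
have h0 i : (i \in 'I_n) -> 0 <= x i * (1 - k i) * (x i * (1 - k i)) by rewrite -expr2 sqr_ge0.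
rewrite uE big1 // => i _; have k0 : 1 - k i != 0 by rewrite gt_eqF // subr_gt0.
have /eqP := psumr_eq0P (fun i _ => h0 i isT) h (i := i) isT.
by rewrite mulf_eq0 orbb mulf_eq0 (negPf k0) orbF => /eqP ->; rewrite scale0r.
Qed.

(** Up to the factor 1 / s, the coordinates of the vectors Q (z j) in the basis P (e i) form an
    orthogonal matrix. Its columns are then unit vectors as well, and the double sum collapses to
    the sum of s^2 / (1 - k i). *)
Lemma trace_bound (s : R) (z : 'I_n -> V) : 0 < s ->
  (forall i j, lorentz (Q (z i)) (Q (z j)) = s ^+ 2 * (i == j)%:R) ->
  \sum_j lorentz (Q (z j)) (P (z j)) <= s ^+ 2 * (n%:R / 2).
Proof.
move=> s0 zz; have [X XP] := choice (fun j => principal_expand (z j)).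
pose A : 'M[R]_n := \matrix_(j, i) (s^-1 * (X j i * (1 - k i))).
have AA : A *m A^T = 1%:M.
  apply/matrixP => i j; rewrite !mxE.
  have := zz i j; have [_ _ ->] := XP i; have [_ _ ->] := XP j; rewrite orth_lorentz => h.
  have -> : (i == j)%:R = s^-1 ^+ 2 * (s ^+ 2 * (i == j)%:R) :> R by rewrite mulrA -exprMn mulVf ?expr1n ?mul1r // gt_eqF.
  by rewrite -h mulr_sumr; apply: eq_bigr => l _; rewrite !mxE; ring.
have BB := mulmx1C AA.
have col i : \sum_j (X j i * (1 - k i)) ^+ 2 = s ^+ 2.
  have := congr1 (fun B : 'M[R]_n => B i i) BB; rewrite !mxE eqxx => h.
  rewrite -[RHS]mulr1 -[X in _ = _ * X]h mulr_sumr; apply: eq_bigr => j _; rewrite !mxE.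
  by field; rewrite gt_eqF.
have -> : \sum_j lorentz (Q (z j)) (P (z j)) = \sum_i s ^+ 2 / (1 - k i).
  transitivity (\sum_j \sum_i (X j i * (1 - k i)) ^+ 2 / (1 - k i)).
    apply: eq_bigr => j _; have [_ -> ->] := XP j; rewrite orth_lorentz; apply: eq_bigr => i _.
    by have := k1 i => h; field; rewrite gt_eqF // subr_gt0.
  by rewrite exchange_big /=; apply: eq_bigr => i _; rewrite -mulr_suml col.
rewrite -mulr_sumr ler_wpM2l ?sqr_ge0 // ler_pdivlMr // mulrC mulr_sumr; exact: ksum.
Qed.

End Principal.

(** * The modified conformal factor *)

Section Conformal.
Context {R : realType} {n : nat}.
Local Notation V := 'rV[R]_n.

Lemma isd_sqrt (F : V -> R) x v a : 0 < F x -> is_derive x v F a ->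
  is_derive x v (fun y => Num.sqrt (F y)) (a / (2 * Num.sqrt (F x))).
Proof.
move=> F0 dF; have ds := is_derive1_sqrt F0.
refine (isd_eq (chain_rule1 (@ex_derive _ _ _ _ _ _ _ ds) (@ex_derive _ _ _ _ _ _ _ dF)) _).
by rewrite (@derive_val _ _ _ _ _ _ _ ds) (@derive_val _ _ _ _ _ _ _ dF) mulrC.
Qed.

Lemma Ck_sqrt k (U : set V) (F : V -> R) : open U -> (forall x, U x -> 0 < F x) -> Ck_on k U F ->
  Ck_on k U (fun y => Num.sqrt (F y)).
Proof.
move=> oU F0; elim: k => [|k IH] hF.
  by split => // x Ux; exact: (continuous_comp (Ck_cont hF Ux) (@sqrt_continuous R (F x))).
have d x v : U x -> is_derive x v (fun y => Num.sqrt (F y)) ('D_v F x / (2 * Num.sqrt (F x))).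
  move=> Ux; apply: isd_sqrt (F0 _ Ux) _.
  by apply: derivableP; exact: Ck_derivable hF _ _ Ux.
split=> [x Ux|v]; first exact: (continuous_comp (Ck_cont hF Ux) (@sqrt_continuous R (F x))).
split=> [x Ux|]; first exact: (@ex_derive _ _ _ _ _ _ _ (d x v Ux)).
apply: (Ck_eq oU (f := fun x => 'D_v F x * (2 * Num.sqrt (F x))^-1)).
  by move=> x Ux; rewrite (@derive_val _ _ _ _ _ _ _ (d x v Ux)).
apply: (CkM oU (Ck_deriv v hF)); apply: (CkV oU).
  by move=> x Ux; rewrite gt_eqF // mulr_gt0 // sqrtr_gt0 F0.
by apply: (CkM oU); [exact: Ck_cst|apply: IH; exact: CkS].
Qed.

(* If u = sqrt F satisfies u Lap u <= (3 - n) |du|^2, then profile F satisfies the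
   same inequality with a strictly positive gain, and it dominates both u and 1. *)
Definition profile (F : R) : R := Num.sqrt F + 2 - (1 + Num.sqrt F)^-1.

Lemma profile_ge (F : R) : Num.sqrt F <= profile F.
Proof.
have u0 := sqrtr_ge0 F; rewrite /profile -addrA lerDl subr_ge0.
by rewrite invf_ple ?posrE //; lra.
Qed.

Lemma profile_gt1 (F : R) : 0 < F -> 1 < profile F.
Proof.
move=> F0; have u0 : 0 < Num.sqrt F by rewrite sqrtr_gt0.
have : (1 + Num.sqrt F)^-1 < 1 by rewrite invf_lt1; lra.
rewrite /profile; lra.
Qed.

(** The second derivative of the profile is - 2 y^3. As u f' <= f and L <= 0, the inequality for [u]
    carries over to [f], and concavity leaves f * 2 y^3 g as gain. Because f' <= 2, u <= f and f >=
    1, this is at least (2 (1 + f)^3)^-1 f'^2 g. *)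
Lemma profile_ineq (u y f f' g L : R) : (3 <= n)%N -> 0 < u -> 0 <= g -> u * L <= (3 - n%:R) * g ->
  y = (1 + u)^-1 -> f = u + 2 - y -> f' = 1 + y ^+ 2 ->
  f * (f' * L - 2 * y ^+ 3 * g) <= - (n%:R - 3 + (2 * (1 + f) ^+ 3)^-1) * (f' ^+ 2 * g).
Proof.
move=> n3 u0 g0 uL yE fE f'E.
have n3R : 0 <= n%:R - 3 :> R by rewrite subr_ge0 (ler_nat R 3 n).
have u1 : 0 < 1 + u by rewrite addr_gt0.
have y0 : 0 < y by rewrite yE invr_gt0.
have y1 : y <= 1 by rewrite yE invf_le1 // lerDl ltW.
have y2 : 0 <= y ^+ 2 by rewrite sqr_ge0.
have y21 : y ^+ 2 <= 1 by rewrite exprn_ile1 // ltW.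
have y3 : 0 < y ^+ 3 by rewrite exprn_gt0.
have fu : u * f' <= f.
  have -> : f = u * f' + (2 * u ^+ 2 + 2 * u + 1) * y ^+ 2 by rewrite fE f'E yE; field; rewrite gt_eqF.
  by rewrite lerDl mulr_ge0 // !addr_ge0 // ?mulr_ge0 ?sqr_ge0 // ltW.
have f1 : 1 <= f by rewrite fE; move: u0 y1; clear; lra.
have fu' : u <= f by rewrite fE; move: y1; clear; lra.
have f'1 : 0 <= f' by rewrite f'E addr_ge0.
have f'2 : f' <= 2 by rewrite f'E; move: y21; clear; lra.
clear fE f'E.
have a1 : f * (f' * L) <= - (n%:R - 3) * (f' ^+ 2 * g).
  have L0 : u * L <= 0.
    by apply: le_trans uL _; rewrite -opprB mulNr oppr_le0 mulr_ge0.
  have L0' : L <= 0 by rewrite -(pmulr_rle0 L u0).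
  apply: (@le_trans _ _ (u * f' * (f' * L))).
    by rewrite ler_wnM2r // mulr_ge0_le0.
  have -> : u * f' * (f' * L) = f' ^+ 2 * (u * L) by ring.
  have -> : - (n%:R - 3) * (f' ^+ 2 * g) = f' ^+ 2 * ((3 - n%:R) * g) by ring.
  by rewrite ler_wpM2l // sqr_ge0.
have a2 : (2 * (1 + f) ^+ 3)^-1 * f' ^+ 2 <= f * (2 * y ^+ 3).
  have f0 : 0 < 1 + f by rewrite addr_gt0 // (lt_le_trans ltr01).
  have c3 : (1 + u) ^+ 3 <= (1 + f) ^+ 3 by rewrite lerXn2r ?nnegrE ?lerD2l // ltW.
  have p3 : 0 < (1 + u) ^+ 3 by rewrite exprn_gt0.
  have p3' : 0 < (1 + f) ^+ 3 by rewrite exprn_gt0.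
  have i3 : (2 * (1 + f) ^+ 3)^-1 <= y ^+ 3 / 2.
    have -> : y ^+ 3 / 2 = (2 * (1 + u) ^+ 3)^-1 by rewrite yE invfM exprVn mulrC.
    by rewrite lef_pV2 ?posrE ?mulr_gt0 // ler_pM2l.
  have f'4 : f' ^+ 2 <= 2 ^+ 2 by rewrite lerXn2r ?nnegrE.
  have i0 : 0 <= (2 * (1 + f) ^+ 3)^-1 by rewrite invr_ge0 mulr_ge0 // ltW.
  have : (2 * (1 + f) ^+ 3)^-1 * f' ^+ 2 <= y ^+ 3 / 2 * 2 ^+ 2 by rewrite ler_pM ?sqr_ge0.
  have : 1 * (2 * y ^+ 3) <= f * (2 * y ^+ 3) by rewrite ler_wpM2r // mulr_ge0 // ltW.
  move: ((2 * (1 + f) ^+ 3)^-1 * f' ^+ 2) (f * (2 * y ^+ 3)) (y ^+ 3) => b1 b2 b3; clear; lra.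
have a3 : (2 * (1 + f) ^+ 3)^-1 * f' ^+ 2 * g <= f * (2 * y ^+ 3) * g by rewrite ler_wpM2r.
move: a1 a3; move: ((2 * (1 + f) ^+ 3)^-1) => k a1 a3.
have -> : f * (f' * L - 2 * y ^+ 3 * g) = f * (f' * L) - f * (2 * y ^+ 3) * g by ring.
have -> : - (n%:R - 3 + k) * (f' ^+ 2 * g) = - (n%:R - 3) * (f' ^+ 2 * g) - k * f' ^+ 2 * g by ring.
exact: lerB.
Qed.

(** For F = u^2 the hypothesis on F is u Lap u <= (3 - n) |du|^2 in other terms. *)
Lemma conformal_flat2 (U : set V) (F : V -> R) : (3 <= n)%N -> open U -> Ck_on 2 U F ->
  (forall x, U x -> 0 < F x) ->
  (forall x, U x -> F x * \tr (hess F x) <= (2 - n%:R / 2) * dot (grad F x) (grad F x)) ->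
  let f y := profile (F y) in Ck_on 2 U f /\
  forall x, U x -> f x * \tr (hess f x) <= - (n%:R - 3 + (2 * (1 + f x) ^+ 3)^-1) * dot (grad f x) (grad f x).
Proof.
move=> n3 oU hF F0 ineq f; pose u y := Num.sqrt (F y).
have u0 x : U x -> 0 < u x by move=> Ux; rewrite sqrtr_gt0 F0.
have uC : Ck_on 2 U u by exact: Ck_sqrt.
have Fu x : U x -> F x = u x * u x by move=> Ux; rewrite -expr2 sqr_sqrtr // ltW // F0.
have iC : Ck_on 2 U (fun y => (1 + u y)^-1).
  apply: (CkV oU); first by move=> x /u0 h; rewrite gt_eqF //; lra.
  exact: (CkD oU (Ck_cst 2 U (1 : R)) uC).
have fC : Ck_on 2 U f.
  exact: (CkB oU (CkD oU uC (Ck_cst 2 U (2 : R))) iC).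
split => // x Ux; have du y v : U y -> is_derive y v u ('D_v u y).
  by move=> Uy; apply: derivableP; exact: Ck_derivable uC _ _ Uy.
have ddu v : is_derive x v ('D_v u) ('D_v ('D_v u) x).
  by apply: derivableP; exact: Ck_derivable (Ck_deriv v uC) _ _ Ux.
have u1 y : U y -> 1 + u y != 0 by move=> /u0 h; rewrite gt_eqF //; lra.
have d1 y v : U y -> is_derive y v (fun y => 1 + u y) ('D_v u y).
  by move=> Uy; refine (isd_eq (isdD (isdC (1 : R) y v) (du y v Uy)) _); rewrite add0r.
have di y v : U y -> is_derive y v (fun y => (1 + u y)^-1) (- 'D_v u y * (1 + u y)^-1 ^+ 2).
  move=> Uy; refine (isd_eq (@isdV _ _ (fun y => 1 + u y) y v _ (u1 y Uy) (d1 y v Uy)) _).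
  by rewrite exprVn.
have df y v : U y -> 'D_v f y = 'D_v u y * (1 + (1 + u y)^-1 ^+ 2).
  move=> Uy; have h := isdB (isdD (du y v Uy) (isdC (2 : R) y v)) (di y v Uy).
  rewrite /f /profile -/(u _) (@derive_val _ _ _ _ _ _ _ h); ring.
have ddf v : 'D_v ('D_v f) x = 'D_v ('D_v u) x * (1 + (1 + u x)^-1 ^+ 2) - 2 * (1 + u x)^-1 ^+ 3 * 'D_v u x ^+ 2.
  have -> : 'D_v ('D_v f) x = 'D_v (fun y => 'D_v u y * (1 + (1 + u y)^-1 * (1 + u y)^-1)) x.
    by apply: near_eq_derive; apply: filterS (open_nbhs_nbhs (conj oU Ux)) => y Uy; rewrite df // expr2.
  have h := isdM (ddu v) (isdD (isdC (1 : R) x v) (isdM (di x v Ux) (di x v Ux))).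
  rewrite (@derive_val _ _ _ _ _ _ _ h); ring.
have dF y v : U y -> 'D_v F y = 2 * u y * 'D_v u y.
  move=> Uy; have -> : 'D_v F y = 'D_v (fun y => u y * u y) y.
    by apply: near_eq_derive; apply: filterS (open_nbhs_nbhs (conj oU Uy)) => z /Fu.
  by rewrite (@derive_val _ _ _ _ _ _ _ (isdM (du y v Uy) (du y v Uy))); ring.
have ddF v : 'D_v ('D_v F) x = 2 * 'D_v u x ^+ 2 + 2 * u x * 'D_v ('D_v u) x.
  have -> : 'D_v ('D_v F) x = 'D_v (fun y => 2 * (u y * 'D_v u y)) x.
    by apply: near_eq_derive; apply: filterS (open_nbhs_nbhs (conj oU Ux)) => y Uy; rewrite dF // mulrA.
  by rewrite (@derive_val _ _ _ _ _ _ _ (isdZ 2 (isdM (du x v Ux) (ddu v)))); ring.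
pose g := \sum_j 'D_(bas j) u x ^+ 2; pose L := \sum_j 'D_(bas j) ('D_(bas j) u) x.
have trf : \tr (hess f x) = (1 + (1 + u x)^-1 ^+ 2) * L - 2 * (1 + u x)^-1 ^+ 3 * g.
  rewrite /mxtrace !mulr_sumr -sumrB; apply: eq_bigr => j _; rewrite mxE ddf; ring.
have gf : dot (grad f x) (grad f x) = (1 + (1 + u x)^-1 ^+ 2) ^+ 2 * g.
  rewrite /dot mulr_sumr; apply: eq_bigr => j _; rewrite !mxE df //; ring.
have trF : \tr (hess F x) = 2 * g + 2 * u x * L.
  rewrite /mxtrace !mulr_sumr -big_split /=; apply: eq_bigr => j _; rewrite mxE ddF; ring.
have gF : dot (grad F x) (grad F x) = 4 * (u x ^+ 2 * g).
  rewrite /dot !mulr_sumr; apply: eq_bigr => j _; rewrite !mxE dF //; ring.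
rewrite trf gf; apply: (profile_ineq n3 (u0 x Ux) _ _ erefl erefl erefl).
  by apply: sumr_ge0 => j _; exact: sqr_ge0.
have := ineq x Ux; rewrite trF gF Fu //; have ux := u0 x Ux => h.
have u2 : 0 < 2 * u x ^+ 2 by rewrite mulr_gt0 // exprn_gt0.
rewrite -(ler_pM2l u2); move: h; clear -u2; move: (u x) g L u2 => a b c a2 h.
have -> : 2 * a ^+ 2 * (a * c) = a * a * (2 * b + 2 * a * c) - 2 * a ^+ 2 * b by ring.
have -> : 2 * a ^+ 2 * ((3 - n%:R) * b) = (2 - n%:R / 2) * (4 * (a ^+ 2 * b)) - 2 * a ^+ 2 * b by field.
by rewrite lerD2r.
Qed.

End Conformal.

(** * The lightcone map of a hypersurface *)

Lemma rV_cont {R : realType} {m : nat} {T : topologicalType} (g : T -> 'rV[R]_m) (p : T) :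
  (forall j, {for p, continuous (fun q => g q 0 j)}) -> {for p, continuous g}.
Proof.
move=> H; apply/cvgrPdist_le => /= e e0.
have n1 j : \forall q \near p, `|g p 0 j - g q 0 j| <= e by exact: ((cvgrPdist_le _ _).1 (H j)).
apply: filterS (filter_forall (nbhs_filter p) n1) => q Hq.
by apply: rV_norm_le (ltW e0) _ => j; rewrite !mxE.
Qed.

Section Charts.
Context {R : realType} {n : nat} {M : topologicalType}.
Variable A : smooth_atlas R n M.
Local Notation V := 'rV[R]_n.
Implicit Types (c d : chart A) (p q : M).

Definition image c : set V := coords c @` dom c.

Lemma open_image c : open (image c).
Proof. exact: (@image_open _ _ _ A c). Qed.

Lemma image_dom c x : image c x -> dom c (param c x) /\ coords c (param c x) = x.
Proof. by move=> [p dp <-]; rewrite coordsK. Qed.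

Lemma dom_image c p : dom c p -> image c (coords c p).
Proof. by move=> dp; exists p. Qed.

Lemma smooth_map_cont {m} (h : M -> 'rV[R]_m) : smooth_map A h -> continuous h.
Proof.
move=> hh p; have [c dp] := dom_cover A p.
have e : {near p, (h \o param c) \o coords c =1 h}.
  by apply: filterS (open_nbhs_nbhs (conj (dom_open c) dp)) => q dq /=; rewrite coordsK.
have ch : {for coords c p, continuous (h \o param c)} := Ck_cont (hh c 0%N) (dom_image dp).
have cc := continuous_comp (coords_continuous dp) ch.
have E : ((h \o param c) \o coords c) p = h p by rewrite /= coordsK.
move: cc; rewrite /prop_for /continuous_at E => cc.
by apply: cvg_trans cc; exact: (near_eq_cvg e).
Qed.

(** Smoothness is tested in two ways: against smooth maps on [M], which is needed to differentiate
    phi and N, and in charts, which is needed to recognize smooth curves. *)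
Definition smooth_section (D : set V) (s : V -> M) :=
  (forall m (h : M -> 'rV[R]_m), smooth_map A h -> forall k, Ck_on k D (h \o s)) /\
  (forall d k, Ck_on k (D `&` s @^-1` dom d) (coords d \o s)).

Lemma param_section c (s' : V -> V) (D : set V) : open D -> (forall y, D y -> image c (s' y)) ->
  (forall k, Ck_on k D s') ->
  (forall y, D y -> {for y, continuous (param c \o s')}) /\ smooth_section D (param c \o s').
Proof.
move=> oD Di sC; have cs y : D y -> {for y, continuous (param c \o s')}.
  move=> Dy; apply: (continuous_comp (Ck_cont (sC 0%N) Dy)).
  exact: (param_continuous (Di y Dy)).
split => //; split=> [m h hh k|d k].
  change (Ck_on k D ((h \o param c) \o s')); exact: (Ck_compV (@open_image c) oD Di (hh c k) (sC k)).
have oD' : open (D `&` (param c \o s') @^-1` dom d).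
  rewrite openE => y [Dy dy]; apply: filterI; first exact: open_nbhs_nbhs.
  by apply: (cs y Dy); apply: open_nbhs_nbhs; split => //; exact: dom_open.
have oI : open (coords c @` (dom c `&` dom d)).
  rewrite openE => _ [p [cp dp] <-].
  have ci := dom_image cp; have pc := param_continuous ci.
  have n1 : nbhs (coords c p) (image c) by apply: open_nbhs_nbhs; split => //; exact: open_image.
  have n2 : nbhs (coords c p) (param c @^-1` dom d).
    by apply: pc; rewrite coordsK //; apply: open_nbhs_nbhs; split => //; exact: dom_open.
  apply: filterS (filterI n1 n2) => x [ix dx]; exists (param c x); last exact: (image_dom ix).2.
  by split => //; exact: (image_dom ix).1.
have Dj y : (D `&` (param c \o s') @^-1` dom d) y -> (coords c @` (dom c `&` dom d)) (s' y).
  move=> [Dy dy]; exists (param c (s' y)); last exact: (image_dom (Di y Dy)).2.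
  by split => //; exact: (image_dom (Di y Dy)).1.
have sC' : Ck_on k (D `&` (param c \o s') @^-1` dom d) s' by apply: Ck_sub (sC k) => y [].
change (Ck_on k (D `&` (param c \o s') @^-1` dom d) ((coords d \o param c) \o s')).
exact: (Ck_compV oI oD' Dj (transition_smooth c d k) sC').
Qed.

Lemma tdiff_sum c p m k (h : M -> 'rV[R]_m) (y : 'I_k -> R) (e : 'I_k -> V) : dom c p -> smooth_map A h ->
  tdiff h c p (\sum_i y i *: e i) = \sum_i y i *: tdiff h c p (e i).
Proof.
move=> dp hh; have D v := C1_derive_sumV (@open_image c) (hh c 1%N) v (dom_image dp).
rewrite /tdiff D (eq_bigr (fun i => \sum_j (y i * e i 0 j) *: 'D_(bas j) (h \o param c) (coords c p))); last first.
  by move=> i _; rewrite D scaler_sumr; apply: eq_bigr => j _; rewrite scalerA.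
rewrite exchange_big /=; apply: eq_bigr => j _; rewrite summxE -scaler_suml.
by congr (_ *: _); apply: eq_bigr => i _; rewrite mxE.
Qed.

Lemma section_derive (D : set V) s x c m (h : M -> 'rV[R]_m) v : open D -> D x -> smooth_section D s ->
  {for x, continuous s} -> dom c (s x) -> smooth_map A h ->
  'D_v (h \o s) x = tdiff h c (s x) ('D_v (coords c \o s) x).
Proof.
move=> oD Dx [_ sS] sc dx hh.
have nx : nbhs x (D `&` s @^-1` dom c).
  apply: filterI; first exact: open_nbhs_nbhs.
  by apply: sc; apply: open_nbhs_nbhs; split => //; exact: dom_open.
have -> : 'D_v (h \o s) x = 'D_v ((h \o param c) \o (coords c \o s)) x.
  by apply: near_eq_derive; apply: filterS nx => y [_ dy] /=; rewrite coordsK.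
have dg : derivable (coords c \o s) x v by apply: (Ck_derivable (sS c 1%N)).
have ix : image c ((coords c \o s) x) by exact: dom_image.
by rewrite (@derive_val _ _ _ _ _ _ _ (chain_ruleV (@open_image c) (hh c 1%N) ix dg)).
Qed.

End Charts.

Section Hypersurface.
Context {R : realType} {n : nat} {M : topologicalType}.
Variable A : smooth_atlas R n M.
Local Notation V := 'rV[R]_n.
Local Notation E := 'rV[R]_n.+2.
Variables (phi eta : M -> E) (kappa : M -> 'I_n -> R).
Hypothesis n3 : (3 <= n)%N.
Hypothesis phiI : immersed_hypersurface A phi.
Hypothesis etaN : unit_normal A phi eta.
Hypothesis kappaP : forall p, principal_curvatures A phi eta p (kappa p).
Hypothesis kappa1 : forall p i, kappa p i < 1.
Hypothesis kappaS : forall p, \sum_(i < n) 2 / (1 - kappa p i) <= n%:R.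

Definition lightcone_map p := phi p + eta p.
Local Notation N := lightcone_map.

Lemma phi_smooth : smooth_map A phi. Proof. by case: phiI => -[]. Qed.

Lemma eta_smooth : smooth_map A eta. Proof. by case: etaN. Qed.

Lemma N_smooth : smooth_map A N.
Proof.
by move=> c k; apply: (CkD (@open_image _ _ _ A c)); [exact: phi_smooth|exact: eta_smooth].
Qed.

Lemma lightcone_null p : lorentz (N p) (N p) = 0.
Proof.
have [_ /(_ p)[h1 _]] := phiI; have [_ h2 h3 _] := etaN.
by rewrite /N !lorentzDl !lorentzDr (lorentzC (eta p) (phi p)) h1 h2 h3; ring.
Qed.

Lemma lorentz_phi_lightcone p : lorentz (phi p) (N p) = -1.
Proof.
have [_ /(_ p)[h1 _]] := phiI; have [_ _ h3 _] := etaN.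
by rewrite /N lorentzDr h1 h3 addr0.
Qed.

Lemma tdiff_N (c : chart A) p v : dom c p -> tdiff N c p v = tdiff phi c p v + tdiff eta c p v.
Proof.
move=> dp; have ip := dom_image dp.
have d1 := derivableP (Ck_derivable (phi_smooth c 1%N) ip (v := v)).
have d2 := derivableP (Ck_derivable (eta_smooth c 1%N) ip (v := v)).
by rewrite /tdiff (@derive_val _ _ _ _ _ _ _ (isdD d1 d2)).
Qed.

Lemma isd_tdiff m (h : M -> 'rV[R]_m) (c : chart A) p v : smooth_map A h -> dom c p ->
  is_derive (coords c p) v (h \o param c) (tdiff h c p v).
Proof. by move=> hh dp; apply: derivableP; exact: (Ck_derivable (hh c 1%N) (dom_image dp)). Qed.

Lemma phi_dN (c : chart A) p v : dom c p -> lorentz (phi p) (tdiff N c p v) = 0.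
Proof.
move=> dp; have ip := dom_image dp; have oI := @open_image _ _ _ A c.
have dphi := isd_tdiff v phi_smooth dp; have deta := isd_tdiff v eta_smooth dp.
have [_ pH] := phiI; have [_ _ pe dpe] := etaN.
have h1 := isd_zero oI ip (h := fun x => lorentz ((phi \o param c) x) ((phi \o param c) x) + 1) (v := v)
  (fun x _ => ltac:(by rewrite /= (pH _).1 addNr)) (isdD (isd_lorentz dphi dphi) (isdC (1 : R) _ v)).
have h2 := isd_zero oI ip (h := fun x => lorentz ((phi \o param c) x) ((eta \o param c) x)) (v := v)
  (fun x _ => ltac:(by rewrite /= pe)) (isd_lorentz dphi deta).
rewrite /= coordsK // in h1 h2; rewrite dpe // add0r in h2.
rewrite tdiff_N // lorentzDr h2 addr0.
by move: h1; rewrite (lorentzC (tdiff phi c p v)) addr0; lra.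
Qed.

Section Frame.
Variables (K K' : E) (w : 'I_n -> E).
Hypothesis frame : null_frame K K' w.

(** For K = (1, y) this is e^rho (1 - <G, y>), so it vanishes exactly on the fibre over [y]. The
    frame is kept general because near that fibre the roles of [K] and [K'] are exchanged. *)
Definition height p := - lorentz (N p) K.
Definition stereo p : V := \row_j (lorentz (N p) (w j) / height p).
Definition visible : set M := [set p | 0 < height p].

Lemma lorentz_N_cont (a : E) : continuous (fun p => lorentz (N p) a).
Proof.
have h : smooth_map A (fun p => (lorentz (N p) a)%:M : 'rV[R]_1).
  move=> c k; apply/(Ck_rV _ _ (@open_image _ _ _ A c)) => j.
  apply: (Ck_eq (@open_image _ _ _ A c) (f := fun x => lorentz ((N \o param c) x) a)).
    by move=> x _; rewrite ord1 mxE eqxx mulr1n.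
  by apply: (Ck_lorentz (@open_image _ _ _ A c) (N_smooth c k)); exact: Ck_cst.
move=> p; have -> : (fun p => lorentz (N p) a) = (fun x : 'rV[R]_1 => x 0 0) \o (fun p => (lorentz (N p) a)%:M).
  by apply/funext => q /=; rewrite mxE eqxx mulr1n.
apply: continuous_comp; first exact: (smooth_map_cont h).
exact: coord_continuous.
Qed.

Lemma height_cont : continuous height.
Proof. by move=> p; apply: cvgN; exact: lorentz_N_cont. Qed.

Lemma open_visible : open visible.
Proof.
have -> : visible = height @^-1` [set x | 0 < x] by [].
by apply: open_comp; [move=> p _; exact: height_cont|exact: open_gt].
Qed.

Lemma stereo_cont p : visible p -> {for p, continuous stereo}.
Proof.
move=> vp; apply: rV_cont => j.
have -> : (fun q => stereo q 0 j) = (fun q => lorentz (N q) (w j) / height q) by apply/funext => q; rewrite mxE.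
apply: cvgM; first exact: lorentz_N_cont.
by apply: cvgV; [rewrite gt_eqF|exact: height_cont].
Qed.

Lemma stereoE p j : visible p -> lorentz (N p) (w j) = height p * stereo p 0 j.
Proof. by move=> vp; rewrite mxE mulrC divfK // gt_eqF. Qed.

Lemma height_Ck (c : chart A) k : Ck_on k (image c) (height \o param c).
Proof.
have oI := @open_image _ _ _ A c; apply: (CkN oI).
by apply: (Ck_lorentz oI (N_smooth c k)); exact: Ck_cst.
Qed.

(** The differential of [stereo] is injective: by [conformal_metric] a vector in its kernel has <dN,
    dN> = 0, while dN multiplies dphi by 1 - kappa > 0 in the principal directions. The inverse
    function theorem then gives the section. *)
Lemma flat_section p0 : visible p0 -> exists (r : R) (s : V -> M) (U : set M),
  [/\ 0 < r, section_on visible stereo (nball (stereo p0) r) s, open U & U p0] /\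
  [/\ forall q, U q -> nball (stereo p0) r (stereo q) /\ s (stereo q) = q &
      smooth_section A (nball (stereo p0) r) s].
Proof.
move=> v0; have [c [e [dc orth etaE]]] := kappaP p0.
have oI := @open_image _ _ _ A c; set x0 := coords c p0.
have ix0 : image c x0 by exact: dom_image.
pose U := image c `&` (height \o param c) @^-1` [set y | 0 < y].
have oU : open U.
  rewrite openE => x [ix hx]; apply: filterI; first exact: open_nbhs_nbhs.
  by apply: (Ck_cont (height_Ck c 0%N) ix); apply: open_nbhs_nbhs; split => //; exact: open_gt.
have Ux0 : U x0 by split => //=; rewrite coordsK.
have NC k : Ck_on k U (N \o param c) by apply: Ck_sub (N_smooth c k) => x [].
have hC k : Ck_on k U (height \o param c) by apply: Ck_sub (height_Ck c k) => x [].
pose g := stereo \o param c.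
have gC k : Ck_on k U g.
  apply/(Ck_rV _ _ oU) => j.
  apply: (Ck_eq oU (f := fun x => lorentz ((N \o param c) x) (w j) * (height (param c x))^-1)).
    by move=> x _; rewrite mxE.
  apply: (CkM oU); first by apply: (Ck_lorentz oU (NC k)); exact: Ck_cst.
  by apply: (CkV oU _ (hC k)) => x [_ /= h]; rewrite gt_eqF.
have inj (v : V) : 'D_v g x0 = 0 -> v = 0.
  move=> gv.
  apply: (@metric_nondegenerate R n (tdiff phi c p0) (tdiff N c p0) e (kappa p0)) => //.
  - by move=> y; exact: (tdiff_sum _ _ dc phi_smooth).
  - by move=> y; exact: (tdiff_sum _ _ dc N_smooth).
  - by move=> i; rewrite tdiff_N // etaE scalerBl scale1r scaleNr.
  have -> := @conformal_metric R n K K' w U (N \o param c) g frame oU (NC 1%N) (gC 1%N)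
     (fun x _ => lightcone_null _) (fun x Ux => Ux.2) (fun x j Ux => stereoE j Ux.2) x0 v v Ux0.
  by rewrite gv -[0 : V](scale0r (0 : V)) dotZl mul0r mulr0.
have [r [s' [B [L [[r0 oB Bx0 BU] [gB sB Lip unit]]]]]] := local_inverse oU (gC 1%N) Ux0 inj.
have gx0 : g x0 = stereo p0 by rewrite /g /= coordsK.
rewrite gx0 in gB sB Lip.
have oD : open (nball (stereo p0) r) by rewrite openE => y; exact: nballP.
have sC k : Ck_on k (nball (stereo p0) r) s'.
  apply: (@inverse_Ck R n g U s' (nball (stereo p0) r) L) => //.
  - by move=> y /sB[/BU].
  - by move=> y /sB[By _]; exact: unit.
have Di y : nball (stereo p0) r y -> image c (s' y) by move=> /sB[/BU[]].
have [cs ss] := param_section oD Di sC.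
exists r, (param c \o s'), (dom c `&` coords c @^-1` B)^°; split; split => //.
- move=> y yD; have [By gy] := sB y yD; have [_ vy] := BU _ By; split => //; exact: cs.
- exact: open_interior.
- apply: filterI; first by apply: open_nbhs_nbhs; split => //; exact: dom_open.
  by apply: (coords_continuous dc); apply: open_nbhs_nbhs.
move=> q /interior_subset [dq Bq]; have [h1 h2] := gB _ Bq.
by move: h1 h2; rewrite /g /= coordsK // /nball /= => -> ->; rewrite coordsK.
Qed.

(** Brings a point of a section into the setting of the linear algebra above: [P] and [Q] are the
    differentials in the chart of the principal directions, and [z] translates directions of the
    coordinates X into that chart. *)
Lemma section_principal (D : set V) s x : open D -> D x -> section_on visible stereo D s -> smooth_section A D s ->
  exists (P Q : V -> E) (e : 'I_n -> V) (z : V -> V),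
  [/\ forall (y : 'I_n -> R), P (\sum_i y i *: e i) = \sum_i y i *: P (e i),
      forall (y : 'I_n -> R), Q (\sum_i y i *: e i) = \sum_i y i *: Q (e i),
      forall i j, lorentz (P (e i)) (P (e j)) = (i == j)%:R &
      forall i, Q (e i) = (1 - kappa (s x) i) *: P (e i)] /\
  [/\ forall v, 'D_v (phi \o s) x = P (z v), forall v, 'D_v (N \o s) x = Q (z v) &
      forall v, lorentz (phi (s x)) (Q (z v)) = 0].
Proof.
move=> oD Dx sS ss; have [c [e [dc orth etaE]]] := kappaP (s x).
have [sc _ _] := sS _ Dx.
have oI := @open_image _ _ _ A c; set x0 := coords c (s x).
have ix0 : image c x0 by exact: dom_image.
exists (tdiff phi c (s x)), (tdiff N c (s x)), e, (fun v => 'D_v (coords c \o s) x).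
split; split.
- by move=> y; exact: (tdiff_sum _ _ dc phi_smooth).
- by move=> y; exact: (tdiff_sum _ _ dc N_smooth).
- exact: orth.
- by move=> i; rewrite tdiff_N // etaE scalerBl scale1r scaleNr.
- by move=> v; exact: (section_derive v oD Dx ss sc dc phi_smooth).
- by move=> v; exact: (section_derive v oD Dx ss sc dc N_smooth).
by move=> v; exact: phi_dN.
Qed.

Section SmoothSection.
Variables (D : set V) (s : V -> M).
Hypothesis oD : open D.
Hypothesis sS : section_on visible stereo D s.
Hypothesis ss : smooth_section A D s.

Let NC k : Ck_on k D (N \o s). Proof. exact: (ss.1 _ _ N_smooth). Qed.
Let phiC k : Ck_on k D (phi \o s). Proof. exact: (ss.1 _ _ phi_smooth). Qed.
Let F0 x : D x -> 0 < height (s x). Proof. by move=> /sS[]. Qed.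
Let Nw x j : D x -> lorentz (N (s x)) (w j) = height (s x) * x 0 j.
Proof. by move=> /sS[_ vx sx]; rewrite (stereoE _ vx) sx. Qed.

Lemma section_height_Ck k : Ck_on k D (height \o s).
Proof. by apply: (CkN oD); apply: (Ck_lorentz oD (NC k)); exact: Ck_cst. Qed.

Lemma section_metric x u v : D x -> lorentz ('D_u (N \o s) x) ('D_v (N \o s) x) = height (s x) ^+ 2 * dot u v.
Proof.
move=> Dx; rewrite (@conformal_metric R n K K' w D (N \o s) (fun x => x) frame oD (NC 1%N) (Ck_id oD)
  (fun x _ => lightcone_null _) F0 Nw x u v Dx) !derive_id; by [].
Qed.

Lemma section_metric_phi x v : D x ->
  lorentz ('D_v (phi \o s) x) ('D_v (phi \o s) x) <= (n%:R / 2 * height (s x)) ^+ 2 * dot v v.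
Proof.
move=> Dx; have [P [Q [e [z [[Ps Qs orth Qe] [dP dQ _]]]]]] := section_principal oD Dx sS ss.
rewrite exprMn -mulrA -section_metric // dP dQ.
exact: (metric_compare Ps Qs orth Qe (kappa1 (s x)) (kappaS (s x))).
Qed.

(** The coordinate directions are orthogonal and of length [height] for <dN, dN>, so [trace_bound]
    estimates the left side of [flat_trace]. The terms with n / 2 * height^2 cancel on both sides,
    and what remains is nonnegativity of the scalar curvature. *)
Lemma section_laplace x : D x ->
  height (s x) * \tr (hess (height \o s) x) <= (2 - n%:R / 2) * dot (grad (height \o s) x) (grad (height \o s) x).
Proof.
move=> Dx; have [P [Q [e [z [[Ps Qs orth Qe] [dP dQ _]]]]]] := section_principal oD Dx sS ss.
have h0 := F0 Dx; have h2 : 0 < height (s x) ^+ 2 by rewrite exprn_gt0.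
have zz i j : lorentz (Q (z (bas i))) (Q (z (bas j))) = height (s x) ^+ 2 * (i == j)%:R.
  rewrite -!dQ section_metric //; congr (_ * _).
  rewrite /dot (bigD1 i) //= big1 ?addr0; last by move=> l /negPf li; rewrite !mxE li andbF mul0r.
  by rewrite !mxE !eqxx mul1r.
have tb := trace_bound Ps Qs orth Qe (kappa1 (s x)) (kappaS (s x)) h0 zz.
have pdN y v : D y -> lorentz (phi (s y)) ('D_v (N \o s) y) = 0.
  move=> Dy; have [P' [Q' [e' [z' [_ [_ dQ' h]]]]]] := section_principal oD Dy sS ss.
  by rewrite dQ' h.
have [_ pH] := phiI.
have ft := @flat_trace R n K K' w D (phi \o s) (N \o s) frame oD (phiC 1%N) (NC 2%N)
  (fun x _ => lightcone_null _) F0 Nw (fun x _ => (pH (s x)).1) (fun x _ => lorentz_phi_lightcone _) pdN x Dx.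
have : \sum_j lorentz (Q (z (bas j))) (P (z (bas j))) = \sum_j lorentz ('D_(bas j) (N \o s) x) ('D_(bas j) (phi \o s) x).
  by apply: eq_bigr => j _; rewrite dP dQ.
move=> e1; rewrite e1 ft in tb.
rewrite -[X in grad X]/(fun y => - lorentz ((N \o s) y) K) -[X in hess X]/(fun y => - lorentz ((N \o s) y) K).
rewrite -[- lorentz ((N \o s) x) K]/(height (s x)) in tb.
move: tb; move: (\tr _) (dot _ _) (height (s x)) h0 h2 => T g h h0 h2 tb.
rewrite -(ler_pM2l h0).
have e2 : (T / h - 2 * g / h ^+ 2 + n%:R / 2 * (h ^+ 2 + g / h ^+ 2)) * h ^+ 2 <= h ^+ 2 * (n%:R / 2) * h ^+ 2.
  by rewrite ler_pM2r.
have e3 : (T / h - 2 * g / h ^+ 2 + n%:R / 2 * (h ^+ 2 + g / h ^+ 2)) * h ^+ 2 = h * T - 2 * g + n%:R / 2 * (h ^+ 4 + g).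
  by field; rewrite gt_eqF.
rewrite e3 in e2; rewrite ler_pM2l //.
have e4 : h ^+ 2 * (n%:R / 2) * h ^+ 2 = n%:R / 2 * h ^+ 4 by ring.
rewrite e4 in e2; lra.
Qed.

Lemma section_flat2 : Ck_on 2 D (profile \o height \o s) /\ forall x, D x ->
  profile (height (s x)) * \tr (hess (profile \o height \o s) x) <=
   - (n%:R - 3 + (2 * (1 + profile (height (s x))) ^+ 3)^-1) * dot (grad (profile \o height \o s) x) (grad (profile \o height \o s) x).
Proof. exact: (conformal_flat2 n3 oD (section_height_Ck 2) F0 section_laplace). Qed.

End SmoothSection.

Definition factor p := profile (height p).

Lemma flat2_visible : flat2 visible stereo factor (fun p => (2 * (1 + factor p) ^+ 3)^-1).
Proof.
move=> p vp; have [r [s [U [[r0 sS oU Up] [sU ss]]]]] := flat_section vp.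
have oD : open (nball (stereo p) r) by rewrite openE => y; exact: nballP.
have [h1 h2] := section_flat2 oD sS ss.
by exists r, s, U; split.
Qed.

Lemma factor_cont p : visible p -> {for p, continuous factor}.
Proof.
move=> vp; have hc : {for p, continuous height} by exact: height_cont.
have sc : {for p, continuous (fun q => Num.sqrt (height q))}.
  exact: (continuous_comp hc (@sqrt_continuous R (height p))).
apply: cvgB; first by apply: cvgD => //; exact: cvg_cst.
apply: cvgV; first by rewrite gt_eqF // ltr_wpDr // sqrtr_ge0.
by apply: cvgD => //; exact: cvg_cst.
Qed.

End Frame.
End Hypersurface.

(** * Comparison of chain length with the induced distance *)

Section Integrals.
Context {R : realType}.
Local Notation mu := (@lebesgue_measure R).

Lemma integral_le_cst (g : R -> R) (s : R) : continuous g -> (forall t, 0 <= g t <= s) ->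
  (\int[mu]_(t in `[0%R, 1%R]) (g t)%:E <= s%:E)%E.
Proof.
move=> gC gs; have mg : measurable_fun (`[0, 1] : set R) g.
  by apply: subspace_continuous_measurable_fun => //; exact: continuous_subspaceT.
apply: (@le_trans _ _ (\int[mu]_(t in `[0%R, 1%R]) (cst s%:E t))%E).
  apply: ge0_le_integral => //.
  - by move=> t _; rewrite lee_fin; case/andP: (gs t).
  - exact/measurable_EFinP.
  - by move=> t _; rewrite lee_fin; case/andP: (gs t).
rewrite integral_cst //= lebesgue_measure_itv /= lte_fin ltr01 -EFinB subr0 mule1 //.
Qed.

(** The fundamental theorem of calculus on [a, b], after which the integral of [g] is enlarged to
    the unit interval. *)
Lemma integral_ge_variation (g h dh : R -> R) (c a b : R) : continuous g -> continuous dh -> 0 <= c ->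
  (forall t, is_derive t (1 : R) h (dh t)) -> (forall t, `|dh t| <= c * g t) -> (forall t, 0 <= g t) ->
  0 <= a -> a < b -> b <= 1 ->
  (`|h b - h a|%:E <= c%:E * \int[mu]_(t in `[0%R, 1%R]) (g t)%:E)%E.
Proof.
move=> gC dC c0 hD hg g0 a0 ab b1.
have mg : measurable_fun (`[0, 1] : set R) g.
  by apply: subspace_continuous_measurable_fun => //; exact: continuous_subspaceT.
have md : measurable_fun (`[a, b] : set R) dh.
  by apply: subspace_continuous_measurable_fun => //; exact: continuous_subspaceT.
have hC : continuous h.
  by move=> t; apply: differentiable_continuous; apply/derivable1_diffP; exact: (@ex_derive _ _ _ _ _ _ _ (hD t)).
have F : (\int[mu]_(x in `[a, b]) (dh x)%:E = (h b)%:E - (h a)%:E)%E.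
  apply: continuous_FTC2 => //; first exact: continuous_subspaceT.
    split.
    - by move=> t _; exact: (@ex_derive _ _ _ _ _ _ _ (hD t)).
    - by apply: cvg_at_right_filter; exact: hC.
    - by apply: cvg_at_left_filter; exact: hC.
  by move=> t _; rewrite derive1E (@derive_val _ _ _ _ _ _ _ (hD t)).
have -> : (`|h b - h a|%:E = `| \int[mu]_(x in `[a, b]) (dh x)%:E |)%E by rewrite F.
apply: le_trans (le_abse_integral _ _ _) _ => //; first exact/measurable_EFinP.
apply: (@le_trans _ _ (\int[mu]_(x in `[a, b]) (c * g x)%:E)%E).
  apply: ge0_le_integral => //.
  - by apply: measurableT_comp => //; exact/measurable_EFinP.
  - apply/measurable_EFinP; apply: measurable_funM => //.
    apply: (measurable_funS _ _ mg) => //; apply: subset_itv; rewrite bnd_simp //.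
  - by move=> t _ /=; rewrite lee_fin.
apply: (@le_trans _ _ (\int[mu]_(x in `[0%R, 1%R]) (c * g x)%:E)%E).
  apply: ge0_subset_integral => //.
  - by apply/measurable_EFinP; apply: measurable_funM.
  - by move=> t _; rewrite lee_fin mulr_ge0.
  - by apply: subset_itv; rewrite bnd_simp.
under eq_integral do rewrite EFinM.
rewrite ge0_integralZl //; first exact/measurable_EFinP.
by move=> t _; rewrite lee_fin.
Qed.

End Integrals.

Section Curves.
Context {R : realType} {n : nat} {M : topologicalType}.
Variable A : smooth_atlas R n M.
Local Notation V := 'rV[R]_n.
Implicit Types (c : chart A) (p q : M) (gamma : R -> M).

Lemma Ck_idR k (U : set R) : Ck_on k U (fun t : R => t).
Proof.
case: k => [|k]; split; try by move=> x _; exact: cvg_id.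
  by [].
move=> v; split=> [x _|]; first exact: derivable_id.
have -> : 'D_v (fun t : R => t) = fun=> v by apply/funext => x; rewrite derive_id.
exact: Ck_cst.
Qed.

Lemma open_curve_dom gamma c : continuous gamma -> open (gamma @^-1` dom c).
Proof. by move=> gC; apply: open_comp; [move=> t _; exact: gC|exact: dom_open]. Qed.

Lemma curve_Ck m (h : M -> 'rV[R]_m) gamma : smooth_curve A gamma -> smooth_map A h ->
  forall k, Ck_on k setT (h \o gamma).
Proof.
move=> [gC gS] hh k; apply: Ck_near => t _; have [c dt] := dom_cover A (gamma t).
exists (gamma @^-1` dom c), ((h \o param c) \o (coords c \o gamma)); split => //.
- exact: open_curve_dom.
- by move=> u du /=; rewrite coordsK.
apply: (Ck_compV (@open_image _ _ _ A c) (open_curve_dom gC) _ (hh c k) (gS c k)) => u du.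
exact: dom_image.
Qed.

Lemma smooth_curve_local gamma : (forall t, exists (B : set R) (gamma' : R -> M),
    [/\ open B, B t, forall u, B u -> gamma' u = gamma u & smooth_curve A gamma']) ->
  smooth_curve A gamma.
Proof.
move=> H; split.
  move=> t; have [B [g' [oB Bt E [gC _]]]] := H t.
  have e : {near t, g' =1 gamma} by apply: filterS (open_nbhs_nbhs (conj oB Bt)) => u /E.
  rewrite /continuous_at -(E t Bt); apply: cvg_trans (gC t); exact: (near_eq_cvg e).
move=> c k; apply: Ck_near => t dt; have [B [g' [oB Bt E [gC gS]]]] := H t.
exists (B `&` g' @^-1` dom c), (coords c \o g'); split.
- by apply: openI => //; exact: open_curve_dom.
- by split => //=; rewrite E.
- by move=> u [Bu _] /=; rewrite E.
by apply: Ck_sub (gS c k) => u [].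
Qed.

Lemma affine_Ck k (a b : R) : Ck_on k setT (fun t : R => a * t + b).
Proof.
apply: (CkD openT); last exact: Ck_cst.
by apply: (CkM openT); [exact: Ck_cst|exact: Ck_idR].
Qed.

Lemma smooth_curve_affine gamma (a b : R) : smooth_curve A gamma -> smooth_curve A (fun t => gamma (a * t + b)).
Proof.
move=> [gC gS].
have aC : continuous (fun t : R => a * t + b) by move=> t; exact: (Ck_cont (affine_Ck 0 a b) (x := t) I).
have gC' : continuous (fun t => gamma (a * t + b)).
  by move=> t; apply: (continuous_comp (aC t) (gC _)).
split => // c k; have oB := open_curve_dom (c := c) gC'.
apply/(Ck_rV _ _ oB) => j.
have hj : Ck_on k (gamma @^-1` dom c) (fun u => (coords c \o gamma) u 0 j).
  by have /(Ck_rV _ _ (open_curve_dom gC)) := gS c k; apply.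
apply: (Ck_comp1 oB _ hj) => //.
by apply: Ck_sub (affine_Ck k a b).
Qed.

Lemma derive_affine m (f : R -> 'rV[R]_m) (a b t : R) : Ck_on 1 setT f ->
  'D_1 (fun u => f (a * u + b)) t = a *: 'D_1 f (a * t + b).
Proof.
move=> fC; have e : (fun u => f (a * u + b)) = (fun u : R => f (b + u *: a)).
  by apply/funext => u; rewrite [a * u + b]addrC [a * u]mulrC.
have d : derivable f (b + t *: a) a by exact: (Ck_derivable fC).
rewrite e (@derive_val _ _ _ _ _ _ _ (is_derive_line d)).
have -> : b + t *: a = a * t + b by rewrite [RHS]addrC [a * t]mulrC.
by rewrite -(C1_deriveZ _ _ fC) // /GRing.scale /= mulr1.
Qed.

Variable phi : M -> 'rV[R]_n.+2.
Hypothesis phiS : smooth_map A phi.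

Definition speed2 gamma t := lorentz ('D_1 (phi \o gamma) t) ('D_1 (phi \o gamma) t).

(** Constancy near both ends lets curves be concatenated smoothly; the speed bound also bounds the
    length over the unit interval. *)
Definition flat_curve p q (sp : R) := exists (gamma : R -> M) (e : R),
  [/\ 0 < e, smooth_curve A gamma, forall t, t <= e -> gamma t = p & forall t, 1 - e <= t -> gamma t = q] /\
  forall t, speed2 gamma t <= sp ^+ 2.

Lemma speed2_near gamma gamma' (B : set R) t : open B -> B t -> (forall u, B u -> gamma' u = gamma u) ->
  speed2 gamma t = speed2 gamma' t.
Proof.
move=> oB Bt E; rewrite /speed2; have -> // : 'D_1 (phi \o gamma) t = 'D_1 (phi \o gamma') t.
by apply: near_eq_derive; apply: filterS (open_nbhs_nbhs (conj oB Bt)) => u /E /= ->.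
Qed.

Lemma speed2_affine gamma (a b t : R) : smooth_curve A gamma ->
  speed2 (fun u => gamma (a * u + b)) t = a ^+ 2 * speed2 gamma (a * t + b).
Proof.
move=> gS; rewrite /speed2.
have -> : 'D_1 (phi \o (fun u => gamma (a * u + b))) t = a *: 'D_1 (phi \o gamma) (a * t + b).
  exact: (derive_affine _ _ _ (curve_Ck gS phiS 1%N)).
by rewrite lorentzZl lorentzZr mulrA -expr2.
Qed.

Lemma flat_curve_cst p sp : flat_curve p p sp.
Proof.
exists (fun=> p), 1; split; first split => //.
  split=> [t|c k]; first exact: cvg_cst.
  exact: Ck_cst.
move=> t; rewrite /speed2; have -> : 'D_1 (phi \o (fun=> p)) t = 0 by exact: derive_cst.
by rewrite lorentz0l sqr_ge0.
Qed.

Lemma flat_curve_mono p q sp sp' : 0 <= sp -> sp <= sp' -> flat_curve p q sp -> flat_curve p q sp'.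
Proof.
move=> s0 ss [g [e [H1 H2]]]; exists g, e; split => // t; apply: le_trans (H2 t) _.
by rewrite lerXn2r ?nnegrE // (le_trans s0).
Qed.

(** Time is shared in the ratio s1 : s2, so that both pieces have speed at most s1 + s2. Near the
    junction both are constantly [q], so the glued curve coincides locally with one of them. *)
Lemma flat_curve_cat p q r s1 s2 : 0 < s1 -> 0 < s2 -> flat_curve p q s1 -> flat_curve q r s2 ->
  flat_curve p r (s1 + s2).
Proof.
move=> s10 s20 [g1 [e1 [[e10 S1 p1 q1] v1]]] [g2 [e2 [[e20 S2 p2 q2] v2]]].
have s0 : 0 < s1 + s2 by rewrite addr_gt0.
pose la := s1 / (s1 + s2); pose mu := s2 / (s1 + s2).
have la0 : 0 < la by rewrite divr_gt0.
have mu0 : 0 < mu by rewrite divr_gt0.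
have lm : la + mu = 1 by rewrite -mulrDl divff // gt_eqF.
pose f1 t := g1 (la^-1 * t + 0); pose f2 t := g2 (mu^-1 * t + (- la / mu)).
have F1 : smooth_curve A f1 by exact: smooth_curve_affine.
have F2 : smooth_curve A f2 by exact: smooth_curve_affine.
pose g t := if t <= la then f1 t else f2 t.
have q1' t : la - la * e1 <= t -> f1 t = q.
  move=> h; rewrite /f1 addr0; apply: q1; rewrite mulrC ler_pdivlMr //; lra.
have q2' t : t <= la + mu * e2 -> f2 t = q.
  move=> h; rewrite /f2; apply: p2.
  by have -> : mu^-1 * t + - la / mu = (t - la) / mu by [ring]; rewrite ler_pdivrMr //; lra.
have B1 t : t < la + mu * e2 -> f1 t = g t \/ la <= t.
  by move=> h; rewrite /g; case: ifP => [_|/negbT]; [left|rewrite -ltNge; right; exact: ltW].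
have le1 : 0 < la * e1 by rewrite mulr_gt0.
have me2 : 0 < mu * e2 by rewrite mulr_gt0.
have E1 t : t < la + mu * e2 -> f1 t = g t.
  move=> h; rewrite /g; case: ifP => // /negbT; rewrite -ltNge => lt.
  by rewrite q1' ?q2' //; lra.
have E2 t : la - la * e1 < t -> f2 t = g t.
  move=> h; rewrite /g; case: ifP => // tl.
  by rewrite q1' ?q2' //; lra.
have near t : exists (B : set R) (g' : R -> M), [/\ open B, B t, forall u, B u -> g' u = g u & smooth_curve A g'] /\
    speed2 g' t <= (s1 + s2) ^+ 2.
  have [tl|tl] := ltP t (la + mu * e2).
    exists [set u | u < la + mu * e2], f1; split; first by split => //; exact: open_lt.
    rewrite /f1 speed2_affine // /la; apply: (@le_trans _ _ (((s1 / (s1 + s2))^-1) ^+ 2 * s1 ^+ 2)).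
      by rewrite ler_wpM2l ?sqr_ge0.
    by rewrite -exprMn le_eqVlt; apply/orP; left; apply/eqP; congr (_ ^+ 2); field; rewrite !gt_eqF.
  exists [set u | la - la * e1 < u], f2; split; first by split; [exact: open_gt|rewrite /=; lra|exact: E2|].
  rewrite /f2 speed2_affine // /mu; apply: (@le_trans _ _ (((s2 / (s1 + s2))^-1) ^+ 2 * s2 ^+ 2)).
    by rewrite ler_wpM2l ?sqr_ge0.
  by rewrite -exprMn le_eqVlt; apply/orP; left; apply/eqP; congr (_ ^+ 2); field; rewrite !gt_eqF.
exists g, (Num.min (la * e1) (Num.min (mu * e2) (mu / 2))); split; first split.
- by rewrite !lt_min le1 me2 divr_gt0.
- by apply: smooth_curve_local => t; have [B [g' [H _]]] := near t; exists B, g'.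
- move=> t; rewrite !le_min => /and3P[t1 t2 _]; rewrite -E1; last by lra.
  by rewrite /f1 addr0; apply: p1; rewrite mulrC ler_pdivrMr // mulrC.
- move=> t tm; have [m1 m2] : 1 - mu * e2 <= t /\ 1 - mu / 2 <= t.
    split; apply: le_trans tm; rewrite lerD2l lerN2 !ge_min lexx ?orbT //.
  rewrite -E2; last by lra.
  rewrite /f2; apply: q2.
  have -> : mu^-1 * t + - la / mu = (t - la) / mu by ring.
  rewrite ler_pdivlMr //; lra.
move=> t; have [B [g' [[oB Bt E _] le]]] := near t.
by rewrite (speed2_near oB Bt E).
Qed.

End Curves.

Section StepCurves.
Context {R : realType} {n : nat} {M : topologicalType}.
Variable A : smooth_atlas R n M.
Local Notation V := 'rV[R]_n.
Local Notation E := 'rV[R]_n.+2.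
Variables (phi eta : M -> E) (kappa : M -> 'I_n -> R).
Hypothesis n3 : (3 <= n)%N.
Hypothesis phiI : immersed_hypersurface A phi.
Hypothesis etaN : unit_normal A phi eta.
Hypothesis kappaP : forall p, principal_curvatures A phi eta p (kappa p).
Hypothesis kappa1 : forall p i, kappa p i < 1.
Hypothesis kappaS : forall p, \sum_(i < n) 2 / (1 - kappa p i) <= n%:R.
Variables (K K' : E) (w : 'I_n -> E).
Hypothesis frame : null_frame K K' w.
Local Notation vis := (visible phi eta K).
Local Notation X := (stereo phi eta K w).
Local Notation h := (height phi eta K).
Local Notation W := (fun p => factor phi eta K p ^+ 2).

Lemma open_section_dom (D : set V) s (d : chart A) : open D -> section_on vis X D s ->
  open (D `&` s @^-1` dom d).
Proof.
move=> oD sS; rewrite openE => y [Dy dy]; apply: filterI; first exact: open_nbhs_nbhs.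
have [sc _ _] := sS y Dy.
by apply: sc; apply: open_nbhs_nbhs; split => //; exact: dom_open.
Qed.

Lemma height_le_factor p : vis p -> h p <= W p.
Proof.
move=> vp; rewrite -[h p]sqr_sqrtr ?(ltW vp) // lerXn2r ?nnegrE ?sqrtr_ge0 ?profile_ge //.
by apply: le_trans (sqrtr_ge0 (h p)) _; exact: profile_ge.
Qed.

Lemma line_is_derive (chi : R -> R) (a v : V) t : derivable chi t 1 ->
  is_derive t (1 : R) (fun u => a + chi u *: v) ('D_1 chi t *: v).
Proof.
move=> d; apply: isd_mx => i j; rewrite ord1 mxE.
have e : (fun u => (a + chi u *: v) 0 j) = (fun u => a 0 j + v 0 j * chi u).
  by apply/funext => u; rewrite !mxE [chi u * _]mulrC.
rewrite e; refine (isd_eq (isdD (isdC (a 0 j) t (1 : R)) (isdZ (v 0 j) (derivableP d))) _).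
by rewrite add0r mulrC.
Qed.

(** The lift of the segment is traversed with parameter [chi]. By [section_metric_phi] the induced
    speed is at most n / 2 * height times the coordinate speed, and the height is at most [W]. *)
Lemma step_flat_curve (chi : R -> R) (C : R) p v q c : smooth_on setT chi -> (forall t, 0 <= chi t <= 1) ->
  (forall t, t <= 4^-1 -> chi t = 0) -> (forall t, 3 / 4 <= t -> chi t = 1) -> 0 < C ->
  (forall t, `|'D_1 chi t| <= C) ->
  step vis X W p v q c -> flat_curve A phi p q (C * (n%:R / 2) * (enorm v * c)).
Proof.
move=> chiS chi01 chi0 chi1 C0 chiC [v0 [pi [[pi0 il] pi1 piw]]].
pose g t := pi (chi t); pose l u := X p + chi u *: v.
have lC k : Ck_on k setT l.
  apply/(Ck_rV _ _ openT) => j.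
  apply: (Ck_eq openT (f := fun u => X p 0 j + chi u * v 0 j)); first by move=> u _; rewrite !mxE.
  by apply: (CkD openT); [exact: Ck_cst|apply: (CkM openT); [exact: chiS|exact: Ck_cst]].
have gC : continuous g.
  move=> t; have [pc _ _] := il _ (chi01 t).
  exact: (continuous_comp (Ck_cont (chiS 0%N) (x := t) I) pc).
have loc t : exists (r : R) (s : V -> M) (B : set R),
    [/\ open B, B t, section_on vis X (nball (X (g t)) r) s & smooth_section A (nball (X (g t)) r) s] /\
    forall u, B u -> nball (X (g t)) r (l u) /\ s (l u) = g u.
  have [pc vt _] := il _ (chi01 t).
  have [r [s [U [[r0 sS oU Ut] [sU ss]]]]] := flat_section phiI etaN kappaP kappa1 frame vt.
  exists r, s, (g @^-1` U); split; first split => //.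
    by apply: open_comp => // u _; exact: gC.
  move=> u /sU; have [_ _ xu] := il _ (chi01 u).
  by rewrite /g xu.
have gS : smooth_curve A g.
  split => // d k; apply: Ck_near => t dt; have [r [s [B [[oB Bt sS ss] H]]]] := loc t.
  have oD : open (nball (X (g t)) r) by rewrite openE => y; exact: nballP.
  exists (B `&` g @^-1` dom d), ((coords d \o s) \o l); split.
  - by apply: openI => //; exact: open_curve_dom.
  - by [].
  - by move=> u [/H[_ /= ->] _].
  have oB' : open (B `&` g @^-1` dom d) by apply: openI => //; exact: open_curve_dom.
  have lB : Ck_on k (B `&` g @^-1` dom d) l by apply: Ck_sub (lC k).
  have HB u : (B `&` g @^-1` dom d) u -> (nball (X (g t)) r `&` s @^-1` dom d) (l u).
    by move=> [/H[h1 h2] du]; split => //=; rewrite h2.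
  have hh := Ck_compV (open_section_dom (d := d) oD sS) oB' HB (ss.2 d k) lB.
  exact: hh.
exists g, 4^-1; split; first split => //.
- by move=> t t4; rewrite /g chi0 // pi0.
- by move=> t t4; rewrite /g chi1 ?pi1 //; lra.
move=> t; have [r [s [B [[oB Bt sS ss] H]]]] := loc t.
have oD : open (nball (X (g t)) r) by rewrite openE => y; exact: nballP.
have [lt st] := H t Bt.
have dchi : derivable chi t 1 by exact: (Ck_derivable (chiS 1%N)).
have dl := line_is_derive (X p) v dchi.
have -> : speed2 phi g t = lorentz ('D_('D_1 chi t *: v) (phi \o s) (l t)) ('D_('D_1 chi t *: v) (phi \o s) (l t)).
  rewrite /speed2; have -> // : 'D_1 (phi \o g) t = 'D_('D_1 chi t *: v) (phi \o s) (l t).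
  have -> : 'D_1 (phi \o g) t = 'D_1 ((phi \o s) \o l) t.
    by apply: near_eq_derive; apply: filterS (open_nbhs_nbhs (conj oB Bt)) => u /H[_ /= ->].
  rewrite (@derive_val _ _ _ _ _ _ _ (chain_ruleV oD (ss.1 _ _ (phi_smooth phiI) 1%N) lt (@ex_derive _ _ _ _ _ _ _ dl))).
  by rewrite (@derive_val _ _ _ _ _ _ _ dl).
apply: le_trans (section_metric_phi phiI etaN kappaP kappa1 kappaS frame oD sS ss _ lt) _.
rewrite st dotZl dotZr -enorm_sq.
have [_ vt _] := il _ (chi01 t).
have hc : h (g t) <= c by apply: le_trans (height_le_factor vt) _; exact: piw.
have h0 : 0 <= h (g t) by exact: ltW.
have -> : (n%:R / 2 * h (g t)) ^+ 2 * ('D_1 chi t * ('D_1 chi t * enorm v ^+ 2)) =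
  (`|'D_1 chi t| * (n%:R / 2) * (enorm v * h (g t))) ^+ 2.
  rewrite !exprMn real_normK ?num_real //; ring.
have n20 : 0 <= n%:R / 2 :> R by rewrite divr_ge0.
have c0 : 0 <= c by exact: le_trans hc.
rewrite lerXn2r ?nnegrE ?mulr_ge0 ?enorm_ge0 // ?(ltW C0) //.
by rewrite !ler_pM ?mulr_ge0 ?enorm_ge0 // ?ler_wpM2r ?ler_wpM2l ?enorm_ge0.
Qed.

(** The margin [d] is there because concatenation needs positive speed bounds, whereas a trivial
    chain may cost 0. *)
Lemma reach_flat_curve : exists2 C : R, 0 < C & forall p q c (d : R), 0 < d ->
  reach vis X W 1 p q c -> flat_curve A phi p q (C * c + d).
Proof.
have [chi [C [chiS chi01 chi0 chi1 [C0 chiC]]]] := @smooth_step R.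
have n0 : 0 < n%:R :> R by rewrite ltr0n (leq_trans _ n3).
have C20 : 0 < C * (n%:R / 2) by rewrite !mulr_gt0.
exists (C * (n%:R / 2)) => // p q c d d0; elim=> [{}p {}c m c0|{}p v p' u {}q {}c c2 st vh r IH le].
  exact: flat_curve_cst.
have f1 := step_flat_curve chiS chi01 chi0 chi1 C0 chiC st.
have W1 z : vis z -> 1 <= W z.
  by move=> vz; rewrite expr_ge1 // ltW // ?(lt_trans ltr01) // profile_gt1.
have [_ _ u1 _] := stepM W1 st; have [_ _ c0] := reachM W1 r.
have v0 : 0 < enorm v by apply: enorm_gt0; case: st.
have s1 : 0 < C * (n%:R / 2) * (enorm v * u) by rewrite !mulr_gt0 // (lt_le_trans ltr01).
have s2 : 0 < C * (n%:R / 2) * c + d by rewrite ltr_wpDl // mulr_ge0 // ltW.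
apply: flat_curve_mono (flat_curve_cat (phi_smooth phiI) s1 s2 f1 IH).
  by rewrite addr_ge0 // ltW.
by rewrite addrA -mulrDr lerD2r ler_wpM2l // ltW.
Qed.

Lemma speed_cont gamma : smooth_curve A gamma -> continuous (fun t => Num.sqrt (speed2 phi gamma t)).
Proof.
move=> gS t; have gC := curve_Ck gS (phi_smooth phiI) 1%N.
have sC : Ck_on 0 setT (speed2 phi gamma) by apply: (Ck_lorentz openT); exact: Ck_deriv.
exact: (continuous_comp (Ck_cont sC (x := t) I) (@sqrt_continuous R _)).
Qed.

Lemma curve_lengthE gamma : curve_length phi gamma =
  (\int[lebesgue_measure]_(t in `[0%R, 1%R]) (Num.sqrt (speed2 phi gamma t))%:E)%E.
Proof. by apply: eq_integral => t _; rewrite /= derive1E. Qed.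

Lemma flat_curve_dist p q sp : 0 <= sp -> flat_curve A phi p q sp -> (induced_dist A phi p q <= sp%:E)%E.
Proof.
move=> s0 [g [e [[e0 gS gp gq] gv]]].
apply: (@le_trans _ _ (curve_length phi g)).
  apply: ereal_inf_lbound; exists g => //; split => //; first by apply: gp; exact: ltW.
  by apply: gq; rewrite gerBl ltW.
rewrite curve_lengthE; apply: integral_le_cst; first exact: speed_cont.
move=> t; rewrite sqrtr_ge0 /= -[leRHS]ger0_norm // -sqrtr_sqr ler_wsqrtr //.
Qed.

End StepCurves.

(** * The induced distance controls the topology *)

Section Klein.
Context {R : realType} {m : nat}.
Implicit Types z v : 'rV[R]_m.+1.

(* 1/z_0 and the Klein coordinates z_i/z_0, which are Lipschitz for the hyperbolic metric *)
Definition klein z (i : 'I_m.+1) : R := (if i == ord0 then 1 else z 0 i) / z 0 ord0.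

Lemma hyperbolic_dot z : hyperbolic_space z -> let zs := \row_i z 0 (lift ord0 i) in
  dot zs zs = z 0 ord0 ^+ 2 - 1.
Proof.
move=> [h _] /=; have -> : dot (\row_i z 0 (lift ord0 i)) (\row_i z 0 (lift ord0 i)) = \sum_i z 0 (lift ord0 i) * z 0 (lift ord0 i).
  by apply: eq_bigr => i _; rewrite !mxE.
by move: h; rewrite /lorentz; lra.
Qed.

Lemma klein_inj z z' : hyperbolic_space z -> hyperbolic_space z' -> (forall i, klein z i = klein z' i) -> z = z'.
Proof.
move=> [_ z0] [_ z0'] e.
have e0 : z 0 ord0 = z' 0 ord0.
  by have := e ord0; rewrite /klein eqxx !mul1r => /invr_inj.
apply/rowP => i; have := e i; rewrite /klein; case: eqP => [-> //|_].
by rewrite e0 => /(mulIf _); apply; rewrite invr_eq0 gt_eqF.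
Qed.

(** Orthogonality to [z] and Cauchy-Schwarz in the spatial coordinates give v_0^2 <= (z_0^2 - 1) <v,
    v>. Hence <v, v> >= 0, and every coordinate of [v] is at most z_0 sqrt <v, v>. *)
Lemma klein_speed z v i : hyperbolic_space z -> lorentz z v = 0 ->
  let dk := if i == ord0 then - v 0 ord0 / z 0 ord0 ^+ 2 else (v 0 i * z 0 ord0 - z 0 i * v 0 ord0) / z 0 ord0 ^+ 2 in
  0 <= lorentz v v /\ `|dk| <= 2 * Num.sqrt (lorentz v v).
Proof.
move=> hz zv; have hd := hyperbolic_dot hz; have [_ z0] := hz.
pose zs : 'rV[R]_m := \row_i z 0 (lift ord0 i); pose vs : 'rV[R]_m := \row_i v 0 (lift ord0 i).
rewrite -/zs in hd; set a := z 0 ord0 in z0 hd *; set b := v 0 ord0.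
have zv' : dot zs vs = a * b.
  have -> : dot zs vs = \sum_i z 0 (lift ord0 i) * v 0 (lift ord0 i) by apply: eq_bigr => j _; rewrite !mxE.
  by move: zv; rewrite /lorentz -/a -/b; lra.
set S := lorentz v v; have SE : dot vs vs = S + b ^+ 2.
  have -> : dot vs vs = \sum_i v 0 (lift ord0 i) * v 0 (lift ord0 i) by apply: eq_bigr => j _; rewrite !mxE.
  by rewrite /S /lorentz -/b; ring.
have a1 : 1 <= a ^+ 2 by have := dot_ge0 zs; rewrite hd; lra.
have a1' : 1 <= a by rewrite -(ler_sqr (x := 1)) ?nnegrE ?expr1n // ltW.
have CS : (a * b) ^+ 2 <= (a ^+ 2 - 1) * (S + b ^+ 2) by rewrite -zv' -hd -SE; exact: dot_CS.
have bS : b ^+ 2 <= (a ^+ 2 - 1) * S by move: CS; rewrite exprMn; move: (a ^+ 2) (b ^+ 2) => x y; nra.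
have S0 : 0 <= S.
  have h : 0 <= a ^+ 2 * S.
    have : a ^+ 2 * S = (a ^+ 2 - 1) * S + S by ring.
    have : 0 <= b ^+ 2 by exact: sqr_ge0.
    have : 0 <= S + b ^+ 2 by rewrite -SE dot_ge0.
    lra.
  by rewrite -(pmulr_rge0 S (lt_le_trans ltr01 a1)).
split => //; have s0 := sqrtr_ge0 S; have sS : Num.sqrt S ^+ 2 = S by rewrite sqr_sqrtr.
set s := Num.sqrt S in s0 sS *.
have sq (x y : R) : 0 <= y -> x ^+ 2 <= y ^+ 2 -> `|x| <= y.
  by move=> y0 xy; rewrite -(ler_sqr (x := `|x|)) ?nnegrE // real_normK ?num_real.
have as0 : 0 <= a * s by rewrite mulr_ge0 // ltW.
have bL : `|b| <= a * s.
  apply: sq => //; rewrite exprMn sS; apply: le_trans bS _; rewrite mulrBl mul1r; lra.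
have a2 : 0 < a ^+ 2 by rewrite exprn_gt0.
case: ifP => [_|/negbT i0].
  rewrite normrM normrN normfV (gtr0_norm a2) ler_pdivrMr //; apply: le_trans bL _.
  have : a * s <= a ^+ 2 * s by rewrite ler_wpM2r // expr2 ler_peMl // ltW.
  have : 0 <= a ^+ 2 * s by rewrite mulr_ge0 // ltW.
  lra.
have [j ij] : exists j, i = lift ord0 j.
  by case: (unliftP ord0 i) i0 => [j ->|->]; [exists j|rewrite eqxx].
have zsj : z 0 i = zs 0 j by rewrite mxE ij.
have vsj : v 0 i = vs 0 j by rewrite mxE ij.
have cz : `|z 0 i| <= a.
  apply: sq; first exact: ltW.
  rewrite zsj; apply: le_trans (_ : dot zs zs <= _); last by rewrite hd; lra.
  by rewrite -enorm_sq -(real_normK (num_real (zs 0 j))) lerXn2r ?nnegrE ?enorm_ge0 ?enorm_coord.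
have cv : `|v 0 i| <= a * s.
  apply: sq => //; rewrite vsj; apply: le_trans (_ : dot vs vs <= _); last by rewrite SE exprMn sS; lra.
  by rewrite -enorm_sq -(real_normK (num_real (vs 0 j))) lerXn2r ?nnegrE ?enorm_ge0 ?enorm_coord.
rewrite normrM normfV (gtr0_norm a2) ler_pdivrMr //; apply: le_trans (ler_normB _ _) _.
rewrite !normrM (gtr0_norm z0).
have h1 : `|v 0 i| * a <= a * s * a by rewrite ler_wpM2r // ltW.
have h2 : `|z 0 i| * `|b| <= a * (a * s) by rewrite ler_pM.
have -> : 2 * s * a ^+ 2 = a * s * a + a * (a * s) by ring.
exact: lerD.
Qed.

End Klein.

Section DistanceTopology.
Context {R : realType} {n : nat} {M : topologicalType}.
Variable A : smooth_atlas R n M.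
Local Notation V := 'rV[R]_n.
Local Notation E := 'rV[R]_n.+2.
Variables (phi : M -> E).
Hypothesis hM : hausdorff_space M.
Hypothesis phiI : immersed_hypersurface A phi.

Let phiS : smooth_map A phi. Proof. by case: phiI => -[]. Qed.
Let phiH p : hyperbolic_space (phi p). Proof. by case: phiI. Qed.

Lemma curve_klein gamma i a b : smooth_curve A gamma -> 0 <= a -> a < b -> b <= 1 ->
  (`|klein (phi (gamma b)) i - klein (phi (gamma a)) i|%:E <= 2%:E * curve_length phi gamma)%E.
Proof.
move=> gS a0 ab b1; pose Phi := phi \o gamma.
have PC k : Ck_on k setT Phi by exact: curve_Ck gS phiS k.
have P0 t : Phi t 0 ord0 != 0 by rewrite gt_eqF //; case: (phiH (gamma t)).
have PCi k j : Ck_on k setT (fun t => Phi t 0 j) by have /(Ck_rV _ _ openT) := PC k; apply.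
have kC k : Ck_on k setT (fun t => klein (Phi t) i).
  rewrite /klein; apply: (CkM openT); last by apply: (CkV openT) => // t _; exact: P0.
  by case: (i == ord0); [exact: Ck_cst|exact: PCi].
have dP t : is_derive t (1 : R) Phi ('D_1 Phi t) by apply: derivableP; exact: (Ck_derivable (PC 1%N)).
have dPi t j : is_derive t (1 : R) (fun t => Phi t 0 j) (('D_1 Phi t) 0 j).
  exact: (isd_coord 0 j (@ex_derive _ _ _ _ _ _ _ (dP t))).
have tang t : lorentz (Phi t) ('D_1 Phi t) = 0.
  have h0 u : setT u -> lorentz (Phi u) (Phi u) + 1 = 0 by move=> _; rewrite (phiH (gamma u)).1 addNr.
  have := isd_zero openT (x := t) I h0 (isdD (isd_lorentz (dP t) (dP t)) (isdC (1 : R) t 1)).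
  by rewrite (lorentzC ('D_1 Phi t)) addr0; lra.
have kD t : 'D_1 (fun t => klein (Phi t) i) t = if i == ord0 then - ('D_1 Phi t) 0 ord0 / Phi t 0 ord0 ^+ 2
    else (('D_1 Phi t) 0 i * Phi t 0 ord0 - Phi t 0 i * ('D_1 Phi t) 0 ord0) / Phi t 0 ord0 ^+ 2.
  have dV := isdV (P0 t) (dPi t ord0); rewrite /klein; case: ifP => _.
    rewrite (@derive_val _ _ _ _ _ _ _ (isdM (isdC (1 : R) t 1) dV)); ring.
  by rewrite (@derive_val _ _ _ _ _ _ _ (isdM (dPi t i) dV)); field.
rewrite curve_lengthE; apply: (@integral_ge_variation R _ (fun t => klein (Phi t) i) ('D_1 (fun t => klein (Phi t) i))) => //.
- exact: (speed_cont phiI).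
- by move=> t; have d0 := Ck_deriv (1 : R) (kC 1%N); exact: (Ck_cont d0 (x := t) I).
- by move=> t; apply: derivableP; exact: (Ck_derivable (kC 1%N)).
- by move=> t; rewrite kD; have [_] := klein_speed i (phiH (gamma t)) (tang t).
Qed.

(** Pairing phi with its partial derivatives at [l] gives a map between spaces of equal dimension,
    whose derivative there is the Gram matrix of an injective differential; the inverse function
    theorem applies to it. *)
Lemma immersion_inj (c : chart A) l : dom c l -> exists2 B : set V, nbhs (coords c l) B &
  forall x, B x -> image c x /\ (phi (param c x) = phi l -> x = coords c l).
Proof.
move=> dl; pose g := phi \o param c; set x0 := coords c l.
have oI := @open_image _ _ _ A c; have ix0 : image c x0 by exact: dom_image.
pose f x : V := \row_j dot ('D_(bas j) g x0) (g x).
have gC k : Ck_on k (image c) g by exact: phiS.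
have gCi k j : Ck_on k (image c) (fun x => g x 0 j) by have /(Ck_rV _ _ oI) := gC k; apply.
have fj j : (fun x => f x 0 j) = (fun x => \sum_i ('D_(bas j) g x0) 0 i * g x 0 i).
  by apply/funext => x; rewrite mxE.
have fC : Ck_on 1 (image c) f.
  apply/(Ck_rV _ _ oI) => j; rewrite fj; apply: (Ck_sum _ oI) => i _.
  by apply: (CkM oI); [exact: Ck_cst|exact: gCi].
have inj (v : V) : 'D_v f x0 = 0 -> v = 0.
  move=> fv; have dg : is_derive x0 v g ('D_v g x0) by apply: derivableP; exact: (Ck_derivable (gC 1%N)).
  have h j : dot ('D_(bas j) g x0) ('D_v g x0) = 0.
    have df : derivable f x0 v by exact: (Ck_derivable fC).
    have := congr1 (fun u : V => u 0 j) fv; rewrite mxE -(@derive_val _ _ _ _ _ _ _ (isd_coord 0 j df)) fj.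
    rewrite (@derive_val _ _ _ _ _ _ _ (isd_sum (index_enum _) (fun i => isdZ (('D_(bas j) g x0) 0 i) (isd_coord 0 i (@ex_derive _ _ _ _ _ _ _ dg))))).
    by [].
  have [[_ imm] _] := phiI; apply: (imm c l dl); rewrite /tdiff -/g -/x0.
  have z : dot ('D_v g x0) ('D_v g x0) = 0.
    rewrite {1}(C1_derive_sumV oI (gC 1%N) v ix0).
    have -> : dot (\sum_j v 0 j *: 'D_(bas j) g x0) ('D_v g x0) = \sum_j v 0 j * dot ('D_(bas j) g x0) ('D_v g x0).
      rewrite /dot; under eq_bigr do rewrite summxE mulr_suml.
      by rewrite exchange_big /=; apply: eq_bigr => j _; rewrite mulr_sumr; apply: eq_bigr => i _; rewrite mxE mulrA.
    by rewrite big1 // => j _; rewrite h mulr0.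
  by apply/eqP; apply: contraT => /enorm_gt0; rewrite /enorm z sqrtr0 ltxx.
have [r [s [B [L [[r0 oB Bx0 BI] [sf _ _ _]]]]]] := local_inverse oI fC ix0 inj.
exists B; first exact: open_nbhs_nbhs.
move=> x Bx; split; first exact: BI.
move=> e; have [_ <-] := sf x Bx; have [_ <-] := sf x0 Bx0; congr (s _).
by apply/rowP => j; rewrite !mxE /g /= e coordsK.
Qed.

(** A curve reaching [l] from outside a small chart ball crosses the image of the sphere [S]. By
    local injectivity and compactness the Klein coordinates there differ from those at l by at least
    [mu] in total, and by [curve_klein] changing them costs length. *)
Lemma dist_topology l (U : set M) : nbhs l U -> exists2 de : R, 0 < de &
  forall q, (induced_dist A phi q l < de%:E)%E -> U q.
Proof.
move=> Ul; have [c dl] := dom_cover A l; set x0 := coords c l.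
have [B nB HB] := immersion_inj dl.
have ix0 : image c x0 by exact: dom_image.
have nU : nbhs x0 (param c @^-1` U) by apply: (param_continuous ix0); rewrite coordsK.
have [r r0 Hr] := nbhs_dist (filterI nB nU).
pose rho := r / 2; have rho0 : 0 < rho by rewrite divr_gt0.
have ball_in x : `|x - x0| <= rho -> [/\ image c x, phi (param c x) = phi l -> x = x0 & U (param c x)].
  move=> h; have [|Bx Ux] := Hr x; first by rewrite (le_lt_trans h) // /rho; lra.
  by have [h1 h2] := HB x Bx; split.
pose D : set V := [set x | `|x - x0| <= rho]; pose S : set V := [set x | `|x - x0| = rho].
have nC : continuous (fun x : V => `|x - x0|).
  by move=> x; apply: continuous_comp; [apply: continuousB; [exact: cvg_id|exact: cst_continuous]|exact: norm_continuous].
have bD z : `|x0| + rho < z -> forall x, D x -> `|x| <= z.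
  move=> zr x /= xD; rewrite -(subrK x0 x); apply: le_trans (ler_normD _ _) _.
  by apply: le_trans (ltW zr); rewrite addrC lerD2l.
have cD : compact D.
  apply: bounded_closed_compact; first by exists (`|x0| + rho); split; [exact: num_real|exact: bD].
  by apply: (closed_comp (f := fun x : V => `|x - x0|) (D := [set y | y <= rho])); [move=> x _; exact: nC|exact: closed_le].
have cS : compact S.
  apply: bounded_closed_compact.
    exists (`|x0| + rho); split; first exact: num_real.
    by move=> z zr x xS; apply: (bD z zr x); rewrite /D /=; move: xS => /= ->.
  by apply: (closed_comp (f := fun x : V => `|x - x0|) (D := [set y | y = rho])); [move=> x _; exact: nC|exact: closed_eq].
pose d x := \sum_i `|klein (phi l) i - klein (phi (param c x)) i|.
have dC x : D x -> {for x, continuous d}.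
  move=> /ball_in[ix _ _]; apply: (@cvg_sum R _ _ (nbhs x)) => i.
  apply: cvg_norm; apply: cvgB; first exact: cvg_cst.
  have pC j : {for x, continuous (fun x => (phi \o param c) x 0 j)}.
    have g := Ck_cont (phiS c 0%N) ix.
    exact: (continuous_comp g (@coord_continuous _ _ _ 0 j _)).
  apply: cvgM; last by apply: cvgV; [rewrite gt_eqF //; case: (phiH (param c x))|exact: (pC ord0)].
  by case: (i == ord0); [exact: cvg_cst|exact: (pC i)].
have [mu mu0 muS] : exists2 mu : R, 0 < mu & forall x, S x -> mu <= d x.
  pose P (T : set V) := exists2 mu : R, 0 < mu & forall x, T x -> S x -> mu <= d x.
  suff [mu mu0 H] : P S by exists mu => // x Sx; apply: H.
  apply: compact_ideal cS _ _ _ _.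
  - by exists 1.
  - move=> T T' [a a0 Ha] [b b0 Hb]; exists (Num.min a b); first by rewrite lt_min a0.
    by move=> x [Tx|Tx] Sx; rewrite ge_min ?(Ha x Tx Sx) // (Hb x Tx Sx) orbT.
  - by move=> T T' TT [a a0 H]; exists a => // x /TT; apply: H.
  move=> x Sx; have Dx : D x by rewrite /D /=; move: Sx => /= ->.
  have [ix inj _] := ball_in x Dx.
  have dx0 : 0 < d x.
    rewrite lt_neqAle sumr_ge0 // andbT; apply/eqP => /esym dx.
    have e : phi (param c x) = phi l.
      apply: klein_inj => // i; apply/eqP; rewrite eq_sym -subr_eq0 -normr_eq0; apply/eqP.
      by apply: (psumr_eq0P _ dx).
    by move: Sx; rewrite /S /= (inj e) subrr normr0 => h; move: rho0; rewrite -h ltxx.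
  have [|e e0 He] := continuous_dist (dC x Dx) (e := d x / 2); first by rewrite divr_gt0.
  exists (nball x e); first by apply: nballP; rewrite /nball /= subrr normr0.
  exists (d x / 2); first by rewrite divr_gt0.
  by move=> z /He; rewrite ltr_norml => /andP[]; lra.
(* A change of at most 2 de in each of the n + 2 Klein coordinates adds up to mu / 2 only. *)
pose de := mu / (4 * n.+2%:R).
have de0 : 0 < de by rewrite divr_gt0 // mulr_gt0.
exists de => // q /ereal_inf_lt[_ [gamma [gS g0 g1] <-] len].
pose Ob := dom c `&` coords c @^-1` [set x | `|x - x0| < rho].
suff Oq : Ob q.
  by case: Oq => dq /ltW /ball_in[_ _]; rewrite coordsK.
apply: contrapT => nq.
have no_cross t : 0 <= t <= 1 -> ~ (param c @` S) (gamma t).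
  move=> /andP[t0 t1] [x Sx gx].
  (* [curve_klein] needs a nontrivial time interval. At the final time the curve is at [l], which is
     not on the sphere. *)
  have [t1'|t1'] := ltP t 1; last first.
    have t1E : t = 1 by apply/eqP; rewrite eq_le t1.
    have [ix inj _] := ball_in x (ltac:(by move: Sx => /= ->)).
    have xx : x = x0 by apply: inj; rewrite gx t1E g1.
    by move: Sx; rewrite /S /= xx subrr normr0 => h; move: rho0; rewrite -h ltxx.
  have hi i : `|klein (phi l) i - klein (phi (param c x)) i| <= 2 * de.
    have := curve_klein i gS t0 t1' (lexx 1); rewrite g1 -gx => h.
    rewrite -lee_fin; apply: le_trans h _; rewrite EFinM lee_wpmul2l ?lee_fin //; exact: ltW.
  have : d x <= \sum_(i < n.+2) 2 * de by apply: ler_sum => i _; exact: hi.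
  rewrite sumr_const card_ord -[_ *+ _]mulr_natl => h.
  have := muS x Sx; have : n.+2%:R * (2 * de) = mu / 2 by rewrite /de; move: (n.+2%:R : R) (ltr0Sn R n.+1) => N N0; field; rewrite gt_eqF.
  by move: h mu0; clear; lra.
have oO : open Ob.
  rewrite openE => p [dp xp]; apply: filterI; first by apply: open_nbhs_nbhs; split => //; exact: dom_open.
  by apply: (coords_continuous dp); apply: (nballP (x := x0)).
have cC : closed (param c @` D).
  apply: compact_closed => //; apply: continuous_compact => //.
  apply: continuous_in_subspaceT => x; rewrite inE => /ball_in[ix _ _].
  exact: (param_continuous ix).
have split p : (param c @` D) p -> Ob p \/ (param c @` S) p.
  move=> [x Dx <-]; have [ix _ _] := ball_in x Dx; have [dx xE] := image_dom ix.
  move: Dx; rewrite /D /= le_eqVlt => /orP[/eqP xS|xO]; [right|left]; first by exists x.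
  by split => //=; rewrite xE.
have [gC _] := gS.
have : ~ Ob (gamma 1).
  apply: (itv01_ind (P := fun t => ~ Ob (gamma t))); rewrite ?g0 //; last by rewrite ler01 lexx.
  move=> s s01; have [Os|nOs] := pselect (Ob (gamma s)).
    have nb : nbhs s (gamma @^-1` Ob) by apply: gC; exact: open_nbhs_nbhs.
    have [e e0 He] := nbhs_dist nb.
    by exists e => // t t' _ _ /He Ot _ /(_ Ot).
  have nD : ~ (param c @` D) (gamma s) by move=> /split[//|]; exact: no_cross.
  have nb : nbhs s (gamma @^-1` (~` (param c @` D))).
    by apply: gC; apply: open_nbhs_nbhs; split => //; exact: closed_openC.
  have [e e0 He] := nbhs_dist nb.
  exists e => // t t' _ _ _ /He nt' _ [dO xO]; apply: nt'; exists (coords c (gamma t')); last by rewrite coordsK.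
  exact: ltW.
by rewrite g1; apply; split => //=; rewrite subrr normr0.
Qed.

End DistanceTopology.

(** * Completeness away from the fibre *)

Section Completeness.
Context {R : realType} {n : nat} {M : topologicalType}.
Variable A : smooth_atlas R n M.
Local Notation V := 'rV[R]_n.
Local Notation E := 'rV[R]_n.+2.
Variables (phi eta : M -> E) (kappa : M -> 'I_n -> R).
Hypothesis n3 : (3 <= n)%N.
Hypothesis hM : hausdorff_space M.
Hypothesis phiI : immersed_hypersurface A phi.
Hypothesis etaN : unit_normal A phi eta.
Hypothesis phi_complete : complete_hypersurface A phi.
Hypothesis kappaP : forall p, principal_curvatures A phi eta p (kappa p).
Hypothesis kappa1 : forall p i, kappa p i < 1.
Hypothesis kappaS : forall p, \sum_(i < n) 2 / (1 - kappa p i) <= n%:R.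
Variables (K K' : E) (w : 'I_n -> E).
Hypothesis frame : null_frame K K' w.
Local Notation N := (lightcone_map phi eta).
Local Notation vis := (visible phi eta K).
Local Notation X := (stereo phi eta K w).
Local Notation h := (height phi eta K).
Local Notation W := (fun p => factor phi eta K p ^+ 2).

Lemma stereo_null p : vis p -> lorentz (N p) K' = - (h p * dot (X p) (X p)).
Proof.
move=> vp; have := @flat_null R n K K' w setT (fun=> N p) (fun=> X p) frame (fun x _ => lightcone_null phiI etaN p)
  (fun x _ => vp) (fun x j _ => stereoE w j vp) 0 I.
by move=> ->.
Qed.

Lemma factor_gt1 p : vis p -> 1 < factor phi eta K p.
Proof. exact: profile_gt1. Qed.

Lemma factor_sq_ge1 p : vis p -> 1 <= W p.
Proof. by move=> vp; have := factor_gt1 vp => h1; rewrite expr_ge1 // ltW // (lt_trans ltr01). Qed.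

Lemma lim_ge0 (g : M -> R) (y : nat -> M) l : continuous g -> y @ \oo --> l -> (forall k, 0 <= g (y k)) -> 0 <= g l.
Proof.
move=> gC yl g0; rewrite leNgt; apply/negP => gl.
have nU : nbhs l (g @^-1` [set x | x < 0]) by apply: gC; apply: open_nbhs_nbhs; split => //; exact: open_lt.
have ev : \forall k \near \oo, g (y k) < 0 := yl _ nU.
by have [k] := filter_ex ev; rewrite ltNge g0.
Qed.

(** By [reach_flat_curve] the sequence is Cauchy for the induced distance and has a limit in [M];
    the point is that the limit avoids the removed fibre. The coordinates [X] stay bounded along the
    sequence, so if the height tended to 0, then <N, K'> would too, and all components of N would
    vanish at the limit, against <phi, N> = -1. *)
Lemma complete_reach (y : nat -> M) : (forall k, reach vis X W 1 (y k) (y k.+1) (2^-1 ^+ k)) ->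
  exists2 l, vis l & y @ \oo --> l.
Proof.
move=> yr; have h20 k : 0 < 2^-1 ^+ k :> R by rewrite exprn_gt0.
have ry i j : reach vis X W 1 (y i) (y (i + j)%N) (2 * 2^-1 ^+ i - 2 * 2^-1 ^+ (i + j)).
  elim: j => [|j IH].
    by rewrite addn0 subrr; apply: reach0 => //; have [] := reachM factor_sq_ge1 (yr i).
  rewrite addnS; apply: reach_mono (reach_trans IH (yr _)) _.
  rewrite exprS le_eqVlt; apply/orP; left; apply/eqP.
  by move: (2^-1 ^+ (i + j)) (2^-1 ^+ i) => a b; field.
have ry' i j : (i <= j)%N -> reach vis X W 1 (y i) (y j) (2 * 2^-1 ^+ i).
  move=> ij; have := ry i (j - i)%N; rewrite subnKC // => r; apply: reach_mono r _.
  by rewrite gerBl mulr_ge0 // ltW.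
have [C C0 CP] := reach_flat_curve n3 phiI etaN kappaP kappa1 kappaS frame.
have small (e : R) : 0 < e -> exists k, 2^-1 ^+ k < e.
  move=> e0; have g : (fun k => (2^-1 : R) ^+ k) @ \oo --> (0 : R).
    by apply: cvg_expr; rewrite ger0_norm // invf_lt1 // ltr1n.
  have /cvgrPdist_lt /(_ e e0) ev := g; have [k] := filter_ex ev.
  by rewrite sub0r normrN gtr0_norm // => hk; exists k.
have [l yl] : exists l, forall e : R, 0 < e -> exists N0, forall i, (N0 <= i)%N -> (induced_dist A phi (y i) l < e%:E)%E.
  apply: phi_complete => e e0.
  have [k hk] := small (e / (8 * C)) (ltac:(by rewrite divr_gt0 // mulr_gt0)).
  have key i j : (k <= i)%N -> reach vis X W 1 (y i) (y j) (2 * 2^-1 ^+ k) -> (induced_dist A phi (y i) (y j) < e%:E)%E.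
    move=> ki r; have e2 : 0 < e / 2 by rewrite divr_gt0.
    have fc := CP _ _ _ (e / 2) e2 r.
    apply: le_lt_trans (flat_curve_dist phiI _ fc) _.
      by rewrite addr_ge0 ?mulr_ge0 // ?ltW // h20.
    rewrite lte_fin; move: hk; rewrite ltr_pdivlMr ?mulr_gt0 // => hk.
    have : C * (2 * 2^-1 ^+ k) = 2^-1 ^+ k * (8 * C) / 4 by field.
    by move: hk e0 => + + ->; lra.
  exists k => i j ki kj; apply: key => //.
  have mono a : (k <= a)%N -> 2 * 2^-1 ^+ a <= 2 * 2^-1 ^+ k :> R.
    by move=> ka; rewrite ler_pM2l // ler_wiXn2l // invf_le1 // ler1n.
  have [ij|ji] := leqP i j; first by apply: reach_mono (ry' _ _ ij) _; exact: mono.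
  by apply: (reach_sym factor_sq_ge1); apply: reach_mono (ry' _ _ (ltnW ji)) _; exact: mono.
have cl : y @ \oo --> l.
  move=> U nU; have [de de0 H] := dist_topology hM phiI nU.
  have [N0 HN] := yl de de0; exists N0 => // i /= Ni; apply: H; exact: HN.
exists l => //; rewrite /visible /= ltNge; apply/negP => hl.
have vy k : vis (y k) by have [] := reachM factor_sq_ge1 (yr k).
(* The whole sequence lies at cost at most 2 from its first point, which bounds the sup norm of X;
   the factor n passes to the Euclidean norm. *)
pose B := (n%:R * (`|X (y 0%N)| + 2)) ^+ 2.
have hy k : 0 <= h (y k) by exact: (ltW (vy k)).
have XB k : dot (X (y k)) (X (y k)) <= B.
  have := reach_dist factor_sq_ge1 (ry' 0%N k (leq0n k)); rewrite expr0 mulr1 => xd.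
  rewrite -enorm_sq lerXn2r ?nnegrE ?enorm_ge0 ?mulr_ge0 ?addr_ge0 //.
  apply: le_trans (enorm_norm _) _; rewrite ler_wpM2l //.
  by have := ler_normD (X (y k) - X (y 0%N)) (X (y 0%N)); rewrite subrK; lra.
have hC := height_cont phiI etaN (K := K); have kC := lorentz_N_cont phiI etaN (a := K').
have h0 : 0 <= h l by apply: (lim_ge0 (g := h) _ cl) => // k; exact: hy.
have g0 : 0 <= - lorentz (N l) K'.
  apply: (lim_ge0 (g := fun p => - lorentz (N p) K') _ cl) => [p|k]; first by apply: cvgN; exact: kC.
  by rewrite stereo_null // opprK mulr_ge0 ?dot_ge0 // hy.
have g1 : 0 <= B * h l + lorentz (N l) K'.
  apply: (lim_ge0 (g := fun p => B * h p + lorentz (N p) K') _ cl) => [p|k].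
    by apply: cvgD; [apply: cvgM; [exact: cvg_cst|exact: hC]|exact: kC].
  by rewrite stereo_null // [B * _]mulrC -mulrBr mulr_ge0 ?subr_ge0 // hy.
have hl0 : h l = 0 by apply/eqP; rewrite eq_le hl.
have kl0 : lorentz (N l) K = 0 by apply/eqP; rewrite -oppr_eq0; apply/eqP.
have kl1 : lorentz (N l) K' = 0 by move: g1; rewrite hl0 mulr0 add0r => g1; apply/eqP; rewrite eq_le g1 andbT -oppr_ge0.
have := lightcone_null phiI etaN l; rewrite frame kl0 kl1 !(mul0r, mulr0, addr0, oppr0, add0r) => s0.
have wl0 j : lorentz (N l) (w j) = 0.
  apply/eqP; rewrite -sqrf_eq0 expr2; apply/eqP.
  by apply: (psumr_eq0P _ s0) => // i _; rewrite -expr2 sqr_ge0.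
have := lorentz_phi_lightcone phiI etaN l; rewrite frame kl0 kl1 !(mul0r, mulr0, addr0, oppr0, add0r) big1.
  by move=> /eqP; rewrite eq_sym oppr_eq0 oner_eq0.
by move=> j _; rewrite wl0 mulr0.
Qed.

Lemma visible_good p r : vis p -> good vis (rball vis X W p r).
Proof.
move=> vp.
have XC q : vis q -> {for q, continuous X} by move=> vq; exact: (stereo_cont phiI etaN).
have WC q : vis q -> {for q, continuous W}.
  by move=> vq; apply: cvgM; exact: (factor_cont phiI etaN).
have fl := flat2_flat (flat2_visible n3 phiI etaN kappaP kappa1 kappaS frame).
by have := @proper R n M vis X W hM fl XC WC factor_sq_ge1 complete_reach p r vp.
Qed.

End Completeness.

(** * The ends at the fibres of the Gauss map *)

Section Inversion.
Context {R : realType} {n : nat}.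
Local Notation V := 'rV[R]_n.
Implicit Types x : V.

(** The transition map between stereographic coordinates from antipodal points. *)
Definition inversion x : V := (dot x x)^-1 *: x.

Lemma dot_gt0 x : x != 0 -> 0 < dot x x.
Proof. by move=> x0; rewrite -enorm_sq exprn_gt0 // enorm_gt0. Qed.

Lemma inversion_neq0 x : x != 0 -> inversion x != 0.
Proof. by move=> x0; rewrite scaler_eq0 negb_or x0 invr_eq0 gt_eqF // dot_gt0. Qed.

Lemma dot_inversion x : x != 0 -> dot (inversion x) (inversion x) = (dot x x)^-1.
Proof. by move=> /dot_gt0 d0; rewrite /inversion !dotE; field; rewrite gt_eqF. Qed.

Lemma inversionK x : x != 0 -> inversion (inversion x) = x.
Proof.
move=> x0; rewrite {1}/inversion dot_inversion // invrK /inversion scalerA divff ?scale1r // gt_eqF // dot_gt0 //.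
Qed.

Lemma norm_inversion x : x != 0 -> `|inversion x| <= `|x|^-1.
Proof.
move=> x0; have d0 := dot_gt0 x0; have n0 : 0 < `|x| by rewrite normr_gt0.
rewrite normrZ normfV (gtr0_norm d0) mulrC ler_pdivrMr // ler_pdivlMl // -expr2.
exact: dotxx_norm.
Qed.

Lemma norm_inversion_ge x : x != 0 -> (n%:R ^+ 2 * `|x|)^-1 <= `|inversion x|.
Proof.
move=> x0; have d0 := dot_gt0 x0; have nx : 0 < `|x| by rewrite normr_gt0.
have dn : dot x x <= n%:R ^+ 2 * `|x| ^+ 2.
  by rewrite -exprMn -enorm_sq lerXn2r ?nnegrE ?enorm_ge0 ?mulr_ge0 // enorm_norm.
have n20 : 0 < n%:R ^+ 2 * `|x| by rewrite -(pmulr_lgt0 _ nx) -mulrA -expr2 (lt_le_trans d0).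
have i0 : 0 < (dot x x)^-1 * `|x| by rewrite mulr_gt0 ?invr_gt0.
rewrite normrZ normfV (gtr0_norm d0) invf_ple ?posrE //.
by rewrite invfM invrK ler_pdivrMr // -mulrA -expr2.
Qed.

Lemma inversion_cont x : x != 0 -> {for x, continuous inversion}.
Proof.
move=> x0; apply: rV_cont => j.
have -> : (fun y => inversion y 0 j) = (fun y => (dot y y)^-1 * y 0 j) by apply/funext => y; rewrite mxE.
have dC : {for x, continuous (fun z => dot z z)}.
  by apply: (@cvg_sum R _ _ (nbhs x)) => i; apply: cvgM; exact: coord_continuous.
have iC := @cvgV _ _ (nbhs x) _ (fun z => dot z z) _ (lt0r_neq0 (dot_gt0 x0)) dC.
exact: (cvgM (iC _) (@coord_continuous _ _ _ 0 j x)).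
Qed.

End Inversion.

Section EndReach.
Context {R : realType} {n : nat} {M : topologicalType}.
Local Notation V := 'rV[R]_n.
Variables (M0 : set M) (X : M -> V) (f : M -> R).
Local Notation W := (fun p => f p ^+ 2).
Hypothesis n3 : (3 <= n)%N.
Hypothesis f1 : forall p, M0 p -> 1 < f p.

Let W1 p : M0 p -> 1 <= W p.
Proof. by move=> /f1 h; rewrite expr_ge1 // ltW // (lt_trans ltr01). Qed.

Lemma is_end_mono R0 R1 s : R0 <= R1 -> is_end M0 X f R0 s -> is_end M0 X f R1 s.
Proof.
move=> RR [sS l2 lim]; split.
- by move=> x; rewrite /exterior /= => h; apply: sS; exact: le_lt_trans h.
- by move=> x h; apply: l2; exact: le_lt_trans h.
- by move=> e /lim[r H]; exists r => x h; apply: H; exact: le_lt_trans h.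
Qed.

Lemma end_segment R0 s (x v : V) : is_end M0 X f R0 s -> (forall t, 0 <= t <= 1 -> R0 < `|x + t *: v|) ->
  exists c, reach M0 X W 1 (s x) (s (x + v)) c.
Proof.
move=> E H; have := H 0 itv01_0; rewrite scale0r addr0 => xR.
have [v0|v0] := eqVneq v 0.
  by exists 0; rewrite v0 addr0; apply: reach0 => //; have [] := end_section E xR.
exists (enorm v * 2 ^+ 2); apply: (step_refine W1 ltr01); split => //.
exists (fun t => s (x + t *: v)); split.
- by apply: line_lift (end_section E) _ => t t01; exact: H.
- by rewrite scale1r.
move=> t t01; have [_ m _] := end_section E (H t t01).
by rewrite lerXn2r ?nnegrE ?(end_le2 E) ?H // ltW // (lt_trans ltr01) ?f1.
Qed.

(** The exterior of a cube is crossed by segments on which one coordinate stays beyond R0: first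
    coordinate [i], large at the starting point, is kept while all others become R0 + 1; then i is
    moved while another coordinate [j] keeps that value. *)
Lemma end_connected R0 s (x y : V) : 0 <= R0 -> is_end M0 X f R0 s -> R0 < `|x| -> R0 < `|y| ->
  exists c, reach M0 X W 1 (s x) (s y) c.
Proof.
move=> R00 E.
suff H z : R0 < `|z| -> exists c, reach M0 X W 1 (s z) (s (const_mx (R0 + 1))) c.
  move=> /H[c rc] /H[d rd]; exists (c + d); exact: reach_trans rc (reach_sym W1 rd).
move=> zR; have [i zi] : exists i, R0 < `|z 0 i|.
  apply: contrapT => nz; move: zR; rewrite ltNge; apply/negP/negPn; apply: rV_norm_le => // j.
  by rewrite leNgt; apply/negP => h; apply: nz; exists j.
have [j ji] : exists j : 'I_n, j != i.
  have n1 : (1 < n)%N by exact: leq_trans n3.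
  have [i0|i0] := eqVneq (i : nat) 0%N.
    by exists (Ordinal n1); rewrite -val_eqE /= i0.
  by exists (Ordinal (ltnW n1)); rewrite -val_eqE /= eq_sym.
pose T := R0 + 1; pose y1 : V := \row_k (if k == i then z 0 i else T).
have [|c1 r1] := @end_segment R0 s z (y1 - z) E.
  move=> t _; apply: lt_le_trans zi (le_trans _ (rV_coord_le _ i)).
  by rewrite !mxE eqxx subrr mulr0 addr0.
have [|c2 r2] := @end_segment R0 s y1 (const_mx T - y1) E.
  move=> t _; apply: lt_le_trans (rV_coord_le _ j).
  by rewrite !mxE (negPf ji) subrr mulr0 addr0 ger0_norm /T; lra.
rewrite addrC subrK in r1; rewrite [y1 + _]addrC subrK in r2.
by exists (c1 + c2); exact: reach_trans r1 r2.
Qed.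

End EndReach.

Section Final.
Context {R : realType} {n : nat} {M : topologicalType}.
Variable A : smooth_atlas R n M.
Local Notation V := 'rV[R]_n.
Local Notation E := 'rV[R]_n.+2.
Variables (phi eta : M -> E) (kappa : M -> 'I_n -> R) (G : M -> 'rV[R]_n.+1).
Hypothesis n3 : (3 <= n)%N.
Hypothesis hM : hausdorff_space M.
Hypothesis connectedM : connected [set: M].
Hypothesis phiI : immersed_hypersurface A phi.
Hypothesis etaN : unit_normal A phi eta.
Hypothesis phi_complete : complete_hypersurface A phi.
Hypothesis kappaP : forall p, principal_curvatures A phi eta p (kappa p).
Hypothesis kappa1 : forall p i, kappa p i < 1.
Hypothesis kappaS : forall p, \sum_(i < n) 2 / (1 - kappa p i) <= n%:R.
Hypothesis gaussG : gauss_map phi eta G.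
Variables (y : 'rV[R]_n.+1) (w : 'I_n -> E).
Hypothesis yu : unit_sphere y.
Local Notation K := (null_vector y).
Local Notation K' := (null_vector (- y)).
Hypothesis frame : null_frame K K' w.
Local Notation N := (lightcone_map phi eta).
Local Notation vis := (visible phi eta K).
Local Notation X := (stereo phi eta K w).
Local Notation h := (height phi eta K).
Local Notation f := (factor phi eta K).
Local Notation W := (fun p => f p ^+ 2).
Local Notation vis' := (visible phi eta K').
Local Notation X' := (stereo phi eta K' w).
Local Notation h' := (height phi eta K').
Let frame' : null_frame K' K w := null_frame_sym frame.

Lemma lorentz_null_vector (a b : 'rV[R]_n.+1) : lorentz (null_vector a) (null_vector b) = -1 + dot a b.
Proof.
rewrite /null_vector lorentz_row row_mx0 mulr1; congr (_ + _).
by apply: eq_bigr => i _; rewrite mxE row_mxS.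
Qed.

Lemma sphere_dot (a : 'rV[R]_n.+1) : unit_sphere a -> dot a a = 1.
Proof. by move=> <-; apply: eq_bigr => i _; rewrite expr2. Qed.

Lemma visible_gauss p : G p != y -> vis p.
Proof.
move=> Gy; have [Gu [rho Grho]] := gaussG.
rewrite /visible /= /height /lightcone_map Grho lorentzZl lorentz_null_vector oppr_gt0.
rewrite pmulr_rlt0 ?expR_gt0 // addrC subr_lt0.
have := dot_gt0 (x := G p - y); rewrite subr_eq0 => /(_ Gy).
by rewrite !dotE (sphere_dot (Gu p)) (sphere_dot yu) (dotC y); lra.
Qed.

Lemma antipodal_gauss p : G p = y -> vis' p /\ X' p = 0.
Proof.
move=> Gy; have [Gu [rho Grho]] := gaussG.
have hp : 0 < h' p.
  rewrite /height /lightcone_map Grho Gy lorentzZl lorentz_null_vector dotNr (sphere_dot yu).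
  by rewrite -mulrN mulr_gt0 ?expR_gt0 //; lra.
have k0 : lorentz (N p) K = 0.
  by rewrite /lightcone_map Grho Gy lorentzZl lorentz_null_vector (sphere_dot yu) addNr mulr0.
split => //; have := lightcone_null phiI etaN p; rewrite frame k0 !(mul0r, mulr0, addr0, oppr0, add0r) => s0.
apply/rowP => j; rewrite !mxE; have -> : lorentz (N p) (w j) = 0; last by rewrite mul0r.
apply/eqP; rewrite -sqrf_eq0 expr2; apply/eqP.
by apply: (psumr_eq0P _ s0) => // i _; rewrite -expr2 sqr_ge0.
Qed.

Lemma height_antipodal q : vis' q -> h q = h' q * dot (X' q) (X' q).
Proof. by move=> vq; rewrite /height (stereo_null phiI etaN frame' vq) opprK. Qed.

Lemma stereo_antipodal q : vis' q -> X' q != 0 -> vis q /\ X q = inversion (X' q).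
Proof.
move=> vq x0; have d0 := dot_gt0 x0; have hq := height_antipodal vq; split.
  by rewrite /visible /= hq mulr_gt0.
apply/rowP => j; rewrite [in LHS]mxE [in RHS]mxE hq (stereoE w j vq).
have vq' : h' q != 0 by rewrite gt_eqF.
by move: vq' d0; move: (dot _ _) (h' q) => d c c0 d0; field; rewrite c0 gt_eqF.
Qed.

Lemma profile_le (t : R) : 0 <= t -> profile t <= 1 + 2 * Num.sqrt t.
Proof.
move=> t0; have u0 := sqrtr_ge0 t; rewrite /profile; move: (Num.sqrt t) u0 => u u0.
have u1 : 0 < 1 + u by rewrite ltr_wpDr.
have : 1 - u <= (1 + u)^-1.
  rewrite -[(1 + u)^-1]mul1r ler_pdivlMr //; have := sqr_ge0 u; lra.
lra.
Qed.

(** The coordinates from the antipodal point are regular at [p] and vanish there, so their section,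
    composed with the inversion, parametrizes a punctured neighbourhood of p by the exterior of a
    cube. There the height is at most H / |x|^2, so [factor] tends to 1. The last two clauses, that
    the end contains all visible points near p and accumulates at p, serve to prove
    connectedness. *)
Lemma end_at p (U : set M) : G p = y -> nbhs p U -> exists (R0 : R) (s : V -> M),
  [/\ 0 <= R0, is_end vis X f R0 s & forall x, R0 < `|x| -> U (s x)] /\
  [/\ exists2 B, nbhs p B & forall q, B q -> vis q -> exists2 x, R0 < `|x| & q = s x &
      forall B, nbhs p B -> exists2 x, R0 < `|x| & B (s x)].
Proof.
move=> Gp nU; have [vp xp] := antipodal_gauss Gp.
have [r [s [U0 [[r0 sS oU0 Up] [sU _]]]]] := flat_section phiI etaN kappaP kappa1 frame' vp.
have sp : s 0 = p by have [_] := sU p Up; rewrite xp.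
rewrite xp in sS sU.
have b0 : nball (0 : V) r 0 by rewrite /nball /= subrr normr0.
have [s0C _ _] := sS _ b0.
pose H := h' p + 1; have H0 : 0 < H by rewrite /H ltr_wpDl // ltW.
have nH : nbhs p (h' @^-1` [set t | t < H]).
  have hc : {for p, continuous h'} by exact: (height_cont phiI etaN).
  apply: hc; apply: open_nbhs_nbhs; split; first exact: open_lt.
  by rewrite /H /= ltrDl.
have nS : nbhs (0 : V) (s @^-1` (U `&` [set q | h' q < H])).
  by apply: s0C; rewrite sp; exact: filterI.
have [r1 r10 Hr1] := nbhs_dist nS.
pose u := Num.sqrt H; have u0 : 0 < u by rewrite sqrtr_gt0.
(* The bounds by 1 / r and 1 / r1 make the inversion land in the domain of the section and in [U];
   R0 >= 2 u makes [factor] at most 2. *)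
have [R0 [R00 Rr Rr1 Ru]] : exists R0 : R, [/\ 0 < R0, r^-1 <= R0, r1^-1 <= R0 & 2 * u <= R0].
  exists (r^-1 + r1^-1 + 2 * u); have i1 : 0 < r^-1 by rewrite invr_gt0.
  have i2 : 0 < r1^-1 by rewrite invr_gt0.
  by split; lra.
have ext x : R0 < `|x| -> [/\ x != 0, nball 0 r (inversion x), U (s (inversion x)) & h' (s (inversion x)) < H].
  move=> xR; have nx : 0 < `|x| by exact: lt_trans xR.
  have x0 : x != 0 by rewrite -normr_gt0.
  have small (a : R) : 0 < a -> a^-1 <= R0 -> `|inversion x| < a.
    move=> a0 aR; apply: le_lt_trans (norm_inversion x0) _.
    by rewrite invf_plt ?posrE //; apply: le_lt_trans aR xR.
  have [|Ux hx] := Hr1 (inversion x); first by rewrite subr0; exact: small.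
  by split => //; rewrite /nball /= subr0; exact: small.
pose sg x := s (inversion x).
have key x : R0 < `|x| -> [/\ vis (sg x), X (sg x) = x & h (sg x) <= H / `|x| ^+ 2].
  move=> xR; have [x0 bx Ux hx] := ext x xR; have [_ vx sx] := sS _ bx.
  have ix0 := inversion_neq0 x0; have [|v1 x1] := stereo_antipodal vx; first by rewrite sx.
  split => //; first by rewrite x1 sx inversionK.
  rewrite /sg (height_antipodal vx) sx dot_inversion //.
  apply: ler_pM; rewrite ?invr_ge0 ?dot_ge0 //; [exact: ltW|exact: ltW|].
  by rewrite lef_pV2 ?posrE ?dotxx_norm ?dot_gt0 // exprn_gt0 // (lt_trans R00 xR).
have fsg x : R0 < `|x| -> f (sg x) <= 1 + 2 * u / `|x|.
  move=> xR; have [vx _ hx] := key x xR; have nx : 0 < `|x| by exact: lt_trans xR.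
  apply: le_trans (profile_le (ltW vx)) _; rewrite lerD2l -mulrA ler_wpM2l //.
  apply: le_trans (ler_wsqrtr hx) _.
  have -> : H / `|x| ^+ 2 = (u / `|x|) ^+ 2 by rewrite expr_div_n sqr_sqrtr // ltW.
  by rewrite sqrtr_sqr ger0_norm // divr_ge0 // ltW.
exists R0, sg; split; split.
- exact: ltW.
- split.
  + move=> x xR; have [vx Xx _] := key x xR; have [x0 bx _ _] := ext x xR; split => //.
    by have [sc _ _] := sS _ bx; exact: (continuous_comp (inversion_cont x0) sc).
  + move=> x xR; apply: le_trans (fsg x xR) _; have nx : 0 < `|x| by exact: lt_trans xR.
    have : 2 * u / `|x| <= 1 by rewrite ler_pdivrMr // mul1r (le_trans Ru) // ltW.
    lra.
  move=> e e0; exists (2 * u / e) => x xR xe; apply: le_lt_trans (fsg x xR) _.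
  have nx : 0 < `|x| by exact: lt_trans xR.
  by rewrite ltrD2l ltr_pdivrMr //; move: xe; rewrite ltr_pdivrMr // [e * _]mulrC.
- by move=> x /ext[].
- have n0 : 0 < n%:R :> R by rewrite ltr0n (leq_trans _ n3).
  pose a := (n%:R ^+ 2 * (R0 + 1))^-1; have R1 : 0 < R0 + 1 by rewrite addr_gt0.
  have a0 : 0 < a by rewrite invr_gt0 mulr_gt0 // exprn_gt0.
  exists (U0 `&` [set q | vis' q] `&` X' @^-1` nball 0 a).
    apply: filterI.
      apply: filterI; first exact: open_nbhs_nbhs.
      by apply: open_nbhs_nbhs; split => //; exact: (open_visible phiI etaN).
    by apply: (stereo_cont phiI etaN vp); rewrite xp; apply: nballP; rewrite /nball /= subrr normr0.
  move=> q [[U0q vq'] qa] vq; have [_ sq] := sU q U0q.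
  have x0 : X' q != 0.
    apply/eqP => x0; have := height_antipodal vq'; rewrite x0 => hq.
    by move: vq; rewrite /visible /= hq -[0 : V](scale0r (0 : V)) dotZl mul0r mulr0 ltxx.
  exists (inversion (X' q)); last by rewrite /sg inversionK.
  have nx : 0 < `|X' q| by rewrite normr_gt0.
  apply: lt_le_trans (norm_inversion_ge x0); move: qa; rewrite /nball /= subr0 /a => qa.
  have n2 : 0 < n%:R ^+ 2 :> R by rewrite exprn_gt0.
  rewrite invfM -(ltr_pM2l n2) mulrA divff ?gt_eqF // mul1r.
  rewrite -[_ * R0]invrK ltf_pV2 ?posrE ?invr_gt0 ?mulr_gt0 //.
  apply: lt_trans qa _; rewrite ltf_pV2 ?posrE ?mulr_gt0 //.
  by rewrite ltr_pM2l // ltrDl.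
- move=> B nB; have nB' : nbhs (0 : V) (s @^-1` B) by apply: s0C; rewrite sp.
  have [e e0 He] := nbhs_dist nB'.
  pose T := R0 + e^-1; have T0 : 0 < T by rewrite addr_gt0 ?invr_gt0.
  have n0 : (0 < n)%N by exact: leq_trans n3.
  have nT : `|T *: bas (Ordinal n0) : V| = T by rewrite (bas_norm _ _).1 gtr0_norm.
  exists (T *: bas (Ordinal n0)); first by rewrite nT /T ltrDl invr_gt0.
  apply: He; rewrite subr0; apply: le_lt_trans (norm_inversion _) _.
    by rewrite -normr_gt0 nT.
  by rewrite nT invf_plt ?posrE // /T ltrDr.
Qed.

(** Removing the fibre does not disconnect [M]: every point has a neighbourhood whose visible points
    can be joined to each other, at the fibre because an end is connected, and visible points are
    dense. *)
Lemma visible_connected p q : vis p -> vis q -> exists c, reach vis X W 1 p q c.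
Proof.
move=> vp vq; have W1 z : vis z -> 1 <= W z by exact: factor_sq_ge1.
have fl := flat2_flat (flat2_visible n3 phiI etaN kappaP kappa1 kappaS frame).
have XC z : vis z -> {for z, continuous X} by move=> vz; exact: (stereo_cont phiI etaN).
have WC z : vis z -> {for z, continuous W}.
  by move=> vz; apply: cvgM; exact: (factor_cont phiI etaN).
pose ok (z : M) := exists c, reach vis X W 1 p z c.
have dich (z : M) : exists2 U : set M, nbhs z U & (forall a b, U a -> U b -> vis a -> vis b -> ok a -> ok b) /\
    (forall B : set M, nbhs z B -> exists2 a, vis a & B a).
  have [Gz|Gz] := eqVneq (G z) y.
    have [R0 [s [[R00 E _] [[B nB HB] dense]]]] := end_at Gz (@filterT _ _ (nbhs_filter z)).
    exists B => //; split.
      move=> a b Ba Bb va vb [c rc]; have [x xR ax] := HB a Ba va; have [x' xR' bx] := HB b Bb vb.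
      have [d rd] := end_connected n3 (@factor_gt1 R n M phi eta K) R00 E xR xR'.
      by exists (c + d); apply: reach_trans rc _; rewrite ax bx.
    move=> U nU; have [x xR Ux] := dense U nU; exists (s x) => //.
    by have [] := end_section E xR.
  have vz := visible_gauss Gz.
  have [U nU HU] := local_reach fl XC WC W1 vz ltr01 ltr01.
  exists U => //; split.
    by move=> a b Ua Ub _ _ [c rc]; exists (c + 1); exact: reach_trans rc (HU _ _ Ua Ub).
  by move=> B nB; exists z => //; exact: nbhs_singleton nB.
(* Open by construction. It is closed because at a limit point density provides a visible point that
   is already reached, and [dich] spreads this over a whole neighbourhood. *)
pose Ein := [set z : M | exists2 U : set M, nbhs z U & forall a, U a -> vis a -> ok a].
have oin : open Ein.
  rewrite openE => z [U nU HU]; rewrite /interior; apply: filterS (nbhs_interior nU) => a Ua.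
  by exists U.
have oout : open (~` Ein).
  rewrite openE => z nz; have [U nU [HU dense]] := dich z.
  rewrite /interior; apply: filterS (nbhs_interior nU) => a Ua [B nB HB]; apply: nz.
  have [U' nU' [_ dense']] := dich a.
  have [b vb [Bb Ub]] := dense' (B `&` U) (filterI nB Ua).
  exists U => // c Uc vc; exact: HU _ _ Ub Uc vb vc (HB b Bb vb).
have Ep : Ein p.
  have [U nU HU] := local_reach fl XC WC W1 vp ltr01 ltr01.
  by exists U => // a Ua _; exists 1; apply: HU => //; exact: nbhs_singleton nU.
have ET : Ein = setT.
  apply: connectedM; first by exists p.
    by exists Ein => //; rewrite setTI.
  by exists Ein; [rewrite -(setCK Ein); exact: open_closedC|rewrite setTI].
have : Ein q by rewrite ET.
by move=> [U nU HU]; apply: HU => //; exact: nbhs_singleton nU.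
Qed.

(** Disjoint neighbourhoods of two points of the fibre contain disjoint ends, which [two_ends]
    excludes once both are restricted to a common radius. *)
Lemma gauss_fiber p q : G p = y -> G q = y -> p = q.
Proof.
move=> Gp Gq; apply: contrapT => pq.
have := hM; rewrite open_hausdorff => /(_ p q (introN eqP pq))[[U1 U2]] /= [/set_mem U1p /set_mem U2q] [oU1 oU2 /eqP U12].
have [R1 [s1 [[R10 E1 H1] _]]] := end_at Gp (open_nbhs_nbhs (conj oU1 U1p)).
have [R2 [s2 [[R20 E2 H2] _]]] := end_at Gq (open_nbhs_nbhs (conj oU2 U2q)).
pose R0 := Num.max R1 R2.
have E1' := is_end_mono (_ : R1 <= R0) E1; have E2' := is_end_mono (_ : R2 <= R0) E2.
have fl := flat2_visible n3 phiI etaN kappaP kappa1 kappaS frame.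
apply: (two_ends n3 hM fl _ _ (@factor_gt1 R n M phi eta K) (fun _ _ => lexx _) _ visible_connected (R0 := R0) _ (E1' _) (E2' _)).
- by move=> z vz; exact: (stereo_cont phiI etaN).
- by move=> z vz; exact: (factor_cont phiI etaN).
- by move=> z r vz; exact: (visible_good n3 hM phiI etaN phi_complete kappaP kappa1 kappaS frame).
- by rewrite le_max R10.
- by rewrite le_max lexx.
- by rewrite le_max lexx orbT.
move=> x x' xR xR' e.
have : (U1 `&` U2) (s1 x).
  split; first by apply: H1; apply: le_lt_trans xR; rewrite le_max lexx.
  by rewrite e; apply: H2; apply: le_lt_trans xR'; rewrite le_max lexx orbT.
by rewrite U12.
Qed.

End Final.

Unset Implicit Arguments.

Theorem theorem1p1 (R : realType) (n : nat) (M : topologicalType)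
    (A : smooth_atlas R n M) (phi eta : M -> 'rV[R]_n.+2)
    (kappa : M -> 'I_n -> R) (G : M -> 'rV[R]_n.+1)
    (n_ge3 : (3 <= n)%N)
    (hausdorffM : hausdorff_space M)
    (countableM : @second_countable M)
    (connectedM : connected [set: M])
    (phi_immersed : immersed_hypersurface A phi)
    (eta_normal : unit_normal A phi eta)
    (phi_complete : complete_hypersurface A phi)
    (phi_convex : horospherically_convex A phi eta)
    (kappaP : forall p, principal_curvatures A phi eta p (kappa p))
    (orientation : forall p i, kappa p i < 1)
    (kappa_bound : forall p, \sum_(i < n) 2 / (1 - kappa p i) <= n%:R)
    (gaussG : gauss_map phi eta G) :
  injective G.
Proof.
move=> p q pq; have yu := gaussG.1 q; have [w frame] := exists_null_frame yu.
exact: (gauss_fiber n_ge3 hausdorffM connectedM phi_immersed eta_normal phi_complete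
  kappaP orientation kappa_bound gaussG yu frame pq erefl).
Qed.
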